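(* Let $\mathcal D_S$ denote the class of pseudoconvex balanced domains $D=D_h\subset\mathbb C^2$ such that $h\not\equiv0$ and $h^{-1}(0)$ is dense in $\mathbb C^2$. Then: (1) there is a $D\in\mathcal D_S$ such that its four-dimensional volume $\mathcal L^4(D)=\infty$; (2) there is a $D\in\mathcal D_S$ such that $K_D(z)>0$ for all $z\in D$ (equivalently, $\mathcal L^4(D)<\infty$) but $D$ does not admit the Bergman metric; (3) there is a $D\in\mathcal D_S$ such that $D$ admits the Bergman metric.
   Context: A balanced domain is $D_h:=\{z\in\mathbb C^2:h(z)<1\}$ where $h:\mathbb C^2\to[0,\infty)$ is upper semicontinuous and homogeneous, i.e. $h(\lambda z)=|\lambda|h(z)$ for $\lambda\in\mathbb C$, $z\in\mathbb C^2$; $D_h$ is pseudoconvex iff $\log h$ is plurisubharmonic. $\mathcal L^4$ is Lebesgue measure on $\mathbb C^2$. $L_h^2(D):=L^2(D)\cap\mathcal O(D)$ with the $L^2$-norm $\|\cdot\|$. The Bergman kernel on the diagonal is $K_D(z):=\sup\{|f(z)|^2: f\in L_h^2(D),\ \|f\|\le1\}$, $z\in D$. If $K_D>0$ on $D$, the Bergman pseudometric is given by $\beta_D^2(z;X):=\sum_{j,k=1}^2\frac{\partial^2\log K_D}{\partial z_j\partial\bar z_k}(z)X_j\bar X_k$, $z\in D$, $X\in\mathbb C^2$. $D$ admits the Bergman metric if $K_D(z)>0$ for all $z\in D$ and $\beta_D$ is positive definite, i.e. $\beta_D^2(z;X)>0$ for all $z\in D$ and $X\ne0$. It is known (Siciak)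 that the class $\mathcal D_S$ is non-empty. *)

(* Defs.v *)
From HB Require Import structures.
From mathcomp Require Import all_boot all_order all_algebra.
From mathcomp Require Import all_classical all_reals all_analysis.
From mathcomp Require Import complex.

Set Implicit Arguments.
Unset Strict Implicit.
Unset Printing Implicit Defensive.

Import Order.TTheory GRing.Theory Num.Theory.
Import numFieldNormedType.Exports.
Local Open Scope classical_set_scope.
Local Open Scope ring_scope.
Local Open Scope complex_scope.

(** In [R[i]] the norm [`|z|] is an element of [R[i]] (a nonnegative real), and
    [x < y] means that [y - x] is real and positive. The topology of
    ['rV[R[i]]_2] is the usual product topology of C^2. *)
HB.instance Definition _ (R : realType) := NormedModule.copy R[i] R[i]^o.

Notation C2 R := 'rV[R[i]]_2.

Definition cmod (R : realType) (z : R[i]) : R := complex.Re `|z|.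

(** The Euclidean norm; the library norm of ['rV[R[i]]_2] is the max norm. *)
Definition enorm (R : realType) (z : C2 R) : R :=
  Num.sqrt (\sum_(j < 2) cmod (z 0 j) ^+ 2).

Definition C2_of_R4 (R : realType) (p : R * R * R * R) : C2 R :=
  \row_(j < 2) if j == 0 then p.1.1.1 +i* p.1.1.2 else p.1.2 +i* p.2.

Definition lebesgue4 (R : realType)
    : {measure set (measurableTypeR R * measurableTypeR R * measurableTypeR R *
                    measurableTypeR R) -> \bar R} :=
  (@lebesgue_measure R \x @lebesgue_measure R \x
   @lebesgue_measure R \x @lebesgue_measure R)%E.

Definition volume (R : realType) (D : set (C2 R)) : \bar R :=
  lebesgue4 R (@C2_of_R4 R @^-1` D).

Definition upper_semicontinuous_on (R : realType) (D : set (C2 R))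
    (u : C2 R -> \bar R) : Prop :=
  forall z, D z -> forall a : R, (u z < a%:E)%E ->
    \forall w \near within D (nbhs z), (u w < a%:E)%E.

(** [u : D -> [-oo, +oo[] is u.s.c. and satisfies the sub-mean value inequality
    over the boundary of every closed affine complex disc contained in [D]. *)
Definition plurisubharmonic_on (R : realType) (D : set (C2 R))
    (u : C2 R -> \bar R) : Prop :=
  [/\ forall z, D z -> (u z < +oo)%E,
      upper_semicontinuous_on D u &
      forall a b : C2 R,
        (forall l : R[i], `|l| <= 1 -> D (a + l *: b)) ->
        (u a <= ((2 * pi)^-1)%R%:E *
          \int[lebesgue_measure]_(t in `[0%R, (2 * pi)%R])
            u (a + (cos t +i* sin t)%C *: b)%R)%E].

(** [+oo] when [D] is the whole space. *)
Definition boundary_dist (R : realType) (D : set (C2 R)) (z : C2 R) : \bar R :=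
  ereal_inf [set (enorm (z - w))%:E | w in ~` D].

(** Hartogs' definition; for a balanced domain [D_h] it amounts to
    plurisubharmonicity of [log h]. *)
Definition pseudoconvex (R : realType) (D : set (C2 R)) : Prop :=
  open D /\ plurisubharmonic_on D (fun z => - lne (boundary_dist D z))%E.

Definition balanced_fun (R : realType) (h : C2 R -> R) : Prop :=
  [/\ forall z, 0 <= h z,
      upper_semicontinuous_on setT (EFin \o h) &
      forall (l : R[i]) (z : C2 R), h (l *: z) = cmod l * h z].

Definition balanced_domain (R : realType) (h : C2 R -> R) : set (C2 R) :=
  [set z | h z < 1].

(** [balanced_domain h] is open because [h] is u.s.c., and connected because it
    is star-shaped about 0. *)
Definition siciak_domain (R : realType) (D : set (C2 R)) : Prop :=
  exists h : C2 R -> R,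
    [/\ balanced_fun h, D = balanced_domain h, pseudoconvex D,
        exists z, h z <> 0 &
        dense (h @^-1` [set 0])].

Definition holomorphic_on (R : realType) (D : set (C2 R))
    (f : C2 R -> R[i]) : Prop :=
  forall z, D z -> differentiable f z.

Definition L2norm (R : realType) (D : set (C2 R)) (f : C2 R -> R[i]) : \bar R :=
  ((\int[lebesgue4 R]_(p in @C2_of_R4 R @^-1` D)
     (cmod (f (C2_of_R4 p)) ^+ 2)%:E) `^ 2^-1)%E.

Definition L2h (R : realType) (D : set (C2 R)) : set (C2 R -> R[i]) :=
  [set f | holomorphic_on D f /\ (L2norm D f < +oo)%E].

(** The supremum is finite at every point of an open set [D] (mean value
    property), so the real-valued [sup] is meaningful there. *)
Definition bergman_kernel (R : realType) (D : set (C2 R)) (z : C2 R) : R :=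
  sup [set cmod (f z) ^+ 2 | f in [set f | L2h D f /\ (L2norm D f <= 1)%E]].

(** Derivative at [z] of [t |-> f (z + t v)], [t] real. *)
Definition real_deriv (R : realType) (v : C2 R) (f : C2 R -> R[i]) (z : C2 R)
    : R[i] :=
  derive1 (fun t : R => complex.Re (f (z + t%:C *: v))) 0 +i*
  derive1 (fun t : R => complex.Im (f (z + t%:C *: v))) 0.

(** The Wirtinger operators d/dz_j = (d/dx_j - i d/dy_j) / 2 and
    d/d(conj z_j) = (d/dx_j + i d/dy_j) / 2. *)
Definition dz (R : realType) (j : 'I_2) (f : C2 R -> R[i]) (z : C2 R) : R[i] :=
  2^-1 * (real_deriv (delta_mx 0 j) f z - 'i * real_deriv ('i *: delta_mx 0 j) f z).

Definition dzbar (R : realType) (j : 'I_2) (f : C2 R -> R[i]) (z : C2 R) : R[i] :=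
  2^-1 * (real_deriv (delta_mx 0 j) f z + 'i * real_deriv ('i *: delta_mx 0 j) f z).

Definition bergman_metric2 (R : realType) (D : set (C2 R)) (z X : C2 R) : R[i] :=
  \sum_(j < 2) \sum_(k < 2)
    dz j (dzbar k (fun w => (ln (bergman_kernel D w))%:C)) z *
      X 0 j * (X 0 k)^*.

Definition admits_bergman_metric (R : realType) (D : set (C2 R)) : Prop :=
  (forall z, D z -> 0 < bergman_kernel D z) /\
  (forall z X, D z -> X != 0 -> 0 < bergman_metric2 D z X).

(* Main.v *)
(** With [||z||] the sup norm, [(a_j)] dense in the plane, [a_0 = 0], [A_j = 1 + |a_j|],
    [t_j(z) = |z_2 - a_j z_1| / (A_j ||z||) <= 1], the three domains are [{h < 1}] for
    [h(z) = ||z|| prod_j t_j(z)^(c_j)], where [c_j = 4^-j/64] for [j >= 1] and only [c_0 = n/64] varies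
    ([n = 48, 24, 1]).  The zero set contains the dense family of lines [z_2 = a_j z_1].

    Pseudoconvexity: [h] is a decreasing limit of functions [h_N] having a power that is a maximum of moduli of
    polynomials, so polynomial discs with boundary in [D] lie in [D]; Hartogs' argument (with analytic polynomials
    approximating [log dist(., bD)] on the circle by Fejér-type kernels) then makes [- log dist(., bD)]
    plurisubharmonic.

    Volume: near [z_2 = 0] and in the shell [||z|| ~ 8^m] the domain looks like [|z_2| < |z_1|^(1 - 1/c_0)], which has
    infinite volume for [c_0 = 3/4] and finite volume for [c_0 = 3/8], while the other lines contribute summable amounts.
    For [c_0 = 3/8] the mean value inequality on polydiscs centred on [z_2 = 0] gives sublinear growth there, so every
    square integrable holomorphic function is constant on that line (Liouville) and the metric degenerates along it.

    For [c_0 = 1/64] the functions [1, z_1, z_2] are square integrable.  Orthonormalising a sequence that contains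
    them and near-extremal functions at the rational points gives [K = sum_n |q_n|^2] with
    termwise differentiation in [l^2], hence [K^2 beta^2(z; X) = |a|^2 |b|^2 - |<b, a>|^2] with [a = (q_n(z))],
    [b = (d_X q_n(z))].  Equality in Cauchy-Schwarz would make [d_X f(z)] proportional to [f(z)] for
    [f = 1, z_1, z_2], forcing [X = 0]. *)

Require Import Defs.
From HB Require Import structures.
From mathcomp Require Import all_boot all_order all_algebra.
From mathcomp Require Import all_classical all_reals all_analysis.
From mathcomp Require Import measurable_realfun complex.
From mathcomp Require Import ring lra zify.

Set Implicit Arguments.
Unset Strict Implicit.
Unset Printing Implicit Defensive.

Import Order.TTheory GRing.Theory Num.Theory.
Import numFieldNormedType.Exports.
Local Open Scope classical_set_scope.
Local Open Scope ring_scope.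
Local Open Scope complex_scope.

(** * Complex numbers and roots of unity *)

(** In the local model around [z_2 = 0] the shell [|z_1| ~ r] has volume of order [r^(4 - 2/c_0)],
    so the volume is finite for [c_0 < 1/2]. A function of norm 1 is bounded on the line by a
    multiple of [r^(1/c_0 - 2)], which is sublinear for [c_0 > 1/3], and the coordinates are square
    integrable for [c_0 < 1/3]. The values 3/4, 3/8 and 1/64 lie in the three ranges. The exponents
    sum to less than 1 and finitely many of them have a common denominator, so a power of [h_N]
    involves only polynomials. That [h] does not vanish identically comes from the volume: for
    [n = 1] the set [{h < 1}] has finite volume, and the other two functions are compared with this
    one. Function theory rests on means over roots of unity instead of contour integrals:
    orthogonality of powers is then exact finite algebra, Cauchy's theorem becomes a statement on
    dyadic polar grids, and averages over rotations act directly on functions of two variables. *)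

Section ComplexBasics.
Variable R : realType.
Local Notation C := R[i].
Implicit Types z w : C.

Lemma cmod_norm z : `|z| = (cmod z)%:C.
Proof. by rewrite /cmod normc_def. Qed.

Lemma cmodE z : cmod z = Num.sqrt (complex.Re z ^+ 2 + complex.Im z ^+ 2).
Proof. by rewrite /cmod normc_def. Qed.

Lemma cmod_ge0 z : 0 <= cmod z.
Proof. by rewrite cmodE sqrtr_ge0. Qed.

Lemma cmodM z w : cmod (z * w) = cmod z * cmod w.
Proof. by apply: (@complexI R); rewrite rmorphM -!cmod_norm normrM. Qed.

Lemma cmodD z w : cmod (z + w) <= cmod z + cmod w.
Proof. by rewrite -lecR rmorphD -!cmod_norm ler_normD. Qed.

Lemma cmodN z : cmod (- z) = cmod z.
Proof. by apply: (@complexI R); rewrite -!cmod_norm normrN. Qed.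

Lemma cmodB z w : cmod (z - w) <= cmod z + cmod w.
Proof. by rewrite -(cmodN w) cmodD. Qed.

Lemma cmodC z w : cmod (z - w) = cmod (w - z).
Proof. by rewrite -cmodN opprB. Qed.

Lemma cmod0 : cmod (0 : C) = 0.
Proof. by apply: (@complexI R); rewrite -!cmod_norm normr0. Qed.

Lemma cmod1 : cmod (1 : C) = 1.
Proof. by apply: (@complexI R); rewrite -!cmod_norm normr1. Qed.

Lemma cmodX z n : cmod (z ^+ n) = cmod z ^+ n.
Proof. by apply: (@complexI R); rewrite rmorphXn -!cmod_norm normrX. Qed.

Lemma cmod_eq0 z : (cmod z == 0) = (z == 0).
Proof. by rewrite -[RHS]normr_eq0 cmod_norm -(inj_eq (@complexI R)). Qed.

Lemma cmod_gt0 z : (0 < cmod z) = (z != 0).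
Proof. by rewrite lt_def cmod_eq0 cmod_ge0 andbT. Qed.

Lemma cmodV z : cmod z^-1 = (cmod z)^-1.
Proof. by apply: (@complexI R); rewrite fmorphV -!cmod_norm normfV. Qed.

Lemma cmod_real (x : R) : cmod x%:C = `|x|.
Proof. by rewrite cmodE /= expr0n /= addr0 sqrtr_sqr. Qed.

Lemma real_complex_nat n : (n%:R : R)%:C = n%:R :> C.
Proof. by rewrite rmorph_nat. Qed.

Lemma cmod_nat n : cmod (n%:R : C) = n%:R.
Proof. by rewrite -real_complex_nat cmod_real normr_nat. Qed.

Lemma cmodJ z : cmod (conjc z) = cmod z.
Proof. by case: z => a b; rewrite !cmodE /= sqrrN. Qed.

Lemma cmod_sum I (r : seq I) (P : pred I) (F : I -> C) :
  cmod (\sum_(i <- r | P i) F i) <= \sum_(i <- r | P i) cmod (F i).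
Proof.
elim/big_rec2: _ => [|i x y _ h]; first by rewrite cmod0.
by apply: le_trans (cmodD _ _) _; rewrite lerD2l.
Qed.

Lemma cmod_prod I (r : seq I) (P : pred I) (F : I -> C) :
  cmod (\prod_(i <- r | P i) F i) = \prod_(i <- r | P i) cmod (F i).
Proof. by elim/big_rec2: _ => [|i x y _ <-]; rewrite ?cmod1 ?cmodM. Qed.

Lemma cmod_dist z w : `|cmod z - cmod w| <= cmod (z - w).
Proof.
rewrite ler_norml lerBlDr; apply/andP; split; last first.
  by rewrite -{1}[z](subrK w) cmodD.
by rewrite lerNl opprB cmodC lerBlDr -{1}[w](subrK z) cmodD.
Qed.

Lemma Re_le z : `|complex.Re z| <= cmod z.
Proof. by rewrite cmodE -sqrtr_sqr ler_wsqrtr // lerDl sqr_ge0. Qed.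

Lemma Im_le z : `|complex.Im z| <= cmod z.
Proof. by rewrite cmodE -sqrtr_sqr ler_wsqrtr // lerDr sqr_ge0. Qed.

Lemma cmod_le_ReIm z : cmod z <= `|complex.Re z| + `|complex.Im z|.
Proof.
case: z => a b; rewrite cmodE /= -(@ger0_norm _ (`|a| + `|b|)) ?addr_ge0 //.
rewrite -sqrtr_sqr ler_wsqrtr // sqrrD !real_normK ?num_real //.
by rewrite lerD2r lerDl mulrn_wge0 ?mulr_ge0.
Qed.

Lemma cmod_sqr z : ((cmod z) ^+ 2)%:C = z * conjc z.
Proof.
case: z => a b; rewrite cmodE /= sqr_sqrtr ?addr_ge0 ?sqr_ge0 //.
by apply/eqP; rewrite eq_complex /=; apply/andP; split; apply/eqP; ring.
Qed.

Lemma cmod_sqrE z : cmod z ^+ 2 = complex.Re z ^+ 2 + complex.Im z ^+ 2.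
Proof. by rewrite cmodE sqr_sqrtr ?addr_ge0 ?sqr_ge0. Qed.

Definition cis (t : R) : C := (cos t +i* sin t)%C.

Lemma cis0 : cis 0 = 1.
Proof. by rewrite /cis cos0 sin0. Qed.

Lemma cisD s t : cis (s + t) = cis s * cis t.
Proof.
rewrite /cis cosD sinD; apply/eqP; rewrite eq_complex /=.
by apply/andP; split; apply/eqP; ring.
Qed.

Lemma cisX t n : cis t ^+ n = cis (n%:R * t).
Proof.
elim: n => [|n IH]; first by rewrite expr0 mul0r cis0.
by rewrite exprS IH -cisD -{1}[t]mul1r -mulrDl nat1r.
Qed.

Lemma cmod_cis t : cmod (cis t) = 1.
Proof. by rewrite cmodE /= cos2Dsin2 sqrtr1. Qed.

Lemma unimod_mulJ z : cmod z = 1 -> z * conjc z = 1.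
Proof. by move=> h; rewrite -cmod_sqr h expr1n. Qed.

Lemma unimod_neq0 z : cmod z = 1 -> z != 0.
Proof. by move=> h; rewrite -cmod_gt0 h. Qed.

Lemma unimodJ z : cmod z = 1 -> conjc z = z^-1.
Proof.
move=> h; apply: (mulfI (unimod_neq0 h)).
by rewrite unimod_mulJ // divff // unimod_neq0.
Qed.

Lemma cis2pi : cis (2 * pi) = 1.
Proof. by rewrite /cis mulr_natl cos2pi sin2pi. Qed.

Lemma cos_eq1 (t : R) : 0 < t < 2 * pi -> cos t != 1.
Proof.
move=> /andP[t0 t2]; have -> : t = (t / 2) *+ 2 by rewrite -mulr_natr mulfVK.
rewrite cos_mulr2n cos2sin2.
have s0 : 0 < sin (t / 2).
  by rewrite sin_gt0_pi // divr_gt0 //= ltr_pdivrMr // mulrC.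
have s2 : 0 < sin (t / 2) ^+ 2 by rewrite exprn_gt0.
by rewrite lt_eqF // mulr2n; lra.
Qed.

Definition om n : C := cis (2 * pi / n%:R).

Lemma cmod_om n : cmod (om n) = 1. Proof. exact: cmod_cis. Qed.

Lemma cmod_omX n k : cmod (om n ^+ k) = 1.
Proof. by rewrite cmodX cmod_om expr1n. Qed.

Lemma omXn n : (0 < n)%N -> om n ^+ n = 1.
Proof.
by move=> n0; rewrite cisX mulrC divfK ?pnatr_eq0 -?lt0n // cis2pi.
Qed.

Lemma omX_neq1 n k : (0 < k < n)%N -> om n ^+ k != 1.
Proof.
move=> /andP[k0 kn]; have n0 : (0 < n)%N by exact: ltn_trans kn.
rewrite cisX; apply/eqP => h.
have hlt : (0 : R) < k%:R * (2 * pi / n%:R) < (2 * pi : R).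
  have p0 : 0 < (2 * pi : R) by rewrite mulr_gt0 ?pi_gt0.
  rewrite mulr_gt0 ?ltr0n ?divr_gt0 ?ltr0n //= mulrCA gtr_pMr //.
  by rewrite ltr_pdivrMr ?ltr0n // mul1r ltr_nat.
by move: (cos_eq1 hlt); move: h => [-> _]; rewrite eqxx.
Qed.

Lemma omX_eq1 n k : (0 < n)%N -> (om n ^+ k == 1) = (n %| k)%N.
Proof.
move=> n0; apply/idP/idP => [|/dvdnP[q ->]]; last first.
  by rewrite mulnC exprM omXn // expr1n.
rewrite {1}(divn_eq k n) exprD mulnC exprM omXn // expr1n mul1r /dvdn.
by apply: contraTT; rewrite -lt0n => h; rewrite omX_neq1 // h ltn_mod.
Qed.

Lemma sum_om n k : (0 < n)%N ->
  \sum_(j < n) (om n ^+ j) ^+ k = if (n %| k)%N then n%:R else 0.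
Proof.
move=> n0; rewrite -omX_eq1 //; case: ifPn => [/eqP h|h].
  under eq_bigr do rewrite -exprM mulnC exprM h expr1n.
  by rewrite sumr_const card_ord.
under eq_bigr do rewrite -exprM mulnC exprM.
apply/eqP; have: (om n ^+ k - 1) * \sum_(j < n) (om n ^+ k) ^+ j = 0.
  by rewrite -subrX1 -exprM mulnC exprM omXn // expr1n subrr.
by move/eqP; rewrite mulf_eq0 subr_eq0 (negPf h).
Qed.

(* Means over roots of unity stand in for integrals over the circle. *)
Definition avg n (F : C -> C) : C := n%:R^-1 * \sum_(j < n) F (om n ^+ j).

Lemma avgD n F G : avg n (fun u => F u + G u) = avg n F + avg n G.
Proof. by rewrite /avg big_split mulrDr. Qed.

Lemma avgZ n c F : avg n (fun u => c * F u) = c * avg n F.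
Proof. by rewrite /avg -mulr_sumr mulrCA. Qed.

Lemma avgB n F G : avg n (fun u => F u - G u) = avg n F - avg n G.
Proof. by rewrite /avg sumrB mulrBr. Qed.

Lemma avg_sum n I (r : seq I) (P : pred I) (F : I -> C -> C) :
  avg n (fun u => \sum_(i <- r | P i) F i u) = \sum_(i <- r | P i) avg n (F i).
Proof. by rewrite /avg exchange_big mulr_sumr. Qed.

Lemma eq_avg n F G : (forall u, cmod u = 1 -> F u = G u) -> avg n F = avg n G.
Proof. by move=> h; rewrite /avg; congr (_ * _); apply: eq_bigr => j _; rewrite h ?cmod_omX. Qed.

Lemma avg_le n F (M : R) : 0 <= M -> (forall u, cmod u = 1 -> cmod (F u) <= M) ->
  cmod (avg n F) <= M.
Proof.
move=> M0 h; rewrite /avg cmodM cmodV cmod_nat.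
case: n => [|n]; first by rewrite invr0 mul0r.
rewrite mulrC ler_pdivrMr ?ltr0n //; apply: le_trans (cmod_sum _ _ _) _.
apply: (@le_trans _ _ (\sum_(j < n.+1) M)).
  by apply: ler_sum => j _; apply: h; rewrite cmod_omX.
by rewrite sumr_const card_ord mulr_natr.
Qed.

Lemma avg_dist n F G (e : R) : 0 <= e ->
  (forall u, cmod u = 1 -> cmod (F u - G u) <= e) ->
  cmod (avg n F - avg n G) <= e.
Proof. by move=> e0 h; rewrite -avgB; exact: avg_le. Qed.

Lemma avg_cst n c : (0 < n)%N -> avg n (fun=> c) = c.
Proof.
move=> n0; rewrite /avg sumr_const card_ord -[X in _ * X]mulr_natl mulrA mulVf ?mul1r //.
by rewrite pnatr_eq0 -lt0n.
Qed.

(** Discrete orthogonality: on the circle [conjc u] is the inverse of [u], so [conjc u ^+ b] becomes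
    [u ^+ (n - b)]; the bounds [a, b < n] exclude aliasing. *)
Lemma avg_monoJ n a b : (a < n)%N -> (b < n)%N ->
  avg n (fun u => u ^+ a * conjc u ^+ b) = (a == b)%:R.
Proof.
move=> an bn; have n0 : (0 < n)%N by exact: leq_ltn_trans an.
have nn : n%:R != 0 :> C by rewrite pnatr_eq0 -lt0n.
have -> : avg n (fun u => u ^+ a * conjc u ^+ b) =
   n%:R^-1 * \sum_(j < n) (om n ^+ j) ^+ (a + (n - b)).
  congr (_ * _); apply: eq_bigr => j _; rewrite exprD; congr (_ * _).
  have u1 := cmod_omX n j; rewrite unimodJ // exprVn.
  apply: (@mulfI _ ((om n ^+ j) ^+ b)); first by rewrite expf_neq0 // unimod_neq0.
  rewrite -exprD subnKC ?(ltnW bn) // divff; last by rewrite expf_neq0 // unimod_neq0.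
  by rewrite -exprM mulnC exprM omXn // expr1n.
rewrite sum_om //; case: (altP (a =P b)) => [->|ab].
  by rewrite subnKC ?(ltnW bn) // dvdnn mulVf.
case: ifPn => [|_]; last by rewrite mulr0.
move=> /dvdnP [q hq]; exfalso; move: hq ab an bn.
case: q => [|[|q]]; last rewrite !mulSn; move=> ? /eqP; lia.
Qed.

Lemma avg_rot n (F : C -> C) j : (0 < n)%N -> avg n (fun u => F (om n ^+ j * u)) = avg n F.
Proof.
move=> n0; elim: j => [|j IH]; first by apply: eq_avg => u _; rewrite expr0 mul1r.
rewrite -IH /avg; congr (_ * _).
case: n n0 {IH} => // n _; rewrite big_ord_recr [RHS]big_ord_recl /= addrC; congr (_ + _).
  by rewrite exprSr -mulrA -exprS omXn // expr0 mulr1 // mulr1.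
by apply: eq_bigr => i _; rewrite /bump /= add1n exprSr -mulrA -exprS.
Qed.

(** Stated with the real-valued modulus, so that every tolerance is a real number rather than a
    positive element of [C]. *)
Definition climC (u : nat -> C) (l : C) :=
  forall e : R, 0 < e -> exists N, forall n, (N <= n)%N -> cmod (u n - l) < e.

Lemma climC_uniq u l l' : climC u l -> climC u l' -> l = l'.
Proof.
move=> h h'; apply/eqP; rewrite -subr_eq0 -cmod_eq0 eq_le cmod_ge0 andbT.
apply/ler_addgt0Pr => e e0; rewrite add0r.
have e2 : 0 < e / 2 by rewrite divr_gt0.
have [N hN] := h _ e2; have [N' hN'] := h' _ e2.
have -> : l - l' = (u (maxn N N') - l') - (u (maxn N N') - l) by ring.
apply: le_trans (cmodB _ _) _; rewrite [leRHS]splitr lerD // ltW //.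
  by rewrite hN' // leq_maxr.
by rewrite hN // leq_maxl.
Qed.

Lemma climC_le u l (M : R) : (exists N, forall n, (N <= n)%N -> cmod (u n) <= M) -> climC u l -> cmod l <= M.
Proof.
move=> [N0 h] ul; apply/ler_addgt0Pr => e e0; have [N hN] := ul _ e0.
have -> : l = u (maxn N N0) - (u (maxn N N0) - l) by ring.
apply: le_trans (cmodB _ _) _; apply: lerD; first by apply: h; rewrite leq_maxr.
by rewrite ltW // hN // leq_maxl.
Qed.

Lemma climCD u v l m : climC u l -> climC v m -> climC (fun n => u n + v n) (l + m).
Proof.
move=> h h' e e0; have e2 : 0 < e / 2 by rewrite divr_gt0.
have [N hN] := h _ e2; have [N' hN'] := h' _ e2; exists (maxn N N') => n.
rewrite geq_max => /andP[/hN nN /hN' nN'].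
have -> : u n + v n - (l + m) = (u n - l) + (v n - m) by ring.
by apply: le_lt_trans (cmodD _ _) _; rewrite [ltRHS]splitr ltrD.
Qed.

Lemma climCZ u l c : climC u l -> climC (fun n => c * u n) (c * l).
Proof.
move=> h e e0; have c0 : 0 < cmod c + 1 by rewrite ltr_wpDl ?cmod_ge0.
have [N hN] := h _ (divr_gt0 e0 c0); exists N => n /hN.
rewrite ltr_pdivlMr // => hn; rewrite -mulrBr cmodM; apply: le_lt_trans hn.
by rewrite mulrC ler_wpM2l ?cmod_ge0 // lerDl.
Qed.

Lemma climC_cst c : climC (fun=> c) c.
Proof. by move=> e e0; exists 0%N => n _; rewrite subrr cmod0. Qed.

Lemma climC_sum m (u : nat -> nat -> C) l : (forall i, (i < m)%N -> climC (u i) (l i)) ->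
  climC (fun n => \sum_(i < m) u i n) (\sum_(i < m) l i).
Proof.
elim: m => [|m IH] h.
  by rewrite big_ord0; under eq_fun do rewrite big_ord0; exact: climC_cst.
rewrite big_ord_recr /=; under eq_fun do rewrite big_ord_recr /=.
by apply: climCD; [apply: IH => i im; apply: h; rewrite ltnS ltnW | apply: h].
Qed.

Lemma climC_cauchy u :
  (forall e : R, 0 < e -> exists N, forall m n, (N <= m)%N -> (N <= n)%N -> cmod (u m - u n) < e) ->
  exists l, climC u l.
Proof.
move=> h.
have aux (f : C -> R) : (forall z w, `|f z - f w| <= cmod (z - w)) ->
    exists l : R, forall e, 0 < e -> exists N, forall n, (N <= n)%N -> `|f (u n) - l| < e.
  move=> fL; have : cvg ((f \o u) @ \oo).
    apply/cauchy_cvgP/cauchy_exP => e e0; have [N hN] := h _ e0.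
    exists (f (u N)), N => // n /= Nn; rewrite /ball /=.
    by apply: le_lt_trans (fL _ _) _; apply: hN.
  move=> /cvgrPdist_lt h'; exists (lim ((f \o u) @ \oo)) => e e0.
  by have [N _ hN] := h' _ e0; exists N => n /hN; rewrite distrC.
have [a ha] : exists l : R, forall e, 0 < e -> exists N, forall n, (N <= n)%N -> `|complex.Re (u n) - l| < e.
  by apply: aux => z w; rewrite -raddfB Re_le.
have [b hb] : exists l : R, forall e, 0 < e -> exists N, forall n, (N <= n)%N -> `|complex.Im (u n) - l| < e.
  by apply: aux => z w; rewrite -raddfB Im_le.
exists (a +i* b)%C => e e0; have e2 : 0 < e / 2 by rewrite divr_gt0.
have [N hN] := ha _ e2; have [N' hN'] := hb _ e2; exists (maxn N N') => n.
rewrite geq_max => /andP[/hN nN /hN' nN'].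
apply: le_lt_trans (cmod_le_ReIm _) _; rewrite [ltRHS]splitr.
by case: (u n) nN nN' => x y /= *; rewrite ltrD.
Qed.

End ComplexBasics.

(** * Averages on the circle *)

Section CircleCompact.
Variable R : realType.
Local Notation C := R[i].

Lemma sin_le (y : R) : `|sin y| <= `|y|.
Proof.
wlog y0 : y / 0 <= y.
  move=> h; have [/h//|/ltW y0] := leP 0 y.
  by rewrite -[`|y|]normrN -[`|sin y|]normrN -sinN h // oppr_ge0.
have [c _] : exists2 c, c \in `[0, y]%R & sin y - sin 0 = cos c * (y - 0).
  apply: MVT_segment => //.
  apply: continuous_subspaceT => x; exact: continuous_sin.
rewrite sin0 !subr0 => ->; rewrite normrM ler_piMl //.
exact: cos_max.
Qed.

(** The chord between two points of the circle has length [2 |sin((s - t)/2)|]. *)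
Lemma cis_lip (s t : R) : cmod (cis s - cis t) <= `|s - t|.
Proof.
have h : cmod (cis s - cis t) ^+ 2 = (2 * sin ((s - t) / 2)) ^+ 2.
  rewrite cmod_sqrE /=.
  have e1 : cos (s - t) = 1 - 2 * sin ((s - t) / 2) ^+ 2.
    have -> : s - t = ((s - t) / 2) *+ 2 by rewrite -mulr_natr mulfVK.
    rewrite cos_mulr2n cos2sin2; set y := sin _.
    have -> : sin ((s - t) / 2 *+ 2 / 2) = y by rewrite /y; congr sin; rewrite -mulr_natr mulfK.
    by rewrite !mulr2n; ring.
  have e2 : 2 * (cos s * cos t + sin s * sin t) = 2 * (1 - 2 * sin ((s - t) / 2) ^+ 2).
    by rewrite -cosB e1.
  have := cos2Dsin2 s; have := cos2Dsin2 t => e3 e4.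
  transitivity (cos s ^+ 2 + sin s ^+ 2 + (cos t ^+ 2 + sin t ^+ 2) - 2 * (cos s * cos t + sin s * sin t)).
    by ring.
  by rewrite e2 e3 e4; ring.
rewrite -(@ler_pXn2r _ 2) ?nnegrE ?cmod_ge0 // h real_normK ?num_real //.
rewrite -[leLHS]real_normK ?num_real // -[leRHS]real_normK ?num_real //.
rewrite ler_pXn2r ?nnegrE // normrM ger0_norm // mulrC -ler_pdivlMr //.
by apply: le_trans (sin_le _) _; rewrite normrM [`|2^-1|]ger0_norm.
Qed.

Lemma cis_surj (u : C) : cmod u = 1 -> exists2 t, 0 <= t <= 2 * pi & u = cis t.
Proof.
case: u => a b h; have : a ^+ 2 + b ^+ 2 = 1 by have := cmod_sqrE (a +i* b)%C; rewrite h expr1n.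
move=> ab; have b2 : 0 <= b ^+ 2 by exact: sqr_ge0.
have a1 : -1 <= a <= 1 by rewrite -ler_norml -(@ler_pXn2r _ 2) ?nnegrE // real_normK ?num_real // expr1n; lra.
have [/andP[t0 tpi] ct] := acos_def a1; have p0 := pi_gt0 R.
have sq : Num.sqrt (1 - a ^+ 2) = `|b|.
  by rewrite -sqrtr_sqr; congr Num.sqrt; lra.
have [b0|b0] := leP 0 b.
  exists (acos a); first by apply/andP; split; lra.
  by rewrite /cis ct sin_acos // sq ger0_norm.
exists (2 * pi - acos a); first by apply/andP; split; lra.
rewrite addrC /cis mulr_natl cosD2pi sinD2pi cosN sinN ct sin_acos // sq ltr0_norm //.
by rewrite opprK.
Qed.

(** Compactness of the circle, inherited from [[0, 2 * pi]] through the 1-Lipschitz map [cis]; the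
    radius may depend on the point. *)
Lemma circle_cover (d : C -> R) : (forall u, cmod u = 1 -> 0 < d u) ->
  exists s : seq C, (forall u, u \in s -> cmod u = 1) /\
    forall v, cmod v = 1 -> exists2 u, u \in s & cmod (v - u) < d u.
Proof.
move=> d0; have := @segment_compact R 0 (2 * pi); rewrite compact_cover => /(_ R `[0, 2 * pi]%classic (fun t => ball t (d (cis t)))).
case.
- by move=> t _; exact: ball_open.
- by move=> t tI; exists t => //; apply: ballxx; rewrite d0 ?cmod_cis.
move=> D _ hD; exists [seq cis t | t <- finmap.enum_fset D]; split.
  by move=> u /mapP[t _ ->]; rewrite cmod_cis.
move=> v /cis_surj [t tI ->]; have [|x /= xD bx] := hD t; first by rewrite /= in_itv.
exists (cis x); first by apply/mapP; exists x.
apply: le_lt_trans (cis_lip _ _) _; rewrite distrC; exact: bx.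
Qed.

Definition circ_cont (f : C -> C) := forall u, cmod u = 1 -> forall e : R, 0 < e ->
  exists2 d : R, 0 < d & forall v, cmod v = 1 -> cmod (v - u) < d -> cmod (f v - f u) < e.

Lemma list_min (s : seq C) (d : C -> R) : (forall u, u \in s -> 0 < d u) ->
  exists2 e, 0 < e & forall u, u \in s -> e <= d u.
Proof.
elim: s => [|a s IH] h; first by exists 1.
have [e e0 he] := IH (fun u us => h u (mem_behead (s := a :: s) us)).
exists (Num.min (d a) e); first by rewrite lt_min e0 h ?mem_head.
by move=> u; rewrite inE => /orP[/eqP ->|/he h']; rewrite ge_min ?lexx // h' orbT.
Qed.

Lemma list_max (s : seq C) (d : C -> R) :
  exists2 e, 0 <= e & forall u, u \in s -> d u <= e.
Proof.
elim: s => [|a s [e e0 he]]; first by exists 0.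
exists (Num.max (d a) e); first by rewrite le_max e0 orbT.
by move=> u; rewrite inE => /orP[/eqP ->|/he h']; rewrite le_max ?lexx // h' orbT.
Qed.

Lemma circ_unif f : circ_cont f -> forall e : R, 0 < e -> exists2 d : R, 0 < d &
  forall u v, cmod u = 1 -> cmod v = 1 -> cmod (v - u) < d -> cmod (f v - f u) < e.
Proof.
move=> fc e e0; have e2 : 0 < e / 2 by rewrite divr_gt0.
have /choice [d hd] : forall u, exists d : R, cmod u = 1 -> 0 < d /\
    forall v, cmod v = 1 -> cmod (v - u) < d -> cmod (f v - f u) < e / 2.
  move=> u; have [u1|u1] := pselect (cmod u = 1); last by exists 0.
  by have [d d0 h] := fc u u1 _ e2; exists d.
(* Halved radii leave room for the distance from [u] to [v], as for a Lebesgue number. *)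
have [s [s1 hs]] := @circle_cover (fun u => d u / 2) (fun u u1 => divr_gt0 (proj1 (hd u u1)) (ltr0Sn R 1)).
have [|e' e'0 he'] := @list_min s (fun u => d u / 2).
  by move=> u us; rewrite divr_gt0 // (proj1 (hd u (s1 u us))).
exists e' => // u v u1 v1 uv; have [w ws wu] := hs u u1.
have [dw0 hw] := hd w (s1 w ws); have ew := he' w ws.
have -> : f v - f u = (f v - f w) - (f u - f w) by ring.
apply: le_lt_trans (cmodB _ _) _; rewrite [ltRHS]splitr ltrD //; apply: hw => //.
  have -> : v - w = (v - u) + (u - w) by ring.
  by apply: le_lt_trans (cmodD _ _) _; rewrite [ltRHS]splitr ltrD // (lt_le_trans uv).
by apply: lt_le_trans wu _; lra.
Qed.

Lemma circ_bdd f : circ_cont f -> exists2 M : R, 0 <= M & forall u, cmod u = 1 -> cmod (f u) <= M.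
Proof.
move=> fc; have /choice [d hd] : forall u, exists d : R, cmod u = 1 -> 0 < d /\
    forall v, cmod v = 1 -> cmod (v - u) < d -> cmod (f v - f u) < 1.
  move=> u; have [u1|u1] := pselect (cmod u = 1); last by exists 0.
  by have [d d0 h] := fc u u1 _ ltr01; exists d.
have [s [s1 hs]] := circle_cover (fun u u1 => proj1 (hd u u1)).
have [M M0 hM] := list_max s (fun u => cmod (f u)).
exists (M + 1); first by rewrite addr_ge0.
move=> u u1; have [w ws wu] := hs u u1; have [_ hw] := hd w (s1 w ws).
have -> : f u = f w + (f u - f w) by ring.
by apply: le_trans (cmodD _ _) _; rewrite lerD ?hM // ltW // hw.
Qed.

Lemma exp_small (q e : R) : 0 <= q < 1 -> 0 < e -> exists N, forall n, (N <= n)%N -> q ^+ n < e.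
Proof.
move=> /andP[q0 q1] e0; have /cvgrPdist_lt h : (fun n => q ^+ n) @ \oo --> (0 : R).
  by apply: cvg_expr; rewrite ger0_norm.
have [N _ hN] := h _ e0; exists N => n /hN.
by rewrite /= sub0r normrN ger0_norm // exprn_ge0.
Qed.

Lemma exp_lin_le (q : R) k : 0 <= q < 1 -> k.+1%:R * q ^+ k <= (1 - q)^-1.
Proof.
move=> /andP[q0 q1]; have q1' : 0 < 1 - q by rewrite subr_gt0.
rewrite -[leRHS]mul1r ler_pdivlMr // mulr_natl mulrC.
apply: (@le_trans _ _ ((1 - q) * \sum_(i < k.+1) q ^+ i)).
  rewrite ler_pM2l // -[X in _ *+ X]card_ord -sumr_const; apply: ler_sum => i _.
  by rewrite ler_wiXn2l // ?ltW // -ltnS.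
rewrite -opprB mulNr -subrX1 opprB gerBl exprn_ge0 //.
Qed.

Lemma lin_exp_small (q e : R) : 0 <= q < 1 -> 0 < e -> exists N, forall n, (N <= n)%N -> n.+1%:R * q ^+ n < e.
Proof.
(* Split [q ^+ n] as [s ^+ n * s ^+ n]: one factor absorbs [n.+1] by [exp_lin_le], the other tends
   to 0. *)
move=> /andP[q0 q1] e0; set s := Num.sqrt q.
have s01 : 0 <= s < 1 by rewrite sqrtr_ge0 /= -[ltRHS]sqrtr1 ltr_sqrt.
have s1 : 0 < 1 - s by case/andP: s01 => _; rewrite subr_gt0.
have [N hN] := exp_small s01 (mulr_gt0 e0 s1).
exists N => n /hN h; have -> : q = s * s by rewrite -expr2 sqr_sqrtr.
rewrite exprMn mulrA; apply: (@le_lt_trans _ _ ((1 - s)^-1 * s ^+ n)).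
  by apply: ler_wpM2r; [rewrite exprn_ge0 // sqrtr_ge0 | exact: exp_lin_le].
by rewrite mulrC ltr_pdivrMr.
Qed.

(** Controls the normalisation of [fkerR]: the linear factor [(2 * m).+1] is harmless against
    geometric decay. *)
Lemma central_binom m : (4 ^ m <= (2 * m).+1 * 'C(2 * m, m))%N.
Proof.
elim: m => [|m IH]; first by rewrite bin0.
have e : (m.+1 * 'C(2 * m.+1, m.+1) = 2 * ((2 * m).+1 * 'C(2 * m, m)))%N.
  have -> : (2 * m.+1 = (2 * m).+2)%N by lia.
  rewrite -mul_bin_diag /=.
  have h : ('C((2 * m).+1, m) = 'C((2 * m).+1, m.+1))%N.
    rewrite -bin_sub; last by lia.
    by congr ('C(_, _)); lia.
  have := mul_bin_diag (2 * m).+1 m; rewrite -h /= => h2.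
  have -> : ((2 * m).+2 = 2 * m.+1)%N by lia.
  by rewrite -mulnA h2.
have m0 : (0 < m.+1)%N by [].
rewrite -(leq_pmul2l m0) mulnCA e expnS.
by move: IH; set X := (_ * 'C(_, _))%N; nia.
Qed.

End CircleCompact.

(** * Approximation on the circle by trigonometric polynomials *)

Section Fejer.
Variable R : realType.
Local Notation C := R[i].

Definition ravg n (G : C -> R) : R := n%:R^-1 * \sum_(j < n) G (om R n ^+ j).

Lemma avg_real n G : avg n (fun u => (G u)%:C) = (ravg n G)%:C.
Proof. by rewrite /avg /ravg rmorphM fmorphV rmorph_nat rmorph_sum. Qed.

Lemma avg_le_real n F G : (forall u, cmod u = 1 -> cmod (F u) <= G u) ->
  cmod (avg n F) <= ravg n G.
Proof.
move=> h; rewrite /avg /ravg cmodM cmodV cmod_nat ler_wpM2l ?invr_ge0 //.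
by apply: le_trans (cmod_sum _ _ _) _; apply: ler_sum => j _; rewrite h ?cmod_omX.
Qed.

(** On the circle this is [|1 + x|^(2m) / C(2m, m)], the de la Vallée Poussin kernel: a
    trigonometric polynomial of degree [m] with constant term 1. *)
Definition fker m (x : C) : C :=
  ('C(2 * m, m)%:R)^-1 * ((1 + x) ^+ (2 * m) * conjc x ^+ m).

(* Approximate identity on the unit circle, concentrated at [x = 1]. *)
Definition fkerR m (x : C) : R := (cmod (1 + x) ^+ 2) ^+ m / 'C(2 * m, m)%:R.

Lemma fkerE m x : cmod x = 1 -> fker m x = (fkerR m x)%:C.
Proof.
move=> x1; rewrite /fker /fkerR mulrC rmorphM fmorphV rmorph_nat rmorphXn /=; congr (_ * _).
rewrite cmod_sqr exprM -exprMn; congr (_ ^+ _).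
rewrite expr2 -mulrA; congr (_ * _).
by rewrite rmorphD rmorph1 mulrDl mul1r unimod_mulJ // addrC.
Qed.

(** Expanding the kernel separates [u] from [v]: the smoothed function is a trigonometric polynomial
    in [v] whose coefficients are Fourier means of [f]. *)
Lemma fejer_expand m n (f : C -> C) v : 
  avg n (fun u => f u * fker m (v * conjc u)) =
  \sum_(i < (2 * m).+1) ('C(2 * m, i)%:R / 'C(2 * m, m)%:R * (v ^+ i * conjc v ^+ m)) *
     avg n (fun u => f u * (u ^+ m * conjc u ^+ i)).
Proof.
under [RHS]eq_bigr do rewrite -avgZ; rewrite -avg_sum.
apply: eq_avg => u u1; rewrite /fker exprDn mulr_suml mulr_sumr mulr_sumr.
apply: eq_bigr => i _; rewrite expr1n mul1r -mulr_natl.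
have -> : conjc (v * conjc u) = conjc v * u by rewrite rmorphM /= conjcK.
by rewrite !exprMn; ring.
Qed.

Lemma avg_fker m n v : cmod v = 1 -> (2 * m < n)%N -> avg n (fun u => fker m (v * conjc u)) = 1.
Proof.
move=> v1 mn; have := fejer_expand m n (fun=> 1) v.
under eq_avg do rewrite mul1r; move=> ->.
have m2 : (m < (2 * m).+1)%N by lia.
rewrite (bigD1 (Ordinal m2)) //= big1 ?addr0 => [|i im].
  under eq_avg do rewrite mul1r; rewrite avg_monoJ ?eqxx ?mulr1; try lia.
  rewrite divff ?mul1r; first by rewrite -exprMn unimod_mulJ // expr1n.
  by rewrite pnatr_eq0 -lt0n bin_gt0; lia.
under eq_avg do rewrite mul1r; rewrite avg_monoJ ?ifN; try (have := ltn_ord i; lia).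
suff /negPf -> : m != i by rewrite mulr0.
by apply: contraNneq im => h; apply/eqP/val_inj.
Qed.

Lemma cmod1B_sqr (x : C) : cmod x = 1 -> cmod (1 + x) ^+ 2 = 4 - cmod (1 - x) ^+ 2.
Proof.
move=> x1; have := cmod_sqrE x; rewrite x1 expr1n !cmod_sqrE.
by case: x {x1} => a b /= h; nra.
Qed.

Lemma fkerR_ge0 m x : 0 <= fkerR m x.
Proof. by rewrite divr_ge0 ?exprn_ge0 ?cmod_ge0. Qed.

(** Away from 1, [|1 + x|^2 <= 4 q] with [q < 1], while [4^N / C(2N, N)] grows at most linearly in
    [N]. Capping [d] at 1 keeps [q] nonnegative. *)
Lemma fkerR_small (d e : R) : 0 < d -> 0 < e -> exists m, forall x : C, cmod x = 1 ->
  d <= cmod (1 - x) -> fkerR m x <= e.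
Proof.
move=> d0 e0; set d' := Num.min d 1.
have d'0 : 0 < d' by rewrite lt_min d0 ltr01.
have d'1 : d' <= 1 by rewrite ge_min lexx orbT.
set q := (1 - d' ^+ 2 / 4) ^+ 1.
have q01 : 0 <= q < 1 by rewrite /q expr1; apply/andP; split; nra.
have [N hN] := lin_exp_small q01 (divr_gt0 e0 (ltr0Sn R 1)); exists N => x x1 dx.
have b0 : 0 < 'C(2 * N, N)%:R :> R by rewrite ltr0n bin_gt0; lia.
rewrite /fkerR ler_pdivrMr //.
have h4 : (4 ^ N)%:R <= (2 * N).+1%:R * 'C(2 * N, N)%:R :> R.
  by rewrite -natrM ler_nat central_binom.
have hq : (cmod (1 + x) ^+ 2) ^+ N <= 4 ^+ N * q ^+ N.
  rewrite -exprMn lerXn2r ?nnegrE ?sqr_ge0 ?mulr_ge0 //; try by case/andP: q01.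
  rewrite cmod1B_sqr // /q expr1.
  have : d' <= cmod (1 - x) by apply: le_trans dx; rewrite ge_min lexx.
  by move=> h; nra.
apply: le_trans hq _; have := hN _ (leqnn N) => hN2.
have qN : 0 <= q ^+ N by rewrite exprn_ge0 //; case/andP: q01.
apply: (@le_trans _ _ ((2 * N).+1%:R * 'C(2 * N, N)%:R * q ^+ N)).
  by rewrite ler_wpM2r // -natrX.
have : (2 * N).+1%:R * q ^+ N <= e.
  apply: (@le_trans _ _ (2 * (N.+1%:R * q ^+ N))); last by lra.
  by rewrite mulrA ler_wpM2r // -natrM ler_nat mulnS add2n leqW.
by move=> h; rewrite mulrAC ler_wpM2r // ltW.
Qed.

Lemma fejer (f : C -> C) : circ_cont f -> forall e : R, 0 < e -> exists m, forall n, (2 * m < n)%N ->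
  forall v, cmod v = 1 -> cmod (avg n (fun u => f u * fker m (v * conjc u)) - f v) <= e.
Proof.
move=> fc e e0; have e2 : 0 < e / 2 by rewrite divr_gt0.
have [d d0 hd] := circ_unif fc e2; have [M M0 hM] := circ_bdd fc.
have M1 : 0 < 2 * M + 1 by rewrite ltr_wpDl // mulr_ge0.
have [m hm] := fkerR_small d0 (divr_gt0 e2 M1).
exists m => n mn v v1; have n0 : (0 < n)%N by exact: leq_ltn_trans mn.
have -> : f v = avg n (fun u => f v * fker m (v * conjc u)) by rewrite avgZ avg_fker ?mulr1.
(* The first term of [G] covers [u] near [v], by uniform continuity; the second covers the rest,
   where the kernel is small against the bound of [f]. *)
rewrite -avgB; pose G u := e / 2 * fkerR m (v * conjc u) + e / 2.
apply: (@le_trans _ _ (ravg n G)).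
  apply: avg_le_real => u u1; have x1 : cmod (v * conjc u) = 1 by rewrite cmodM cmodJ u1 v1 mulr1.
  rewrite fkerE // -mulrBl cmodM cmod_real ger0_norm ?fkerR_ge0 //.
  have h1 : cmod (1 - v * conjc u) = cmod (u - v).
    rewrite -[1](unimod_mulJ u1) -mulrBl cmodM cmodJ u1 mulr1 //.
  have [ud|ud] := ltP (cmod (u - v)) d.
    apply: (@le_trans _ _ (e / 2 * fkerR m (v * conjc u))); last by rewrite lerDl ltW.
    by apply: ler_wpM2r; rewrite ?fkerR_ge0 // ltW // hd.
  apply: (@le_trans _ _ (e / 2)); last by rewrite lerDr mulr_ge0 ?fkerR_ge0 // ltW.
  have hk := hm _ x1; rewrite h1 in hk; have {}hk := hk ud.
  apply: (@le_trans _ _ ((2 * M + 1) * (e / 2 / (2 * M + 1)))).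
    apply: ler_pM; rewrite ?cmod_ge0 ?fkerR_ge0 //.
    by apply: le_trans (cmodB _ _) _; have := hM u u1; have := hM v v1; lra.
  by rewrite mulrC divfK // gt_eqF.
rewrite le_eqVlt; apply/orP; left; apply/eqP; apply: (@complexI R); rewrite -avg_real /G.
transitivity (avg n (fun u => (e / 2)%:C * fker m (v * conjc u) + (e / 2)%:C)).
  by apply: eq_avg => u u1; rewrite fkerE ?cmodM ?cmodJ ?u1 ?v1 ?mulr1 // rmorphD rmorphM.
by rewrite avgD avgZ avg_fker // avg_cst // mulr1 -rmorphD -splitr.
Qed.

(** The smoothed function is a trigonometric polynomial of degree [m], so its mean over [n] points
    is the same for all [n > 2m]; since [f] is within [e/4] of it, the means of [f] form a Cauchy
    sequence. *)
Lemma avg_lim (f : C -> C) : circ_cont f -> exists l, climC (fun n => avg n f) l.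
Proof.
move=> fc; apply: climC_cauchy => e e0.
have e4 : 0 < e / 4 by rewrite divr_gt0.
have [m hm] := fejer fc e4; pose p n0 v := avg n0 (fun u => f u * fker m (v * conjc u)).
have pE n0 n : (2 * m < n)%N -> (2 * m < n0)%N -> avg n (p n0) = avg n0 f.
  move=> mn mn0; rewrite /p; under eq_avg do rewrite fejer_expand; rewrite avg_sum.
  under eq_bigr => i _.
    rewrite (_ : avg _ _ = 'C(2 * m, i)%:R / 'C(2 * m, m)%:R *
       avg n0 (fun u => f u * (u ^+ m * conjc u ^+ i)) * avg n (fun u => u ^+ i * conjc u ^+ m)); last first.
      by rewrite -avgZ; apply: eq_avg => u _; ring.
    rewrite avg_monoJ; try (have := ltn_ord i; lia).
    over.
  have m2 : (m < (2 * m).+1)%N by lia.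
  rewrite (bigD1 (Ordinal m2)) //= big1 ?addr0 => [|i im]; last first.
    suff /negPf -> : i != m :> nat by rewrite mulr0.
    by apply: contraNneq im => h; apply/eqP/val_inj.
  rewrite eqxx mulr1 divff ?mul1r; last by rewrite pnatr_eq0 -lt0n bin_gt0; lia.
  by apply: eq_avg => u u1; rewrite -exprMn unimod_mulJ // expr1n mulr1.
exists (2 * m).+1 => n n' mn mn'.
have h k : (2 * m < k)%N -> cmod (avg k f - avg (2 * m).+1 f) <= e / 4.
  move=> mk; rewrite -(pE (2 * m).+1 k) //; apply: avg_dist; first exact: ltW.
  by move=> u u1; rewrite cmodC; apply: hm.
have -> : avg n f - avg n' f = (avg n f - avg (2 * m).+1 f) - (avg n' f - avg (2 * m).+1 f) by ring.
by apply: le_lt_trans (cmodB _ _) _; have := h n mn; have := h n' mn'; lra.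
Qed.

(** Each coefficient of the smoothed function tends to 0, hence so does its value at [v], which is
    uniformly close to [f v]. *)
Lemma fourier_uniq (f : C -> C) : circ_cont f ->
  (forall a b, climC (fun N => avg (2 ^ N) (fun u => f u * (u ^+ a * conjc u ^+ b))) 0) ->
  forall v, cmod v = 1 -> f v = 0.
Proof.
move=> fc h v v1; apply/eqP; rewrite -cmod_eq0 eq_le cmod_ge0 andbT.
apply/ler_addgt0Pr => e e0; rewrite add0r; have e2 : 0 < e / 2 by rewrite divr_gt0.
have [m hm] := fejer fc e2.
have : climC (fun N => avg (2 ^ N) (fun u => f u * fker m (v * conjc u))) 0.
  have -> : (0 : C) = \sum_(i < (2 * m).+1) 'C(2 * m, i)%:R / 'C(2 * m, m)%:R * (v ^+ i * conjc v ^+ m) * 0.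
    by rewrite big1 // => i _; rewrite mulr0.
  under eq_fun do rewrite fejer_expand.
  apply: (climC_sum (u := fun i N => 'C(2 * m, i)%:R / 'C(2 * m, m)%:R * (v ^+ i * conjc v ^+ m) * avg (2 ^ N) (fun u => f u * (u ^+ m * conjc u ^+ i))) (l := fun i => 'C(2 * m, i)%:R / 'C(2 * m, m)%:R * (v ^+ i * conjc v ^+ m) * 0)).
  by move=> i _; apply: climCZ.
move=> /(_ _ e2) [N hN]; have := hN (maxn N (2 * m)) (leq_maxl _ _); rewrite subr0 => h1.
have := hm (2 ^ maxn N (2 * m))%N; set A := avg _ _ in h1 *.
move=> /(_ (leq_ltn_trans (leq_maxr _ _) (ltn_expl _ (ltnSn 1))) v v1) h2.
have -> : f v = A - (A - f v) by ring.
by apply: le_trans (cmodB _ _) _; lra.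
Qed.

End Fejer.

(** * Cauchy's theorem by discrete contours *)

Section Goursat.
Variable R : realType.
Local Notation C := R[i].

Definition cdiff (F : C -> C) (z : C) := exists d : C, forall e : R, 0 < e ->
  exists2 r : R, 0 < r & forall w, cmod (w - z) < r -> cmod (F w - F z - d * (w - z)) <= e * cmod (w - z).

Lemma nested_dyadic (A : nat -> nat) : (forall L, A L.+1 = (A L).*2 \/ A L.+1 = (A L).*2.+1) ->
  A 0%N = 0%N ->
  exists x : R, forall L, (A L)%:R / 2 ^+ L <= x <= (A L).+1%:R / 2 ^+ L.
Proof.
move=> step A0; pose f L : R := (A L)%:R / 2 ^+ L; pose g L : R := (A L).+1%:R / 2 ^+ L.
have p2 L : 0 < 2 ^+ L :> R by rewrite exprn_gt0.
have fS L : f L <= f L.+1.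
  rewrite /f exprS ler_pdivrMr // mulrAC ler_pdivlMr ?mulr_gt0 //.
  rewrite mulrA ler_pM2r // -natrM ler_nat; case: (step L) => ->; lia.
have gS L : g L.+1 <= g L.
  rewrite /g exprS ler_pdivrMr ?mulr_gt0 // mulrAC ler_pdivlMr //.
  rewrite mulrA ler_pM2r // -natrM ler_nat; case: (step L) => ->; lia.
have fg L : f L <= g L by rewrite /f /g ler_pM2r ?invr_gt0 // ler_nat.
have fm L k : f L <= f (L + k)%N.
  by elim: k => [|k IH]; rewrite ?addn0 // addnS (le_trans IH).
have gm L k : g (L + k)%N <= g L.
  by elim: k => [|k IH]; rewrite ?addn0 // addnS (le_trans _ IH).
have fgLM L M : f L <= g M.
  apply: le_trans (fm L M) _; apply: le_trans (fg _) _; rewrite addnC; exact: gm.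
have hs : has_sup (range f).
  by split; [exists (f 0%N); exists 0%N | exists (g 0%N) => _ [L _ <-]].
exists (sup (range f)) => L; apply/andP; split.
  by apply: ub_le_sup; [case: hs | exists L].
by apply: ge_sup; [exists (f 0%N), 0%N | move=> _ [M _ <-]; exact: fgLM].
Qed.

(** If [P] failed at the root, following a failing quarter at every level would give nested dyadic
    squares shrinking to a point [(x, y)], against the local hypothesis there. *)
Lemma bisection (P : nat -> nat -> nat -> Prop) :
  (forall L a b, P L.+1 a.*2 b.*2 -> P L.+1 a.*2.+1 b.*2 ->
     P L.+1 a.*2 b.*2.+1 -> P L.+1 a.*2.+1 b.*2.+1 -> P L a b) ->
  (forall x y : R, 0 <= x <= 1 -> 0 <= y <= 1 -> exists2 d : R, 0 < d &
     forall L a b, a%:R / 2 ^+ L <= x <= a.+1%:R / 2 ^+ L ->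
       b%:R / 2 ^+ L <= y <= b.+1%:R / 2 ^+ L -> (2 ^+ L)^-1 < d -> P L a b) ->
  P 0%N 0%N 0%N.
Proof.
move=> step loc; apply: contrapT => nP0.
pose child (L : nat) (c c' : nat * nat) := ~ P L.+1 c'.1 c'.2 /\
   (c'.1 = c.1.*2 \/ c'.1 = c.1.*2.+1) /\ (c'.2 = c.2.*2 \/ c'.2 = c.2.*2.+1).
have ex (t : nat * (nat * nat)) : exists c', ~ P t.1 t.2.1 t.2.2 -> child t.1 t.2 c'.
  case: t => L [a b] /=; have [p|np] := pselect (P L a b); first by exists (0, 0)%N.
  have [c1|c1] := pselect (P L.+1 a.*2 b.*2); last by exists (a.*2, b.*2) => _; split=> //=; auto.
  have [c2|c2] := pselect (P L.+1 a.*2.+1 b.*2); last by exists (a.*2.+1, b.*2) => _; split=> //=; auto.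
  have [c3|c3] := pselect (P L.+1 a.*2 b.*2.+1); last by exists (a.*2, b.*2.+1) => _; split=> //=; auto.
  have [c4|c4] := pselect (P L.+1 a.*2.+1 b.*2.+1); last by exists (a.*2.+1, b.*2.+1) => _; split=> //=; auto.
  by exfalso; exact: np (step _ _ _ c1 c2 c3 c4).
have [nx hnx] := choice ex.
pose fix s L : nat * nat := if L is L'.+1 then nx (L', s L') else (0, 0)%N.
have nPs L : ~ P L (s L).1 (s L).2.
  by elim: L => [//|L IH]; have [] := hnx (L, s L) IH.
have ch L : child L (s L) (s L.+1) by exact: (hnx (L, s L) (nPs L)).
have [x hx] := @nested_dyadic (fun L => (s L).1) (fun L => (ch L).2.1) erefl.
have [y hy] := @nested_dyadic (fun L => (s L).2) (fun L => (ch L).2.2) erefl.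
have [||d d0 hd] := loc x y.
- by have := hx 0%N; rewrite expr0 !divr1.
- by have := hy 0%N; rewrite expr0 !divr1.
have [|L hL] := @exp_small R 2^-1 d _ d0.
  by rewrite invr_ge0 ler0n /= invf_lt1 // ltr1n.
apply: (nPs L); apply: hd => //.
by rewrite -exprVn; exact: hL.
Qed.

Variables (r1 r2 : R).
Hypotheses (r10 : 0 <= r1) (r12 : r1 <= r2).

Lemma interp_bnd (t : R) : 0 <= t <= 1 -> r1 <= r1 + (r2 - r1) * t <= r2.
Proof.
move=> /andP[t0 t1]; have d : 0 <= r2 - r1 by rewrite subr_ge0.
have := mulr_ge0 d t0; have := ler_piMr d t1 => h1 h2; apply/andP; split; lra.
Qed.

Lemma interp_norm (t : R) : 0 <= t <= 1 -> `|r1 + (r2 - r1) * t| = r1 + (r2 - r1) * t.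
Proof. by move=> /interp_bnd/andP[h _]; rewrite ger0_norm // (le_trans r10). Qed.

(** Polar coordinates carry the unit square of [bisection] onto the closed annulus of radii [r1] and
    [r2]. *)
Definition gridpt N a b : C :=
  (r1 + (r2 - r1) * (a%:R / 2 ^+ N))%:C * cis (2 * pi * (b%:R / 2 ^+ N)).

Definition edge (F : C -> C) (z w : C) : C := (F z + F w) / 2 * (w - z).

(* Trapezoidal contour sum over the boundary of a block of the polar grid at dyadic depth [N]. *)
Definition contour F N a0 a1 b0 b1 : C :=
  \sum_(a0 <= a < a1) (edge F (gridpt N a b0) (gridpt N a.+1 b0) - edge F (gridpt N a b1) (gridpt N a.+1 b1)) +
  \sum_(b0 <= b < b1) (edge F (gridpt N a1 b) (gridpt N a1 b.+1) - edge F (gridpt N a0 b) (gridpt N a0 b.+1)).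

Lemma contour_splita F N a0 a1 a2 b0 b1 : (a0 <= a1)%N -> (a1 <= a2)%N ->
  contour F N a0 a2 b0 b1 = contour F N a0 a1 b0 b1 + contour F N a1 a2 b0 b1.
Proof. by move=> h1 h2; rewrite /contour (big_cat_nat h1 h2) /= !sumrB; ring. Qed.

Lemma contour_splitb F N a0 a1 b0 b1 b2 : (b0 <= b1)%N -> (b1 <= b2)%N ->
  contour F N a0 a1 b0 b2 = contour F N a0 a1 b0 b1 + contour F N a0 a1 b1 b2.
Proof. by move=> h1 h2; rewrite /contour (big_cat_nat h1 h2) /= !sumrB; ring. Qed.

Lemma contourB F G N a0 a1 b0 b1 : contour (fun z => F z - G z) N a0 a1 b0 b1 =
  contour F N a0 a1 b0 b1 - contour G N a0 a1 b0 b1.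
Proof.
rewrite /contour opprD addrACA -!sumrB; congr (_ + _); apply: eq_bigr => i _; rewrite /edge; ring.
Qed.

(** The trapezoidal rule is exact on affine functions, so the edges telescope through the primitive
    [Q]. *)
Lemma contour_affine (c d : C) N a0 a1 b0 b1 : (a0 <= a1)%N -> (b0 <= b1)%N ->
  contour (fun z => c + d * z) N a0 a1 b0 b1 = 0.
Proof.
move=> h h'; pose Q z := c * z + d * z ^+ 2 / 2.
have eQ z w : edge (fun z => c + d * z) z w = Q w - Q z by rewrite /edge /Q; field.
rewrite /contour; under eq_bigr do rewrite !eQ; under [X in _ + X]eq_bigr do rewrite !eQ.
have T m n (f g : nat -> C) : (m <= n)%N ->
    \sum_(m <= k < n) (f k.+1 - f k - (g k.+1 - g k)) = f n - f m - (g n - g m).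
  by move=> mn; rewrite sumrB !telescope_sumr.
rewrite (T _ _ (fun k => Q (gridpt N k b0)) (fun k => Q (gridpt N k b1)) h).
rewrite (T _ _ (fun k => Q (gridpt N a1 k)) (fun k => Q (gridpt N a0 k)) h'); ring.
Qed.

(** A Lipschitz constant of the polar parametrisation: parameters differing by at most [h] in each
    coordinate give points at distance at most [blk_diam * h]. *)
Definition blk_diam := (r2 - r1) + 2 * pi * r2.

Lemma gridpt_le N a b : cmod (gridpt N a.+1 b - gridpt N a b) <= (r2 - r1) / 2 ^+ N.
Proof.
rewrite /gridpt -mulrBl cmodM cmod_cis mulr1 -rmorphB cmod_real /=.
rewrite opprD addrACA subrr add0r -mulrBr -mulrBl -natrB // subSnn mul1r.
by rewrite ger0_norm // mulr_ge0 ?subr_ge0 // invr_ge0 exprn_ge0.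
Qed.

Lemma gridpt_lea N a b : (a <= 2 ^ N)%N -> cmod (gridpt N a b.+1 - gridpt N a b) <= (2 * pi * r2) / 2 ^+ N.
Proof.
move=> aN; rewrite /gridpt -mulrBr cmodM cmod_real.
have p2 : 0 < 2 ^+ N :> R by rewrite exprn_gt0.
have h : (0 : R) <= a%:R / 2 ^+ N <= (1 : R).
  by rewrite divr_ge0 ?(ltW p2) //= ler_pdivrMr // mul1r -natrX ler_nat.
have -> : 2 * pi * r2 / 2 ^+ N = r2 * (2 * pi / 2 ^+ N) by ring.
apply: ler_pM; rewrite ?cmod_ge0 //.
  by rewrite interp_norm //; case/andP: (interp_bnd h).
apply: le_trans (cis_lip _ _) _.
rewrite -mulrBr -mulrBl -natrB // subSnn mul1r ger0_norm //.
by rewrite mulr_ge0 ?invr_ge0 ?ltW // mulr_gt0 ?pi_gt0.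
Qed.

Lemma contour_le F N a0 a1 b0 b1 (e l : R) : (a0 <= a1)%N -> (a1 <= 2 ^ N)%N -> (b0 <= b1)%N ->
  0 <= e -> (a1 - a0)%:R / 2 ^+ N <= l -> (b1 - b0)%:R / 2 ^+ N <= l ->
  (forall a b, (a0 <= a <= a1)%N -> (b0 <= b <= b1)%N -> cmod (F (gridpt N a b)) <= e) ->
  cmod (contour F N a0 a1 b0 b1) <= 2 * e * l * blk_diam.
Proof.
move=> a01 a1N b01 e0 la lb h.
have p0 := pi_gt0 R.
have eF z w : cmod (F z) <= e -> cmod (F w) <= e -> cmod (edge F z w) <= e * cmod (w - z).
  move=> hz hw; rewrite /edge cmodM cmodM cmodV cmod_nat; apply: ler_wpM2r; first exact: cmod_ge0.
  by have := cmodD (F z) (F w) => hD; rewrite ler_pdivrMr //; lra.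
rewrite /contour; apply: le_trans (cmodD _ _) _.
have -> : 2 * e * l * blk_diam = 2 * e * (r2 - r1) * l + 2 * e * (2 * pi * r2) * l by rewrite /blk_diam; ring.
apply: lerD; apply: le_trans (cmod_sum _ _ _) _.
  apply: (@le_trans _ _ (\sum_(a0 <= a < a1) (2 * e * ((r2 - r1) / 2 ^+ N)))).
    rewrite big_nat_cond [leRHS]big_nat_cond; apply: ler_sum => a; rewrite andbT => /andP[h1 h2].
    apply: le_trans (cmodB _ _) _.
    have -> : 2 * e * ((r2 - r1) / 2 ^+ N) = e * ((r2 - r1) / 2 ^+ N) + e * ((r2 - r1) / 2 ^+ N) by ring.
    by apply: lerD; apply: le_trans (eF _ _ _ _) _; try (apply: h; lia);
      apply: ler_wpM2l => //; exact: gridpt_le.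
  rewrite sumr_const_nat -[leLHS]mulr_natr.
  have -> : 2 * e * ((r2 - r1) / 2 ^+ N) * (a1 - a0)%:R = 2 * e * (r2 - r1) * ((a1 - a0)%:R / 2 ^+ N) by ring.
  by apply: ler_wpM2l => //; rewrite mulr_ge0 ?subr_ge0 // mulr_ge0.
apply: (@le_trans _ _ (\sum_(b0 <= a < b1) (2 * e * ((2 * pi * r2) / 2 ^+ N)))).
  rewrite big_nat_cond [leRHS]big_nat_cond; apply: ler_sum => a; rewrite andbT => /andP[h1 h2].
  apply: le_trans (cmodB _ _) _.
  have -> : 2 * e * ((2 * pi * r2) / 2 ^+ N) = e * ((2 * pi * r2) / 2 ^+ N) + e * ((2 * pi * r2) / 2 ^+ N) by ring.
  by apply: lerD; apply: le_trans (eF _ _ _ _) _; try (apply: h; lia);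
    apply: ler_wpM2l => //; apply: gridpt_lea; lia.
rewrite sumr_const_nat -[leLHS]mulr_natr.
have -> : 2 * e * ((2 * pi * r2) / 2 ^+ N) * (b1 - b0)%:R = 2 * e * (2 * pi * r2) * ((b1 - b0)%:R / 2 ^+ N) by ring.
have r20 : 0 <= r2 := le_trans r10 r12.
by apply: ler_wpM2l => //; rewrite !mulr_ge0 // ltW.
Qed.

(** Goursat's argument: near a point [F] is affine up to [o(|z - p|)], the affine part contributes
    nothing, and the rest is small against the area of the block. *)
Lemma goursat (F : C -> C) : (forall z, r1 <= cmod z <= r2 -> cdiff F z) ->
  forall e : R, 0 < e -> exists N0, forall N, (N0 <= N)%N ->
    cmod (contour F N 0 (2 ^ N) 0 (2 ^ N)) <= e.
Proof.
move=> Fd e e0.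
(* Blocks of every level [L] are summed on the same fine grid of depth [N], so four quarters add up
   exactly to their parent; the tolerance [e / 4^L] is shared equally among them. *)
pose S N L a b := contour F N (a * 2 ^ (N - L)) (a.+1 * 2 ^ (N - L)) (b * 2 ^ (N - L)) (b.+1 * 2 ^ (N - L)).
pose P L a b := (a < 2 ^ L)%N -> exists N0, forall N, (N0 <= N)%N -> cmod (S N L a b) <= e / 4 ^+ L.
suff : P 0%N 0%N 0%N.
  move=> /(_ isT) [N0 hN]; exists N0 => N /hN.
  by rewrite /S !subn0 !mul0n !mul1n expr0 divr1.
apply: bisection.
  move=> L a b h1 h2 h3 h4 aL; have a1 : (a.*2 < 2 ^ L.+1)%N by rewrite expnS; lia.
  have a2 : (a.*2.+1 < 2 ^ L.+1)%N by rewrite expnS; lia.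
  have [N1 {}h1] := h1 a1; have [N2 {}h2] := h2 a2; have [N3 {}h3] := h3 a1; have [N4 {}h4] := h4 a2.
  exists (maxn L.+1 (maxn (maxn N1 N2) (maxn N3 N4))) => N; rewrite !geq_max -!andbA.
  move=> /and5P[LN /h1 {}h1 /h2 {}h2 /h3 {}h3 /h4 {}h4].
  have e2 c : (c * 2 ^ (N - L) = c.*2 * 2 ^ (N - L.+1))%N.
    by rewrite -muln2 -mulnA -expnS; congr (_ * 2 ^ _)%N; lia.
  have -> : S N L a b = (S N L.+1 a.*2 b.*2 + S N L.+1 a.*2.+1 b.*2) +
     (S N L.+1 a.*2 b.*2.+1 + S N L.+1 a.*2.+1 b.*2.+1).
    rewrite /S !e2 !doubleS -!contour_splita ?leq_mul2r ?leqnSn ?orbT //.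
    by rewrite -contour_splitb ?leq_mul2r ?leqnSn ?orbT.
  have -> : e / 4 ^+ L = (e / 4 ^+ L.+1 + e / 4 ^+ L.+1) + (e / 4 ^+ L.+1 + e / 4 ^+ L.+1).
    by rewrite exprS; field; rewrite expf_neq0.
  by apply: le_trans (cmodD _ _) _; apply: lerD; apply: le_trans (cmodD _ _) _; apply: lerD.
move=> x y /andP[x0 x1] /andP[y0 y1].
have p0 := pi_gt0 R.
have pr2 : 0 <= pi * r2 by apply: mulr_ge0; [exact: ltW | exact: le_trans r12].
have K0 : 0 < blk_diam + 1 by rewrite /blk_diam -mulrA ltr_wpDl // addr_ge0 ?subr_ge0 // mulr_ge0.
set K := blk_diam + 1 in K0.
pose p : C := (r1 + (r2 - r1) * x)%:C * cis (2 * pi * y).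
have pr : r1 <= cmod p <= r2.
  by rewrite cmodM cmod_cis mulr1 cmod_real interp_norm ?interp_bnd ?x0.
(* With this slope the height [e / (2 K^2) * K / 2^L], the side [1 / 2^L] and the factor
   [2 * blk_diam] of [contour_le] multiply to at most [e / 4^L]. *)
have [d hd] := Fd _ pr; have e'0 : 0 < e / (2 * K ^+ 2) by rewrite divr_gt0 // mulr_gt0 // exprn_gt0.
have [r r0 hr] := hd _ e'0; exists (r / K); first by rewrite divr_gt0.
move=> L a b /andP[xa xa'] /andP[yb yb'] Lr aL; exists L => N LN.
have p2 m : 0 < 2 ^+ m :> R by rewrite exprn_gt0.
have a1N : (a.+1 * 2 ^ (N - L) <= 2 ^ N)%N.
  by rewrite -[X in (_ <= 2 ^ X)%N](subnKC LN) expnD leq_mul2r aL orbT.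
pose G z := (F p - d * p) + d * z.
have bnd c c' (t : R) : (c * 2 ^ (N - L) <= c' <= c.+1 * 2 ^ (N - L))%N ->
    c%:R / 2 ^+ L <= t -> t <= c.+1%:R / 2 ^+ L -> `|c'%:R / 2 ^+ N - t| <= (2 ^+ L)^-1.
  move=> /andP[h1 h2] h3 h4.
  have E (m : nat) : (m * 2 ^ (N - L))%:R / 2 ^+ N = m%:R / 2 ^+ L :> R.
    rewrite natrM natrX -{2}(subnK LN) exprD; field; rewrite !expf_neq0 //.
  have h5 : c%:R / 2 ^+ L <= c'%:R / 2 ^+ N :> R by rewrite -E ler_pM2r ?invr_gt0 // ler_nat.
  have h6 : c'%:R / 2 ^+ N <= c.+1%:R / 2 ^+ L :> R by rewrite -E ler_pM2r ?invr_gt0 // ler_nat.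
  have h7 : c.+1%:R / 2 ^+ L = c%:R / 2 ^+ L + (2 ^+ L)^-1 :> R by rewrite -natr1 mulrDl mul1r.
  by rewrite ler_norml; apply/andP; split; lra.
have near z a' b' : z = gridpt N a' b' -> (a * 2 ^ (N - L) <= a' <= a.+1 * 2 ^ (N - L))%N ->
   (b * 2 ^ (N - L) <= b' <= b.+1 * 2 ^ (N - L))%N -> cmod (z - p) <= K / 2 ^+ L.
  move=> -> /bnd/(_ xa xa') ha /bnd/(_ yb yb') hb; rewrite /gridpt /p.
  set s := a'%:R / 2 ^+ N in ha *; set t := b'%:R / 2 ^+ N in hb *.
  have -> : (r1 + (r2 - r1) * s)%:C * cis (2 * pi * t) - (r1 + (r2 - r1) * x)%:C * cis (2 * pi * y) =
     (r1 + (r2 - r1) * s - (r1 + (r2 - r1) * x))%:C * cis (2 * pi * t) +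
     (r1 + (r2 - r1) * x)%:C * (cis (2 * pi * t) - cis (2 * pi * y)) by rewrite rmorphB; ring.
  apply: le_trans (cmodD _ _) _; rewrite !cmodM cmod_cis mulr1 !cmod_real.
  apply: (@le_trans _ _ ((r2 - r1) / 2 ^+ L + r2 * (2 * pi / 2 ^+ L))).
    apply: lerD.
      have -> : r1 + (r2 - r1) * s - (r1 + (r2 - r1) * x) = (r2 - r1) * (s - x) by ring.
      by rewrite normrM ger0_norm ?subr_ge0 // ler_wpM2l ?subr_ge0.
    apply: ler_pM => //; rewrite ?cmod_ge0 //.
      by rewrite interp_norm ?x0 //; have /interp_bnd/andP[] : 0 <= x <= 1 by rewrite x0.
    apply: le_trans (cis_lip _ _) _; rewrite -mulrBr normrM ger0_norm; last lra.
    by apply: ler_wpM2l => //; lra.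
  have -> : (r2 - r1) / 2 ^+ L + r2 * (2 * pi / 2 ^+ L) = blk_diam / 2 ^+ L by rewrite /blk_diam; ring.
  by apply: ler_wpM2r; rewrite ?invr_ge0 ?ltW // ltrDl.
(* Subtract the affine approximation [G] of [F] at [p], whose contour sum is 0. *)
have -> : S N L a b = contour (fun z => F z - G z) N (a * 2 ^ (N - L)) (a.+1 * 2 ^ (N - L)) (b * 2 ^ (N - L)) (b.+1 * 2 ^ (N - L)).
  by rewrite contourB contour_affine ?subr0 ?leq_mul2r ?leqnSn ?orbT.
have wid (c : nat) : (c.+1 * 2 ^ (N - L) - c * 2 ^ (N - L))%:R / 2 ^+ N <= (2 ^+ L)^-1 :> R.
  rewrite -mulnBl subSnn mul1n natrX -{2}(subnK LN) exprD invfM mulrA divff ?mul1r //.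
apply: le_trans (@contour_le _ N _ _ _ _ (e / (2 * K ^+ 2) * (K / 2 ^+ L)) (2 ^+ L)^-1 _ _ _ _ _ _ _) _ => //.
- by rewrite leq_mul2r leqnSn orbT.
- by rewrite leq_mul2r leqnSn orbT.
- by rewrite mulr_ge0 ?ltW // divr_gt0.
- move=> a' b' ha hb; have hz := near _ _ _ erefl ha hb.
  have -> : F (gridpt N a' b') - G (gridpt N a' b') = F (gridpt N a' b') - F p - d * (gridpt N a' b' - p).
    by rewrite /G; ring.
  apply: (le_trans (hr _ _)); last by apply: ler_wpM2l => //; exact: ltW.
  by apply: le_lt_trans hz _; rewrite mulrC -ltr_pdivlMr.
have -> : 2 * (e / (2 * K ^+ 2) * (K / 2 ^+ L)) / 2 ^+ L * blk_diam = (e / 4 ^+ L) * (blk_diam / K).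
  have -> : 4 = 2 * 2 :> R by rewrite -natrM.
  by rewrite exprMn; field; rewrite expf_neq0 //= gt_eqF.
rewrite ler_piMr ?divr_ge0 ?exprn_ge0 // ?ltW //.
by rewrite ltr_pdivrMr // mul1r ltrDl.
Qed.

End Goursat.

(** * Complex differentiability *)

Section ComplexDiff.
Variable R : realType.
Local Notation C := R[i].
Implicit Types F G : C -> C.

Lemma cdiff_lip F z : cdiff F z -> exists2 K : R, 0 < K & exists2 r : R, 0 < r &
  forall w, cmod (w - z) < r -> cmod (F w - F z) <= K * cmod (w - z).
Proof.
move=> [d hd]; have [r r0 hr] := hd _ ltr01.
exists (1 + cmod d); first by rewrite ltr_pwDl ?cmod_ge0.
exists r => // w /hr h; have -> : F w - F z = (F w - F z - d * (w - z)) + d * (w - z) by ring.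
by apply: le_trans (cmodD _ _) _; rewrite cmodM mulrDl lerD2r.
Qed.

Lemma cdiff_cont F z : cdiff F z -> forall e : R, 0 < e -> exists2 r : R, 0 < r &
  forall w, cmod (w - z) < r -> cmod (F w - F z) < e.
Proof.
move=> /cdiff_lip [K K0 [r r0 h]] e e0; exists (Num.min r (e / K)).
  by rewrite lt_min r0 divr_gt0.
move=> w; rewrite lt_min => /andP[/h h1 h2]; apply: le_lt_trans h1 _.
by rewrite mulrC -ltr_pdivlMr.
Qed.

Lemma cdiff_cst c z : cdiff (fun=> c : C) z.
Proof.
exists 0 => e e0; exists 1 => // w _.
by rewrite subrr mul0r subrr cmod0 mulr_ge0 ?cmod_ge0 // ltW.
Qed.

Lemma cdiff_id z : cdiff (fun z : C => z) z.
Proof.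
exists 1 => e e0; exists 1 => // w _.
by rewrite mul1r subrr cmod0 mulr_ge0 ?cmod_ge0 // ltW.
Qed.

Lemma cdiffD F G z : cdiff F z -> cdiff G z -> cdiff (fun w => F w + G w) z.
Proof.
move=> [d hd] [d' hd']; exists (d + d') => e e0; have e2 : 0 < e / 2 by rewrite divr_gt0.
have [r r0 hr] := hd _ e2; have [r' r'0 hr'] := hd' _ e2.
exists (Num.min r r'); first by rewrite lt_min r0.
move=> w; rewrite lt_min => /andP[/hr h /hr' h'].
have -> : F w + G w - (F z + G z) - (d + d') * (w - z) =
  (F w - F z - d * (w - z)) + (G w - G z - d' * (w - z)) by ring.
by apply: le_trans (cmodD _ _) _; rewrite [e in leRHS]splitr mulrDl lerD.
Qed.

Lemma absorb_le (a g t : R) : 0 <= a -> 0 <= g -> 0 <= t -> a / (g + 1) * t * g <= a * t.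
Proof.
move=> a0 g0 t0; have g1 : 0 < g + 1 by rewrite ltr_wpDl.
have -> : a / (g + 1) * t * g = a * t * (g / (g + 1)) by ring.
by rewrite ler_piMr ?mulr_ge0 // ler_pdivrMr // mul1r lerDl.
Qed.

Lemma cdiffM F G z : cdiff F z -> cdiff G z -> cdiff (fun w => F w * G w) z.
Proof.
move=> Fd Gd; have [K K0 [s s0 hs]] := cdiff_lip Fd; have [K' K'0 [s' s'0 hs']] := cdiff_lip Gd.
case: Fd Gd => [d hd] [d' hd']; exists (d * G z + F z * d') => e e0.
have a0 : 0 < cmod (G z) + 1 by rewrite ltr_wpDl ?cmod_ge0.
have b0 : 0 < cmod (F z) + 1 by rewrite ltr_wpDl ?cmod_ge0.
have e3 : 0 < e / 3 by rewrite divr_gt0.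
have [r r0 hr] := hd _ (divr_gt0 e3 a0); have [r' r'0 hr'] := hd' _ (divr_gt0 e3 b0).
exists (Num.min (Num.min r r') (Num.min (Num.min s s') (e / 3 / (K * K')))).
  by rewrite !lt_min r0 r'0 s0 s'0 divr_gt0 // mulr_gt0.
move=> w; rewrite !lt_min -!andbA => /and5P[/hr h1 /hr' h2 /hs h3 /hs' h4 h5].
have -> : F w * G w - F z * G z - (d * G z + F z * d') * (w - z) =
  (F w - F z - d * (w - z)) * G z + (G w - G z - d' * (w - z)) * F z + (F w - F z) * (G w - G z) by ring.
set t := cmod (w - z) in h1 h2 h3 h4 h5 *; have t0 : 0 <= t by exact: cmod_ge0.
have -> : e * t = e / 3 * t + e / 3 * t + e / 3 * t by field.
apply: le_trans (cmodD _ _) _; apply: lerD; first apply: le_trans (cmodD _ _) _; first apply: lerD.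
- rewrite cmodM; apply: le_trans (ler_wpM2r (cmod_ge0 _) h1) _.
  by apply: absorb_le; rewrite ?cmod_ge0 // ltW.
- rewrite cmodM; apply: le_trans (ler_wpM2r (cmod_ge0 _) h2) _.
  by apply: absorb_le; rewrite ?cmod_ge0 // ltW.
rewrite cmodM; apply: (@le_trans _ _ ((K * t) * (K' * t))).
  by apply: ler_pM; rewrite ?cmod_ge0.
have -> : K * t * (K' * t) = t * (K * K') * t by ring.
by rewrite ler_wpM2r // -ler_pdivlMr ?mulr_gt0 // ltW.
Qed.

Lemma cdiffZ c F z : cdiff F z -> cdiff (fun w => c * F w) z.
Proof. by apply: cdiffM; exact: cdiff_cst. Qed.

Lemma cdiffX n z : cdiff (fun w : C => w ^+ n) z.
Proof.
elim: n => [|n IH]; first by under eq_fun do rewrite expr0; exact: cdiff_cst.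
by under eq_fun do rewrite exprS; apply: cdiffM => //; exact: cdiff_id.
Qed.

Lemma cdiffV z : z != 0 -> cdiff (fun w : C => w^-1) z.
Proof.
move=> z0; exists (- (z ^- 2)) => e e0; have cz : 0 < cmod z by rewrite cmod_gt0.
have c2 : 0 < cmod z / 2 by rewrite divr_gt0.
exists (Num.min (cmod z / 2) (e * (cmod z ^+ 3 / 2))).
  by rewrite lt_min c2 mulr_gt0 // divr_gt0 // exprn_gt0.
move=> w; rewrite lt_min => /andP[h1 h2].
have wz : cmod z / 2 < cmod w.
  have := cmodD w (z - w); rewrite [w + _]addrC subrK cmodC => h3; lra.
have w0 : w != 0 by rewrite -cmod_gt0 (lt_trans c2).
have -> : w^-1 - z^-1 - - z ^- 2 * (w - z) = (w - z) * ((w - z) / (w * z ^+ 2)).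
  by field; rewrite z0.
rewrite cmodM mulrC ler_wpM2r ?cmod_ge0 // cmodM cmodV cmodM cmodX.
rewrite ler_pdivrMr; last by rewrite mulr_gt0 ?exprn_gt0 // (lt_trans c2).
apply: le_trans (ltW h2) _; apply: ler_wpM2l; first exact: ltW.
have -> : cmod z ^+ 3 / 2 = cmod z / 2 * cmod z ^+ 2 by rewrite exprSr; ring.
by rewrite ler_wpM2r ?exprn_ge0 ?cmod_ge0 // ltW.
Qed.

Lemma cdiffVX n z : z != 0 -> cdiff (fun w : C => w ^- n) z.
Proof.
move=> z0; elim: n => [|n IH]; first by under eq_fun do rewrite expr0 invr1; exact: cdiff_cst.
under eq_fun do rewrite exprS invfM mulrC.
by apply: cdiffM; [|exact: cdiffV].
Qed.

Lemma cdiff_sum n (F : nat -> C -> C) z : (forall k, cdiff (F k) z) ->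
  cdiff (fun w => \sum_(k < n) F k w) z.
Proof.
move=> h; elim: n => [|n IH]; first by under eq_fun do rewrite big_ord0; exact: cdiff_cst.
by under eq_fun do rewrite big_ord_recr /=; apply: cdiffD.
Qed.

Lemma circ_cont_cdiff F (r : R) : 0 < r -> (forall u, cmod u = 1 -> cdiff F (r%:C * u)) ->
  circ_cont (fun u => F (r%:C * u)).
Proof.
move=> r0 h u u1 e e0; have [d d0 hd] := cdiff_cont (h u u1) e0.
exists (d / r); first by rewrite divr_gt0.
move=> v v1; rewrite ltr_pdivlMr // => uv; apply: hd.
by rewrite -mulrBr cmodM cmod_real gtr0_norm // mulrC.
Qed.

Lemma circ_contM F G : circ_cont F -> circ_cont G -> circ_cont (fun u => F u * G u).
Proof.
move=> Fc Gc; have [M M0 hM] := circ_bdd Fc; have [M' M'0 hM'] := circ_bdd Gc.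
move=> u u1 e e0; have e2 : 0 < e / 2 by rewrite divr_gt0.
have a0 : 0 < M + 1 by rewrite ltr_wpDl. have b0 : 0 < M' + 1 by rewrite ltr_wpDl.
have [d d0 hd] := Fc u u1 _ (divr_gt0 e2 b0); have [d' d'0 hd'] := Gc u u1 _ (divr_gt0 e2 a0).
exists (Num.min d d'); first by rewrite lt_min d0.
move=> v v1; rewrite lt_min => /andP[/(hd v v1) h /(hd' v v1) h'].
have -> : F v * G v - F u * G u = (F v - F u) * G v + F u * (G v - G u) by ring.
apply: le_lt_trans (cmodD _ _) _; rewrite [ltRHS]splitr; apply: ltrD; rewrite cmodM.
  rewrite ltr_pdivlMr // in h; apply: le_lt_trans h; apply: ler_wpM2l; rewrite ?cmod_ge0 //.
  by apply: le_trans (hM' _ v1) _; rewrite lerDl.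
rewrite ltr_pdivlMr // in h'; apply: le_lt_trans h'; rewrite mulrC; apply: ler_wpM2l; rewrite ?cmod_ge0 //.
by apply: le_trans (hM _ u1) _; rewrite lerDl.
Qed.

Lemma circ_cont_conjX k : circ_cont (fun u : C => conjc u ^+ k).
Proof.
elim: k => [|k IH]; first by move=> u u1 e e0; exists 1 => // v _ _; rewrite !expr0 subrr cmod0.
under eq_fun do rewrite exprS; apply: circ_contM => // u u1 e e0; exists e => // v v1.
by rewrite -rmorphB cmodJ.
Qed.

Lemma circ_contX k : circ_cont (fun u : C => u ^+ k).
Proof.
elim: k => [|k IH]; first by move=> u u1 e e0; exists 1 => // v _ _; rewrite !expr0 subrr cmod0.
by under eq_fun do rewrite exprS; apply: circ_contM => // u u1 e e0; exists e.
Qed.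

Lemma circ_cont_unif F : (forall e : R, 0 < e -> exists2 G, circ_cont G &
   forall u, cmod u = 1 -> cmod (F u - G u) <= e) -> circ_cont F.
Proof.
move=> h u u1 e e0; have e4 : 0 < e / 4 by rewrite divr_gt0.
have [G Gc hG] := h _ e4; have [d d0 hd] := Gc u u1 _ e4; exists d => // v v1 /(hd v v1) uv.
have -> : F v - F u = (F v - G v) - (F u - G u) + (G v - G u) by ring.
apply: le_lt_trans (cmodD _ _) _; have := cmodB (F v - G v) (F u - G u).
have := hG v v1; have := hG u u1; lra.
Qed.

Lemma sin_ge_half (x : R) : 0 <= x <= 1 -> x / 2 <= sin x.
Proof.
move=> /andP[x0 x1]; have [c /itvP c01] : exists2 c, c \in `[0, x]%R & sin x - sin 0 = cos c * (x - 0).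
  apply: (@MVT_segment _ sin cos) => //.
  by apply: continuous_subspaceT => y; exact: continuous_sin.
rewrite sin0 !subr0 => ->; rewrite mulrC ler_wpM2r //.
have -> : c = (c / 2) *+ 2 by rewrite -mulr_natr mulfVK.
rewrite cos_mulr2n cos2sin2.
have h : sin (c / 2) ^+ 2 <= (1 / 2) ^+ 2.
  rewrite -[leLHS]real_normK ?num_real // ler_pXn2r ?nnegrE ?divr_ge0 //.
  apply: le_trans (sin_le _) _; rewrite ger0_norm ?divr_ge0 ?c01 //.
  by rewrite ler_pM2r ?invr_gt0 //; apply: le_trans x1; rewrite c01.
have aux (y : R) : y <= (1 / 2) ^+ 2 -> 2^-1 <= (1 - y) *+ 2 - 1.
  by rewrite -[_ *+ 2]mulr_natl expr2 => ?; lra.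
exact: aux.
Qed.

(** Cauchy's theorem on an annulus: as [dz = i z dt] on a circle, the mean of [F z * z] is a
    multiple of the contour integral of [F]. *)
Lemma circ_mean F (r1 r2 : R) : 0 <= r1 -> r1 <= r2 ->
  (forall z, r1 <= cmod z <= r2 -> cdiff F z) ->
  climC (fun N => avg (2 ^ N) (fun u => F (r2%:C * u) * (r2%:C * u)) -
                  avg (2 ^ N) (fun u => F (r1%:C * u) * (r1%:C * u))) 0.
Proof.
move=> r10 r12 Fd e e0; have [N0 hN0] := goursat r10 r12 Fd (divr_gt0 e0 (ltr0Sn R 1)).
exists (maxn N0 3) => N; rewrite geq_max => /andP[/hN0 {}hN0 N3]; rewrite subr0.
set n := (2 ^ N)%N; have n0 : (0 < n)%N by rewrite expn_gt0.
have n8 : 8 <= n%:R :> R by rewrite ler_nat (@leq_pexp2l 2 3).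
have nR : 0 < n%:R :> R by rewrite ltr0n.
pose w := om R n; pose m r := avg n (fun u => F (r%:C * u) * (r%:C * u)).
have wi : w * w^-1 = 1 by rewrite divff // unimod_neq0 // cmod_om.
have gp b : cis (2 * pi * (b%:R / 2 ^+ N)) = w ^+ b.
  by rewrite cisX /n natrX; congr cis; ring.
(* Over a full turn the sum may be reindexed, so the trapezoidal sum is exactly a multiple of the
   mean, with a factor tending to [2 pi i]. *)
have V (r : R) : \sum_(0 <= b < n) edge F (r%:C * w ^+ b) (r%:C * w ^+ b.+1) =
   (w - w^-1) / 2 * (n%:R * m r).
  have E : n%:R * m r = \sum_(0 <= b < n) F (r%:C * w ^+ b) * (r%:C * w ^+ b).
    by rewrite /m /avg mulrA divff ?mul1r ?big_mkord // pnatr_eq0 -lt0n.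
  have E' : n%:R * m r = \sum_(0 <= b < n) F (r%:C * w ^+ b.+1) * (r%:C * w ^+ b.+1).
    rewrite /m -(avg_rot _ 1) // /avg mulrA divff ?mul1r ?big_mkord ?pnatr_eq0 -?lt0n //.
    by apply: eq_bigr => b _; rewrite expr1 exprS.
  transitivity ((w - 1) / 2 * (n%:R * m r) + (1 - w^-1) / 2 * (n%:R * m r)); last by field; rewrite unimod_neq0 ?cmod_om.
  rewrite {1}E E' !mulr_sumr -big_split; apply: eq_bigr => b _; rewrite /edge /= exprS.
  set f := F _; set f' := F _; set x := w ^+ b.
  have -> : (1 - w^-1) / 2 * (f' * (r%:C * (w * x))) = f' * (r%:C * x) * (w - w * w^-1) / 2 by ring.
  by rewrite wi; ring.
have : cmod ((w - w^-1) / 2 * n%:R * (m r2 - m r1)) <= e / 2.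
  move: hN0; rewrite /contour /=.
  (* The two radial sides coincide after a full turn and cancel. *)
  have -> : \sum_(0 <= a < 2 ^ N) (edge F (gridpt r1 r2 N a 0) (gridpt r1 r2 N a.+1 0) -
     edge F (gridpt r1 r2 N a (2 ^ N)) (gridpt r1 r2 N a.+1 (2 ^ N))) = 0.
    apply: big1 => a _; rewrite /gridpt !gp omXn // expr0; ring.
  rewrite add0r sumrB.
  have g1 b : gridpt r1 r2 N 0 b = r1%:C * w ^+ b.
    by rewrite /gridpt gp mul0r mulr0 addr0.
  have g2 b : gridpt r1 r2 N (2 ^ N) b = r2%:C * w ^+ b.
    by rewrite /gridpt gp natrX divff ?expf_neq0 // mulr1 addrC subrK.
  under eq_bigr do rewrite !g2; under [X in _ - X]eq_bigr do rewrite !g1.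
  by rewrite !V -!mulrA -!mulrBr !mulrA.
rewrite -/(m r1) -/(m r2) cmodM => h; apply: le_lt_trans (_ : _ <= e / 2) _; last lra.
apply: le_trans h; rewrite ler_peMl ?cmod_ge0 //.
(* The factor is [i n sin(2 pi / n)], of modulus at least [pi] by [sin_ge_half], so removing it
   preserves the bound; [8 <= n] and [pi <= 4] place [2 pi / n] in [[0, 1]]. *)
have -> : (w - w^-1) / 2 * n%:R = ((n%:R * sin (2 * pi / n%:R)) *i)%C.
  rewrite -unimodJ ?cmod_om // subcJ /=.
  transitivity ((n%:R * sin (2 * pi / n%:R))%:C * 'i%C : C); last first.
    by apply/eqP; rewrite eq_complex /=; apply/andP; split; apply/eqP; ring.
  by rewrite rmorphM rmorph_nat; field.
have p2 := pi_ge2 R; have p4 : pi <= 4 :> R.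
  have := pihalf_02_cos_pihalf R; case=> /andP[_]; lra.
rewrite cmodE /= expr0n add0r sqrtr_sqr ger0_norm; last first.
  rewrite mulr_ge0 ?ler0n // sin_ge0_pi // divr_ge0 ?ler0n ?mulr_ge0 ?pi_ge0 //=.
  by rewrite ler_pdivrMr // [pi * _]mulrC; apply: ler_wpM2r; rewrite ?pi_ge0 //; lra.
have hx : (0 : R) <= 2 * pi / n%:R <= (1 : R).
  rewrite divr_ge0 ?ler0n ?mulr_ge0 ?pi_ge0 //=; rewrite ler_pdivrMr //; lra.
apply: le_trans (ler_wpM2l (ltW nR) (sin_ge_half hx)).
have -> : n%:R * (2 * pi / n%:R / 2) = pi :> R by field; rewrite gt_eqF.
lra.
Qed.

End ComplexDiff.

(** * Power series *)

Section Taylor.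
Variable R : realType.
Local Notation C := R[i].

(** Cauchy's estimates with a common bound [M] on the circle of radius [r] are part of the notion,
    so that tails are uniformly small on smaller discs. *)
Definition pser (c : nat -> C) (r M : R) (g : C -> C) :=
  (forall k, cmod (c k) * r ^+ k <= M) /\
  (forall z, cmod z < r -> climC (fun n => \sum_(k < n) c k * z ^+ k) (g z)).

Lemma climCZr (u : nat -> C) l c : climC u l -> climC (fun n => u n * c) (l * c).
Proof. by move=> h; rewrite mulrC; under eq_fun do rewrite mulrC; exact: climCZ. Qed.

Lemma geom_tail (q : R) n m : 0 <= q < 1 -> \sum_(n <= k < m) q ^+ k <= q ^+ n / (1 - q).
Proof.
move=> /andP[q0 q1]; have q1' : 0 < 1 - q by rewrite subr_gt0.
have [nm|mn] := leqP n m; last first.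
  by rewrite big_geq ?(ltnW mn) // divr_ge0 ?exprn_ge0 // ltW.
rewrite -(subnKC nm).
suff h d : \sum_(n <= k < n + d) q ^+ k = (q ^+ n - q ^+ (n + d)) / (1 - q).
  by rewrite h ler_wpM2r ?invr_ge0 ?(ltW q1') // gerBl exprn_ge0.
elim: d => [|j IH]; first by rewrite addn0 big_geq // subrr mul0r.
rewrite addnS big_nat_recr ?leq_addr //= IH exprS; field.
by rewrite gt_eqF.
Qed.

Lemma ratio01 (s r : R) : 0 <= s -> s < r -> 0 <= s / r < 1.
Proof.
move=> s0 sr; have r0 := le_lt_trans s0 sr.
by rewrite divr_ge0 ?(ltW r0) //= ltr_pdivrMr // mul1r.
Qed.

Lemma pser_diff (c : nat -> C) (r M s : R) z n m : 0 < r -> (forall k, cmod (c k) * r ^+ k <= M) ->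
  cmod z <= s -> s < r -> (n <= m)%N ->
  cmod (\sum_(k < m) c k * z ^+ k - \sum_(k < n) c k * z ^+ k) <= M * ((s / r) ^+ n / (1 - s / r)).
Proof.
move=> r0 hM zs sr nm; have s0 : 0 <= s by exact: le_trans (cmod_ge0 _) zs.
have M0 : 0 <= M by apply: le_trans (hM 0%N); rewrite mulr_ge0 ?cmod_ge0 // exprn_ge0 // ltW.
have q01 := ratio01 s0 sr.
rewrite -(big_mkord predT (fun k => c k * z ^+ k)) -(big_mkord predT (fun k => c k * z ^+ k)).
rewrite (big_cat_nat (leq0n n) nm) /= addrAC subrr add0r.
apply: le_trans (cmod_sum _ _ _) _; apply: le_trans (_ : _ <= \sum_(n <= k < m) M * (s / r) ^+ k) _.
  apply: ler_sum => k _; rewrite cmodM cmodX.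
  apply: (@le_trans _ _ (cmod (c k) * s ^+ k)).
    by rewrite ler_wpM2l ?cmod_ge0 // lerXn2r ?nnegrE ?cmod_ge0.
  have -> : cmod (c k) * s ^+ k = (cmod (c k) * r ^+ k) * (s / r) ^+ k.
    by rewrite exprMn exprVn; field; rewrite expf_neq0 // gt_eqF.
  by rewrite ler_wpM2r // exprn_ge0 //; case/andP: q01.
by rewrite -mulr_sumr ler_wpM2l // geom_tail.
Qed.

Lemma pser_tail c r M g s z n : pser c r M g -> 0 < r -> cmod z <= s -> s < r ->
  cmod (g z - \sum_(k < n) c k * z ^+ k) <= M * ((s / r) ^+ n / (1 - s / r)).
Proof.
move=> [hM hg] r0 zs sr; have := hg z (le_lt_trans zs sr).
move=> /(climCD (climC_cst (- \sum_(k < n) c k * z ^+ k))); rewrite addrC; apply: climC_le.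
by exists n => m nm; rewrite addrC; exact: pser_diff nm.
Qed.

Lemma tail_small (M q e : R) : 0 <= q < 1 -> 0 < e -> exists N, forall n, (N <= n)%N -> M * (q ^+ n / (1 - q)) < e.
Proof.
move=> /andP[q0 q1] e0; have q1' : 0 < 1 - q by rewrite subr_gt0.
have M1 : 0 < `|M| + 1 by rewrite ltr_wpDl.
have [||N hN] := @exp_small _ q (e / (`|M| + 1) * (1 - q)); first by rewrite q0.
  by rewrite mulr_gt0 // divr_gt0.
exists N => n /hN; rewrite -ltr_pdivrMr // => h.
have h0 : 0 <= q ^+ n / (1 - q) by rewrite divr_ge0 ?exprn_ge0 // ltW.
apply: (@le_lt_trans _ _ ((`|M| + 1) * (q ^+ n / (1 - q)))).
  by rewrite ler_wpM2r // (le_trans (ler_norm M)) // lerDl.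
by rewrite mulrC -ltr_pdivlMr.
Qed.

Lemma pser_ex (c : nat -> C) (r M : R) z : 0 < r -> (forall k, cmod (c k) * r ^+ k <= M) ->
  cmod z < r -> exists l, climC (fun n => \sum_(k < n) c k * z ^+ k) l.
Proof.
move=> r0 hM zr; apply: climC_cauchy => e e0.
have q01 := ratio01 (cmod_ge0 z) zr.
have [N hN] := tail_small M q01 e0; exists N => m n.
wlog nm : m n / (n <= m)%N.
  move=> h Nm Nn; have [nm|/ltnW mn] := leqP n m; first exact: h.
  by rewrite cmodC; exact: h.
by move=> _ Nn; apply: le_lt_trans (pser_diff r0 hM (lexx _) zr nm) _; exact: hN.
Qed.

Lemma pser_avg c r M g (s : R) a n : pser c r M g -> 0 < r -> 0 <= s -> s < r -> (a < n)%N ->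
  cmod (avg n (fun u => g (s%:C * u) * conjc u ^+ a) - c a * s%:C ^+ a) <= M * ((s / r) ^+ n / (1 - s / r)).
Proof.
move=> hp r0 s0 sr an; have M0 : 0 <= M.
  by apply: le_trans (hp.1 0%N); rewrite mulr_ge0 ?cmod_ge0 // exprn_ge0 // ltW.
have /andP[q0 q1] := ratio01 s0 sr.
(* The partial sum has degree below [n], so the [n]-point mean recovers its coefficient exactly;
   only the tail is lost. *)
have -> : c a * s%:C ^+ a = avg n (fun u => (\sum_(k < n) c k * (s%:C * u) ^+ k) * conjc u ^+ a).
  under eq_avg do rewrite mulr_suml; rewrite avg_sum.
  under eq_bigr => k _.
    rewrite (_ : avg _ _ = c k * s%:C ^+ k * avg n (fun u => u ^+ k * conjc u ^+ a)); last first.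
      by rewrite -avgZ; apply: eq_avg => u _; rewrite exprMn; ring.
    rewrite avg_monoJ //; over.
  rewrite (bigD1 (Ordinal an)) //= eqxx mulr1 big1 ?addr0 // => i ia.
  suff /negPf -> : i != a :> nat by rewrite mulr0.
  by apply: contraNneq ia => h; apply/eqP/val_inj.
apply: avg_dist; first by rewrite mulr_ge0 // divr_ge0 ?exprn_ge0 // subr_ge0 ltW.
move=> u u1; rewrite -mulrBl cmodM cmodX cmodJ u1 expr1n mulr1.
by apply: pser_tail => //; rewrite cmodM cmod_real u1 mulr1 ger0_norm.
Qed.

Lemma pser_avg_lim c r M g (s : R) a : pser c r M g -> 0 < r -> 0 <= s -> s < r ->
  climC (fun n => avg n (fun u => g (s%:C * u) * conjc u ^+ a)) (c a * s%:C ^+ a).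
Proof.
move=> hp r0 s0 sr e e0.
have [N hN] := tail_small M (ratio01 s0 sr) e0; exists (maxn N a.+1) => n.
rewrite geq_max => /andP[Nn an]; apply: le_lt_trans (pser_avg hp r0 s0 sr an) _; exact: hN.
Qed.

(** Passage to the dyadic orders [2 ^ N], the only ones for which [circ_mean] speaks. *)
Lemma climC_exp (u : nat -> C) l : climC u l -> climC (fun N => u (2 ^ N)%N) l.
Proof.
move=> h e e0; have [N hN] := h _ e0; exists N => n Nn; apply: hN.
by apply: leq_trans Nn _; apply: ltnW; exact: ltn_expl.
Qed.

Lemma real_complex_neq0 (r : R) : 0 < r -> r%:C != 0 :> C.
Proof. by move=> r0; rewrite -cmod_gt0 cmod_real normr_gt0 gt_eqF. Qed.

Lemma cmod_circ (r : R) u : 0 <= r -> cmod u = 1 -> cmod (r%:C * u : C) = r.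
Proof. by move=> r0 u1; rewrite cmodM cmod_real u1 mulr1 ger0_norm. Qed.

Section Coefficients.
Variables (g : C -> C) (Rad : R).
Hypotheses (Rad0 : 0 < Rad) (gd : forall z, cmod z < Rad -> cdiff g z).

Let A (r : R) a b N := avg (2 ^ N) (fun u => g (r%:C * u) * (u ^+ a * conjc u ^+ b)).

Lemma circ_cont_disc (r : R) : 0 < r -> r < Rad -> circ_cont (fun u => g (r%:C * u)).
Proof.
move=> r0 rR; apply: circ_cont_cdiff => // u u1; apply: gd.
by rewrite cmod_circ // ltW.
Qed.

Lemma fourier_ex r a b : 0 < r -> r < Rad -> exists l, climC (A r a b) l.
Proof.
move=> r0 rR; have [|l hl] := @avg_lim R (fun u => g (r%:C * u) * (u ^+ a * conjc u ^+ b)).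
  apply: circ_contM; first exact: circ_cont_disc.
  by apply: circ_contM; [exact: circ_contX | exact: circ_cont_conjX].
by exists l; exact: climC_exp hl.
Qed.

(** Cauchy's theorem for [g z / z^(k+1)] on the annulus: the Taylor coefficient read off a circle
    does not depend on its radius. *)
Lemma fourier_scale r1 r2 k l1 l2 : 0 < r1 -> r1 <= r2 -> r2 < Rad ->
  climC (A r1 0%N k) l1 -> climC (A r2 0%N k) l2 -> l1 / r1%:C ^+ k = l2 / r2%:C ^+ k.
Proof.
move=> r10 r12 r2R hl1 hl2; have r20 := lt_le_trans r10 r12; have r1R := le_lt_trans r12 r2R.
have E (r : R) N : 0 < r -> avg (2 ^ N) (fun u => (g (r%:C * u) * (r%:C * u) ^- k.+1) * (r%:C * u)) = (r%:C ^+ k)^-1 * A r 0%N k N.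
  move=> r0; rewrite /A -avgZ; apply: eq_avg => u u1; rewrite unimodJ // expr0 mul1r exprVn !exprMn !exprS.
  by field; rewrite !expf_neq0 ?real_complex_neq0 // unimod_neq0.
apply/eqP; rewrite eq_sym -subr_eq0; apply/eqP.
apply: climC_uniq (@circ_mean R (fun z => g z * z ^- k.+1) r1 r2 (ltW r10) r12 _) => [|z /andP[z1 z2]]; last first.
  apply: cdiffM; first by apply: gd; exact: le_lt_trans r2R.
  by apply: cdiffVX; rewrite -cmod_gt0 (lt_le_trans r10).
under eq_fun do rewrite !E // -mulNr.
by rewrite ![_ / _]mulrC -mulNr; apply: climCD; apply: climCZ.
Qed.

Lemma bdd_at0 : exists2 M0 : R, 0 < M0 & exists2 d : R, 0 < d & forall z, cmod z < d -> cmod (g z) <= M0.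
Proof.
have g0d : cdiff g 0 by apply: gd; rewrite cmod0.
have [d d0 hd] := cdiff_cont g0d ltr01.
exists (cmod (g 0) + 1); first by rewrite ltr_wpDl ?cmod_ge0.
exists d => // z zd; have -> : g z = g 0 + (g z - g 0) by ring.
by apply: le_trans (cmodD _ _) _; rewrite lerD2l ltW // hd // subr0.
Qed.

(** By Cauchy's theorem for [g z * z^a] the quantity [r^(a+1)] times the coefficient is independent
    of [r]; since [g] is bounded near 0, letting the radius shrink shows that it is 0. *)
Lemma fourier_neg r a : 0 < r -> r < Rad -> climC (A r a.+1 0%N) 0.
Proof.
move=> rp rR; have [l' hl'] := fourier_ex a.+1 0%N rp rR; suff <- : l' = 0 by [].
have [M0 M00 [d d0 bnd0]] := bdd_at0.
apply/eqP; rewrite -cmod_eq0 eq_le cmod_ge0 andbT.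
suff h : cmod l' * r ^+ a.+1 <= 0 by rewrite -(@ler_pM2r _ (r ^+ a.+1)) ?mul0r // exprn_gt0.
apply/ler_addgt0Pr => e e0; rewrite add0r.
pose r1 := Num.min (Num.min r (d / 2)) (Num.min 1 (e / M0)).
have r1p : 0 < r1 by rewrite !lt_min rp ltr01 !divr_gt0.
have r1r : r1 <= r by rewrite !ge_min lexx.
have r11 : r1 <= 1 by rewrite !ge_min lexx !orbT.
have r1d : r1 < d by apply: (@le_lt_trans _ _ (d / 2)); [rewrite !ge_min lexx !orbT | lra].
have r1e : r1 <= e / M0 by rewrite !ge_min lexx !orbT.
have [l1 hl1] := fourier_ex a.+1 0%N r1p (le_lt_trans r1r rR).
have E (s : R) N : 0 < s -> avg (2 ^ N) (fun u => (g (s%:C * u) * (s%:C * u) ^+ a) * (s%:C * u)) = (s%:C ^+ a.+1) * A s a.+1 0%N N.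
  by move=> s0; rewrite /A -avgZ; apply: eq_avg => u u1; rewrite expr0 mulr1 !exprMn !exprS; ring.
have h2 : r%:C ^+ a.+1 * l' - r1%:C ^+ a.+1 * l1 = 0.
  apply: climC_uniq (@circ_mean R (fun z => g z * z ^+ a) r1 r (ltW r1p) r1r _) => [|z /andP[z1 z2]]; last first.
    by apply: cdiffM; [apply: gd; exact: le_lt_trans rR | exact: cdiffX].
  under eq_fun do rewrite !E // -mulNr; rewrite -mulNr.
  by apply: climCD; apply: climCZ.
have -> : cmod l' * r ^+ a.+1 = cmod l1 * r1 ^+ a.+1.
  transitivity (cmod (r%:C ^+ a.+1 * l')); first by rewrite cmodM cmodX cmod_real gtr0_norm // mulrC.
  by move/eqP: h2; rewrite subr_eq0 => /eqP ->; rewrite cmodM cmodX cmod_real gtr0_norm // mulrC.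
have l1M : cmod l1 <= M0.
  apply: climC_le hl1; exists 0%N => N _; apply: avg_le; first exact: ltW.
  move=> u u1; rewrite expr0 mulr1 cmodM cmodX u1 expr1n mulr1; apply: bnd0.
  by rewrite cmod_circ // ltW.
apply: (@le_trans _ _ (M0 * (e / M0))); last by rewrite mulrC divfK // gt_eqF.
apply: ler_pM; rewrite ?cmod_ge0 ?exprn_ge0 ?(ltW r1p) //.
by apply: le_trans r1e; rewrite exprS ler_piMr ?(ltW r1p) // exprn_ile1 // ltW.
Qed.

Lemma fourier_coef : exists c, forall r a b, 0 < r -> r < Rad ->
  climC (A r a b) (if (a <= b)%N then c (b - a)%N * r%:C ^+ (b - a) else 0).
Proof.
pose r0 := Rad / 2; have r00 : 0 < r0 by rewrite divr_gt0.
have r0R : r0 < Rad by rewrite /r0; move: Rad0; lra.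
have /choice [l hl] k : exists l, climC (A r0 0%N k) l by exact: fourier_ex.
pose c k := l k / r0%:C ^+ k; exists c.
have lE r k : 0 < r -> r < Rad -> climC (A r 0%N k) (c k * r%:C ^+ k).
  move=> rp rR; have [l' hl'] := fourier_ex 0%N k rp rR.
  suff -> : c k * r%:C ^+ k = l' by [].
  rewrite /c; have [r0r|/ltW rr0] := leP r0 r.
    by rewrite (fourier_scale r00 r0r rR (hl k) hl') divfK // expf_neq0 // real_complex_neq0.
  by rewrite -(fourier_scale rp rr0 r0R hl' (hl k)) divfK // expf_neq0 // real_complex_neq0.
move=> r a b rp rR; case: leqP => ab.
  have := lE r (b - a)%N rp rR; congr climC; apply/funext => N.
  apply: eq_avg => u u1; rewrite -{2}(subnK ab) exprD [u ^+ a * _]mulrCA -exprMn unimod_mulJ //.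
  by rewrite expr1n expr0 mulr1 mul1r.
have := @fourier_neg r (a - b).-1 rp rR; rewrite prednK ?subn_gt0 //; congr climC; apply/funext => N.
apply: eq_avg => u u1; rewrite -{2}(subnK (ltnW ab)) exprD -mulrA -exprMn unimod_mulJ //.
by rewrite expr1n expr0.
Qed.

(** On the circle through [z], the sum of the series built from the coefficients has the same
    Fourier coefficients as [g], so the two agree by [fourier_uniq]. The sequence [c] serves all
    radii and bounds at once. *)
Lemma taylor : exists c, forall r M, 0 < r -> r < Rad ->
  (forall u, cmod u = 1 -> cmod (g (r%:C * u)) <= M) -> pser c r M g.
Proof.
have [c gpart] := fourier_coef.
have cb r M k : 0 < r -> r < Rad -> (forall u, cmod u = 1 -> cmod (g (r%:C * u)) <= M) ->
    cmod (c k) * r ^+ k <= M.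
  move=> rp rR hM; have h := gpart r 0%N k rp rR; rewrite leq0n subn0 in h.
  have -> : cmod (c k) * r ^+ k = cmod (c k * r%:C ^+ k) by rewrite cmodM cmodX cmod_real gtr0_norm.
  apply: climC_le h; exists 0%N => N _; apply: avg_le.
    by apply: le_trans (cmod_ge0 _) (hM 1 (cmod1 R)).
  by move=> u u1; rewrite expr0 mul1r cmodM cmodX cmodJ u1 expr1n mulr1 hM.
exists c => r M rp rR hM; split; first by move=> k; exact: cb.
suff main z : cmod z < Rad -> climC (fun n => \sum_(k < n) c k * z ^+ k) (g z).
  by move=> z zr; apply: main; exact: lt_trans rR.
(* At the origin the circle through [z] degenerates; there the constant term is compared with [g 0]
   on small circles. *)
move=> {r M rp rR hM} zR; have [z0|z0] := eqVneq z 0.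
  have g0d : cdiff g 0 by apply: gd; rewrite cmod0.
  have c0 : c 0%N = g 0.
    apply/eqP; rewrite -subr_eq0 -cmod_eq0 eq_le cmod_ge0 andbT; apply/ler_addgt0Pr => e e0; rewrite add0r.
    have [s s0 hs] := cdiff_cont g0d e0.
    pose r := Num.min (s / 2) (Rad / 2); have rp : 0 < r by rewrite lt_min !divr_gt0.
    have rs : r < s by apply: (@le_lt_trans _ _ (s / 2)); [rewrite ge_min lexx | lra].
    have rR : r < Rad by apply: (@le_lt_trans _ _ (Rad / 2)); [rewrite ge_min lexx orbT | move: Rad0; lra].
    have := gpart r 0%N 0%N rp rR; rewrite leqnn subnn expr0 mulr1 => /(climCD (climC_cst (- g 0))).
    rewrite addrC; apply: climC_le; exists 0%N => N _; rewrite addrC.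
    have N0 : (0 < 2 ^ N)%N by rewrite expn_gt0.
    rewrite -(avg_cst (g 0) N0); apply: avg_dist; first exact: ltW.
    move=> u u1; rewrite !expr0 !mulr1; apply/ltW/hs.
    by rewrite subr0 cmod_circ // ltW.
  move=> e e0; exists 1%N => -[//|n] _; rewrite z0 big_ord_recl expr0 mulr1 big1.
    by rewrite addr0 c0 subrr cmod0.
  by move=> i _; rewrite expr0n mulr0.
have rp : 0 < cmod z by rewrite cmod_gt0.
set r := cmod z in rp zR *; pose v := z / r%:C.
have v1 : cmod v = 1 by rewrite cmodM cmodV cmod_real gtr0_norm // divff // gt_eqF.
have zv : z = r%:C * v by rewrite mulrC divfK // real_complex_neq0.
pose rho := (r + Rad) / 2; have rrho : r < rho by rewrite /rho; lra.
have rhoR : rho < Rad by rewrite /rho; lra.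
(* Coefficient bounds on the larger circle of radius [rho] make the series converge uniformly on the
   circle of radius [r]. *)
have rhop : 0 < rho by exact: lt_trans rrho.
have [M M0' hM] := circ_bdd (circ_cont_disc rhop rhoR).
have hb k : cmod (c k) * rho ^+ k <= M by exact: cb.
have /choice [gt hgt] z' : exists y, cmod z' <= r -> climC (fun n => \sum_(k < n) c k * z' ^+ k) y.
  have [zr|zr] := pselect (cmod z' <= r); last by exists 0.
  by have [y hy] := pser_ex rhop hb (le_lt_trans zr rrho); exists y.
have q01 := ratio01 (ltW rp) rrho.
have tail z' n : cmod z' <= r -> cmod (gt z' - \sum_(k < n) c k * z' ^+ k) <= M * ((r / rho) ^+ n / (1 - r / rho)).
  move=> zr; have := hgt z' zr => /(climCD (climC_cst (- \sum_(k < n) c k * z' ^+ k))).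
  rewrite addrC; apply: climC_le; exists n => m nm; rewrite addrC.
  by apply: pser_diff => //.
have ru u : cmod u = 1 -> cmod (r%:C * u) = r by move=> u1; rewrite cmod_circ // ltW.
suff : forall u, cmod u = 1 -> g (r%:C * u) - gt (r%:C * u) = 0.
  move=> /(_ v v1) /eqP; rewrite subr_eq0 zv => /eqP ->.
  by apply: hgt; rewrite ru.
pose S n z := \sum_(k < n) c k * z ^+ k.
have Sc n : circ_cont (fun u => g (r%:C * u) - S n (r%:C * u)).
  apply: (@circ_cont_cdiff _ (fun z => g z - S n z)) => // u u1.
  apply: cdiffD; first by apply: gd; rewrite ru.
  have -> : (fun w => - S n w) = (fun w => (-1) * S n w) by apply/funext => w; rewrite mulN1r.
  by apply: cdiffZ; apply: (@cdiff_sum _ n (fun k w => c k * w ^+ k)) => k; apply: cdiffZ; exact: cdiffX.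
have approx e : 0 < e -> exists N, forall n, (N <= n)%N -> forall u, cmod u = 1 ->
   cmod (g (r%:C * u) - gt (r%:C * u) - (g (r%:C * u) - S n (r%:C * u))) < e.
  move=> e0; have [N hN] := tail_small M q01 e0; exists N => n Nn u u1.
  have -> : g (r%:C * u) - gt (r%:C * u) - (g (r%:C * u) - S n (r%:C * u)) = S n (r%:C * u) - gt (r%:C * u) by ring.
  by rewrite cmodC; apply: le_lt_trans (tail _ _ _) (hN _ Nn); rewrite ru.
apply: fourier_uniq.
  apply: circ_cont_unif => e e0; have [N hN] := approx _ e0.
  by exists (fun u => g (r%:C * u) - S N (r%:C * u)) => // u u1; apply: ltW; exact: hN.
move=> a b e e0; have e2 : 0 < e / 2 by rewrite divr_gt0.
have [n0 hn0] := approx _ e2; pose n := (maxn n0 (maxn a b)).+1.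
have {}hn0 := hn0 n (leqW (leq_maxl _ _)).
have [N1 hN1] := gpart r a b rp zR _ e2.
exists (maxn N1 (n + a + b)) => N; rewrite geq_max subr0 => /andP[/hN1 {}hN1 nN].
have NN : (n + a + b < 2 ^ N)%N by apply: leq_ltn_trans nN _; exact: ltn_expl.
pose B := avg (2 ^ N) (fun u => (g (r%:C * u) - S n (r%:C * u)) * (u ^+ a * conjc u ^+ b)).
have -> : avg (2 ^ N) (fun u => (g (r%:C * u) - gt (r%:C * u)) * (u ^+ a * conjc u ^+ b)) =
  (avg (2 ^ N) (fun u => (g (r%:C * u) - gt (r%:C * u)) * (u ^+ a * conjc u ^+ b)) - B) + B by ring.
apply: le_lt_trans (cmodD _ _) _; rewrite [ltRHS]splitr; apply: ler_ltD.
  apply: avg_dist; first exact: ltW.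
  move=> u u1; rewrite -mulrBl cmodM cmodM !cmodX cmodJ u1 !expr1n !mulr1.
  by apply: ltW; exact: hn0.
suff -> : B = A r a b N - (if (a <= b)%N then c (b - a)%N * r%:C ^+ (b - a) else 0) by [].
have bN : (b < 2 ^ N)%N := leq_ltn_trans (leq_addl _ _) NN.
have kN (k : 'I_n) : (k + a < 2 ^ N)%N.
  by apply: leq_ltn_trans NN; rewrite (leq_trans _ (leq_addr _ _)) // leq_add2r ltnW.
rewrite /B; under eq_avg do rewrite mulrBl; rewrite avgB; congr (_ - _).
under eq_avg do rewrite mulr_suml; rewrite avg_sum.
under eq_bigr => k _.
  rewrite (_ : avg _ _ = c k * r%:C ^+ k * avg (2 ^ N) (fun u => u ^+ (k + a) * conjc u ^+ b)); last first.
    by rewrite -avgZ; apply: eq_avg => u _; rewrite exprMn exprD; ring.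
  rewrite avg_monoJ //; over.
case: leqP => ab; last first.
  by rewrite big1 // => k _; rewrite gtn_eqF ?mulr0 // (leq_trans ab) // leq_addl.
have ba : (b - a < n)%N.
  by rewrite ltnS (leq_trans (leq_subr _ _)) // (leq_trans (leq_maxr a b)) // leq_maxr.
rewrite (bigD1 (Ordinal ba)) //= subnK // eqxx mulr1 big1 ?addr0 // => i iab.
suff /negPf -> : (i + a)%N != b by rewrite mulr0.
by apply: contraNneq iab => h; apply/eqP/val_inj; rewrite /= -h addnK.
Qed.

End Coefficients.

(* A bounded pointwise limit of power series is a power series. *)
Lemma pser_lim (F : nat -> C -> C) (c : nat -> nat -> C) (g : C -> C) (r M : R) : 0 < r ->
  (forall N, pser (c N) r M (F N)) -> (forall z, cmod z < r -> climC (F^~ z) (g z)) ->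
  exists d, pser d r M g.
Proof.
move=> r0 hF hg; pose s := r / 2; have s0 : 0 < s by rewrite divr_gt0.
have sr : s < r by rewrite /s; lra.
have M0 : 0 <= M by apply: le_trans ((hF 0%N).1 0%N); rewrite mulr_ge0 ?cmod_ge0 // exprn_ge0 // ltW.
have /choice [d hd] a : exists l, climC (fun N => c N a) l.
  suff [l hl] : exists l, climC (fun N => s%:C ^+ a * c N a) l.
    exists ((s%:C ^+ a)^-1 * l); have := climCZ (s%:C ^+ a)^-1 hl.
    congr climC; apply/funext => N; rewrite mulKf // expf_neq0 // real_complex_neq0 //.
  apply: climC_cauchy => e e0; have e4 : 0 < e / 4 by rewrite divr_gt0.
  have [n0 hn0] := tail_small M (ratio01 (ltW s0) sr) e4.
  pose n := (maxn n0 a).+1; have an : (a < n)%N by rewrite ltnS leq_maxr.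
  have hn : M * ((s / r) ^+ n / (1 - s / r)) < e / 4 by apply: hn0; rewrite leqW // leq_maxl.
  (* The coefficient is read off from finitely many points at radius [r / 2], where pointwise
     convergence of [F] suffices; the error is a uniform tail. *)
  pose G N := avg n (fun u => F N (s%:C * u) * conjc u ^+ a).
  have [l hl] : exists l, climC G l.
    exists (avg n (fun u => g (s%:C * u) * conjc u ^+ a)).
    rewrite /G /avg; apply: climCZ.
    apply: (climC_sum (u := fun j N => F N (s%:C * om R n ^+ j) * conjc (om R n ^+ j) ^+ a) (l := fun j => g (s%:C * om R n ^+ j) * conjc (om R n ^+ j) ^+ a)) => j _.
    apply: climCZr; apply: hg.
    by rewrite cmod_circ ?cmod_omX // ltW.
  have [N0 hN0] := hl _ e4; exists N0 => N1 N2 /hN0 h1 /hN0 h2.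
  have h3 := pser_avg (hF N1) r0 (ltW s0) sr an; have h4 := pser_avg (hF N2) r0 (ltW s0) sr an.
  rewrite -/(G N1) in h3; rewrite -/(G N2) in h4.
  have -> : s%:C ^+ a * c N1 a - s%:C ^+ a * c N2 a =
     ((G N1 - l) - (G N2 - l)) - ((G N1 - c N1 a * s%:C ^+ a) - (G N2 - c N2 a * s%:C ^+ a)) by ring.
  have := cmodB ((G N1 - l) - (G N2 - l)) ((G N1 - c N1 a * s%:C ^+ a) - (G N2 - c N2 a * s%:C ^+ a)).
  have := cmodB (G N1 - l) (G N2 - l); have := cmodB (G N1 - c N1 a * s%:C ^+ a) (G N2 - c N2 a * s%:C ^+ a).
  lra.
exists d; have hdM k : cmod (d k) * r ^+ k <= M.
  rewrite -ler_pdivlMr ?exprn_gt0 //; apply: climC_le (hd k); exists 0%N => N _.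
  by rewrite ler_pdivlMr ?exprn_gt0 //; exact: (hF N).1.
split=> // z zr e e0; have e4 : 0 < e / 4 by rewrite divr_gt0.
have [n0 hn0] := tail_small M (ratio01 (cmod_ge0 z) zr) e4.
exists n0 => n nn0; have h : climC (fun N => F N z - \sum_(k < n) c N k * z ^+ k) (g z - \sum_(k < n) d k * z ^+ k).
  apply: climCD; first exact: hg.
  rewrite -mulN1r; under eq_fun do rewrite -mulN1r; apply: climCZ.
  apply: (climC_sum (u := fun k N => c N k * z ^+ k) (l := fun k => d k * z ^+ k)) => k _.
  by apply: climCZr.
rewrite cmodC; apply: le_lt_trans (_ : _ <= e / 4) _; last lra.
apply: climC_le h; exists 0%N => N _; apply: le_trans (ltW (hn0 n nn0)).
exact: pser_tail (hF N) r0 (lexx _) zr.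
Qed.

End Taylor.

(** * Topology of C^2 *)

Section TopC2.
Variable R : realType.
Local Notation C := R[i].
Implicit Types (z w : C2 R) (A : set (C2 R)).

Definition cn z : R := Num.max (cmod (z 0 0)) (cmod (z 0 1)).

Lemma cn0 z : cmod (z 0 0) <= cn z. Proof. by rewrite le_max lexx. Qed.
Lemma cn1 z : cmod (z 0 1) <= cn z. Proof. by rewrite le_max lexx orbT. Qed.
Lemma cn_ge0 z : 0 <= cn z. Proof. exact: le_trans (cmod_ge0 _) (cn0 z). Qed.

Lemma ord2P (P : 'I_2 -> Prop) : P 0 -> P 1 -> forall i, P i.
Proof.
move=> h0 h1 [[|[|//]] hi]; first by have -> : Ordinal hi = 0 by apply: val_inj.
by have -> : Ordinal hi = 1 by apply: val_inj.
Qed.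

Lemma C2P z w : z 0 0 = w 0 0 -> z 0 1 = w 0 1 -> z = w.
Proof. by move=> h0 h1; apply/rowP; apply: ord2P. Qed.

Lemma coord_le_norm z j : `|z 0 j| <= `|z|.
Proof.
suff : `|z 0 j| <= mx_norm z by [].
rewrite mx_normE -[leLHS]nngE num_le; exact: (le_bigmax _ _ (0, j)).
Qed.

Lemma norm_cn z : `|z| = (cn z)%:C.
Proof.
apply/eqP; rewrite eq_le; apply/andP; split.
  have [->|z0] := eqVneq z 0; first by rewrite normr0 lecR cn_ge0.
  have [[i j] /= e] : exists i, mx_norm z = `|z i.1 i.2|.
    by apply: mx_norm_neq0; apply: contra_neq z0 => /mx_norm_eq0.
  rewrite [`|z|]e (ord1 i) cmod_norm lecR.
  by move: j e; apply: ord2P => _; rewrite (cn0, cn1).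
rewrite /cn; have [h|h] := leP (cmod (z 0 0)) (cmod (z 0 1)).
  by rewrite -cmod_norm coord_le_norm.
by rewrite -cmod_norm coord_le_norm.
Qed.

Lemma pos_complexP (e : C) : 0 < e -> exists2 r : R, 0 < r & e = r%:C.
Proof.
move=> e0; have e1 : e = (complex.Re e)%:C by rewrite RRe_real // gtr0_real.
by exists (complex.Re e) => //; rewrite -ltcR -e1.
Qed.

Lemma nbhsC2P z A : nbhs z A <-> exists2 e : R, 0 < e & forall w, cn (w - z) < e -> A w.
Proof.
split.
  move=> /nbhs_normP [_ /pos_complexP[r r0 ->] h]; exists r => // w wz.
  by apply: h; rewrite /ball_ /= -normrN opprB norm_cn ltcR.
move=> [r r0 h]; suff : \near z, A z by []; apply/nbhs_normP; exists r%:C; first by rewrite /= ltcR.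
by move=> w /=; rewrite -normrN opprB norm_cn ltcR; exact: h.
Qed.

Lemma cnD z w : cn (z + w) <= cn z + cn w.
Proof. by rewrite -lecR rmorphD /= -!norm_cn; exact: ler_normD. Qed.
Lemma cnN z : cn (- z) = cn z.
Proof. by apply: (@complexI R); rewrite -!norm_cn normrN. Qed.
Lemma cnZ (c : C) z : cn (c *: z) = cmod c * cn z.
Proof. by apply: (@complexI R); rewrite rmorphM /= -!norm_cn -cmod_norm; exact: normrZ. Qed.
Lemma cnC z w : cn (z - w) = cn (w - z).
Proof. by rewrite -cnN opprB. Qed.
Lemma cn_eq0 z : (cn z == 0) = (z == 0).
Proof. by rewrite -[RHS]normr_eq0 norm_cn -(inj_eq (@complexI R)). Qed.
Lemma cn_0 : cn (0 : C2 R) = 0.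
Proof. by apply/eqP; rewrite cn_eq0. Qed.
Lemma cn_gt0 z : (0 < cn z) = (z != 0).
Proof. by rewrite lt_def cn_eq0 cn_ge0 andbT. Qed.

Definition cdiff2 (f : C2 R -> C) z := exists a b : C, forall e : R, 0 < e ->
  exists2 r : R, 0 < r & forall w, cn (w - z) < r ->
    cmod (f w - f z - (a * (w 0 0 - z 0 0) + b * (w 0 1 - z 0 1))) <= e * cn (w - z).

Lemma littleoC2P z (g : C2 R -> C) :
  (forall e : C, 0 < e -> \forall w \near z, `|g w| <= e * `|w - z : C2 R|) <->
  (forall e : R, 0 < e -> exists2 r : R, 0 < r & forall w, cn (w - z) < r ->
    cmod (g w) <= e * cn (w - z)).
Proof.
split=> h.
  move=> e e0; have ee : 0 < e%:C :> C by rewrite ltcR.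
  have /nbhsC2P[r r0 hr] := h _ ee; exists r => // w /hr.
  by rewrite /= cmod_norm norm_cn -rmorphM lecR.
move=> _ /pos_complexP[e e0 ->]; have [r r0 hr] := h _ e0.
by apply/nbhsC2P; exists r => // w /hr; rewrite /= cmod_norm norm_cn -rmorphM lecR.
Qed.

Definition lin2 (a b : C) (h : C2 R) : C := a * h 0 0 + b * h 0 1.

Lemma lin2_is_linear a b : linear (lin2 a b).
Proof. by move=> k u v; rewrite /lin2 !mxE /GRing.scale /=; ring. Qed.

HB.instance Definition _ a b := GRing.isLinear.Build C (C2 R) C _ (lin2 a b) (lin2_is_linear a b).

Lemma lin2_continuous a b : continuous (lin2 a b).
Proof.
apply/linear_bounded_continuous/linear_boundedP.
exists ((cmod a + cmod b)%:C); split; first by rewrite complex_real.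
move=> k hk h.
rewrite cmod_norm norm_cn; apply: le_trans (_ : _ <= (cmod a + cmod b)%:C * (cn h)%:C) _.
  rewrite -rmorphM lecR mulrDl /lin2; apply: le_trans (cmodD _ _) _.
  by rewrite !cmodM lerD // ler_wpM2l ?cmod_ge0 ?cn0 ?cn1.
by rewrite ler_wpM2r // ?ler0c ?cn_ge0 // ltW.
Qed.

(** Differentiability over the field [C] is complex differentiability; this form, with real
    tolerances and two complex coefficients, is the one used below. *)
Lemma differentiableC2P f z : differentiable f z <-> cdiff2 f z.
Proof.
split.
  move=> /diffP[dc]; have -> : lim (nbhs z) = z by exact: lim_id.
  set df := 'd f z => h.
  pose a := df (delta_mx 0 0); pose b := df (delta_mx 0 1); exists a, b.
  have dfE x : df x = a * x 0 0 + b * x 0 1.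
    rewrite {1}(row_sum_delta x) linear_sum big_ord_recl big_ord1 !linearZ /=.
    by rewrite /GRing.scale /= mulrC [X in _ + X]mulrC; congr (_ * _ + _ * x _ _); apply: val_inj.
  have : forall e : C, 0 < e -> \forall w \near z, `|f w - f z - df (w - z)| <= e * `|w - z : C2 R|.
    have : (f : C2 R -> C) = (fun x => f z + df (x - z)) +o_ (nbhs z) (fun w => w - z : C2 R).
      by apply/funext => x; exact: h.
    move/eqaddoP => h2 e /h2; apply: filterS => w.
    by rewrite !fctE opprD addrA.
  move/littleoC2P => h2 e /h2[r r0 hr]; exists r => // w /hr.
  by rewrite dfE !mxE.
move=> [a [b h]].
have ex : exists df : {linear C2 R -> C}, continuous df /\ forall x,
    f x = f (lim (nbhs z)) + df (x - lim (nbhs z)) +o_(x \near nbhs z) (x - lim (nbhs z)).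
  exists (lin2 a b : {linear C2 R -> C}); split; first exact: lin2_continuous.
  have -> : lim (nbhs z) = z by exact: lim_id.
  have e : (f : C2 R -> C) = (fun x => f z + lin2 a b (x - z)) +o_ (nbhs z) (fun w => w - z : C2 R).
    apply/eqaddoP; apply/littleoC2P => e e0; have [r r0 hr] := h e e0; exists r => // w /hr.
    move=> hw; apply: le_trans hw; rewrite le_eqVlt; apply/orP; left; apply/eqP; congr cmod.
    transitivity (f w - (f z + lin2 a b (w - z))) => //.
    by rewrite /lin2 !mxE opprD addrA.
  by move: e; rewrite funeqE.
by apply/diffP; exact: (getPex ex).
Qed.

End TopC2.

(** * Lebesgue measure on C^2 *)

Section ProductSigmaFinite.
Context d1 d2 (T1 : measurableType d1) (T2 : measurableType d2) (R : realType).
Variable m1 : {sigma_finite_measure set T1 -> \bar R}.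
Variable m2 : {sigma_finite_measure set T2 -> \bar R}.

Lemma product_sigma_finite : sigma_finite setT (m1 \x m2)%E.
Proof.
have [F UF mF] := sigma_finiteT m1; have [G UG mG] := sigma_finiteT m2.
pose H n := if @unpickle (nat * nat)%type n is Some ij then F ij.1 `*` G ij.2 else set0.
exists H; last first.
  move=> n; rewrite /H; case: (unpickle n) => [[i j]|] /=; last by rewrite measure0.
  have [mFi fFi] := mF i; have [mGj fGj] := mG j; split; first exact: measurableX.
  by rewrite product_measure1E // lte_mul_pinfty // ge0_fin_numE.
apply/esym; rewrite -subTset => -[x y] _.
have [i _ Fx] : (\bigcup_n F n) x by rewrite -UF.
have [j _ Gy] : (\bigcup_n G n) y by rewrite -UG.
by exists (pickle (i, j)) => //; rewrite /H pickleK.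
Qed.

(* A copy of the product measure under a fresh name: the library's
   sigma-finite structure on [m1 \x m2] is shadowed by the one for subprobabilities. *)
Definition prodm : set (T1 * T2) -> \bar R := (m1 \x m2)%E.
HB.instance Definition _ := Measure.copy prodm (m1 \x m2)%E.
HB.instance Definition _ := Measure_isSigmaFinite.Build _ _ _ prodm product_sigma_finite.

End ProductSigmaFinite.

(** * Measure preserving maps of product spaces *)

Section MeasurePreserving.
Local Open Scope ereal_scope.

Definition mpres d (T : measurableType d) (R : realType) (m : {measure set T -> \bar R}) (f : T -> T) :=
  measurable_fun setT f /\ forall A, measurable A -> m (f @^-1` A) = m A.

Lemma mpres_comp d (T : measurableType d) (R : realType) (m : {measure set T -> \bar R}) f g :
  mpres m f -> mpres m g -> mpres m (f \o g).
Proof.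
move=> [mf hf] [mg hg]; split; first exact: measurableT_comp.
move=> A mA; rewrite comp_preimage hg ?hf //.
by rewrite -[X in measurable X]setTI; exact: mf.
Qed.

Lemma mpres_id d (T : measurableType d) (R : realType) (m : {measure set T -> \bar R}) : mpres m id.
Proof. by split=> // A _; exact: measurable_id. Qed.

Lemma mpres_integral d (T : measurableType d) (R : realType) (m : {measure set T -> \bar R}) f (F : T -> \bar R) :
  mpres m f -> measurable_fun setT F -> (forall x, 0 <= F x) ->
  \int[m]_x F (f x) = \int[m]_x F x.
Proof.
move=> [mf hf] mF F0.
have := @ge0_integral_pushforward _ _ _ _ R f mf m setT F measurableT mF (fun x _ => F0 x).
rewrite preimage_setT => <-; apply: eq_measure_integral => A mA _; exact: hf.
Qed.

Variable R : realType.
Local Notation mu := (@lebesgue_measure R).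
Local Notation TR := (measurableTypeR R).

Lemma mpres_trans1 (a : R) : mpres mu (fun x : TR => (x + a)%R : TR).
Proof.
have mf : measurable_fun setT (fun x : TR => (x + a)%R : TR).
  exact: measurable_funD.
split=> // A mA; have h := @lebesgue_measure_unique R (pushforward mu (fun x : TR => (x + a)%R : TR)).
apply/esym; apply: h => // _ [[b c]] _ <-.
rewrite /pushforward [X in _ = mu X](_ : _ = `](b - a)%R, (c - a)%R]%classic); last first.
  by apply/seteqP; split=> x /=; rewrite !in_itv /= ltrBlDr lerBrDr.
rewrite !lebesgue_measure_itv /= !lte_fin ltrD2r; case: ifP => // _.
by rewrite -!EFinB; congr EFin; ring.
Qed.

(** On each section the shear is a translation of the line, which preserves Lebesgue measure. *)
Lemma mpres_shear d (T : measurableType d) (m : {sigma_finite_measure set T -> \bar R}) (phi : T -> TR) :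
  measurable_fun setT phi -> mpres (m \x mu) (fun p : T * TR => (p.1, (p.2 + phi p.1)%R : TR)).
Proof.
move=> mphi.
have mf : measurable_fun setT (fun p : T * TR => (p.1, (p.2 + phi p.1)%R : TR)).
  apply/measurable_fun_pairP; split=> /=; first exact: measurable_fst.
  by apply: measurable_funD; [exact: measurable_snd | exact: (measurableT_comp mphi measurable_fst)].
split=> // A mA; rewrite /product_measure1; apply: eq_integral => t _ /=.
rewrite -((mpres_trans1 (phi t)).2 (xsection A t)); last exact: measurable_xsection.
by congr (mu _); apply/seteqP; split=> y; rewrite /xsection /= !inE.
Qed.

Lemma mpres_prod d1 d2 (T1 : measurableType d1) (T2 : measurableType d2)
  (m1 : {sigma_finite_measure set T1 -> \bar R}) (m2 : {sigma_finite_measure set T2 -> \bar R}) f g :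
  mpres m1 f -> mpres m2 g -> mpres (m1 \x m2) (fun p : T1 * T2 => (f p.1, g p.2)).
Proof.
move=> [mf hf] [mg hg].
have mh : measurable_fun setT (fun p : T1 * T2 => (f p.1, g p.2)).
  apply/measurable_fun_pairP; split=> /=.
    exact: (measurableT_comp mf measurable_fst).
  exact: (measurableT_comp mg measurable_snd).
split=> // A mA; apply/esym.
apply: (@product_measure_unique _ _ _ _ R m1 m2 (pushforward (m1 \x m2) (fun p : T1 * T2 => (f p.1, g p.2)))) => //.
move=> A1 A2 mA1 mA2; rewrite /pushforward.
have mA1' : measurable (f @^-1` A1) by rewrite -[X in measurable X]setTI; exact: mf.
have mA2' : measurable (g @^-1` A2) by rewrite -[X in measurable X]setTI; exact: mg.
by rewrite -(hf _ mA1) -(hg _ mA2) -product_measure1E.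
Qed.

Lemma mpres_swap : mpres (mu \x mu) (fun p : TR * TR => (p.2, p.1)).
Proof.
have mh : measurable_fun setT (fun p : TR * TR => (p.2, p.1)).
  by apply/measurable_fun_pairP; split=> /=; [exact: measurable_snd | exact: measurable_fst].
split=> // A mA; apply/esym.
apply: (@product_measure_unique _ _ _ _ R mu mu (pushforward (mu \x mu) (fun p : TR * TR => (p.2, p.1)))) => //.
move=> A1 A2 mA1 mA2; rewrite /pushforward muleC -product_measure1E //.
by congr ((_ \x _) _); apply/seteqP; split=> -[x y] /= [].
Qed.

Lemma mpres_swap3 d (T : measurableType d) (m : {sigma_finite_measure set T -> \bar R}) :
  mpres ((m \x mu) \x mu) (fun p : T * TR * TR => ((p.1.1, p.2), p.1.2)).
Proof.
have mh : measurable_fun setT (fun p : T * TR * TR => ((p.1.1, p.2), p.1.2)).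
  apply/measurable_fun_pairP; split=> /=.
    apply/measurable_fun_pairP; split=> /=; last exact: measurable_snd.
    exact: (measurableT_comp measurable_fst measurable_fst).
  exact: (measurableT_comp measurable_snd measurable_fst).
split=> // A mA.
have mA' : measurable ((fun p : T * TR * TR => ((p.1.1, p.2), p.1.2)) @^-1` A).
  by rewrite -[X in measurable X]setTI; exact: mh.
have E (B : set (T * TR * TR)) : measurable B ->
    ((m \x mu) \x mu) B = \int[m]_t (mu \x mu) [set p | B ((t, p.1), p.2)].
  move=> mB; rewrite {1}/product_measure1.
  rewrite (fubini_tonelli1 (mu \o xsection B)) //; first exact: measurable_fun_xsection.
refine (etrans (E _ mA') (etrans _ (esym (E _ mA)))); apply: eq_integral => t _.
have mAt : measurable [set p : TR * TR | A ((t, p.1), p.2)].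
  have mh2 : measurable_fun setT (fun p : TR * TR => ((t, p.1), p.2) : T * TR * TR).
    apply/measurable_fun_pairP; split=> /=; last exact: measurable_snd.
    by apply/measurable_fun_pairP; split=> /=; [exact: measurable_cst | exact: measurable_fst].
  by have := mh2 measurableT _ mA; rewrite setTI.
by rewrite -(mpres_swap.2 _ mAt).
Qed.

End MeasurePreserving.

(** * Rotations, translations and open sets for Lebesgue measure on C^2 *)

Section Lebesgue4.
Variable R : realType.
Local Notation C := R[i].
Local Notation mu := (@lebesgue_measure R).
Local Notation TR := (measurableTypeR R).
Local Notation T4 := (TR * TR * TR * TR)%type.
Local Notation P := (@C2_of_R4 R).
Local Notation L4 := (lebesgue4 R).

Local Notation M2 := (prodm mu mu).
Local Notation M3 := (prodm M2 mu).

Definition R4_of_C2 (z : C2 R) : T4 :=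
  (complex.Re (z 0 0), complex.Im (z 0 0), complex.Re (z 0 1), complex.Im (z 0 1)).

Lemma R4_of_C2K z : P (R4_of_C2 z) = z.
Proof.
apply: C2P; rewrite /R4_of_C2 /C2_of_R4 mxE /=; first by case: (z 0 0).
by case: (z 0 1).
Qed.

Lemma mpres_ext d (T : measurableType d) (m : {measure set T -> \bar R}) (f g : T -> T) : f =1 g -> mpres m f -> mpres m g.
Proof. by move=> /funext ->. Qed.

Lemma mpres_sh2 (a : R) : mpres (mu \x mu)%E (fun p : TR * TR => (p.1, p.2 + a * p.1) : TR * TR).
Proof.
apply: (@mpres_shear R _ TR mu (fun x => a * x)).
by apply: measurable_funM; [exact: measurable_cst | exact: measurable_id].
Qed.

Lemma mpres_sh1 (a : R) : mpres (mu \x mu)%E (fun p : TR * TR => (p.1 + a * p.2, p.2) : TR * TR).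
Proof.
have h := mpres_comp (mpres_swap R) (mpres_comp (mpres_sh2 a) (mpres_swap R)).
exact: mpres_ext h.
Qed.

Lemma rot_id1 (c s t x y : R) : s * t = 1 - c -> t * (1 + c) = s ->
  x + - t * y + - t * (y + s * (x + - t * y)) = c * x - s * y.
Proof.
move=> st tc; transitivity ((1 - s * t) * x - t * (1 + (1 - s * t)) * y); first ring.
have e : 1 - (1 - c) = c by ring.
by rewrite st e tc.
Qed.

Lemma rot_id2 (c s t x y : R) : s * t = 1 - c -> y + s * (x + - t * y) = s * x + c * y.
Proof.
move=> st; transitivity (s * x + (1 - s * t) * y); first ring.
have e : 1 - (1 - c) = c by ring.
by rewrite st e.
Qed.

(** A plane rotation is a product of three shears with slopes [- t], [s], [- t], where [t] is the
    tangent of the half angle; this excludes [c = -1]. *)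
Lemma mpres_rot2 (c s : R) : c ^+ 2 + s ^+ 2 = 1 -> c != -1 ->
  mpres (mu \x mu)%E (fun p : TR * TR => (c * p.1 - s * p.2, s * p.1 + c * p.2) : TR * TR).
Proof.
move=> cs c1; have c10 : 1 + c != 0 by apply: contra c1 => /eqP h; apply/eqP; lra.
pose t := s / (1 + c).
have h := mpres_comp (mpres_sh1 (- t)) (mpres_comp (mpres_sh2 s) (mpres_sh1 (- t))).
apply: mpres_ext h => -[x y] /=.
have st : s * t = 1 - c by rewrite /t; apply: (mulIf c10); rewrite mulrA divfK //; lra.
have tc : t * (1 + c) = s by rewrite divfK.
by rewrite (rot_id1 x y st tc) (rot_id2 x y st).
Qed.

Lemma mpres_L4 (f : T4 -> T4) : mpres (M3 \x mu)%E f -> mpres L4 f.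
Proof. by []. Qed.

Lemma mpres_sh43 (a : R) : mpres L4 (fun p : T4 => (p.1, p.2 + a * p.1.2) : T4).
Proof.
have mp : measurable_fun setT (fun t : TR * TR * TR => a * t.2 : TR).
  by apply: measurable_funM; [exact: measurable_cst | exact: measurable_snd].
apply: mpres_L4; exact: (mpres_shear M3 mp).
Qed.

Lemma mpres_sh34 (a : R) : mpres L4 (fun p : T4 => (p.1.1, p.1.2 + a * p.2, p.2) : T4).
Proof.
have h : mpres L4 (fun p : T4 => (p.1.1, p.2, p.1.2) : T4) by apply: mpres_L4; exact: (@mpres_swap3 R _ _ M2).
have h2 := mpres_comp h (mpres_comp (mpres_sh43 a) h).
exact: mpres_ext h2.
Qed.

Lemma mpres_rot34 (c s : R) : c ^+ 2 + s ^+ 2 = 1 -> c != -1 ->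
  mpres L4 (fun p : T4 => (p.1.1, c * p.1.2 - s * p.2, s * p.1.2 + c * p.2) : T4).
Proof.
move=> cs c1; have c10 : 1 + c != 0 by apply: contra c1 => /eqP h; apply/eqP; lra.
pose t := s / (1 + c).
have h := mpres_comp (mpres_sh34 (- t)) (mpres_comp (mpres_sh43 s) (mpres_sh34 (- t))).
apply: mpres_ext h => -[[q x] y] /=.
have st : s * t = 1 - c by rewrite /t; apply: (mulIf c10); rewrite mulrA divfK //; lra.
have tc : t * (1 + c) = s by rewrite divfK.
by rewrite (rot_id1 x y st tc) (rot_id2 x y st).
Qed.

Lemma mpres_rot12 (c s : R) : c ^+ 2 + s ^+ 2 = 1 -> c != -1 ->
  mpres L4 (fun p : T4 => (c * p.1.1.1 - s * p.1.1.2, s * p.1.1.1 + c * p.1.1.2, p.1.2, p.2) : T4).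
Proof.
move=> cs c1; apply: mpres_L4; exact: (mpres_prod (m1 := M3) (mpres_prod (m1 := M2) (mpres_rot2 cs c1) (@mpres_id _ TR R mu)) (@mpres_id _ TR R mu)).
Qed.

Lemma mpres_rot (u : C) : cmod u = 1 -> mpres L4 (fun p => R4_of_C2 (u *: P p)).
Proof.
have main v : cmod v = 1 -> complex.Re v != -1 -> mpres L4 (fun p => R4_of_C2 (v *: P p)).
  case: v => c s v1 /= c1; have cs : c ^+ 2 + s ^+ 2 = 1 by rewrite -(cmod_sqrE (c +i* s)%C) v1 expr1n.
  have h := mpres_comp (mpres_rot12 cs c1) (mpres_rot34 cs c1).
  apply: mpres_ext h => -[[[x y] a] b]; rewrite /= /R4_of_C2 /C2_of_R4 !mxE /=.
  by congr (_, _, _, _); ring.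
move=> u1; have [e|/main] := eqVneq (complex.Re u) (-1); last exact.
(* The half-angle tangent is infinite at [u = -1], so that rotation is performed as two quarter
   turns. *)
have ui : u = 'i%C * 'i%C.
  have := cmod_sqrE u; rewrite u1 e; case: u {u1} e => a b /= -> h.
  have -> : b = 0 by apply/eqP; rewrite -sqrf_eq0; apply/eqP; lra.
  by apply/eqP; rewrite eq_complex /=; apply/andP; split; apply/eqP; ring.
have hi : mpres L4 (fun p => R4_of_C2 ('i%C *: P p)).
  by apply: main; [rewrite cmodE /= expr0n add0r expr1n sqrtr1 | rewrite /= eq_sym oppr_eq0 oner_eq0].
apply: mpres_ext (mpres_comp hi hi) => p /=.
by rewrite R4_of_C2K scalerA ui.
Qed.

Lemma mpres_trans (w : C2 R) : mpres L4 (fun p => R4_of_C2 (w + P p)).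
Proof.
have h1 := mpres_prod (mpres_trans1 (complex.Re (w 0 0))) (mpres_trans1 (complex.Im (w 0 0))).
have h2 := mpres_prod (m1 := M2) h1 (mpres_trans1 (complex.Re (w 0 1))).
have h3 := mpres_prod (m1 := M3) h2 (mpres_trans1 (complex.Im (w 0 1))).
apply: mpres_ext h3 => -[[[x y] a] b]; rewrite /= /R4_of_C2 /C2_of_R4 !mxE /=.
by case: (w 0 0) => ? ?; case: (w 0 1) => ? ? /=; congr (_, _, _, _); rewrite addrC.
Qed.

Lemma ratr_approx (x e : R) : 0 < e -> exists q : rat, `|x - ratr q| < e.
Proof.
move=> e0; have [|q] := @rat_in_itvoo R (x - e) (x + e).
  by rewrite ltrBlDr -addrA ltrDl addr_gt0.
rewrite in_itv /= => /andP[h1 h2]; exists q; rewrite ltr_norml; apply/andP; split; lra.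
Qed.

(** Links the topology of [C2] to the product sigma-algebra of R^4: an open set is a countable union
    of boxes with rational centres and half-sides [1 / (k+1)]. *)
Lemma open_measurable4 (U : set (C2 R)) : open U -> measurable (P @^-1` U : set T4).
Proof.
move=> oU.
pose box (t : rat * rat * rat * rat * nat) : set T4 :=
  `]ratr t.1.1.1.1 - t.2.+1%:R^-1, ratr t.1.1.1.1 + t.2.+1%:R^-1[%classic `*`
  `]ratr t.1.1.1.2 - t.2.+1%:R^-1, ratr t.1.1.1.2 + t.2.+1%:R^-1[%classic `*`
  `]ratr t.1.1.2 - t.2.+1%:R^-1, ratr t.1.1.2 + t.2.+1%:R^-1[%classic `*`
  `]ratr t.1.2 - t.2.+1%:R^-1, ratr t.1.2 + t.2.+1%:R^-1[%classic.
have mbox t : measurable (box t).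
  by do 3 (apply: measurableX; last exact: measurable_itv); exact: measurable_itv.
have itvE (x a e : R) : `]a - e, a + e[%classic x <-> `|x - a| < e.
  by rewrite /= in_itv /= ltr_distl.
pose A n : set T4 := if @unpickle (rat * rat * rat * rat * nat)%type n is Some t then
   (if asbool (box t `<=` P @^-1` U) then box t else set0) else set0.
suff -> : P @^-1` U = \bigcup_n A n.
  apply: bigcup_measurable => n _; rewrite /A; case: (unpickle n) => [t|] //.
  by case: ifP => // _; exact: mbox.
apply/seteqP; split=> [p Up|p [n _]]; last first.
  rewrite /A; case: (unpickle n) => [t|] //; case: ifP => // /asboolP h; exact: h.
have [e e0 he] : exists2 e : R, 0 < e & forall w, cn (w - P p) < e -> U w.
  by apply/nbhsC2P; exact: open_nbhs_nbhs.
have [k hk] : exists k : nat, k.+1%:R^-1 < e / 4 :> R.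
  have e4 : 0 < e / 4 by rewrite divr_gt0.
  exists (Num.truncn (e / 4)^-1); rewrite -[ltRHS]invrK ltf_pV2 ?posrE ?invr_gt0 //.
  by rewrite truncnS_gt.
have d0 : 0 < k.+1%:R^-1 :> R by rewrite invr_gt0 ltr0n.
case: p Up he => [[[x y] a] b] Up he.
have [q1 h1] := ratr_approx x d0; have [q2 h2] := ratr_approx y d0.
have [q3 h3] := ratr_approx a d0; have [q4 h4] := ratr_approx b d0.
have [n hn] : exists n, unpickle n = Some (q1, q2, q3, q4, k) by exists (pickle (q1, q2, q3, q4, k)); exact: pickleK.
exists n; first by [].
rewrite /A hn.
case: asboolP => [_|[]]; first by do 3 (split; last exact/itvE); exact/itvE.
move=> [[[x' y'] a'] b'] [[[/itvE /= g1 /itvE g2] /itvE g3] /itvE /= g4]; apply: he.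
have tri (s s' : R) (q : rat) : `|s - ratr q| < k.+1%:R^-1 -> `|s' - ratr q| < k.+1%:R^-1 -> `|s' - s| < e / 2.
  move=> f1 f2; have -> : s' - s = (s' - ratr q) - (s - ratr q) by ring.
  have f3 := ler_normB (s' - ratr q) (s - ratr q); apply: le_lt_trans f3 _.
  move: {itvE mbox} f1 f2 hk; move: (k.+1%:R^-1 : R) => d; lra.
rewrite /cn gt_max; apply/andP; split; rewrite !mxE /=.
  apply: le_lt_trans (cmod_le_ReIm _) _ => /=; rewrite [ltRHS]splitr.
  by apply: ltrD; [exact: tri h1 g1 | exact: tri h2 g2].
apply: le_lt_trans (cmod_le_ReIm _) _ => /=; rewrite [ltRHS]splitr.
by apply: ltrD; [exact: tri h3 g3 | exact: tri h4 g4].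
Qed.

Definition contC (D : set (C2 R)) (g : C2 R -> C) := forall z, D z -> forall e : R, 0 < e ->
  exists2 r : R, 0 < r & forall w, cn (w - z) < r -> cmod (g w - g z) < e.

Lemma contC_meas (D : set (C2 R)) g : open D -> contC D g ->
  measurable_fun (P @^-1` D : set T4) (fun p : T4 => cmod (g (P p))).
Proof.
move=> oD gc mD; apply: (measurability _ (RGenOInfty.measurableE R)) => //.
move=> _ [_ [a ->] <-].
have -> : P @^-1` D `&` (fun p => cmod (g (P p))) @^-1` `]a, +oo[%classic =
  P @^-1` [set z | D z /\ a < cmod (g z)].
  by apply/seteqP; split=> p /=; rewrite in_itv /= andbT.
apply: open_measurable4; rewrite openE => z [Dz az]; apply/nbhsC2P.
have [e e0 he] : exists2 e : R, 0 < e & forall w, cn (w - z) < e -> D w.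
  by apply/nbhsC2P; exact: open_nbhs_nbhs.
have az0 : 0 < cmod (g z) - a by rewrite subr_gt0.
have [r r0 hr] := gc z Dz _ az0; exists (Num.min e r); first by rewrite lt_min e0.
move=> w; rewrite lt_min => /andP[/he Dw /hr h]; split=> //.
have := le_lt_trans (cmod_dist (g w) (g z)) h; rewrite ltr_norml => /andP[]; lra.
Qed.

Lemma contC_cst D (c : C) : contC D (fun=> c).
Proof. by move=> z _ e e0; exists 1 => // w _; rewrite subrr cmod0. Qed.

Lemma contC_bdd D g z : contC D g -> D z -> exists2 M : R, 0 < M & exists2 r : R, 0 < r &
  forall w, cn (w - z) < r -> cmod (g w) <= M.
Proof.
move=> gc Dz; have [r r0 hr] := gc z Dz _ ltr01.
exists (cmod (g z) + 1); first by rewrite ltr_wpDl ?cmod_ge0.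
exists r => // w /hr h; have -> : g w = g z + (g w - g z) by ring.
by apply: le_trans (cmodD _ _) _; rewrite lerD2l ltW.
Qed.

Lemma contCD D f g : contC D f -> contC D g -> contC D (fun z => f z + g z).
Proof.
move=> fc gc z Dz e e0; have e2 : 0 < e / 2 by rewrite divr_gt0.
have [r r0 hr] := fc z Dz _ e2; have [r' r'0 hr'] := gc z Dz _ e2.
exists (Num.min r r'); first by rewrite lt_min r0.
move=> w; rewrite lt_min => /andP[/hr h /hr' h'].
have -> : f w + g w - (f z + g z) = (f w - f z) + (g w - g z) by ring.
by apply: le_lt_trans (cmodD _ _) _; rewrite [ltRHS]splitr ltrD.
Qed.

Lemma contCM D f g : contC D f -> contC D g -> contC D (fun z => f z * g z).
Proof.
move=> fc gc z Dz e e0; have [M M0 [s s0 hs]] := contC_bdd gc Dz.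
have e2 : 0 < e / 2 by rewrite divr_gt0. have N0 : 0 < cmod (f z) + 1 by rewrite ltr_wpDl ?cmod_ge0.
have [r r0 hr] := fc z Dz _ (divr_gt0 e2 M0); have [r' r'0 hr'] := gc z Dz _ (divr_gt0 e2 N0).
exists (Num.min s (Num.min r r')); first by rewrite !lt_min s0 r0.
move=> w; rewrite !lt_min => /and3P[/hs h1 /hr h2 /hr' h3].
have -> : f w * g w - f z * g z = (f w - f z) * g w + f z * (g w - g z) by ring.
apply: le_lt_trans (cmodD _ _) _; rewrite [ltRHS]splitr !cmodM; apply: ler_ltD.
  rewrite ltr_pdivlMr // in h2; apply/ltW; apply: le_lt_trans h2.
  by rewrite ler_wpM2l ?cmod_ge0.
rewrite ltr_pdivlMr // in h3; apply: le_lt_trans h3.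
by rewrite mulrC ler_wpM2l ?cmod_ge0 // lerDl.
Qed.

Lemma contC_sum D I (s : seq I) (F : I -> C2 R -> C) : (forall i, contC D (F i)) ->
  contC D (fun z => \sum_(i <- s) F i z).
Proof.
move=> h; elim: s => [|i s IH]; first by under eq_fun do rewrite big_nil; exact: contC_cst.
by under eq_fun do rewrite big_cons; apply: contCD.
Qed.

Lemma contC_scale (D : set (C2 R)) g (u : C) : contC D g -> (forall z, D z -> D (u *: z)) ->
  contC D (fun z => g (u *: z)).
Proof.
move=> gc hu z Dz e e0; have [r r0 hr] := gc _ (hu z Dz) _ e0.
have u1 : 0 < cmod u + 1 by rewrite ltr_wpDl ?cmod_ge0.
exists (r / (cmod u + 1)); first by rewrite divr_gt0.
move=> w; rewrite ltr_pdivlMr // => h; apply: hr; rewrite -scalerBr cnZ.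
by apply: le_lt_trans h; rewrite mulrC ler_wpM2l ?cn_ge0 // lerDl.
Qed.

Definition circled (D : set (C2 R)) := forall (u : C) z, cmod u = 1 -> D z -> D (u *: z).

Definition sqint (D : set (C2 R)) (g : C2 R -> C) : \bar R :=
  (\int[L4]_(p in P @^-1` D) (cmod (g (P p)) ^+ 2)%:E)%E.

Lemma contC_meas2 (D : set (C2 R)) g : open D -> contC D g ->
  measurable_fun (P @^-1` D : set T4) (fun p : T4 => (cmod (g (P p)) ^+ 2)%:E).
Proof.
move=> oD gc; apply/measurable_EFinP; apply: measurable_funX; exact: contC_meas.
Qed.

Lemma sqint_rot (D : set (C2 R)) g (u : C) : open D -> circled D -> contC D g -> cmod u = 1 ->
  sqint D (fun z => g (u *: z)) = sqint D g.
Proof.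
move=> oD cD gc u1; rewrite /sqint [LHS]integral_mkcond [RHS]integral_mkcond.
pose F : T4 -> \bar R := (fun p => (cmod (g (P p)) ^+ 2)%:E) \_ (P @^-1` D).
have mF : measurable_fun setT F.
  by apply/(measurable_restrictT _ (open_measurable4 oD)); exact: contC_meas2.
have F0 p : (0 <= F p)%E by rewrite /F patchE; case: ifP => // _; rewrite lee_fin sqr_ge0.
rewrite -[RHS](mpres_integral (mpres_rot u1) mF F0); apply: eq_integral => p _.
rewrite /F /patch /= R4_of_C2K.
suff -> : (R4_of_C2 (u *: P p) \in P @^-1` D) = (p \in P @^-1` D) by [].
apply/idP/idP; rewrite !inE /= ?R4_of_C2K => h; last exact: cD.
have -> : P p = u^-1 *: (u *: P p) by rewrite scalerA mulVf ?scale1r // unimod_neq0.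
by apply: cD => //; rewrite cmodV u1 invr1.
Qed.

End Lebesgue4.

(** * Mean value inequality *)

Section MeanValue.
Variable R : realType.
Local Notation C := R[i].
Local Notation P := (@C2_of_R4 R).
Local Notation L4 := (lebesgue4 R).
Implicit Types (D B : set (C2 R)) (f g : C2 R -> C).

Lemma cdiff2_lip f z : cdiff2 f z -> exists2 K : R, 0 < K & exists2 r : R, 0 < r &
  forall w, cn (w - z) < r -> cmod (f w - f z) <= K * cn (w - z).
Proof.
move=> [a [b h]]; have [r r0 hr] := h _ ltr01.
exists (cmod a + cmod b + 1); first by rewrite ltr_wpDl ?addr_ge0 ?cmod_ge0.
exists r => // w /hr {}hr; set l := a * _ + _ in hr.
have -> : f w - f z = (f w - f z - l) + l by ring.
apply: le_trans (cmodD _ _) _; rewrite mulrDl addrC lerD //.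
apply: le_trans (cmodD _ _) _; rewrite mulrDl !cmodM.
have e j : w 0 j - z 0 j = (w - z) 0 j by rewrite !mxE.
by rewrite !e; apply: lerD; apply: ler_wpM2l; rewrite ?cmod_ge0 // /cn le_max lexx ?orbT.
Qed.

Lemma holo_contC D f : (forall z, D z -> differentiable f z) -> contC D f.
Proof.
move=> h z Dz e e0; have /differentiableC2P /cdiff2_lip [K K0 [r r0 hr]] := h z Dz.
exists (Num.min r (e / K)); first by rewrite lt_min r0 divr_gt0.
move=> w; rewrite lt_min => /andP[/hr h1]; rewrite ltr_pdivlMr // mulrC.
exact: le_lt_trans.
Qed.

Lemma cdiff2_line f z v x : cdiff2 f (z + x *: v) -> cdiff (fun y => f (z + y *: v)) x.
Proof.
move=> [a [b h]]; exists (a * v 0 0 + b * v 0 1) => e e0.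
have v1 : 0 < cn v + 1 by rewrite ltr_wpDl ?cn_ge0.
have [r r0 hr] := h _ (divr_gt0 e0 v1).
exists (r / (cn v + 1)); first by rewrite divr_gt0.
move=> y; rewrite ltr_pdivlMr // => hy.
have E : z + y *: v - (z + x *: v) = (y - x) *: v by rewrite opprD addrACA subrr add0r scalerBl.
have := hr (z + y *: v); rewrite E cnZ; set t := cmod (y - x) in hy *.
have t0 : 0 <= t := cmod_ge0 _; have n0 := cn_ge0 v.
have yr : t * cn v < r by apply: le_lt_trans hy; rewrite ler_wpM2l // lerDl.
move=> /(_ yr); rewrite !mxE.
have -> : a * (z 0 0 + y * v 0 0 - (z 0 0 + x * v 0 0)) + b * (z 0 1 + y * v 0 1 - (z 0 1 + x * v 0 1)) = (a * v 0 0 + b * v 0 1) * (y - x) by ring.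
move=> h1; apply: le_trans h1 _.
have -> : e / (cn v + 1) * (t * cn v) = e * t * (cn v / (cn v + 1)) by ring.
by rewrite ler_piMr ?mulr_ge0 ?(ltW e0) // ler_pdivrMr // mul1r lerDl.
Qed.

Lemma ravg_sqr n (G : C -> R) : (ravg n G) ^+ 2 <= ravg n (fun u => G u ^+ 2).
Proof.
case: n => [|n]; first by rewrite /ravg !big_ord0 !mulr0 expr0n.
set m := ravg _ G; pose N : R := n.+1%:R.
have N0 : 0 < N by rewrite ltr0n.
have s1 : \sum_(j < n.+1) G (om R n.+1 ^+ j) = N * m by rewrite /m /ravg mulrA divff ?mul1r // gt_eqF.
have : 0 <= \sum_(j < n.+1) (G (om R n.+1 ^+ j) - m) ^+ 2 by apply: sumr_ge0 => i _; exact: sqr_ge0.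
have -> : \sum_(j < n.+1) (G (om R n.+1 ^+ j) - m) ^+ 2 =
  \sum_(j < n.+1) G (om R n.+1 ^+ j) ^+ 2 - N * m ^+ 2.
  transitivity (\sum_(j < n.+1) (G (om R n.+1 ^+ j) ^+ 2 - (2 * m) * G (om R n.+1 ^+ j) + m ^+ 2)).
    by apply: eq_bigr => i _; ring.
  rewrite big_split sumrB -mulr_sumr s1 sumr_const card_ord /= -[X in _ + X = _]mulr_natl -/N.
  ring.
rewrite subr_ge0 => h; rewrite -(ler_pM2l N0); apply: le_trans h _.
by rewrite /ravg -/N mulrA mulfV ?mul1r ?gt_eqF.
Qed.

Lemma avg_mean (g : C -> C) (Rad : R) : 1 < Rad -> (forall z, cmod z < Rad -> cdiff g z) ->
  climC (fun N => avg (2 ^ N) g) (g 0).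
Proof.
move=> R1 gd; pose r := (1 + Rad) / 2.
have r1 : 1 < r by rewrite /r; lra. have rR : r < Rad by rewrite /r; lra.
have r0 : 0 < r := lt_trans ltr01 r1.
have [c hc] := taylor (lt_trans ltr01 R1) gd.
have [M _ hM] := circ_bdd (circ_cont_disc gd r0 rR).
have hp := hc _ _ r0 rR hM.
have c0 : g 0 = c 0%N.
  apply: (climC_uniq (hp.2 0 _)); first by rewrite cmod0.
  move=> e e0; exists 1%N => -[//|n] _; rewrite big_ord_recl big1 ?addr0 ?expr0 ?mulr1 ?subrr ?cmod0 //.
  by move=> i _; rewrite expr0n mulr0.
have := climC_exp (pser_avg_lim 0 hp r0 ler01 r1); rewrite c0 expr0 mulr1.
move=> h e e0; have [N hN] := h e e0; exists N => n /hN; congr (cmod (_ - _) < _).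
by apply: eq_avg => u _; rewrite expr0 mulr1 mul1r.
Qed.

Definition discal B := forall (l : C) z, cmod l <= 1 -> B z -> B (l *: z).

Lemma open_scale B z : open B -> B z -> exists2 s : R, 1 < s & B (s%:C *: z).
Proof.
move=> oB Bz; have [e e0 he] : exists2 e : R, 0 < e & forall w, cn (w - z) < e -> B w.
  by apply/nbhsC2P; exact: open_nbhs_nbhs.
have n1 : 0 < cn z + 1 by rewrite ltr_wpDl ?cn_ge0.
exists (1 + e / 2 / (cn z + 1)); first by rewrite ltrDl !divr_gt0.
apply: he; rewrite -[X in _ - X]scale1r -scalerBl cnZ.
have -> : (1 + e / 2 / (cn z + 1))%:C - 1 = (e / 2 / (cn z + 1))%:C :> C by rewrite rmorphD /= addrC addKr.
rewrite cmod_real ger0_norm ?divr_ge0 ?(ltW n1) ?(ltW e0) // mulrAC ltr_pdivrMr //.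
by have := cn_ge0 z; nra.
Qed.

(** The means [F N] of [g] over the rotations [u *: z] tend pointwise to [g 0]. By convexity and
    rotation invariance they have square integral at most that of [g], and Fatou's lemma passes to
    the limit. *)
Lemma mean_sqint B g : open B -> discal B -> (forall z, B z -> differentiable g z) ->
  ((cmod (g 0) ^+ 2)%:E * volume B <= sqint B g)%E.
Proof.
move=> oB dB gd; have gc := holo_contC gd.
have cB : circled B by move=> u z u1; apply: dB; rewrite u1.
have mB := open_measurable4 oB.
pose F N z := avg (2 ^ N) (fun u => g (u *: z)).
have Fc N : contC B (F N).
  rewrite /F /avg; apply: contCM; first exact: contC_cst.
  apply: contC_sum => i; apply: contC_scale => // z; apply: cB; exact: cmod_omX.
have F_lim z : B z -> climC (F^~ z) (g 0).
  (* Openness gives a slice disc of radius [s > 1], which the mean value property on the unit circle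
     requires. *)
  move=> Bz; have [s s1 Bs] := open_scale oB Bz.
  have e0 : (fun x => g (0 + x *: z)) = (fun x => g (x *: z)) by apply/funext => x; rewrite add0r.
  have gd1 x : cmod x < s -> cdiff (fun x => g (x *: z)) x.
    move=> xs; rewrite -e0; apply: cdiff2_line; rewrite add0r; apply/differentiableC2P; apply: gd.
    have s0 : 0 < s := lt_trans ltr01 s1.
    have -> : x *: z = (x / s%:C) *: (s%:C *: z) by rewrite scalerA divfK // real_complex_neq0.
    apply: dB => //; rewrite cmodM cmodV cmod_real gtr0_norm // ler_pdivrMr // mul1r; exact: ltW.
  by have := avg_mean s1 gd1; rewrite scale0r.
have le1 N : (sqint B (F N) <= sqint B g)%E.
  have n0 : (0 < 2 ^ N)%N by rewrite expn_gt0.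
  pose G i (p : _) := ((2 ^ N)%:R^-1%:E * (cmod (g (om R (2 ^ N) ^+ i *: P p)) ^+ 2)%:E)%E.
  have gic i : contC B (fun z => g (om R (2 ^ N) ^+ i *: z)).
    by apply: contC_scale => // z; apply: cB; exact: cmod_omX.
  have mG i : measurable_fun (P @^-1` B) (G i).
    by apply: emeasurable_funM; [exact: measurable_cst | exact: (contC_meas2 oB (gic i))].
  have i0 : 0 <= (2 ^ N)%:R^-1 :> R by rewrite invr_ge0 ler0n.
  have G0 i p : (0 <= G i p)%E by rewrite /G -EFinM lee_fin mulr_ge0 // sqr_ge0.
  have le2 : (sqint B (F N) <= \int[L4]_(p in P @^-1` B) (\sum_(i < 2 ^ N) G i p)%R)%E.
    apply: ge0_le_integral => //.
    - by move=> p _; rewrite lee_fin sqr_ge0.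
    - exact: contC_meas2.
    - have := @emeasurable_sum _ _ R (P @^-1` B) _ (index_enum _) (fun i : 'I_(2 ^ N) => G i) (fun i => mG i); exact.
    move=> p _; rewrite /G; under eq_bigr do rewrite -EFinM.
    rewrite sumEFin lee_fin -mulr_sumr.
    have h1 : cmod (F N (P p)) <= ravg (2 ^ N) (fun u => cmod (g (u *: P p))) by apply: avg_le_real => u _.
    have h2 := ravg_sqr (2 ^ N) (fun u => cmod (g (u *: P p))).
    have h3 := le_trans (cmod_ge0 _) h1.
    by apply: le_trans h2; rewrite ler_pXn2r // nnegrE ?cmod_ge0.
  apply: le_trans le2 _; rewrite ge0_integral_sum //; last by move=> i; exact: mG.
  have e i : (\int[L4]_(p in P @^-1` B) G i p = (2 ^ N)%:R^-1%:E * sqint B g)%E.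
    rewrite ge0_integralZl //; last first.
    - by move=> p _; rewrite lee_fin sqr_ge0.
    - exact: (contC_meas2 oB (gic i)).
    by congr (_ * _)%E; exact: (sqint_rot oB cB gc (cmod_omX R (2 ^ N) i)).
  rewrite (eq_bigr (fun=> ((2 ^ N)%:R^-1%:E * sqint B g)%E)); last by move=> i _; exact: e.
  have q0 : (0 <= sqint B g)%E by apply: integral_ge0 => p _; rewrite lee_fin sqr_ge0.
  case: (sqint B g) q0 => [x| |] // _; last exact: leey.
  under eq_bigr do rewrite -EFinM.
  by rewrite sumEFin sumr_const card_ord -[X in (X%:E)%E]mulr_natl mulrA mulfV ?mul1r // pnatr_eq0 -lt0n.
have : (\int[L4]_(p in P @^-1` B) limn_einf (fun N => (cmod (F N (P p)) ^+ 2)%:E) <=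
  limn_einf (fun N => sqint B (F N)))%E.
  apply: fatou => //; first by move=> N; exact: contC_meas2.
  by move=> N p _; rewrite lee_fin sqr_ge0.
have -> : (\int[L4]_(p in P @^-1` B) limn_einf (fun N => (cmod (F N (P p)) ^+ 2)%:E) =
   (cmod (g 0) ^+ 2)%:E * volume B)%E.
  rewrite -[RHS]integral_cst //; apply: eq_integral => p; rewrite inE => Bp.
  apply: (cvg_limn_einf_sup _).1; apply: cvg_EFin; first by apply: nearW.
  have cv : (fun N => cmod (F N (P p))) @ \oo --> cmod (g 0); last exact: (cvgM cv cv).
  apply/cvgrPdist_lt => e e0; have [N0 hN0] := F_lim _ Bp e e0; exists N0 => // n /hN0 h.
  by apply: le_lt_trans h; rewrite /= distrC; exact: cmod_dist.
move/le_trans; apply; rewrite limn_einf_lim; apply: lime_le; first exact: is_cvg_einfs.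
apply: nearW => n; apply: ereal_inf_le; exists (sqint B (F n)) => //; exists n => //=.
Qed.

End MeanValue.

(** * Bounds and positivity of the Bergman kernel *)

Section KernelBounds.
Variable R : realType.
Local Notation C := R[i].
Local Notation P := (@C2_of_R4 R).
Local Notation L4 := (lebesgue4 R).
Local Notation TR := (measurableTypeR R).
Local Notation T4 := (TR * TR * TR * TR)%type.
Implicit Types (D B : set (C2 R)) (f g : C2 R -> C).

Lemma sqint_ge0 D f : (0 <= sqint D f)%E.
Proof. by apply: integral_ge0 => p _; rewrite lee_fin sqr_ge0. Qed.

Lemma L2norm_sqint D f : (L2norm D f = sqint D f `^ 2^-1)%E.
Proof. by []. Qed.

Lemma L2norm_le1 D f : (L2norm D f <= 1)%E = (sqint D f <= 1)%E.
Proof.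
rewrite L2norm_sqint; case: (sqint D f) (sqint_ge0 D f) => [x| |] // x0.
  rewrite lee_fin in x0; rewrite poweR_EFin powR12_sqrt // !lee_fin.
  by rewrite -[in LHS]sqrtr1 ler_sqrt.
by rewrite poweRyr // invr_neq0.
Qed.

Lemma L2norm_lty D f : (L2norm D f < +oo)%E = (sqint D f < +oo)%E.
Proof.
rewrite L2norm_sqint; case: (sqint D f) (sqint_ge0 D f) => [x| |] // x0.
  by rewrite poweR_EFin !ltry.
by rewrite poweRyr // invr_neq0.
Qed.

Definition rect (c s t : R) : set (C2 R) := [set z | [/\ `|complex.Re (z 0 0) - c| < s,
  `|complex.Im (z 0 0)| < s, `|complex.Re (z 0 1)| < t & `|complex.Im (z 0 1)| < t]].

Lemma rect_preimage c s t : P @^-1` rect c s t =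
  `]c - s, c + s[%classic `*` `]- s, s[%classic `*` `]- t, t[%classic `*` `]- t, t[%classic.
Proof.
apply/seteqP; split=> -[[[x y] a] b]; rewrite /rect /= !mxE /= !in_itv /= ltr_distl !ltr_norml.
  by case=> *; do !split.
by case=> -[[]].
Qed.

Lemma rect_meas c s t : measurable (P @^-1` rect c s t).
Proof.
rewrite rect_preimage; do 3 (apply: measurableX; last exact: measurable_itv); exact: measurable_itv.
Qed.

Lemma volume_rect c s t : 0 <= s -> 0 <= t -> volume (rect c s t) = ((2 * s) ^+ 2 * (2 * t) ^+ 2)%:E.
Proof.
move=> s0 t0; rewrite /volume rect_preimage /lebesgue4.
have M a b : a <= b -> lebesgue_measure (`]a, b[%classic : set (measurableTypeR R)) = (b - a)%:E.
  move=> ab; rewrite lebesgue_measure_itv /= lte_fin; case: ltP => // ba.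
  have E : b = a by apply/eqP; rewrite eq_le ba ab.
  by rewrite E subrr.
have m1 (a b : R) : measurable (`]a, b[%classic : set (measurableTypeR R)) by exact: measurable_itv.
have m2 (a b a' b' : R) : measurable (`]a, b[%classic `*` `]a', b'[%classic : set (measurableTypeR R * measurableTypeR R)).
  by apply: measurableX.
have m3 (a b a' b' a'' b'' : R) : measurable (`]a, b[%classic `*` `]a', b'[%classic `*` `]a'', b''[%classic :
    set (measurableTypeR R * measurableTypeR R * measurableTypeR R)).
  by apply: measurableX.
have e1 := @product_measure1E _ _ _ _ R (prodm (prodm lebesgue_measure lebesgue_measure) lebesgue_measure)
  lebesgue_measure _ _ (m3 (c - s) (c + s) (- s) s (- t) t) (m1 (- t) t).
have e2 := @product_measure1E _ _ _ _ R (prodm lebesgue_measure lebesgue_measure)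
  lebesgue_measure _ _ (m2 (c - s) (c + s) (- s) s) (m1 (- t) t).
have e3 := @product_measure1E _ _ _ _ R lebesgue_measure
  lebesgue_measure _ _ (m1 (c - s) (c + s)) (m1 (- s) s).
etransitivity; first exact: e1.
refine (etrans (congr1 (fun x => x * _)%E e2) _).
refine (etrans (congr1 (fun x => x * _ * _)%E e3) _).
transitivity (((c + s - (c - s))%:E * (s - - s)%:E * (t - - t)%:E * (t - - t)%:E)%E).
  by congr (_ * _ * _ * _)%E; apply: M; lra.
by rewrite -!EFinM; congr EFin; ring.
Qed.

Definition polydisc (r s : R) : set (C2 R) := [set z | cmod (z 0 0) < r /\ cmod (z 0 1) < s].

Lemma coord_cn (z : C2 R) j : cmod (z 0 j) <= cn z.
Proof. by move: j; apply: ord2P; rewrite /cn le_max lexx ?orbT. Qed.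

Lemma cn_lt (z : C2 R) (r : R) : (cn z < r) = (cmod (z 0 0) < r) && (cmod (z 0 1) < r).
Proof. by rewrite /cn gt_max. Qed.

Lemma polydisc_open r s : open (polydisc r s).
Proof.
rewrite openE => z [zr zs]; apply/nbhsC2P; exists (Num.min (r - cmod (z 0 0)) (s - cmod (z 0 1))).
  by rewrite lt_min !subr_gt0 zr.
move=> w; rewrite lt_min => /andP[h1 h2].
have k j : cmod (w 0 j) <= cmod (z 0 j) + cn (w - z).
  have := coord_cn (w - z) j; rewrite !mxE => h.
  have -> : w 0 j = z 0 j + (w 0 j - z 0 j) by ring.
  by apply: le_trans (cmodD _ _) _; rewrite lerD2l.
by split; [apply: le_lt_trans (k 0) _ | apply: le_lt_trans (k 1) _]; rewrite -ltrBrDl.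
Qed.

Lemma polydisc_discal r s : discal (polydisc r s).
Proof.
move=> l z l1 [zr zs]; split; rewrite mxE cmodM; [move: zr|move: zs]; apply: le_lt_trans;
  by rewrite ler_piMl ?cmod_ge0.
Qed.

(** A box of half-sides [r / 2] and [s / 2] fits inside because [|z| <= |Re z| + |Im z|]. Only
    orders of magnitude matter later, so the factor [pi^2] is given up. *)
Lemma volume_polydisc_ge r s : 0 <= r -> 0 <= s -> ((r ^+ 2 * s ^+ 2)%:E <= volume (polydisc r s))%E.
Proof.
move=> r0 s0; have -> : r ^+ 2 * s ^+ 2 = (2 * (r / 2)) ^+ 2 * (2 * (s / 2)) ^+ 2 by field.
rewrite -(volume_rect 0) ?divr_ge0 //; apply: le_measure; rewrite ?inE.
- exact: rect_meas.
- by apply: open_measurable4; exact: polydisc_open.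
move=> p [h1 h2 h3 h4]; rewrite subr0 in h1.
by split; apply: le_lt_trans (cmod_le_ReIm _) _; rewrite [ltRHS]splitr ltrD.
Qed.

Lemma sqint_trans D B f w : open D -> open B -> contC D f -> (forall z, B z -> D (w + z)) ->
  (sqint B (fun z => f (w + z)%R) <= sqint D f)%E.
Proof.
move=> oD oB fc BD; rewrite /sqint [leLHS]integral_mkcond [leRHS]integral_mkcond.
pose F D f : T4 -> \bar R := (fun p => (cmod (f (P p)) ^+ 2)%:E) \_ (P @^-1` D).
have mF D' f' : open D' -> contC D' f' -> measurable_fun setT (F D' f').
  by move=> o c; apply/(measurable_restrictT _ (open_measurable4 o)); exact: contC_meas2.
have F0 D' f' p : (0 <= F D' f' p)%E by rewrite /F patchE; case: ifP => // _; rewrite lee_fin sqr_ge0.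
rewrite -[leRHS](mpres_integral (mpres_trans w) (mF _ _ oD fc) (F0 D f)).
apply: ge0_le_integral => //.
- by move=> p _; exact: (F0 B (fun z => f (w + z))).
- apply: (mF B (fun z => f (w + z))) => // z Bz e e0.
  have [r r0 hr] := fc _ (BD z Bz) e e0; exists r => // w' h; apply: hr.
  by rewrite opprD addrACA subrr add0r.
- exact: (measurableT_comp (mF _ _ oD fc) (mpres_trans w).1).
move=> p _; rewrite /F /patch /= R4_of_C2K.
case: ifPn; rewrite ?inE => h; last by case: ifP => // _; rewrite lee_fin sqr_ge0.
by rewrite ifT // inE /= R4_of_C2K; exact: BD.
Qed.

Lemma lemM D f w r s N : open D -> (forall z, D z -> differentiable f z) -> 0 < r -> 0 < s ->
  (forall z, polydisc r s z -> D (w + z)) -> (sqint D f <= N%:E)%E ->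
  cmod (f w) ^+ 2 <= N / (r ^+ 2 * s ^+ 2).
Proof.
move=> oD fd r0 s0 sub fN; rewrite ler_pdivlMr ?mulr_gt0 ?exprn_gt0 //.
have gd z : polydisc r s z -> differentiable (fun z => f (w + z)) z.
  move=> /sub /fd /differentiableC2P [a [b h]]; apply/differentiableC2P; exists a, b => e e0.
  have [d d0 hd] := h e e0; exists d => // w' hw'.
  have E : w + w' - (w + z) = w' - z by rewrite opprD addrACA subrr add0r.
  have E' j : (w + w') 0 j - (w + z) 0 j = w' 0 j - z 0 j by rewrite !mxE; ring.
  by have := hd (w + w'); rewrite E !E'; exact.
have := mean_sqint (@polydisc_open r s) (@polydisc_discal r s) gd; rewrite addr0 => h.
rewrite -lee_fin; apply: le_trans (le_trans h (le_trans _ fN)); last first.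
  by apply: sqint_trans => //; [exact: polydisc_open | exact: holo_contC].
rewrite EFinM; apply: lee_wpmul2l; first by rewrite lee_fin sqr_ge0.
by apply: volume_polydisc_ge; exact: ltW.
Qed.

Lemma open_polydisc D z : open D -> D z -> exists2 r : R, 0 < r & forall w, cn (w - z) < r -> D w.
Proof. by move=> oD Dz; apply/nbhsC2P; exact: open_nbhs_nbhs. Qed.

(** Polydiscs of radius [r / 2] around all points within [r / 2] of [z] stay in [D], so one constant
    bounds all point evaluations near [z]. *)
Lemma unif_bound D z : open D -> D z -> exists2 r : R, 0 < r & exists2 M : R, 0 < M &
  (forall w, cn (w - z) < r -> D w) /\
  forall f N w, (forall z, D z -> differentiable f z) -> (sqint D f <= N%:E)%E -> cn (w - z) < r ->
    cmod (f w) ^+ 2 <= M * N.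
Proof.
move=> oD Dz; have [r r0 hr] := open_polydisc oD Dz.
have r2 : 0 < r / 2 by rewrite divr_gt0.
exists (r / 2) => //; exists ((r / 2) ^+ 2 * (r / 2) ^+ 2)^-1; first by rewrite invr_gt0 mulr_gt0 ?exprn_gt0.
split=> [w wz|f N w fd fN wz]; first by apply: hr; lra.
rewrite mulrC; apply: lemM fN => // v [v0 v1]; apply: hr.
have -> : w + v - z = (w - z) + v by rewrite addrAC.
apply: le_lt_trans (cnD _ _) _; rewrite [ltRHS]splitr; apply: ltrD wz _; by rewrite cn_lt v0.
Qed.

Lemma differentiable_const (c : C) z : differentiable (fun _ : C2 R => c) z.
Proof.
apply/differentiableC2P; exists 0, 0 => e e0; exists 1 => // w _.
by rewrite subrr !mul0r addr0 subrr cmod0 mulr_ge0 ?(ltW e0) ?cn_ge0.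
Qed.

Lemma sqint_cst D c : open D -> sqint D (fun=> c) = ((cmod c ^+ 2)%:E * volume D)%E.
Proof. by move=> oD; rewrite /sqint -integral_cst //; exact: open_measurable4. Qed.

Definition unitH D : set (C2 R -> C) := [set f | (forall z, D z -> differentiable f z) /\ (sqint D f <= 1%:E)%E].

Lemma kernelE D z : bergman_kernel D z = sup [set cmod (f z) ^+ 2 | f in unitH D].
Proof.
rewrite /bergman_kernel; congr (sup [set _ | _ in _]); apply/seteqP; split=> f /=.
  by move=> [[h _] h2]; split; rewrite // -L2norm_le1.
by move=> [h1 h2]; rewrite /= L2norm_le1; split=> //; split=> //; rewrite L2norm_lty (le_lt_trans h2) // ltry.
Qed.

Lemma unitH0 D : open D -> unitH D (fun=> 0).
Proof. by move=> oD; split=> [z _|]; [exact: differentiable_const | rewrite sqint_cst // cmod0 expr0n mul0e lee_fin]. Qed.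

Lemma kernel_has_sup D z : open D -> D z -> has_sup [set cmod (f z) ^+ 2 | f in unitH D].
Proof.
move=> oD Dz; split; first by exists (cmod 0 ^+ 2); exists (fun=> 0); [exact: unitH0 | ].
have [r r0 [M M0 [_ hM]]] := unif_bound oD Dz.
by exists M => _ [f [fd f1] <-]; rewrite -[M]mulr1; apply: hM; rewrite // subrr cn_0.
Qed.

Lemma kernel_ge D z f : open D -> D z -> unitH D f -> cmod (f z) ^+ 2 <= bergman_kernel D z.
Proof.
by move=> oD Dz fD; rewrite kernelE; apply: ub_le_sup; [exact: (kernel_has_sup oD Dz).2 | exists f].
Qed.

Lemma kernel_le D z M : open D -> (forall f, unitH D f -> cmod (f z) ^+ 2 <= M) -> bergman_kernel D z <= M.
Proof.
move=> oD h; rewrite kernelE; apply: ge_sup; first by exists (cmod 0 ^+ 2); exists (fun=> 0); [exact: unitH0|].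
by move=> _ [f fD <-]; exact: h.
Qed.

Lemma volume_gt0 D z : open D -> D z -> (0 < volume D)%E.
Proof.
move=> oD Dz; have [r r0 hr] := open_polydisc oD Dz.
have f0 := @lemM D (fun=> 1) z r r 0 oD (fun z _ => differentiable_const 1 z) r0 r0.
rewrite ltNge; apply/negP => v0; have : cmod (1 : C) ^+ 2 <= 0 / (r ^+ 2 * r ^+ 2).
  apply: f0 => [w [w0 w1]|]; last by rewrite sqint_cst // cmod1 expr1n mul1e.
  by apply: hr; rewrite addrAC subrr add0r cn_lt w0.
by rewrite mul0r cmod1 expr1n ler10.
Qed.

Lemma kernel_pos D z : open D -> D z -> (volume D < +oo)%E -> 0 < bergman_kernel D z.
Proof.
move=> oD Dz; have v0 := volume_gt0 oD Dz; case E : (volume D) v0 => [v| |] //; rewrite lte_fin => v0 _.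
have c0 : 0 < Num.sqrt v^-1 by rewrite sqrtr_gt0 invr_gt0.
have u1 : unitH D (fun=> (Num.sqrt v^-1)%:C).
  split=> [w _|]; first exact: differentiable_const.
  rewrite sqint_cst // E cmod_real ger0_norm ?(ltW c0) // sqr_sqrtr ?invr_ge0 ?(ltW v0) //.
  by rewrite -EFinM mulVf // gt_eqF.
by apply: lt_le_trans (kernel_ge oD Dz u1); rewrite exprn_gt0 // cmod_real normr_gt0 gt_eqF.
Qed.

(** Positivity at 0 gives a function of norm at most 1 with [f 0 != 0], and [mean_sqint] on the
    whole of [D] bounds the volume; conversely, finite volume makes constants square integrable. *)
Lemma kernel_pos_iff D : open D -> discal D -> D 0 ->
  (forall z, D z -> 0 < bergman_kernel D z) <-> (volume D < +oo)%E.
Proof.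
move=> oD dD D0; split=> [h|h z Dz]; last exact: kernel_pos.
have [f fD f0] : exists2 f, unitH D f & f 0 != 0.
  apply: contrapT => hn; have := h 0 D0; rewrite ltNge => /negP; apply; apply: kernel_le => // f fD.
  have -> : f 0 = 0 by apply/eqP/negPn/negP => f0; apply: hn; exists f.
  by rewrite cmod0 expr0n.
have := le_trans (mean_sqint oD dD fD.1) fD.2.
have c0 : 0 < cmod (f 0) ^+ 2 by rewrite exprn_gt0 // cmod_gt0.
case: (volume D) => [v| |] //; first by rewrite ltry.
by rewrite gt0_muley.
Qed.

Lemma siciak_open D : siciak_domain D -> [/\ open D, discal D & D 0].
Proof.
move=> [h [[h0 _ hl] -> [oD _] _ _]]; split=> //.
  move=> l z l1; rewrite /balanced_domain /= hl; apply: le_lt_trans.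
  by rewrite ler_piMl.
by rewrite /balanced_domain /= -(scale0r 0) hl cmod0 mul0r.
Qed.

Lemma siciak_kernel_pos D : siciak_domain D ->
  (forall z, D z -> 0 < bergman_kernel D z) <-> (volume D < +oo)%E.
Proof. by move=> /siciak_open [oD dD D0]; exact: kernel_pos_iff. Qed.

End KernelBounds.

(** * Analytic polynomials with prescribed real part *)

Section TrigPoly.
Variable R : realType.
Local Notation C := R[i].

Lemma ReD (z w : C) : complex.Re (z + w) = complex.Re z + complex.Re w.
Proof. by case: z; case: w. Qed.

Lemma Re_sum I (r : seq I) (F : I -> C) : complex.Re (\sum_(i <- r) F i) = \sum_(i <- r) complex.Re (F i).
Proof. by elim: r => [|i r IH]; rewrite ?big_nil // !big_cons ReD IH. Qed.

Lemma ReZ (x : R) (z : C) : complex.Re (x%:C * z) = x * complex.Re z.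
Proof. by case: z => a b /=; rewrite mul0r subr0. Qed.

Lemma ReN (z : C) : complex.Re (- z) = - complex.Re z.
Proof. by case: z. Qed.

Lemma ReJ (z : C) : complex.Re (conjc z) = complex.Re z.
Proof. by case: z. Qed.

Lemma avg_Re n (F : C -> C) : complex.Re (avg n F) = ravg n (fun u => complex.Re (F u)).
Proof. by rewrite /avg -real_complex_nat -fmorphV ReZ Re_sum. Qed.

Definition polyf (F : C -> C) := exists p : {poly C}, forall x, F x = p.[x].

Lemma polyf_cst c : polyf (fun=> c).
Proof. by exists c%:P => x; rewrite hornerC. Qed.

Lemma polyf_id : polyf id.
Proof. by exists 'X => x; rewrite hornerX. Qed.

Lemma polyfD F G : polyf F -> polyf G -> polyf (fun x => F x + G x).
Proof. by move=> [p hp] [q hq]; exists (p + q) => x; rewrite hornerD hp hq. Qed.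

Lemma polyfM F G : polyf F -> polyf G -> polyf (fun x => F x * G x).
Proof. by move=> [p hp] [q hq]; exists (p * q) => x; rewrite hornerM hp hq. Qed.

Lemma polyfX F n : polyf F -> polyf (fun x => F x ^+ n).
Proof. by move=> [p hp]; exists (p ^+ n) => x; rewrite horner_exp hp. Qed.

Lemma polyf_sum I (r : seq I) (F : I -> C -> C) : (forall i, polyf (F i)) ->
  polyf (fun x => \sum_(i <- r) F i x).
Proof.
move=> h; elim: r => [|i r IH]; first by under eq_fun do rewrite big_nil; exact: polyf_cst.
by under eq_fun do rewrite big_cons; apply: polyfD.
Qed.

Lemma polyf_prod I (r : seq I) (F : I -> C -> C) : (forall i, polyf (F i)) ->
  polyf (fun x => \prod_(i <- r) F i x).
Proof.
move=> h; elim: r => [|i r IH]; first by under eq_fun do rewrite big_nil; exact: polyf_cst.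
by under eq_fun do rewrite big_cons; apply: polyfM.
Qed.

Lemma polyf_circ_cont F : polyf F -> circ_cont F.
Proof.
move=> [p hp]; have -> : F = fun x => \sum_(i < size p) p`_i * x ^+ i.
  by apply/funext => x; rewrite hp horner_coef.
elim: (size p) => [|n IH]; first by under eq_fun do rewrite big_ord0; move=> u _ e e0; exists 1 => // v _ _; rewrite subrr cmod0.
under eq_fun do rewrite big_ord_recr /=.
move=> u u1 e e0; have e2 : 0 < e / 2 by rewrite divr_gt0.
have cc : circ_cont (fun x => p`_n * x ^+ n).
  by apply: circ_contM (circ_contX n) => v _ d d0; exists 1 => // w _ _; rewrite subrr cmod0.
have [d d0 hd] := IH u u1 _ e2; have [d' d'0 hd'] := cc u u1 _ e2.
exists (Num.min d d'); first by rewrite lt_min d0.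
move=> v v1; rewrite lt_min => /andP[/(hd v v1) h /(hd' v v1) h'].
rewrite opprD addrACA; apply: le_lt_trans (cmodD _ _) _.
by rewrite [ltRHS]splitr ltrD.
Qed.

Definition kco m l : R := 'C(2 * m, m + l)%:R / 'C(2 * m, m)%:R.

(* The analytic polynomial whose real part on the unit circle is the kernel [fkerR m]. *)
Definition Hm m (x : C) : C := 1 + 2 * \sum_(l < m) (kco m l.+1)%:C * x ^+ l.+1.

Lemma Hm0 m : Hm m 0 = 1.
Proof. by rewrite /Hm big1 ?mulr0 ?addr0 // => l _; rewrite expr0n mulr0. Qed.

Lemma fker_sum m (x : C) : fker m x = \sum_(0 <= i < (2 * m).+1) ('C(2 * m, i)%:R / 'C(2 * m, m)%:R) * (x ^+ i * conjc x ^+ m).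
Proof.
rewrite /fker exprDn mulr_suml mulr_sumr big_mkord; apply: eq_bigr => i _.
by rewrite expr1n mul1r -[X in X * conjc x ^+ m]mulr_natl; ring.
Qed.

(** The symmetry [C(2m, m - l) = C(2m, m + l)] pairs the powers [x^l] and [x^(-l)] into
    conjugates. *)
Lemma fker_Hm m x : cmod x = 1 -> 2 * fker m x = Hm m x + conjc (Hm m x).
Proof.
move=> x1; have xx := unimod_mulJ x1.
have b0 : 'C(2 * m, m)%:R != 0 :> C by rewrite pnatr_eq0 -lt0n bin_gt0 mul2n -addnn leq_addr.
rewrite fker_sum (@big_cat_nat _ _ _ m) //=; last by rewrite mul2n -addnn leqW // leq_addr.
have m2 : (m < (2 * m).+1)%N by lia.
have m3 : ((2 * m).+1 - m.+1 = m)%N by lia.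
rewrite (big_ltn m2) divff // mul1r -exprMn xx expr1n.
rewrite -[m.+1]add0n big_addn m3 big_nat_rev /= add0n.
set k := fun l => ('C(2 * m, m + l.+1)%:R / 'C(2 * m, m)%:R : C).
have -> : \sum_(0 <= i < m) 'C(2 * m, m - i.+1)%:R / 'C(2 * m, m)%:R * (x ^+ (m - i.+1) * conjc x ^+ m) =
  \sum_(0 <= i < m) k i * conjc x ^+ i.+1.
  rewrite !big_nat; apply: eq_bigr => i /andP[_ im].
  have -> : 'C(2 * m, m - i.+1) = 'C(2 * m, m + i.+1).
    by rewrite -bin_sub; [congr 'C(_, _)|]; lia.
  by rewrite /k; congr (_ * _); rewrite -[in X in _ * conjc x ^+ X](subnK im) exprD mulrA -exprMn xx expr1n mul1r.
have -> : \sum_(0 <= i < m) 'C(2 * m, i + m.+1)%:R / 'C(2 * m, m)%:R * (x ^+ (i + m.+1) * conjc x ^+ m) =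
  \sum_(0 <= i < m) k i * x ^+ i.+1.
  rewrite !big_nat; apply: eq_bigr => i _; rewrite /k addnS -addSn [(i.+1 + m)%N]addnC.
  by congr (_ * _); rewrite exprD -mulrA mulrC -mulrA [conjc _ ^+ _ * _]mulrC -exprMn xx expr1n mulr1.
rewrite /Hm rmorphD rmorphM rmorph1 rmorph_nat rmorph_sum !big_mkord /=.
have kE l : (kco m l.+1)%:C = k l by rewrite /kco /k rmorphM fmorphV !rmorph_nat.
under [X in _ = _ + 2 * X + _]eq_bigr do rewrite kE.
have -> : \sum_(i < m) conjc ((kco m i.+1)%:C * x ^+ i.+1) = \sum_(i < m) k i * conjc x ^+ i.+1.
  apply: eq_bigr => i _; have J : conjc (kco m i.+1)%:C = k i by rewrite conjc_real kE.
  by rewrite -J -rmorphXn -rmorphM.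
set s := \sum_(i < m) _; set t := \sum_(i < m) _; ring.
Qed.

Lemma Re_Hm m x : cmod x = 1 -> complex.Re (Hm m x) = fkerR m x.
Proof.
move=> x1; have := congr1 (@complex.Re R) (fker_Hm m x1).
rewrite ReD ReJ (fkerE m x1).
rewrite -[2]real_complex_nat ReZ /= => h; lra.
Qed.

(** Convolution with [Hm] in place of the kernel keeps the real part on the circle and gives a
    polynomial in [v]; at [v = 0] only the constant term 1 of [Hm] remains, leaving the mean of
    [f]. *)
Lemma fejer_poly (f : C -> R) (e : R) : circ_cont (fun u => (f u)%:C) -> 0 < e ->
  exists (F : C -> C) (c : R), [/\ polyf F, F 0 = c%:C &
    forall v, cmod v = 1 -> `|complex.Re (F v) - f v| <= e].
Proof.
move=> fc e0; have [m hm] := fejer fc e0; pose n := (2 * m).+1.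
exists (fun v => avg n (fun u => (f u)%:C * Hm m (v * conjc u))), (ravg n f); split.
- apply: polyfM; first exact: polyf_cst.
  apply: polyf_sum => i; apply: polyfM; first exact: polyf_cst.
  rewrite /Hm; apply: polyfD; first exact: polyf_cst.
  apply: polyfM; first exact: polyf_cst.
  apply: polyf_sum => l; apply: polyfM; first exact: polyf_cst.
  apply: polyfX; apply: polyfM; [exact: polyf_id | exact: polyf_cst].
- rewrite -avg_real; apply: eq_avg => u _; by rewrite mul0r Hm0 mulr1.
move=> v v1; rewrite avg_Re -cmod_real rmorphB /= -avg_real.
have := hm n (ltnSn _) v v1; congr (cmod (_ - _) <= _); apply: eq_avg => u u1.
have vu : cmod (v * conjc u) = 1 by rewrite cmodM cmodJ v1 u1 mulr1.
rewrite ReZ (Re_Hm m vu) (fkerE m vu) [in RHS]rmorphM; reflexivity.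
Qed.

Lemma is_derive_cosn (n : nat) (a t : R) : is_derive t 1 (fun t => a * cos (n%:R * t)) (- (a * n%:R * sin (n%:R * t))).
Proof.
have h1 : is_derive t (1 : R) (fun t => n%:R * t) n%:R.
  have h := @is_deriveZ R R R id n%:R t 1 1 (is_derive_id t 1); apply: (is_derive_eq h).
  by rewrite /GRing.scale /= mulr1.
have h2 := @is_derive1_comp R cos (fun t => n%:R * t) t _ _ (is_derive_cos _) h1.
have h3 := @is_deriveZ R R R _ a t 1 _ h2.
by apply: (is_derive_eq h3); rewrite /GRing.scale /=; ring.
Qed.

Lemma is_derive_sinn (n : nat) (a t : R) : is_derive t 1 (fun t => a * sin (n%:R * t)) (a * n%:R * cos (n%:R * t)).
Proof.
have h1 : is_derive t (1 : R) (fun t => n%:R * t) n%:R.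
  have h := @is_deriveZ R R R id n%:R t 1 1 (is_derive_id t 1); apply: (is_derive_eq h).
  by rewrite /GRing.scale /= mulr1.
have h2 := @is_derive1_comp R sin (fun t => n%:R * t) t _ _ (is_derive_sin _) h1.
have h3 := @is_deriveZ R R R _ a t 1 _ h2.
by apply: (is_derive_eq h3); rewrite /GRing.scale /=; ring.
Qed.

Lemma Re_cisM (c : C) t : complex.Re (c * cis t) = complex.Re c * cos t + - complex.Im c * sin t.
Proof. by case: c => a b /=; ring. Qed.

Lemma int_polyf F c : polyf F -> F 0 = c%:C ->
  (\int[lebesgue_measure]_(t in `[0%R, (2 * pi)%R]) (complex.Re (F (cis t)))%:E)%E = (2 * pi * c)%:E.
Proof.
move=> [p hp] F0.
pose f n (t : R) : R := \sum_(i < n) (complex.Re p`_i * cos (i%:R * t) + - complex.Im p`_i * sin (i%:R * t)).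
(* The primitive of [f n]; the index 0 is separate since its primitive is linear. The remaining
   terms are periodic and cancel between 0 and [2 pi]. *)
pose g n (t : R) : R := \sum_(i < n) if (i : nat) is 0%N then c * t else
   (complex.Re p`_i / i%:R * sin (i%:R * t) + complex.Im p`_i / i%:R * cos (i%:R * t)).
have pc : p`_0 = c%:C by rewrite -horner_coef0 -hp.
pose N := (size p).+1.
have fE t : complex.Re (F (cis t)) = f N t.
  rewrite hp (@horner_coef_wide _ N) ?leqnSn // Re_sum /f; apply: eq_bigr => i _; by rewrite cisX Re_cisM.
have fd n (t : R) : exists d : R, is_derive t (1 : R) (f n : R -> R) d.
  elim: n => [|n [d IH]]; first by exists 0; rewrite /f; under eq_fun do rewrite big_ord0; exact: is_derive_cst.
  have h := is_deriveD IH (is_deriveD (is_derive_cosn n (complex.Re p`_n) t) (is_derive_sinn n (- complex.Im p`_n) t)).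
  by eexists; rewrite /f; under eq_fun do rewrite big_ord_recr /=; exact: h.
have gd n (t : R) : is_derive t (1 : R) (g n : R -> R) (f n t).
  elim: n => [|n IH].
    by rewrite /f big_ord0 /g; under eq_fun do rewrite big_ord0; exact: is_derive_cst.
  rewrite /g; under eq_fun do rewrite big_ord_recr /=; rewrite /f big_ord_recr /=.
  apply: is_deriveD IH _; case: n => [|n].
    rewrite mul0r cos0 sin0 pc /= mulr0 mulr1 addr0.
    have := @is_deriveZ R R R id c t 1 1 (is_derive_id _ _) => h.
    by apply: (is_derive_eq h); rewrite /GRing.scale /= mulr1.
  have n0 : n.+1%:R != 0 :> R by rewrite pnatr_eq0.
  have h := is_deriveD (is_derive_sinn n.+1 (complex.Re p`_n.+1 / n.+1%:R) t) (is_derive_cosn n.+1 (complex.Im p`_n.+1 / n.+1%:R) t).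
  apply: (is_derive_eq h); rewrite !divfK //; ring.
have cf : continuous (f N).
  move=> t; have [d [h _]] := fd N t; apply: differentiable_continuous.
  exact/derivable1_diffP.
have cg : continuous (g N).
  move=> t; have [h _] := gd N t; apply: differentiable_continuous.
  exact/derivable1_diffP.
under eq_integral do rewrite fE.
rewrite (@continuous_FTC2 _ _ (g N)) ?mulr_gt0 ?pi_gt0 //.
- rewrite -EFinB; congr EFin; rewrite /g /N !big_ord_recl /= mulr0 add0r.
  have c2 (n : nat) : cos (n%:R * (2 * pi)) = 1 :> R /\ sin (n%:R * (2 * pi)) = 0 :> R.
    by have := cisX (2 * pi : R) n; rewrite cis2pi expr1n => -[<- <-].
  rewrite -[RHS](mulrC c) -[RHS]addr0 -addrA; congr (_ + _); apply/eqP; rewrite subr_eq0; apply/eqP.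
  by apply: eq_bigr => i _; rewrite (mulr0 (bump 0 i)%:R) cos0 sin0 (c2 _).1 (c2 _).2.
- exact: continuous_subspaceT.
- split=> [t _||]; first by have [] := gd N t.
    exact/cvg_at_right_filter/cg.
  exact/cvg_at_left_filter/cg.
by move=> t _; rewrite derive1E; have [_ ->] := gd N t.
Qed.

End TrigPoly.

(** * Pseudoconvexity from polynomial discs *)

Section Hartogs.
Variable R : realType.
Local Notation C := R[i].
Implicit Types (z w : C2 R) (D : set (C2 R)).

Lemma enormE z : enorm z = Num.sqrt (cmod (z 0 0) ^+ 2 + cmod (z 0 1) ^+ 2).
Proof.
rewrite /enorm !big_ord_recl big_ord0 addr0; congr (Num.sqrt (_ + cmod (z 0 _) ^+ 2)).
exact/val_inj.
Qed.

Lemma enorm_ge0 z : 0 <= enorm z.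
Proof. exact: sqrtr_ge0. Qed.

Lemma enorm_sqr z : enorm z ^+ 2 = cmod (z 0 0) ^+ 2 + cmod (z 0 1) ^+ 2.
Proof. by rewrite enormE sqr_sqrtr // addr_ge0 ?sqr_ge0. Qed.

Lemma enormZ (c : C) z : enorm (c *: z) = cmod c * enorm z.
Proof.
rewrite !enormE !mxE !cmodM !exprMn -mulrDr sqrtrM ?sqr_ge0 // sqrtr_sqr ger0_norm ?cmod_ge0 //.
Qed.

Lemma enormD z w : enorm (z + w) <= enorm z + enorm w.
Proof.
rewrite -(@ler_pXn2r _ 2) ?nnegrE ?addr_ge0 ?enorm_ge0 // sqrrD !enorm_sqr !mxE.
set a := cmod (z 0 0); set b := cmod (z 0 1); set c := cmod (w 0 0); set d := cmod (w 0 1).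
have h1 : cmod (z 0 0 + w 0 0) ^+ 2 <= (a + c) ^+ 2 by rewrite ler_pXn2r ?nnegrE ?cmodD ?addr_ge0 ?cmod_ge0.
have h2 : cmod (z 0 1 + w 0 1) ^+ 2 <= (b + d) ^+ 2 by rewrite ler_pXn2r ?nnegrE ?cmodD ?addr_ge0 ?cmod_ge0.
have h3 : a * c + b * d <= enorm z * enorm w.
  rewrite -(@ler_pXn2r _ 2) ?nnegrE ?addr_ge0 ?mulr_ge0 ?enorm_ge0 ?cmod_ge0 // exprMn !enorm_sqr -/a -/b -/c -/d.
  have := sqr_ge0 (a * d - b * c).
  have -> : (a ^+ 2 + b ^+ 2) * (c ^+ 2 + d ^+ 2) = (a * c + b * d) ^+ 2 + (a * d - b * c) ^+ 2 by ring.
  by rewrite lerDl.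
rewrite -[_ *+ 2]mulr_natl; nra.
Qed.

Lemma enormC z w : enorm (z - w) = enorm (w - z).
Proof. by rewrite -opprB -scaleN1r enormZ cmodN cmod1 mul1r. Qed.

Lemma enorm_le_cn z : enorm z <= 2 * cn z.
Proof.
rewrite -(@ler_pXn2r _ 2) ?nnegrE ?mulr_ge0 ?enorm_ge0 ?cn_ge0 // enorm_sqr.
have h j : cmod (z 0 j) ^+ 2 <= cn z ^+ 2 by rewrite ler_pXn2r ?nnegrE ?cmod_ge0 ?cn_ge0 //; move: j; apply: ord2P; rewrite /cn le_max lexx ?orbT.
have := h 0; have := h 1; have := sqr_ge0 (cn z); rewrite exprMn.
move: (cmod (z 0 0) ^+ 2) (cmod (z 0 1) ^+ 2) (cn z ^+ 2) => x y t; lra.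
Qed.

Lemma cn_le_enorm z : cn z <= enorm z.
Proof.
have h j : cmod (z 0 j) <= enorm z.
  rewrite -(@ler_pXn2r _ 2) ?nnegrE ?enorm_ge0 ?cmod_ge0 // enorm_sqr.
  by move: j; apply: ord2P; rewrite ?lerDl ?lerDr sqr_ge0.
by rewrite /cn ge_max !h.
Qed.

Definition bdist D z : R := fine (boundary_dist D z).

Section BoundaryDist.
Variables (D : set (C2 R)) (w0 : C2 R).
Hypotheses (oD : open D) (Dw0 : ~ D w0).

Lemma bdistE z : boundary_dist D z = (bdist D z)%:E.
Proof.
rewrite /bdist fineK // ge0_fin_numE; last first.
  by apply: le_ereal_inf_tmp => _ [w _ <-]; rewrite lee_fin enorm_ge0.
by apply: le_lt_trans (ltry (enorm (z - w0))); apply: ereal_inf_lbound; exists w0.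
Qed.

Lemma bdist_le z w : ~ D w -> bdist D z <= enorm (z - w).
Proof. by move=> Dw; rewrite -lee_fin -bdistE; apply: ereal_inf_lbound; exists w. Qed.

Lemma bdist_ge z r : (forall w, ~ D w -> r <= enorm (z - w)) -> r <= bdist D z.
Proof. by move=> h; rewrite -lee_fin -bdistE; apply: le_ereal_inf_tmp => _ [w Dw <-]; rewrite lee_fin h. Qed.

Lemma bdist_gt0 z : D z -> 0 < bdist D z.
Proof.
move=> Dz; have [e e0 he] : exists2 e : R, 0 < e & forall w, cn (w - z) < e -> D w.
  by apply/nbhsC2P; exact: open_nbhs_nbhs.
apply: lt_le_trans e0 _; apply: bdist_ge => w Dw; apply: le_trans (cn_le_enorm _).
by rewrite cnC leNgt; apply/negP => /he.
Qed.

Lemma bdist_lip z z' : bdist D z <= bdist D z' + 2 * cn (z - z').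
Proof.
rewrite -lerBlDr; apply: bdist_ge => w Dw; rewrite lerBlDr.
apply: le_trans (bdist_le z Dw) _; have -> : z - w = (z' - w) + (z - z').
  by rewrite [RHS]addrC addrA subrK.
by apply: le_trans (enormD _ _) _; rewrite lerD2l enorm_le_cn.
Qed.

Lemma lne_bdist z : D z -> (- lne (boundary_dist D z))%E = (- ln (bdist D z))%:E.
Proof. by move=> Dz; rewrite bdistE lne_EFin ?bdist_gt0. Qed.

End BoundaryDist.

Lemma abs_lt_of_le (x y t p d : R) : x <= y + 2 * t -> y <= x + 2 * t -> 2 * t + p < d -> 0 <= p -> `|x - y| < d.
Proof. by move=> h1 h2 h3 h4; rewrite ltr_norml; apply/andP; split; lra. Qed.

Lemma ln_near (x e : R) : 0 < x -> 0 < e -> exists2 d : R, 0 < d & forall y, `|y - x| < d -> `|ln y - ln x| < e.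
Proof.
move=> x0 e0; have /cvgrPdist_lt /(_ e e0) [d d0 hd] := continuous_ln x0.
by exists d => // y yx; rewrite distrC; apply: hd; rewrite /= distrC.
Qed.

(** The polynomial [(1 - F / (k+1))^(k+1)] approximates [exp (- F)] on the circle and at 0; the
    margin [e] absorbs both errors. *)
Lemma exp_poly (F : C -> C) (f : C -> R) (c e : R) : polyf F -> F 0 = c%:C -> 0 < e ->
  (forall v, cmod v = 1 -> f v + e <= complex.Re (F v)) ->
  exists Q, [/\ polyf Q, forall v, cmod v = 1 -> cmod (Q v) < expR (- f v) & expR (- c - e) <= cmod (Q 0)].
Proof.
move=> Fp F0 e0 Ff; have [B B0 hB] := circ_bdd (polyf_circ_cont Fp).
(* With [s = 1 / (k+1)], the three terms secure [s B^2 <= e], [2 |c s| <= 1] and [2 s c^2 <= e], in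
   this order. *)
pose T := B ^+ 2 / e + 2 * `|c| + 2 * c ^+ 2 / e.
have T1 : 0 <= B ^+ 2 / e by rewrite divr_ge0 ?sqr_ge0 ?(ltW e0).
have T2 : 0 <= 2 * c ^+ 2 / e.
  by apply: divr_ge0; [apply: mulr_ge0 => //; exact: sqr_ge0 | exact: ltW].
have T3 := normr_ge0 c.
have [k hk] : exists k : nat, T < k.+1%:R by exists (Num.truncn T); rewrite truncnS_gt.
set s : R := k.+1%:R^-1; have K0 : 0 < k.+1%:R :> R by rewrite ltr0n.
have Ks : k.+1%:R * s = 1 by rewrite mulfV ?gt_eqF.
have s0 : 0 < s by rewrite invr_gt0.
have b1 : s * B ^+ 2 <= e.
  rewrite mulrC ler_pdivrMr // -ler_pdivrMl // mulrC; move: hk; rewrite /T.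
  move: (B ^+ 2 / e) (2 * c ^+ 2 / e) T1 T2 => p q; lra.
have b2 : 2 * (s * c ^+ 2) <= e.
  rewrite mulrCA mulrC ler_pdivrMr // -ler_pdivrMl // mulrC; move: hk; rewrite /T.
  move: (B ^+ 2 / e) (2 * c ^+ 2 / e) T1 T2 => p q; lra.
have b3 : 2 * `|c * s| <= 1.
  rewrite normrM (gtr0_norm s0) mulrA ler_pdivrMr // mul1r; move: hk; rewrite /T.
  move: (B ^+ 2 / e) (2 * c ^+ 2 / e) T1 T2 => p q; lra.
exists (fun v => (1 - s%:C * F v) ^+ k.+1); split.
- apply: polyfX; apply: polyfD; first exact: polyf_cst.
  have [p hp] := polyfM (polyf_cst (- s%:C)) Fp; exists p => x; by rewrite -hp mulNr.
- move=> v v1; rewrite cmodX -(@ltr_pXn2r _ 2) ?nnegrE ?exprn_ge0 ?cmod_ge0 ?expR_ge0 //.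
  rewrite -exprM mulnC exprM -expRM_natl.
  (* Expand [|1 - s F|^2 = 1 - 2 s Re F + s^2 |F|^2] and use [1 + x <= exp x]. *)
  have h1 : cmod (1 - s%:C * F v) ^+ 2 <= expR (- 2 * (s * complex.Re (F v)) + s ^+ 2 * B ^+ 2).
    apply: le_trans (expR_ge1Dx _).
    have -> : cmod (1 - s%:C * F v) ^+ 2 = 1 + (- 2 * (s * complex.Re (F v)) + s ^+ 2 * cmod (F v) ^+ 2).
      by rewrite !cmod_sqrE; case: (F v) => x y /=; ring.
    rewrite lerD2l lerD2l ler_wpM2l ?sqr_ge0 // ler_pXn2r ?nnegrE ?cmod_ge0 //; exact: hB.
  apply: le_lt_trans (lerXn2r _ _ _ h1) _; rewrite ?nnegrE ?sqr_ge0 ?expR_ge0 //.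
  rewrite -expRM_natl ltr_expR.
  have -> : k.+1%:R * (- 2 * (s * complex.Re (F v)) + s ^+ 2 * B ^+ 2) =
    - 2 * ((k.+1%:R * s) * complex.Re (F v)) + (k.+1%:R * s) * (s * B ^+ 2) by ring.
  rewrite Ks !mul1r; have := Ff v v1; move: b1; move: (s * B ^+ 2) => p; lra.
rewrite F0 cmodX -rmorphM -(rmorph1 (real_complex R)) -rmorphB cmod_real.
set y := s * c; have yE : `|y| = `|c * s| by rewrite mulrC.
have y1 : - (1 / 2) <= y <= 1 / 2 by rewrite -ler_norml yE; lra.
have [y2 y3] := andP y1.
have z0 : 0 < 1 - y by lra.
rewrite (ger0_norm (ltW z0)).
(* For [|y| <= 1/2] one has [1 / (1 - y) <= 1 + y + 2 y^2], which is at most the exponential. *)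
have h1 : expR (- (y + 2 * y ^+ 2)) <= 1 - y.
  rewrite expRN -[leRHS]invrK lef_pV2 ?posrE ?expR_gt0 ?invr_gt0 //.
  have -> : (1 - y)^-1 = 1 + y / (1 - y) by field; rewrite gt_eqF.
  apply: le_trans (expR_ge1Dx _) _; rewrite ler_expR ler_pdivrMr //.
  have -> : (y + 2 * y ^+ 2) * (1 - y) = y + y ^+ 2 * (1 - 2 * y) by ring.
  by rewrite lerDl mulr_ge0 ?sqr_ge0 //; lra.
apply: le_trans (lerXn2r k.+1 _ _ h1); rewrite ?nnegrE ?expR_ge0 ?(ltW z0) //.
rewrite -expRM_natl ler_expR.
have -> : k.+1%:R * - (y + 2 * y ^+ 2) = - ((k.+1%:R * s) * c) - (k.+1%:R * s) * (2 * (s * c ^+ 2)) by rewrite /y; ring.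
by rewrite Ks !mul1r; move: b2; move: (2 * (s * c ^+ 2)) => p; lra.
Qed.

(* Polynomial discs suffice, [F] and [G] being the two coordinates. *)
Definition disc_hull D := forall F G : C -> C, polyf F -> polyf G ->
  (forall u, cmod u = 1 -> D (\row_(j < 2) if j == 0 then F u else G u)) ->
  D (\row_(j < 2) if j == 0 then F 0 else G 0).

Lemma row2E (z : C2 R) : z = \row_(j < 2) if j == 0 then z 0 0 else z 0 1.
Proof. by apply: C2P; rewrite mxE. Qed.

Lemma cis_continuous (f : C -> R) : circ_cont (fun u => (f u)%:C) -> continuous (fun t : R => f (cis t)).
Proof.
move=> fc t; apply/cvgrPdist_lt => e e0.
have [d d0 hd] := fc (cis t) (cmod_cis t) e e0; exists d => // s /= st.
have := hd (cis s) (cmod_cis s); rewrite -rmorphB cmod_real distrC /=; apply.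
by apply: le_lt_trans (cis_lip _ _) _; rewrite distrC.
Qed.

Lemma continuous_integrable_circ (g : R -> R) : continuous g ->
  lebesgue_measure.-integrable `[0, 2 * pi] (EFin \o g).
Proof.
by move=> gc; apply: continuous_compact_integrable; [exact: segment_compact | exact: continuous_subspaceT].
Qed.

(** Take a polynomial [Q] with [|Q u|] below the distance from [a + u b] to the complement on the
    circle. For [|v| < 1] the disc [a + l b + Q l v] has its boundary in [D], hence its centre too,
    so the distance at [a] is at least [|Q 0|]; and [- ln |Q 0|] nearly equals the mean of
    [- ln dist]. *)
Lemma disc_hull_pseudoconvex D w0 : open D -> ~ D w0 -> disc_hull D -> pseudoconvex D.
Proof.
move=> oD Dw0 hD; have d0 := bdist_gt0 oD Dw0; have dl := bdist_lip Dw0; have dE := lne_bdist oD Dw0.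
split=> //; split.
- by move=> z Dz; rewrite dE // ltry.
- move=> z Dz a; rewrite dE // lte_fin => za; apply/nbhsC2P.
  have ea : expR (- a) < bdist D z by rewrite -(@lnK _ (bdist D z)) ?posrE ?d0 // ltr_expR; lra.
  exists ((bdist D z - expR (- a)) / 2); first by rewrite divr_gt0 ?subr_gt0.
  move=> w wz Dw; rewrite dE // lte_fin.
  have := dl z w; rewrite cnC => h.
  have h2 : expR (- a) < bdist D w by move: wz h; move: (cn _) => c; lra.
  suff : - a < ln (bdist D w) by lra.
  by rewrite -ltr_expR lnK ?posrE ?d0.
move=> a b hab.
have Dab u : cmod u = 1 -> D (a + u *: b) by move=> u1; apply: hab; rewrite cmod_norm u1.
have Da : D a by have := hab 0; rewrite scale0r addr0 normr0; apply; rewrite ler01.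
pose f u := - ln (bdist D (a + u *: b)).
have fc : circ_cont (fun u => (f u)%:C).
  move=> u u1 e e0; have [d dd hd] := ln_near (d0 _ (Dab u u1)) e0.
  have b1 : 0 < 2 * cn b + 1 by rewrite ltr_wpDl ?mulr_ge0 ?cn_ge0.
  exists (d / (2 * cn b + 1)); first by rewrite divr_gt0.
  move=> v v1; rewrite ltr_pdivlMr // => uv; rewrite -rmorphB cmod_real /f -opprB opprK addrC.
  have E s t : a + s *: b - (a + t *: b) = (s - t) *: b by rewrite opprD addrACA subrr add0r scalerBl.
  rewrite normrN; apply: hd; have := dl (a + u *: b) (a + v *: b); have := dl (a + v *: b) (a + u *: b).
  rewrite !E !cnZ (cmodC u v) => h1 h2; move: uv; rewrite mulrDr mulr1 => uv.
  have := cmod_ge0 (v - u) => p0.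
  have e1 : cmod (v - u) * (2 * cn b) = 2 * (cmod (v - u) * cn b) by ring.
  rewrite e1 in uv; exact: abs_lt_of_le h1 h2 uv p0.
rewrite dE //.
have cF := cis_continuous fc; have iF := continuous_integrable_circ cF.
have EI : (\int[lebesgue_measure]_(t in `[0%R, (2 * pi)%R]) - lne (boundary_dist D (a + (cos t +i* sin t)%C *: b)%R) =
    \int[lebesgue_measure]_(t in `[0%R, (2 * pi)%R]) (f (cis t))%:E)%E.
  by apply: eq_integral => t _; rewrite dE //; apply: Dab; exact: cmod_cis.
rewrite EI.
have p0 : 0 < 2 * pi :> R by rewrite mulr_gt0 ?pi_gt0.
rewrite lee_pdivlMl //.
have iE : (\int[lebesgue_measure]_(t in `[0%R, (2 * pi)%R]) (f (cis t))%:E)%E =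
  (Rintegral lebesgue_measure `[0, 2 * pi] (fun t => f (cis t)))%:E.
  by rewrite /Rintegral fineK // integrable_fin_num.
rewrite iE -EFinM lee_fin; apply/ler_addgt0Pr => e e0.
(* Four errors [e'] accumulate: three in [lnb], from raising [F] and from [exp_poly], and one in the
   comparison of integrals. *)
pose e' := e / (2 * pi) / 4; have e'0 : 0 < e' by rewrite !divr_gt0.
have [F [c [Fp F0 hF]]] := fejer_poly fc e'0.
(* Raising [F] by [2 e'] turns the two-sided error [e'] into the lower margin that [exp_poly] asks
   for. *)
have G1 : forall v, cmod v = 1 -> f v + e' <= complex.Re (F v + (2 * e')%:C).
  by move=> v v1; rewrite ReD /=; have := hF v v1; rewrite ler_norml => /andP[]; lra.
have G0 : F 0 + (2 * e')%:C = (c + 2 * e')%:C by rewrite F0 -rmorphD.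
have [Q [Qp Qlt Q0]] := exp_poly (polyfD Fp (polyf_cst (2 * e')%:C)) G0 e'0 G1.
have q0 : 0 < cmod (Q 0) := lt_le_trans (expR_gt0 _) Q0.
have key : cmod (Q 0) <= bdist D a.
  apply: (bdist_ge Dw0) => w Dw; rewrite leNgt; apply/negP => aw; apply: Dw.
  (* A point [w] outside [D] at distance less than [|Q 0|] would be the centre of such a disc. *)
  pose v := (Q 0)^-1 *: (w - a).
  have v1 : enorm v < 1 by rewrite enormZ cmodV enormC mulrC ltr_pdivrMr // mul1r.
  have := hD (fun l => (a + l *: b + Q l *: v) 0 0) (fun l => (a + l *: b + Q l *: v) 0 1).
  have -> : (\row_(j < 2) if j == 0 then (a + 0 *: b + Q 0 *: v) 0 0 else (a + 0 *: b + Q 0 *: v) 0 1) = w.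
    rewrite -row2E scale0r addr0 scalerA mulfV -?cmod_gt0 // scale1r addrC subrK //.
  apply.
  - have [p hp] := polyfD (polyfD (polyf_cst (a 0 0)) (polyfM (polyf_id R) (polyf_cst (b 0 0)))) (polyfM Qp (polyf_cst (v 0 0))).
    by exists p => x; rewrite -hp !mxE.
  - have [p hp] := polyfD (polyfD (polyf_cst (a 0 1)) (polyfM (polyf_id R) (polyf_cst (b 0 1)))) (polyfM Qp (polyf_cst (v 0 1))).
    by exists p => x; rewrite -hp !mxE.
  move=> u u1; rewrite -row2E; apply: contrapT => hn.
  have := bdist_le Dw0 (a + u *: b) hn; rewrite opprD addNKr -scaleN1r enormZ cmodN cmod1 mul1r enormZ.
  have := Qlt u u1; rewrite /f opprK lnK ?posrE ?d0 //; last exact: Dab.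
  move=> h1 h2; have := lt_le_trans h1 h2; apply/negP; rewrite -leNgt ler_piMr ?cmod_ge0 //; exact: ltW.
have lnb : - ln (bdist D a) <= c + 3 * e'.
  have h : expR (- (c + 2 * e') - e') <= bdist D a by apply: le_trans Q0 key.
  have : - (c + 2 * e') - e' <= ln (bdist D a) by rewrite -ler_expR lnK ?posrE ?d0.
  lra.
have Fcc : circ_cont (fun u => (complex.Re (F u))%:C).
  move=> u u1 d dd; have [r r0 hr] := polyf_circ_cont Fp u1 dd; exists r => // v v1 /(hr v v1).
  apply: le_lt_trans; rewrite -rmorphB cmod_real.
  have -> : complex.Re (F v) - complex.Re (F u) = complex.Re (F v - F u) by rewrite ReD ReN.
  exact: Re_le.
have ccF := cis_continuous Fcc.
have iRe := continuous_integrable_circ ccF.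
have int1 : 2 * pi * (c - e') <= Rintegral lebesgue_measure `[0, 2 * pi] (fun t => f (cis t)).
  have [p hp] := polyfD Fp (polyf_cst (- e'%:C)).
  have I1 := @int_polyf R (fun x => F x - e'%:C) (c - e') (ex_intro _ p hp).
  have := I1; rewrite F0 -rmorphB => /(_ erefl) {}I1.
  rewrite -lee_fin -I1 -iE; apply: le_integral => //.
  - apply: continuous_integrable_circ => t.
    have -> : (fun t => complex.Re (F (cis t) - e'%:C)) = (fun t => complex.Re (F (cis t)) - e').
      by apply/funext => s; rewrite ReD ReN.
    apply: cvgB; [exact: ccF | exact: cvg_cst].
  move=> t _; rewrite lee_fin ReD ReN /=.
  by have := hF (cis t) (cmod_cis t); rewrite ler_norml => /andP[]; lra.
have ee : 2 * pi * e' * 4 = e by rewrite /e' -mulrA divfK // mulrC divfK // gt_eqF.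
have : 2 * pi * - ln (bdist D a) <= 2 * pi * (c + 3 * e') by rewrite ler_pM2l.
move/le_trans; apply; rewrite -ee.
have -> : 2 * pi * (c + 3 * e') = 2 * pi * (c - e') + 2 * pi * e' * 4 by ring.
by rewrite lerD2r.
Qed.

End Hartogs.

(** * The functions h *)

Section Family.
Variable R : realType.
Local Notation C := R[i].
Implicit Types (z w : C2 R).

Lemma contCX (D : set (C2 R)) (g : C2 R -> C) n : contC D g -> contC D (fun z => g z ^+ n).
Proof.
move=> gc; elim: n => [|n IH]; first by under eq_fun do rewrite expr0; exact: contC_cst.
by under eq_fun do rewrite exprS; apply: contCM.
Qed.

Lemma contC_prod (D : set (C2 R)) I (s : seq I) (F : I -> C2 R -> C) : (forall i, contC D (F i)) ->
  contC D (fun z => \prod_(i <- s) F i z).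
Proof.
move=> h; elim: s => [|i s IH]; first by under eq_fun do rewrite big_nil; exact: contC_cst.
by under eq_fun do rewrite big_cons; apply: contCM.
Qed.

Lemma contC_coord (D : set (C2 R)) j : contC D (fun z => z 0 j).
Proof.
move=> z _ e e0; exists e => // w; apply: le_lt_trans.
by have := coord_cn (w - z) j; rewrite !mxE.
Qed.

Lemma sum_lt_const n (F : nat -> R) (K : R) : (forall j, F j < K) -> \sum_(j < n.+1) F j < n.+1%:R * K.
Proof.
move=> h; elim: n => [|n IH]; first by rewrite big_ord1 mul1r.
by rewrite big_ord_recr /= -natr1 mulrDl mul1r ltrD.
Qed.

(** The mean over more points than the degree equals [Q 0] exactly, and a finite mean keeps the
    strict inequality. *)
Lemma polyf_max (Q : C -> C) (K : R) : polyf Q -> (forall u, cmod u = 1 -> cmod (Q u) < K) -> cmod (Q 0) < K.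
Proof.
move=> [p hp] h; pose n := (size p).+1.
have E : avg n Q = Q 0.
  rewrite (_ : Q = fun u => \sum_(i < size p) p`_i * (u ^+ i * conjc u ^+ 0)); last first.
    by apply/funext => u; rewrite hp horner_coef; apply: eq_bigr => i _; rewrite expr0 mulr1.
  rewrite avg_sum; apply: eq_bigr => i _; rewrite avgZ avg_monoJ ?ltnS ?(ltnW (ltn_ord i)) // expr0 mulr1.
  by rewrite expr0n.
rewrite -E /avg cmodM cmodV cmod_nat mulrC ltr_pdivrMr ?ltr0n //.
apply: le_lt_trans (cmod_sum _ _ _) _; rewrite mulrC.
by apply: (sum_lt_const _ (F := fun j => cmod (Q (om R n ^+ j)))) => j; apply: h; exact: cmod_omX.
Qed.

Variables (a : nat -> C) (c : nat -> R).

Definition lf j z : C := z 0 1 - a j * z 0 0.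
Definition Aj j : R := 1 + cmod (a j).
Definition tj j z : R := cmod (lf j z) / (Aj j * cn z).
Definition hN N z : R := cn z * \prod_(j < N) (tj j z) `^ (c j).
(* [hN] is nonincreasing in [N] because [tj <= 1], so the infimum is the limit. At [z = 0] the quotient in [tj] is [0]. *)
Definition hs z : R := inf [set hN N z | N in setT].

Hypothesis c_gt0 : forall j, 0 < c j.
(** [M] is a common denominator of the first [N] exponents, and [0 < e] says that they sum to less
    than 1, leaving a positive power of the norm of [z]. *)
Hypothesis dyadic : forall N, exists (M e : nat) (k : nat -> nat),
  [/\ (0 < e)%N, M = (e + \sum_(j < N) k j)%N & forall j, (j < N)%N -> c j * M%:R = (k j)%:R].

Lemma Aj_gt0 j : 0 < Aj j.
Proof. by rewrite ltr_pwDl ?cmod_ge0. Qed.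

Lemma tj_ge0 j z : 0 <= tj j z.
Proof. by rewrite divr_ge0 ?mulr_ge0 ?cmod_ge0 ?cn_ge0 // ltW // Aj_gt0. Qed.

Lemma lf_le j z : cmod (lf j z) <= Aj j * cn z.
Proof.
rewrite /lf /Aj mulrDl mul1r; apply: le_trans (cmodB _ _) _; rewrite cmodM lerD ?coord_cn //.
by rewrite ler_wpM2l ?cmod_ge0 ?coord_cn.
Qed.

Lemma tj_le1 j z : tj j z <= 1.
Proof.
have [->|z0] := eqVneq z 0; first by rewrite /tj cn_0 mulr0 invr0 mulr0.
by rewrite ler_pdivrMr ?mulr_gt0 ?Aj_gt0 ?cn_gt0 // mul1r lf_le.
Qed.

Lemma hN_ge0 N z : 0 <= hN N z.
Proof. by rewrite mulr_ge0 ?cn_ge0 // prodr_ge0 // => j _; exact: powR_ge0. Qed.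

Lemma hN_le N m z : (N <= m)%N -> hN m z <= hN N z.
Proof.
move=> /subnK <-; elim: (m - N)%N => [//|n IH]; rewrite addSn.
apply: le_trans IH; rewrite /hN big_ord_recr /= mulrA ler_piMr //; first exact: hN_ge0.
have h := @ge0_ler_powR R _ (ltW (c_gt0 (n + N))) (tj (n + N) z) 1 _ _ (tj_le1 (n + N) z).
by rewrite powR1 in h; apply: h; rewrite nnegrE ?tj_ge0.
Qed.

Lemma hs_inf z : has_inf [set hN N z | N in setT].
Proof. by split; [exists (hN 0 z); exists 0%N | exists 0 => _ [N _ <-]; exact: hN_ge0]. Qed.

Lemma hs_le N z : hs z <= hN N z.
Proof. by apply: (ge_inf (hs_inf z).2); exists N. Qed.

Lemma hs_ge z x : (forall N, x <= hN N z) -> x <= hs z.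
Proof. by move=> h; apply: lb_le_inf; [exact: (hs_inf z).1 | move=> _ [N _ <-]]. Qed.

Lemma hs_ge0 z : 0 <= hs z.
Proof. by apply: hs_ge => N; exact: hN_ge0. Qed.

Lemma hs_lt z x : hs z < x -> exists N, hN N z < x.
Proof. by move=> /(inf_lt (hs_inf z).1) [_ [N _ <-] h]; exists N. Qed.

Lemma cn0_hN N : hN N 0 = 0.
Proof. by rewrite /hN cn_0 mul0r. Qed.

Lemma tjZ j l z : l != 0 -> tj j (l *: z) = tj j z.
Proof.
move=> l0; rewrite /tj cnZ /lf !mxE.
have -> : l * z 0 1 - a j * (l * z 0 0) = l * (z 0 1 - a j * z 0 0) by ring.
have cl : cmod l != 0 by rewrite cmod_eq0.
by rewrite cmodM mulrCA invfM mulrACA mulfV ?mul1r.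
Qed.

Lemma hNZ N l z : hN N (l *: z) = cmod l * hN N z.
Proof.
have [->|l0] := eqVneq l 0; first by rewrite scale0r cn0_hN cmod0 mul0r.
by rewrite /hN cnZ mulrA; congr (_ * _); apply: eq_bigr => j _; rewrite tjZ.
Qed.

Lemma hsZ l z : hs (l *: z) = cmod l * hs z.
Proof.
have le l' z' : l' != 0 -> hs (l' *: z') <= cmod l' * hs z'.
  move=> l0; have cl : 0 < cmod l' by rewrite cmod_gt0.
  rewrite mulrC -ler_pdivrMr //; apply: hs_ge => N; rewrite ler_pdivrMr // mulrC -hNZ; exact: hs_le.
have [->|l0] := eqVneq l 0.
  rewrite scale0r cmod0 mul0r; apply/eqP; rewrite eq_le hs_ge0 andbT.
  by apply: le_trans (hs_le 0 0) _; rewrite cn0_hN.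
apply/eqP; rewrite eq_le le //=; have := le l^-1 (l *: z); rewrite invr_eq0 => /(_ l0).
rewrite scalerA mulVf // scale1r cmodV mulrC ler_pdivlMr ?cmod_gt0 //; by rewrite mulrC.
Qed.

Definition Pi (e N : nat) (k : nat -> nat) (i : 'I_2) z : C := z 0 i ^+ e * \prod_(j < N) lf j z ^+ k j.

(** In the [M]-th power the denominators of the [tj] cancel: [K * hN ^+ M] is [cn z ^+ e] times the
    product of the [|lf j z|^(k j)], which is the larger of the moduli of the polynomials [Pi 0] and
    [Pi 1]. *)
Lemma hN_char N : exists (M e : nat) (k : nat -> nat) (K : R), [/\ (0 < M)%N, 0 < K &
  forall z x, 0 < x -> (hN N z < x) = (cmod (Pi e N k 0 z) < K * x ^+ M) && (cmod (Pi e N k 1 z) < K * x ^+ M)].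
Proof.
have [M [e [k [e0 Me ck]]]] := dyadic N; have M0 : (0 < M)%N by rewrite Me; lia.
exists M, e, k, (\prod_(j < N) Aj j ^+ k j).
have K0 : 0 < \prod_(j < N) Aj j ^+ k j by rewrite prodr_gt0 // => j _; rewrite exprn_gt0 // Aj_gt0.
split=> // z x x0.
have E : \prod_(j < N) Aj j ^+ k j * hN N z ^+ M = cn z ^+ e * \prod_(j < N) cmod (lf j z) ^+ k j.
  have [->|z0] := eqVneq z 0; first by rewrite cn0_hN cn_0 !expr0n !gtn_eqF // mulr0 mul0r.
  have n0 : 0 < cn z by rewrite cn_gt0.
  rewrite /hN exprMn -prodrXl.
  have -> : \prod_(j < N) (tj j z `^ c j) ^+ M = \prod_(j < N) tj j z ^+ k j.
    apply: eq_bigr => j _; rewrite -powR_mulrn ?powR_ge0 // -powRrM ck //.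
    by rewrite powR_mulrn // tj_ge0.
  rewrite Me exprD; set PA := \prod_(j < N) Aj j ^+ _; set PT := \prod_(j < N) tj j z ^+ _.
  have -> (x1 x2 : R) : PA * (x1 * x2 * PT) = x1 * (PA * (x2 * PT)) by ring.
  congr (_ * _); rewrite /PA /PT -prodrXr /= -!big_split /=.
  apply: eq_bigr => j _; rewrite -!exprMn; congr (_ ^+ _).
  by rewrite /tj mulrA mulrC divfK // mulf_neq0 ?gt_eqF // Aj_gt0.
have P i : cmod (Pi e N k i z) = cmod (z 0 i) ^+ e * \prod_(j < N) cmod (lf j z) ^+ k j.
  by rewrite /Pi cmodM cmodX cmod_prod; congr (_ * _); apply: eq_bigr => j _; rewrite cmodX.
have q0 : 0 <= \prod_(j < N) cmod (lf j z) ^+ k j by rewrite prodr_ge0 // => j _; rewrite exprn_ge0 // cmod_ge0.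
rewrite -(@ltr_pXn2r _ M) ?nnegrE ?hN_ge0 ?(ltW x0) // -(ltr_pM2l K0) E !P.
have le i : cmod (z 0 i) ^+ e * \prod_(j < N) cmod (lf j z) ^+ k j <= cn z ^+ e * \prod_(j < N) cmod (lf j z) ^+ k j.
  by rewrite ler_wpM2r // lerXn2r ?nnegrE ?cmod_ge0 ?cn_ge0 ?coord_cn.
apply/idP/andP => [h|[h1 h2]]; first by split; apply: le_lt_trans (le _) h.
by rewrite {1}/cn; case: (leP (cmod (z 0 0))).
Qed.

Lemma contC_Pi e N k i : contC setT (Pi e N k i).
Proof.
apply: contCM; first by apply: contCX; exact: contC_coord.
apply: contC_prod => j; apply: contCX; rewrite /lf.
have := contCD (@contC_coord setT 1) (contCM (@contC_cst R setT (- a j)) (@contC_coord setT 0)).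
by under eq_fun do rewrite mulNr.
Qed.

Lemma hN_usc N z x : hN N z < x -> exists2 r : R, 0 < r & forall w, cn (w - z) < r -> hN N w < x.
Proof.
move=> hx; have x0 := le_lt_trans (hN_ge0 N z) hx.
have [M [e [k [K [M0 K0 h]]]]] := hN_char N.
move: hx; rewrite h // => /andP[h1 h2].
have g i : cmod (Pi e N k i z) < K * x ^+ M -> exists2 r : R, 0 < r & forall w, cn (w - z) < r -> cmod (Pi e N k i w) < K * x ^+ M.
  move=> hi; have [||r r0 hr] := @contC_Pi e N k i z _ (K * x ^+ M - cmod (Pi e N k i z)); rewrite ?subr_gt0 //.
  exists r => // w /hr; have := cmod_dist (Pi e N k i w) (Pi e N k i z); rewrite ler_norml => /andP[_].
  move: (cmod (_ - _)) => t; lra.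
have [r r0 hr] := g _ h1; have [s s0 hs'] := g _ h2.
exists (Num.min r s); first by rewrite lt_min r0.
by move=> w; rewrite lt_min h // => /andP[/hr -> /hs' ->].
Qed.

Lemma hs_balanced : balanced_fun hs.
Proof.
split; [exact: hs_ge0 | | exact: hsZ].
move=> z _ x; rewrite /= lte_fin => /hs_lt [N hN1]; apply/nbhsC2P.
have [r r0 hr] := hN_usc hN1; exists r => // w /hr h _; rewrite lte_fin.
exact: le_lt_trans (hs_le N w) h.
Qed.

Lemma hs_open : open [set z | hs z < 1].
Proof.
rewrite openE => z /= /hs_lt [N hN1]; apply/nbhsC2P.
have [r r0 hr] := hN_usc hN1; exists r => // w /hr h.
exact: le_lt_trans (hs_le N w) h.
Qed.

Lemma hs_zero j z : lf j z = 0 -> hs z = 0.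
Proof.
move=> l0; apply/eqP; rewrite eq_le hs_ge0 andbT; apply: le_trans (hs_le j.+1 z) _.
rewrite /hN big_ord_recr /= {2}/tj l0 cmod0 mul0r powR0 ?mulr0 //; exact: lt0r_neq0.
Qed.

Lemma hs_dense : (forall x (e : R), 0 < e -> exists j, cmod (a j - x) < e) -> dense (hs @^-1` [set 0]).
Proof.
move=> da O [z Oz] oO; have [r r0 hr] : exists2 e : R, 0 < e & forall w, cn (w - z) < e -> O w.
  by apply/nbhsC2P; exact: open_nbhs_nbhs.
(* The lines [z_2 = a_j z_1] meet [z_1 = 0] only at the origin, so [z] is first moved off that
   axis. *)
pose w0 : C := if z 0 0 == 0 then (r / 2)%:C else z 0 0.
have w00 : w0 != 0.
  by rewrite /w0; case: (eqVneq (z 0 0) 0) => [_|z0] //; apply: real_complex_neq0; rewrite divr_gt0.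
have c0 : 0 < cmod w0 by rewrite cmod_gt0.
have [j hj] := da (z 0 1 / w0) _ (divr_gt0 r0 c0).
pose w : C2 R := \row_(i < 2) if i == 0 then w0 else a j * w0.
exists w; split; last by rewrite /=; apply: (@hs_zero j); rewrite /lf !mxE /= subrr.
apply: hr; rewrite cn_lt !mxE /=; apply/andP; split.
  rewrite /w0; case: (eqVneq (z 0 0) 0) => [->|_]; last by rewrite subrr cmod0.
  by rewrite subr0 cmod_real ger0_norm ?divr_ge0 ?(ltW r0) //; move: r0; lra.
have -> : a j * w0 - z 0 1 = (a j - z 0 1 / w0) * w0 by rewrite mulrBl divfK.
by rewrite cmodM -ltr_pdivlMr.
Qed.

Lemma polyf_Pi e N k i F G : polyf F -> polyf G ->
  polyf (fun u => Pi e N k i (\row_(j < 2) if j == 0 then F u else G u)).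
Proof.
move=> Fp Gp; apply: polyfM.
  apply: polyfX; move: i; apply: ord2P; by under eq_fun do rewrite mxE //.
apply: polyf_prod => j; apply: polyfX; rewrite /lf.
have [p hp] := polyfD Gp (polyfM (polyf_cst (- a j)) Fp).
by exists p => x; rewrite -hp !mxE /= mulNr.
Qed.

(** Each boundary point already satisfies [hN < 1] for some [N]. By compactness and monotonicity in
    [N], as in Dini's theorem, one [m] works on the whole circle, and the maximum principle applies
    to the two polynomials of [hN_char]. *)
Lemma hs_disc_hull : disc_hull [set z | hs z < 1].
Proof.
move=> F G Fp Gp hFG; pose phi u : C2 R := \row_(j < 2) if j == 0 then F u else G u.
have /choice [n hn] : forall u, exists n, cmod u = 1 -> hN n (phi u) < 1.
  move=> u; have [u1|u1] := pselect (cmod u = 1); last by exists 0%N.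
  by have [n hn] := hs_lt (hFG u u1); exists n.
have /choice [d hd] : forall u, exists d : R, cmod u = 1 -> 0 < d /\
   forall v, cmod v = 1 -> cmod (v - u) < d -> hN (n u) (phi v) < 1.
  move=> u; have [u1|u1] := pselect (cmod u = 1); last by exists 0.
  have [M [e [k [K [M0 K0 h]]]]] := hN_char (n u).
  have := hn u u1; rewrite h // expr1n mulr1 => /andP[h1 h2].
  have g i : cmod (Pi e (n u) k i (phi u)) < K -> exists2 r : R, 0 < r &
      forall v, cmod v = 1 -> cmod (v - u) < r -> cmod (Pi e (n u) k i (phi v)) < K.
    move=> hi; have cc := polyf_circ_cont (polyf_Pi e (n u) k i Fp Gp).
    have [|r r0 hr] := cc u u1 (K - cmod (Pi e (n u) k i (phi u))); rewrite ?subr_gt0 //.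
    exists r => // v v1 /(hr v v1); have := cmod_dist (Pi e (n u) k i (phi v)) (Pi e (n u) k i (phi u)).
    rewrite ler_norml => /andP[_]; rewrite -/(phi v) -/(phi u); move: (cmod (_ - _)) => t; lra.
  have [r r0 hr] := g _ h1; have [s s0 hs'] := g _ h2.
  exists (Num.min r s) => _; split; first by rewrite lt_min r0.
  by move=> v v1; rewrite lt_min h // expr1n mulr1 => /andP[/(hr v v1) -> /(hs' v v1) ->].
have [s [s1 hs1]] := @circle_cover R d (fun u u1 => (hd u u1).1).
pose m := \max_(u <- s) n u.
have hm u : cmod u = 1 -> hN m (phi u) < 1.
  move=> u1; have [v vs uv] := hs1 u u1; apply: le_lt_trans ((hd v (s1 v vs)).2 u u1 uv).
  apply: hN_le; exact: leq_bigmax_seq.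
apply: (le_lt_trans (hs_le m _)).
have [M [e [k [K [M0 K0 h]]]]] := hN_char m.
have Pl i u : cmod u = 1 -> cmod (Pi e m k i (phi u)) < K.
  by move=> /hm; rewrite h // expr1n mulr1 => /andP[]; move: i; apply: ord2P.
rewrite h // expr1n mulr1; apply/andP; split.
  exact: (polyf_max (polyf_Pi e m k 0 Fp Gp) (Pl 0)).
exact: (polyf_max (polyf_Pi e m k 1 Fp Gp) (Pl 1)).
Qed.

Lemma hs_siciak : (forall x (e : R), 0 < e -> exists j, cmod (a j - x) < e) -> (exists z, hs z != 0) ->
  siciak_domain [set z | hs z < 1].
Proof.
move=> da [z z0]; exists hs; split=> //.
- exact: hs_balanced.
(* The point outside the domain is [z] rescaled to [hs = 1]. *)
- apply: (@disc_hull_pseudoconvex _ _ ((hs z)^-1%:C *: z)); [exact: hs_open | | exact: hs_disc_hull].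
  have p0 : 0 < hs z by rewrite lt0r z0 hs_ge0.
  by rewrite /= hsZ cmod_real ger0_norm ?invr_ge0 ?(ltW p0) // mulVf // ltxx.
- by exists z; apply/eqP.
- exact: hs_dense.
Qed.

End Family.

(** * Choice of the slopes and exponents *)

Section Sequences.
Variable R : realType.
Local Notation C := R[i].
Implicit Types (z w : C2 R).

Definition bseq (t : nat) : C :=
  if @unpickle (rat * rat)%type t is Some pq then (ratr pq.1 +i* ratr pq.2)%C else 0.

(* Every value of [bseq] occurs at infinitely many indices [j], late enough for the bound [1 + |a_j| <= 2^j]. *)
Definition aseq (j : nat) : C := let x := bseq (logn 2 j) in if 1 + cmod x <= 2 ^+ j then x else 0.

Lemma aseq_le j : 1 + cmod (aseq j) <= 2 ^+ j.
Proof. by rewrite /aseq; case: ifP => // _; rewrite cmod0 addr0 exprn_ege1 // ler1n. Qed.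

Lemma aseq0 : aseq 0 = 0.
Proof.
have := aseq_le 0; rewrite expr0 gerDl => h; apply/eqP; rewrite -cmod_eq0 eq_le h cmod_ge0 //.
Qed.

Lemma aseq_dense (x : C) (e : R) : 0 < e -> exists j, cmod (aseq j - x) < e.
Proof.
move=> e0; have e2 : 0 < e / 2 by rewrite divr_gt0.
have [p hp] := ratr_approx (complex.Re x) e2; have [q hq] := ratr_approx (complex.Im x) e2.
pose y : C := (ratr p +i* ratr q)%C; pose t := pickle (p, q).
have bt : bseq t = y by rewrite /bseq /t pickleK.
(* The factor [2 ^ t] fixes the 2-adic valuation, hence the value [y]; the odd factor makes [j]
   large enough for the size bound. *)
pose m := Num.truncn (1 + cmod y); pose j := (2 ^ t * (2 * m).+1)%N.
exists j; have lj : logn 2 j = t.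
  rewrite /j lognM ?expn_gt0 // pfactorK // (_ : logn 2 _ = 0%N) ?addn0 //.
  by apply/eqP; rewrite -leqn0 -[leqRHS](logn1 2); rewrite logn1 leqn0; apply/eqP; rewrite lognE /= dvdn2 /= oddM.
have t0 : (0 < 2 ^ t)%N by rewrite expn_gt0.
have mj : (m < j)%N by rewrite /j; apply: leq_trans (leq_pmull _ t0); lia.
have yj : 1 + cmod y <= 2 ^+ j.
  apply: le_trans (ltW (truncnS_gt (1 + cmod y))) _; rewrite -/m -natrX ler_nat.
  exact: (leq_trans mj (ltnW (ltn_expl _ _))).
rewrite /aseq lj bt yj; apply: le_lt_trans (cmod_le_ReIm _) _.
by rewrite [ltRHS]splitr; case: (x) hp hq => a b /= hp hq; apply: ltrD; rewrite distrC.
Qed.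

Definition cseq (n j : nat) : R := (if j is 0%N then n%:R else 1) / 64 / 4 ^+ j.

Lemma cseq_gt0 n j : (0 < n)%N -> 0 < cseq n j.
Proof. by move=> n0; rewrite /cseq divr_gt0 ?exprn_gt0 // divr_gt0 //; case: j => // *; rewrite ltr0n. Qed.

Lemma cseq_dyadic n : (0 < n)%N -> (n < 63)%N -> forall N, exists (M e : nat) (k : nat -> nat),
  [/\ (0 < e)%N, M = (e + \sum_(j < N) k j)%N & forall j, (j < N)%N -> cseq n j * M%:R = (k j)%:R].
Proof.
move=> n0 n63 N; pose kap j := if j is 0%N then n else 1%N.
pose S N := (\sum_(j < N) kap j * 4 ^ (N - j))%N.
have SS m : S m.+1 = (4 * S m + 4 * kap m)%N.
  rewrite /S big_ord_recr /= subSnn expn1 [(kap m * 4)%N]mulnC; congr (_ + _)%N.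
  by rewrite big_distrr /=; apply: eq_bigr => i _; rewrite subSn 1?ltnW // expnS; nia.
(* The slack 2 closes the induction: four times it covers the new term 4 and the slack itself. As
   [n < 63], the sum stays below [64 * 4 ^ N]. *)
have Sle m : (S m + 2 <= n.+1 * 4 ^ m)%N.
  elim: m => [|[|m] IH]; first by rewrite /S big_ord0; lia.
    by rewrite SS /S big_ord0 /= expn1; lia.
  by rewrite SS /=; move: IH; rewrite [(4 ^ m.+2)%N]expnS; lia.
have p4 : (0 < 4 ^ N)%N by rewrite expn_gt0.
exists (64 * 4 ^ N)%N, (64 * 4 ^ N - S N)%N, (fun j => kap j * 4 ^ (N - j))%N; split.
- by have := Sle N; rewrite subn_gt0; nia.
- by rewrite subnK //; have := Sle N; nia.
move=> j jN; rewrite /cseq !natrM !natrX.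
have -> : (4 : R) ^+ N = 4 ^+ (N - j) * 4 ^+ j by rewrite -exprD subnK // ltnW.
rewrite (_ : (if j is 0%N then n%:R else 1) = (kap j)%:R :> R); last by case: (j).
have h4 : (4 : R) ^+ j != 0 by rewrite expf_neq0 // pnatr_eq0.
by field.
Qed.

Lemma prod_powR2 N (x : nat -> R) : \prod_(j < N) (2 : R) `^ (x j) = 2 `^ (\sum_(j < N) x j).
Proof.
elim: N => [|N IH]; first by rewrite !big_ord0 powRr0.
by rewrite !big_ord_recr /= IH -powRD // pnatr_eq0 implybT.
Qed.

(** If every [tj] were at least [2^(- m u_j)], the product would be at least [2^(- m L)], because
    the sum of the [c_j u_j] is at most [L], and [hs] would be at least 1. The weights [u]
    distribute the smallness among the lines. *)
Lemma hs_lt_ex (a : nat -> C) (c : nat -> R) (u : nat -> nat) (L m : nat) z : (forall j, 0 < c j) ->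
  (forall N, \sum_(j < N) c j * (u j)%:R <= L%:R) ->
  hs a c z < 1 -> 2 ^+ (L * m) <= cn z -> exists j, tj a j z < (2 ^+ (m * u j))^-1.
Proof.
move=> c0 cu /hs_lt [N hN1] zl; apply: contrapT => hn; move: hN1; apply/negP; rewrite -leNgt.
have ht j : (2 ^+ (m * u j))^-1 <= tj a j z by rewrite leNgt; apply/negP => h; apply: hn; exists j.
have h1 : (2 : R) `^ (- (L * m)%:R) <= \prod_(j < N) tj a j z `^ c j.
  apply: (@le_trans _ _ (\prod_(j < N) (2 : R) `^ (- (c j * (m * u j)%:R)))).
    rewrite (prod_powR2 N (fun j => - (c j * (m * u j)%:R))) ler_powR ?ler1n // sumrN lerN2.
    rewrite (_ : \sum_(j < N) _ = m%:R * \sum_(j < N) c j * (u j)%:R); last first.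
      by rewrite mulr_sumr; apply: eq_bigr => j _; rewrite natrM; ring.
    by rewrite natrM mulrC ler_wpM2r ?ler0n.
  apply: ler_prod => j _; rewrite powR_ge0 /= mulrC -mulNr powRrM.
  have E : (2 : R) `^ (- (m * u j)%:R) = (2 ^+ (m * u j))^-1 by rewrite powRN powR_mulrn.
  have := @ge0_ler_powR R (c j) (ltW (c0 j)) (2 `^ (- (m * u j)%:R)) (tj a j z).
  by apply; rewrite ?nnegrE ?powR_ge0 ?tj_ge0 // E.
apply: le_trans (ler_pM (exprn_ge0 _ _) (powR_ge0 _ _) zl h1); rewrite ?ler0n //.
by rewrite powRN powR_mulrn // mulfV // expf_neq0 // pnatr_eq0.
Qed.

(** Only the exponent of [j = 0] changes with [n], so the two functions differ by a power of [tj 0],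
    which is positive wherever the first of them does not vanish. *)
Lemma hs_compare (n n' : nat) z : (0 < n' <= n)%N -> hs aseq (cseq n') z != 0 -> hs aseq (cseq n) z != 0.
Proof.
move=> /andP[n'0 n'n] h; have n0 : (0 < n)%N by lia.
have t0 : 0 < tj aseq 0 z.
  rewrite lt0r tj_ge0 andbT; apply: contra h => /eqP t0.
  have := hs_le aseq (cseq n') 1 z; rewrite /hN big_ord1 t0 powR0 ?mulr0; last exact: lt0r_neq0 (cseq_gt0 _ _).
  by rewrite eq_le hs_ge0 andbT.
set d := cseq n 0 - cseq n' 0.
have d0 : 0 <= d by rewrite subr_ge0 /cseq expr0 !divr1 ler_pM2r ?invr_gt0 // ler_nat.
pose y := tj aseq 0 z `^ d; have y0 : 0 < y by apply: powR_gt0.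
have y1 : y <= 1.
  have hh := @ge0_ler_powR R d d0 (tj aseq 0 z) 1 _ _ (tj_le1 aseq 0 z).
  by rewrite powR1 in hh; apply: hh; rewrite nnegrE ?tj_ge0.
apply: lt0r_neq0; apply: (@lt_le_trans _ _ (y * hs aseq (cseq n') z)).
  by rewrite mulr_gt0 // lt0r h hs_ge0.
apply: hs_ge => -[|N].
  apply: (@le_trans _ _ (hs aseq (cseq n') z)); first by rewrite ler_piMl ?hs_ge0.
  by apply: le_trans (hs_le _ _ 0 z) _; rewrite /hN !big_ord0.
have -> : hN aseq (cseq n) N.+1 z = y * hN aseq (cseq n') N.+1 z; last by rewrite ler_pM2l // hs_le.
rewrite /hN !big_ord_recl /=.
have -> : tj aseq 0 z `^ cseq n 0 = y * tj aseq 0 z `^ cseq n' 0.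
  by rewrite /y -powRD ?subrK // (gt_eqF t0) implybT.
by rewrite -!mulrA mulrCA.
Qed.

End Sequences.

(** * Volumes *)

Section Volumes.
Variable R : realType.
Local Notation C := R[i].
Local Notation P := (@C2_of_R4 R).
Local Notation L4 := (lebesgue4 R).
Local Notation mu := (@lebesgue_measure R).
Local Notation TR := (measurableTypeR R).
Local Notation T4 := (TR * TR * TR * TR)%type.
Local Notation M2 := (prodm mu mu).
Local Notation M3 := (prodm M2 mu).
Implicit Types (z w : C2 R).

(* The measure preserving shear sending the line [z_2 = a z_1] to [z_2 = 0]. *)
Definition csh (a : C) z : C2 R := \row_(j < 2) if j == 0 then z 0 0 else z 0 1 - a * z 0 0.

Lemma mpres_csh a : mpres L4 (fun p => R4_of_C2 (csh a (P p))).
Proof.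
case: a => s t.
have m2 (x y : R) : measurable_fun setT (fun q : TR * TR => x * q.1 + y * q.2 : TR).
  apply: measurable_funD; apply: measurable_funM; try exact: measurable_cst;
    [exact: measurable_fst | exact: measurable_snd].
have m3 (x y : R) : measurable_fun setT (fun q : TR * TR * TR => x * q.1.1 + y * q.1.2 : TR).
  exact: (measurableT_comp (m2 x y) measurable_fst).
have h1 := mpres_prod (m1 := M3) (mpres_shear M2 (m2 (- s) t)) (@mpres_id _ TR R mu).
have h2 := mpres_shear M3 (m3 (- t) (- s)).
apply: mpres_ext (mpres_comp h2 h1) => -[[[x y] x'] y'] /=.
rewrite /csh /R4_of_C2 /C2_of_R4 !mxE /=.
by congr (_, _, _, _); ring.
Qed.

Definition slab (a : C) (Q e : R) : set (C2 R) := [set z | rect 0 Q e (csh a z)].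

Lemma slab_meas a Q e : measurable (P @^-1` slab a Q e).
Proof.
have -> : P @^-1` slab a Q e = (fun p => R4_of_C2 (csh a (P p))) @^-1` (P @^-1` rect 0 Q e).
  by apply/seteqP; split=> p; rewrite /slab /= R4_of_C2K.
rewrite -[X in measurable X]setTI; apply: (mpres_csh a).1 => //; exact: rect_meas.
Qed.

Lemma volume_slab a Q e : 0 <= Q -> 0 <= e -> L4 (P @^-1` slab a Q e) = ((2 * Q) ^+ 2 * (2 * e) ^+ 2)%:E.
Proof.
move=> Q0 e0; have h := (mpres_csh a).2 _ (rect_meas 0 Q e).
refine (etrans _ (etrans h (volume_rect 0 Q0 e0))).
by congr (L4 _); apply/seteqP; split=> p; rewrite /slab /= R4_of_C2K.
Qed.

Lemma slabP a Q e z : cn z < Q -> cmod (z 0 1 - a * z 0 0) < e -> slab a Q e z.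
Proof.
move=> zQ ze; rewrite /slab /rect /= !mxE /= subr0; split; apply: le_lt_trans (_ : _ <= _) _; try exact: Re_le; try exact: Im_le => //.
- exact: le_lt_trans (coord_cn z 0) zQ.
- exact: le_lt_trans (coord_cn z 0) zQ.
- exact: ze.
exact: ze.
Qed.

Lemma cnball_open (r : R) : open [set z : C2 R | cn z < r].
Proof.
have -> : [set z : C2 R | cn z < r] = polydisc r r by apply/seteqP; split=> z /=; rewrite cn_lt => /andP.
exact: polydisc_open.
Qed.

Lemma nneseries_geo (u : nat -> \bar R) (K : R) : 0 <= K -> (forall i, 0 <= u i)%E ->
  (forall i, u i <= (K / 2 ^+ i.+1)%:E)%E -> (\sum_(0 <= i <oo) u i <= K%:E)%E.
Proof.
move=> K0 u0 h; apply: le_trans (epsilon_trick0 xpredT K0); apply: lee_nneseries => // i _.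
by rewrite natrX.
Qed.

(** By [hs_lt_ex] the shell [2^(L m) <= cn z < 2^(L (m+1))] of the domain is covered by slabs around
    the lines. The inequality of exponents says that the volume of the slab [j] times the bound
    [2^(om m)] of [|g|^2] is at most [2^kap / 2^(j+1) / 2^(m+1)], which sums over [j] and [m]. *)
Lemma sqint_fin (c : nat -> R) (u om : nat -> nat) (L kap : nat) (g : C2 R -> C) :
  (forall j, 0 < c j) -> (forall N, \sum_(j < N) c j * (u j)%:R <= L%:R) ->
  (forall N, exists (M e : nat) (k : nat -> nat),
    [/\ (0 < e)%N, M = (e + \sum_(j < N) k j)%N & forall j, (j < N)%N -> c j * M%:R = (k j)%:R]) ->
  (forall m j, (0 < m)%N -> (4 + 4 * (L * m.+1) + 2 * j + om m + j.+1 + m.+1 <= 2 * (m * u j) + kap)%N) ->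
  contC [set z | hs (aseq R) c z < 1] g ->
  (forall m z, cn z < 2 ^+ (L * m.+1) -> cmod (g z) ^+ 2 <= 2 ^+ om m) ->
  (0 < L)%N -> (sqint [set z | (hs (aseq R) c z < 1)%R] g < +oo)%E.
Proof.
move=> c0 cu dy hexp gc gle L0; set D := [set z | _].
have oD : open D by exact: hs_open.
pose Q m : R := 2 ^+ (L * m.+1).
have Q0 m : 0 <= Q m by rewrite exprn_ge0 // ler0n.
(* The shell 0 is a full ball; its lower bound is 0 rather than [2^0], so the shells exhaust the
   domain. *)
pose lo m : R := if m is 0%N then 0 else 2 ^+ (L * m).
pose Dm m : set T4 := P @^-1` [set z | [/\ D z, cn z < Q m & lo m <= cn z]].
have mDm m : measurable (Dm m).
  have -> : Dm m = (P @^-1` (D `&` [set z | cn z < Q m])) `\` (P @^-1` [set z | cn z < lo m]).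
    apply/seteqP; split=> p /=; rewrite /Dm /=.
      by move=> [h1 h2 h3]; split=> //; apply/negP; rewrite -leNgt.
    by move=> [[h1 h2] /negP]; rewrite -leNgt.
  apply: measurableD; apply: open_measurable4; last exact: cnball_open.
  by apply: openI => //; exact: cnball_open.
have UD : P @^-1` D = \bigcup_m Dm m.
  apply/seteqP; split=> p; last by move=> [m _ []].
  move=> Dp; have ex : exists m, cn (P p) < Q m.
    exists (Num.truncn (cn (P p))); apply: lt_le_trans (truncnS_gt _) _.
    rewrite /Q -natrX ler_nat; apply: leq_trans (ltnW (ltn_expl _ (ltnSn 1))) _.
    by rewrite leq_exp2l // leq_pmull.
  case: (ex_minnP ex) => m hm mmin; exists m => //; split=> //.
  case: m hm mmin => [|m] hm mmin; first exact: cn_ge0.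
  by rewrite leNgt; apply/negP => h; have := mmin m h; rewrite ltnn.
have tI : trivIset setT Dm.
  apply/trivIsetP => i j _ _; wlog ij : i j / (i < j)%N.
    by move=> h; rewrite neq_ltn => /orP[] ij; [|rewrite setIC]; apply: h => //; rewrite neq_ltn ij ?orbT.
  move=> _; rewrite -subset0 => p [[_ h1 _] [_ _ h2]]; have := lt_le_trans h1 (le_refl _).
  move=> {h1}h1; have : Q i <= lo j.
    by case: j ij h2 => // j ij _; rewrite /Q /lo ler_eXn2l ?ltr1n // leq_mul2l ij orbT.
  by rewrite leNgt => /negP; apply; exact: le_lt_trans h2 h1.
have mg := contC_meas2 oD gc.
rewrite /sqint UD ge0_integral_bigcup //; last 2 first.
- by rewrite -UD.
- by move=> p _; rewrite lee_fin sqr_ge0.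
pose W m : R := 2 ^+ om m; have W0 m : 0 < W m by rewrite exprn_gt0.
have i1 m : (\int[L4]_(x in Dm m) (cmod (g (P x)) ^+ 2)%:E <= (W m)%:E * L4 (Dm m))%E.
  rewrite -integral_cst //; apply: ge0_le_integral => //.
  - by move=> p _; rewrite lee_fin sqr_ge0.
  - by apply: measurable_funS mg; [exact: open_measurable4 | move=> p []].
  by move=> p [_ h _]; rewrite lee_fin; exact: gle.
pose V0 : R := (2 * Q 0%N) ^+ 2 * (2 * Q 0%N) ^+ 2.
have V00 : 0 <= V0 by rewrite mulr_ge0 ?sqr_ge0.
(* The first summand pays for the ball of shell 0, bounded by a box; the second for all other
   shells. *)
pose K : R := 2 * (W 0%N * V0) + 2 ^+ kap.
have K0 : 0 <= K by rewrite addr_ge0 ?mulr_ge0 ?exprn_ge0 ?ler0n ?(ltW (W0 _)).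
suff i2 m : ((W m)%:E * L4 (Dm m) <= (K / 2 ^+ m.+1)%:E)%E.
  apply: (le_lt_trans _ (ltry K)); apply: nneseries_geo => // m.
    by apply: integral_ge0 => p _; rewrite lee_fin sqr_ge0.
  exact: le_trans (i1 m) (i2 m).
case: m => [|m].
  have : (L4 (Dm 0%N) <= V0%:E)%E.
    rewrite -(volume_rect 0 (Q0 0%N) (Q0 0%N)); apply: le_measure; rewrite ?inE //; first exact: rect_meas.
    move=> p [_ h _]; have k j := le_lt_trans (coord_cn (P p) j) h.
    by split; rewrite ?subr0; [exact: le_lt_trans (Re_le _) (k 0) | exact: le_lt_trans (Im_le _) (k 0)
      | exact: le_lt_trans (Re_le _) (k 1) | exact: le_lt_trans (Im_le _) (k 1)].
  move=> h; apply: (@le_trans _ _ ((W 0%N)%:E * V0%:E)%E).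
    by apply: lee_wpmul2l => //; rewrite lee_fin ltW.
  rewrite -EFinM lee_fin expr1 ler_pdivlMr // mulrC /K lerDl exprn_ge0 // ler0n.
(* The slab width follows from [tj < 2^(- q u_j)] with [Aj <= 2^j] and [cn z < Q q]. *)
pose q := m.+1; pose e j : R := 2 ^+ j * Q q / 2 ^+ (q * u j).
have e0 j : 0 <= e j by rewrite divr_ge0 ?mulr_ge0 ?exprn_ge0 ?ler0n.
have sub : Dm q `<=` \bigcup_j (P @^-1` slab (aseq R j) (Q q) (e j)).
  move=> p [Dp hQ hlo]; have [j hj] := hs_lt_ex c0 cu Dp hlo.
  have n0 : 0 < cn (P p) by apply: lt_le_trans hlo; rewrite exprn_gt0.
  exists j => //; apply: slabP => //; move: hj; rewrite /tj ltr_pdivrMr ?mulr_gt0 ?Aj_gt0 //.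
  move/lt_le_trans; apply; rewrite /e mulrC ler_wpM2r ?invr_ge0 ?exprn_ge0 ?ler0n //.
  by apply: ler_pM; rewrite ?(ltW hQ) ?(ltW n0) ?(ltW (Aj_gt0 _ _)) // aseq_le.
have h1 := measure_sigma_subadditive L4 (fun j => slab_meas (aseq R j) (Q q) (e j)) (mDm q) sub.
have h2 : (L4 (Dm q) <= (2 ^+ kap / 2 ^+ q.+1 / W q)%:E)%E.
  apply: le_trans h1 _; apply: nneseries_geo => //.
    by rewrite !divr_ge0 ?exprn_ge0 ?ler0n ?(ltW (W0 _)).
  move=> j; rewrite volume_slab // lee_fin.
  rewrite ler_pdivlMr ?exprn_gt0 // ler_pdivlMr // ler_pdivlMr ?exprn_gt0 //.
  have -> : (2 * Q q) ^+ 2 * (2 * e j) ^+ 2 * 2 ^+ j.+1 * W q * 2 ^+ q.+1 =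
    2 ^+ (4 + 4 * (L * q.+1) + 2 * j + om q + j.+1 + q.+1) / 2 ^+ (2 * (q * u j)).
    have x2 (n : nat) : (2 : R) ^+ (2 * n) = (2 ^+ n) ^+ 2 by rewrite mulnC exprM.
    have x4 (n : nat) : (2 : R) ^+ (4 * n) = (2 ^+ n) ^+ 4 by rewrite mulnC exprM.
    have -> : (2 : R) ^+ (4 + 4 * (L * q.+1) + 2 * j + om q + j.+1 + q.+1) =
      2 ^+ 4 * (2 ^+ (L * q.+1)) ^+ 4 * (2 ^+ j) ^+ 2 * 2 ^+ om q * 2 ^+ j.+1 * 2 ^+ q.+1.
      by rewrite -x4 -x2 -!exprD.
    rewrite x2 /e /W /Q; set X := 2 ^+ (L * _); set Y := 2 ^+ (q * _).
    have Y0 : Y != 0 by rewrite expf_neq0 // pnatr_eq0.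
    by field.
  rewrite ler_pdivrMr ?exprn_gt0 // -exprD ler_eXn2l ?ltr1n //; have := @hexp q j isT; lia.
apply: (@le_trans _ _ ((W q)%:E * (2 ^+ kap / 2 ^+ q.+1 / W q)%:E)%E).
  by apply: lee_wpmul2l => //; rewrite lee_fin ltW.
rewrite -EFinM lee_fin mulrC divfK ?gt_eqF // ler_pM2r ?invr_gt0 ?exprn_gt0 // /K lerDr.
by rewrite mulr_ge0 // mulr_ge0 // ltW.
Qed.

Lemma sum_half (u : nat -> R) N : (forall j, u j = 2^-1 ^+ j.+1) -> \sum_(j < N) u j <= 1.
Proof.
move=> h; have -> : \sum_(j < N) u j = 1 - 2^-1 ^+ N; last by rewrite gerBl exprn_ge0 // invr_ge0 ler0n.
elim: N => [|N IH]; first by rewrite big_ord0 expr0 subrr.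
by rewrite big_ord_recr /= IH h exprS; field.
Qed.

Lemma exp_lin j m : (0 < m)%N -> (m + j <= 2 ^ j * m)%N.
Proof.
move=> m0; elim: j => [|j IH]; first by rewrite expn0 mul1n addn0.
rewrite expnS; have : (0 < 2 ^ j)%N by rewrite expn_gt0.
nia.
Qed.

Lemma sqint_fin1 g : contC [set z | hs (aseq R) (cseq R 1) z < 1] g ->
  (forall z, cmod (g z) <= Num.max 1 (cn z)) -> (sqint [set z | (hs (aseq R) (cseq R 1) z < 1)%R] g < +oo)%E.
Proof.
(* Here [c_j u_j = 2^(-j-1)], with sum at most [L = 1]; [om] reflects the linear growth of [g], and
   12 is the constant term left in the inequality of exponents. *)
move=> gc gle; apply: (@sqint_fin _ (fun j => 32 * 2 ^ j)%N (fun m => 2 * m.+1)%N 1 12) => //.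
- by move=> j; exact: cseq_gt0.
- move=> N; rewrite (eq_bigr (fun j : 'I_N => (2^-1 : R) ^+ j.+1)); first exact: (@sum_half (fun j => 2^-1 ^+ j.+1)).
  move=> [j /= _] _; rewrite /cseq natrM natrX exprS.
  rewrite (_ : (if j is 0%N then 1%:R else 1) = 1 :> R); last by case: j.
  have -> : (4 : R) = 2 * 2 by ring.
  have h2 : (2 : R) ^+ j != 0 by rewrite expf_neq0 // pnatr_eq0.
  by rewrite exprMn exprVn; field.
- exact: cseq_dyadic.
- by move=> m j m0; have := exp_lin j m0; lia.
move=> m z hz; rewrite mulnC exprM lerXn2r ?nnegrE ?cmod_ge0 ?exprn_ge0 ?ler0n //.
apply: (le_trans (gle z)); rewrite mul1n in hz; by rewrite ge_max (ltW hz) andbT exprn_ege1 // ler1n.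
Qed.

Lemma sqint_fin2 : (volume [set z | (hs (aseq R) (cseq R 24) z < 1)%R] < +oo)%E.
Proof.
set D := [set z | _]; have oD : open D by apply: hs_open; exact: cseq_dyadic.
have -> : volume D = sqint D (fun=> 1) by rewrite sqint_cst // cmod1 expr1n mul1e.
(* For [j = 0] the inequality of exponents needs [2 u_0 >= 4 L + 1 = 9], whence 5. Then
   [c_0 u_0 = 15/8], and the other terms sum to at most 1/8, giving [L = 2]. *)
apply: (@sqint_fin _ (fun j => if j is 0%N then 5 else 8 * 2 ^ j)%N (fun m => 0)%N 2 14) => //.
- by move=> j; exact: cseq_gt0.
- case=> [|N]; first by rewrite big_ord0 ler0n.
  rewrite big_ord_recl /= /cseq expr0 divr1 (eq_bigr (fun j : 'I_N => (2^-1 : R) ^+ j.+1 / 8)); last first.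
    move=> [j /= _] _; rewrite /bump /= add1n natrM natrX.
    have -> : (4 : R) = 2 * 2 by ring.
    have h2 : (2 : R) ^+ j.+1 != 0 by rewrite expf_neq0 // pnatr_eq0.
    by rewrite exprMn exprVn; field.
  rewrite -mulr_suml; have := @sum_half (fun j => 2^-1 ^+ j.+1) N (fun=> erefl); move: (\sum_(i < N) _) => S; lra.
- exact: cseq_dyadic.
- move=> m [|j] m0; first lia.
  by have := exp_lin j.+1 m0; lia.
- exact: contC_cst.
by move=> m z _; rewrite cmod1 expr1n expr0.
Qed.

End Volumes.

(** * Infinite volume; degenerate metric *)

Section FirstParts.
Variable R : realType.
Local Notation C := R[i].
Local Notation P := (@C2_of_R4 R).
Implicit Types (z w : C2 R).

Definition Dn n : set (C2 R) := [set z | hs (aseq R) (cseq R n) z < 1].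

Lemma eqy_nat (v : \bar R) : (forall n : nat, (n%:R%:E <= v)%E) -> v = +oo%E.
Proof.
case: v => [v| |] // h; last by have := h 0%N.
by have := h (Num.truncn v).+1; rewrite lee_fin leNgt truncnS_gt.
Qed.

Lemma Dn_open n : (0 < n)%N -> (n < 63)%N -> open (Dn n).
Proof. by move=> n0 n63; apply: hs_open; exact: cseq_dyadic. Qed.

(** If the function vanished identically, its domain would be all of C^2, against the finite volume
    given by [sqint_fin1] for the constant 1. *)
Lemma hs1_neq0 : exists z, hs (aseq R) (cseq R 1) z != 0.
Proof.
apply: contrapT => hn; have h0 z : hs (aseq R) (cseq R 1) z = 0.
  by apply/eqP/negPn/negP => h; apply: hn; exists z.
have o1 : open (Dn 1) by exact: Dn_open.
have fin := @sqint_fin1 R (fun=> 1) (@contC_cst R _ 1).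
rewrite sqint_cst // cmod1 expr1n mul1e in fin.
suff h : volume (Dn 1) = +oo%E.
  by have := fin (fun z => _); rewrite -/(Dn 1) h ltxx => k; suff : false by []; apply: k => z; rewrite le_max lexx.
apply: eqy_nat => n; apply: (@le_trans _ _ (volume (rect 0 n%:R n%:R))); last first.
  apply: le_measure; rewrite ?inE; [exact: rect_meas | exact: open_measurable4 |].
  by move=> p _; rewrite /Dn /= h0.
rewrite volume_rect ?ler0n // lee_fin; case: n => [|n]; first by rewrite mulr0 expr0n mulr0.
have n1 : 1 <= n.+1%:R :> R by rewrite ler1n.
move: (n.+1%:R : R) n1 => x x1; have x2 : 1 <= x ^+ 2 by rewrite exprn_ege1.
have -> : (2 * x) ^+ 2 * (2 * x) ^+ 2 = x * (16 * x * x ^+ 2) by ring.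
rewrite ler_peMr; [by [] | by lra |]; nra.
Qed.

Lemma Dn_siciak n : (0 < n)%N -> (n < 63)%N -> siciak_domain (Dn n).
Proof.
move=> n0 n63; apply: hs_siciak.
- by move=> j; exact: cseq_gt0.
- exact: cseq_dyadic.
- by move=> x e; exact: aseq_dense.
have [z hz] := hs1_neq0; exists z; apply: hs_compare hz; lia.
Qed.

(** Only the factor [j = 0] is kept, as the others are at most 1; raising to the power [q] clears
    the exponent [c_0 = p/q]. *)
Lemma hs_small n p q z : (0 < n)%N -> (p <= q)%N -> (0 < p)%N -> cseq R n 0 * q%:R = p%:R ->
  cn z ^+ (q - p) * cmod (z 0 1) ^+ p < 1 -> Dn n z.
Proof.
move=> n0 pq p0 npq hz; rewrite /Dn /=.
have [->|z0] := eqVneq z 0; first by rewrite (@hs_zero _ _ _ (fun j => cseq_gt0 R j n0) 0) // /lf !mxE mulr0 subrr.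
have r0 : 0 < cn z by rewrite cn_gt0.
apply: le_lt_trans (hs_le _ _ 1 z) _; rewrite /hN big_ord1.
have t0 := tj_ge0 (aseq R) 0 z.
rewrite ltNge; apply/negP => h1; have : 1 <= (cn z * tj (aseq R) 0 z `^ cseq R n 0) ^+ q by rewrite exprn_ege1.
rewrite leNgt => /negP; apply; rewrite exprMn -[X in _ * X]powR_mulrn ?powR_ge0 // -powRrM npq powR_mulrn //.
rewrite /tj /lf /Aj aseq0 cmod0 addr0 mul1r mul0r subr0 expr_div_n.
have -> : cn z ^+ q = cn z ^+ (q - p) * cn z ^+ p by rewrite -exprD subnK.
rewrite -mulrA mulrCA; have rp : cn z ^+ p != 0 by rewrite expf_neq0 // gt_eqF.
by rewrite [X in X < 1](_ : _ = cn z ^+ (q - p) * cmod (z 0 1) ^+ p) //; field.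
Qed.

Lemma infinite_volume : siciak_domain (Dn 48) /\ volume (Dn 48) = +oo%E.
Proof.
have sD := Dn_siciak (isT : (0 < 48)%N) isT; split=> //; have [oD _ _] := siciak_open sD.
(* On the box [cn z < 4 s] and [|z_2| < 2 t], so [cn z * |z_2|^3 < 32 s t^3 = 1/2], while its volume
   [16 s^2 t^2 = 16^m] is unbounded. *)
apply: eqy_nat => m; pose s : R := 8 ^+ m; pose t : R := (4 * 2 ^+ m)^-1.
have s0 : 0 < s by rewrite exprn_gt0. have t0 : 0 < t by rewrite invr_gt0 mulr_gt0 ?exprn_gt0.
have st : s * t ^+ 3 = 64^-1.
  rewrite /s /t (_ : (8 : R) = 2 ^+ 3); last by ring.
  rewrite exprAC; have h2 : (2 : R) ^+ m != 0 by rewrite expf_neq0 // pnatr_eq0.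
  by field.
have s1 : 1 <= s by rewrite exprn_ege1 // ler1n.
have t1 : t <= 1.
  rewrite invf_le1 ?mulr_gt0 ?exprn_gt0 //; have : 1 <= (2 : R) ^+ m by rewrite exprn_ege1 // ler1n.
  by move: (2 ^+ m) => x; lra.
apply: (@le_trans _ _ (volume (rect (2 * s) s t))); last first.
  apply: le_measure; rewrite ?inE; [exact: rect_meas | exact: open_measurable4 |].
  move=> p [h1 h2 h3 h4]; apply: (@hs_small 48 3 4) => //; first by rewrite /cseq expr0; field.
  rewrite expr1; set z := P p in h1 h2 h3 h4 *.
  have z1 : cmod (z 0 1) < 2 * t by apply: le_lt_trans (cmod_le_ReIm _) _; lra.
  have z0 : cmod (z 0 0) < 4 * s.
    apply: le_lt_trans (cmod_le_ReIm _) _; have := ler_normD (complex.Re (z 0 0) - 2 * s) (2 * s).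
    rewrite subrK (ger0_norm (mulr_ge0 _ (ltW s0))) //; lra.
  have zc : cn z < 4 * s by rewrite cn_lt z0 /=; apply: lt_le_trans z1 _; lra.
  have c0 := cmod_ge0 (z 0 1); have r0 := cn_ge0 z.
  have y3 : cmod (z 0 1) ^+ 3 <= (2 * t) ^+ 3 by rewrite lerXn2r ?nnegrE ?(ltW z1) // mulr_ge0 // ltW.
  have t3 : 0 < (2 * t) ^+ 3 by rewrite exprn_gt0 // mulr_gt0.
  apply: (@le_lt_trans _ _ (cn z * (2 * t) ^+ 3)); first by rewrite ler_wpM2l.
  apply: (@lt_trans _ _ (4 * s * (2 * t) ^+ 3)); first by rewrite ltr_pM2r.
  have -> : 4 * s * (2 * t) ^+ 3 = 32 * (s * t ^+ 3) by ring.
  by rewrite st; lra.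
rewrite volume_rect ?(ltW s0) ?(ltW t0) // lee_fin.
have -> : (2 * s) ^+ 2 * (2 * t) ^+ 2 = (4 ^+ m) ^+ 2.
  rewrite /s /t (_ : (8 : R) = 2 ^+ 3); last by ring.
  rewrite (_ : (4 : R) ^+ m = 2 ^+ m * 2 ^+ m); last by rewrite -exprMn; congr (_ ^+ _); ring.
  rewrite exprAC; have h2 : (2 : R) ^+ m != 0 by rewrite expf_neq0 // pnatr_eq0.
  by field.
apply: (@le_trans _ _ (4 ^+ m)); first by rewrite -natrX ler_nat ltnW // ltn_expl.
by rewrite expr2 ler_peMr ?exprn_ge0 ?ler0n // exprn_ege1 // ler1n.
Qed.

Notation e0 := (delta_mx 0 0 : C2 R).

(** The bound has order [|x|^(2/3)], as [4^m = (8^m)^(2/3)]: a long thin polydisc around the point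
    still has enough volume for sublinear growth. *)
Lemma D24_line_bound f (x : C) m : unitH (Dn 24) f -> cmod x = 2 * 8 ^+ m -> cmod (f (x *: e0)) <= 8 * 4 ^+ m.
Proof.
move=> [fd f1] xm; have oD : open (Dn 24) by exact: Dn_open.
(* With [c_0 = 3/8] the domain contains [cn z ^5 |z_2|^3 < 1]; here [(3 s)^5 t^3 = 243/512], and
   [1 / (s t) = 8 * 4^m] is the bound. *)
pose s : R := 8 ^+ m; pose t : R := (8 * 32 ^+ m)^-1.
have s0 : 0 < s by rewrite exprn_gt0. have t0 : 0 < t by rewrite invr_gt0 mulr_gt0 ?exprn_gt0.
have h2 : (2 : R) ^+ m != 0 by rewrite expf_neq0 // pnatr_eq0.
have E8 : (8 : R) ^+ m = (2 ^+ m) ^+ 3 by rewrite exprAC; congr (_ ^+ _); ring.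
have E32 : (32 : R) ^+ m = (2 ^+ m) ^+ 5 by rewrite exprAC; congr (_ ^+ _); ring.
have E4 : (4 : R) ^+ m = (2 ^+ m) ^+ 2 by rewrite exprAC; congr (_ ^+ _); ring.
have s1 : 1 <= s by rewrite exprn_ege1 // ler1n.
have t1 : t <= 1.
  rewrite invf_le1 ?mulr_gt0 ?exprn_gt0 //; have : 1 <= (32 : R) ^+ m by rewrite exprn_ege1 // ler1n.
  by move: (32 ^+ m) => y; lra.
have sub z : polydisc s t z -> Dn 24 (x *: e0 + z).
  move=> [z0 z1]; apply: (@hs_small 24 3 8) => //; first by rewrite /cseq expr0; field.
  set w := x *: e0 + z.
  have w1 : cmod (w 0 1) < t by rewrite !mxE /= mulr0 add0r.
  have w0 : cmod (w 0 0) < 3 * s.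
    by rewrite !mxE /= mulr1; apply: le_lt_trans (cmodD _ _) _; rewrite xm -/s; lra.
  have wc : cn w < 3 * s by rewrite cn_lt w0 /=; apply: lt_le_trans w1 _; lra.
  have c0 := cmod_ge0 (w 0 1); have r0 := cn_ge0 w.
  have y3 : cmod (w 0 1) ^+ 3 <= t ^+ 3 by rewrite lerXn2r ?nnegrE ?(ltW w1) // ltW.
  have y5 : cn w ^+ 5 <= (3 * s) ^+ 5 by rewrite lerXn2r ?nnegrE ?(ltW wc) // mulr_ge0 // ltW.
  apply: (@le_lt_trans _ _ ((3 * s) ^+ 5 * t ^+ 3)).
    by apply: ler_pM; rewrite ?exprn_ge0.
  have -> : (3 * s) ^+ 5 * t ^+ 3 = 243 / 512 by rewrite /s /t E8 E32; field.
  lra.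
have := lemM oD fd s0 t0 sub f1.
have -> : 1 / (s ^+ 2 * t ^+ 2) = (8 * 4 ^+ m) ^+ 2 by rewrite /s /t E8 E32 E4; field.
by rewrite ler_pXn2r // nnegrE ?cmod_ge0 // mulr_ge0 ?exprn_ge0 ?ler0n.
Qed.

Lemma D24_line n x : (0 < n)%N -> Dn n (x *: e0).
Proof.
move=> n0; rewrite /Dn /= (@hs_zero _ _ _ (fun j => cseq_gt0 R j n0) 0) //.
by rewrite /lf aseq0 !mxE /= mulr0 mul0r subrr.
Qed.

(** Liouville's theorem: on the circle of radius [2 * 8^m] the growth is [O(4^m)], so the Taylor
    series minus its constant term is [O(|x| / 2^m)] at [x]. *)
Lemma D24_liouville f (x : C) : unitH (Dn 24) f -> f (x *: e0) = f 0.
Proof.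
move=> fD; pose g (y : C) := f (0 + y *: e0).
have gE y : g y = f (y *: e0) by rewrite /g add0r.
have gd y : cdiff g y.
  by apply: cdiff2_line; apply/differentiableC2P; apply: fD.1; rewrite add0r; exact: D24_line.
suff h : cmod (g x - g 0) = 0 by move/eqP: h; rewrite cmod_eq0 subr_eq0 !gE scale0r => /eqP.
apply/eqP; rewrite eq_le cmod_ge0 andbT; apply/ler_addgt0Pr => e e_gt0; rewrite add0r.
(* The first summand makes the final bound [8 |x| / 2^m] at most [e]; the second keeps [x] inside
   half of the circle. *)
pose A := 8 * (cmod x + 1) / e + cmod x; have x0 := cmod_ge0 x.
have B0 : 0 <= 8 * (cmod x + 1) / e by rewrite divr_ge0 ?(ltW e_gt0) // mulr_ge0 // addr_ge0.
pose m := Num.truncn A; have mA : A < 2 ^+ m.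
  by apply: lt_le_trans (truncnS_gt _) _; rewrite -natrX ler_nat ltn_expl.
have p2 : 1 <= (2 : R) ^+ m by rewrite exprn_ege1 // ler1n.
have E8 : (8 : R) ^+ m = (2 ^+ m) ^+ 3 by rewrite exprAC; congr (_ ^+ _); ring.
have E4 : (4 : R) ^+ m = (2 ^+ m) ^+ 2 by rewrite exprAC; congr (_ ^+ _); ring.
pose r : R := 2 * 8 ^+ m; have r0 : 0 < r by rewrite mulr_gt0 ?exprn_gt0.
have b2 : 2 ^+ m <= (8 : R) ^+ m by rewrite lerXn2r ?nnegrE ?ler_nat.
have x8 : cmod x < 8 ^+ m by apply: lt_le_trans b2; apply: le_lt_trans mA; rewrite lerDr.
have xr : cmod x < r by rewrite /r; lra.
have r1 : r < r + 1 by rewrite ltrDl.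
have [c hc] := @taylor R g (r + 1) (addr_gt0 r0 ltr01) (fun y _ => gd y).
have hp : pser c r (8 * 4 ^+ m) g.
  apply: hc => // u u1; rewrite gE; apply: D24_line_bound => //.
  by rewrite cmodM u1 mulr1 cmod_real ger0_norm // ltW.
have g0 : g 0 = c 0%N.
  apply: (climC_uniq (hp.2 0 _)); first by rewrite cmod0.
  move=> d d0; exists 1%N => -[//|n] _; rewrite big_ord_recl big1 ?addr0 ?expr0 ?mulr1 ?subrr ?cmod0 //.
  by move=> i _; rewrite expr0n mulr0.
have := pser_tail 1 hp r0 (lexx (cmod x)) xr; rewrite big_ord1 expr0 mulr1 -g0 expr1 => /le_trans; apply.
have q : cmod x / r <= 2^-1 by rewrite ler_pdivrMr // /r mulrA mulVf ?pnatr_eq0 // mul1r ltW.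
have q0 : 0 <= cmod x / r by rewrite divr_ge0 // ltW.
apply: (@le_trans _ _ (8 * 4 ^+ m * (2 * (cmod x / r)))).
  rewrite ler_wpM2l ?mulr_ge0 ?exprn_ge0 ?ler0n // ler_pdivrMr; last by lra.
  by move: (cmod x / r) q q0 => y; nra.
have -> : 8 * 4 ^+ m * (2 * (cmod x / r)) = 8 * cmod x / 2 ^+ m.
  by rewrite /r E4 E8; field; rewrite gt_eqF // (lt_le_trans ltr01).
rewrite ler_pdivrMr; last exact: lt_le_trans ltr01 p2.
rewrite -ler_pdivrMl // mulrC; apply: le_trans (ltW mA); rewrite /A.
apply: (@le_trans _ _ (8 * (cmod x + 1) / e)); last by rewrite lerDl.
by rewrite ler_pM2r ?invr_gt0 //; lra.
Qed.

Lemma D24_kernel_line x : bergman_kernel (Dn 24) (x *: e0) = bergman_kernel (Dn 24) 0.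
Proof.
have oD : open (Dn 24) by exact: Dn_open.
have D0 : Dn 24 0 by have := @D24_line 24 0 isT; rewrite scale0r.
apply/eqP; rewrite eq_le; apply/andP; split; apply: (kernel_le oD) => f fD.
  by rewrite (D24_liouville x fD); exact: (kernel_ge oD D0 fD).
by rewrite -(D24_liouville x fD); exact: (kernel_ge oD (@D24_line 24 x isT) fD).
Qed.

Lemma real_deriv_cst (v : C2 R) f z : (forall t : R, f (z + t%:C *: v) = f z) -> real_deriv v f z = 0.
Proof.
move=> h; rewrite /real_deriv; under [X in derive1 X]eq_fun do rewrite h.
by under [X in _ +i* derive1 X _]eq_fun do rewrite h; rewrite !derive1_cst.
Qed.

(** The kernel is constant on the complex line of [e0], so the first Wirtinger derivative along it
    vanishes at every point of that line and may be differentiated along it again. *)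
Lemma D24_metric0 : bergman_metric2 (Dn 24) 0 e0 = 0.
Proof.
pose G w : C := (ln (bergman_kernel (Dn 24) w))%:C.
have Gl x : G (x *: e0) = G 0 by rewrite /G D24_kernel_line.
have line (x y : C) (t : R) (v : C2 R) : v = y *: e0 -> x *: e0 + t%:C *: v = (x + t%:C * y) *: e0.
  by move=> ->; rewrite scalerA scalerDl.
have v1 : e0 = 1 *: e0 by rewrite scale1r.
have dG x : dzbar 0 G (x *: e0) = 0.
  rewrite /dzbar !real_deriv_cst ?mulr0 ?addr0 ?mulr0 // => t.
    by rewrite (line x 'i t _ erefl) !Gl.
  by rewrite (line x 1 t _ v1) !Gl.
have ddG : dz 0 (dzbar 0 G) 0 = 0.
  have dG0 : dzbar 0 G 0 = 0 by rewrite -(scale0r e0) dG.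
  have r1 : real_deriv e0 (dzbar 0 G) 0 = 0 by apply: real_deriv_cst => t; rewrite add0r dG0 dG.
  have r2 : real_deriv ('i *: e0) (dzbar 0 G) 0 = 0.
    by apply: real_deriv_cst => t; rewrite add0r scalerA dG0 dG.
  by rewrite /dz r1 r2 mulr0 oppr0 addr0 mulr0.
rewrite /bergman_metric2 big1 // => j _; rewrite big1 // => k _.
move: j k; apply: ord2P; apply: ord2P; rewrite !mxE /= ?mulr0 ?mul0r ?mulr1 //.
- by rewrite -/G ddG mul0r.
- by rewrite rmorph0 mulr0.
Qed.

Lemma kernel_pos_no_metric : [/\ siciak_domain (Dn 24), forall z, Dn 24 z -> 0 < bergman_kernel (Dn 24) z &
  ~ admits_bergman_metric (Dn 24)].
Proof.
have sD := Dn_siciak (isT : (0 < 24)%N) isT; split=> //.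
  by apply/(siciak_kernel_pos sD); exact: sqint_fin2.
move=> [_ /(_ 0 e0)]; rewrite D24_metric0 ltxx => h; suff : false by []; apply: h.
  by have := @D24_line 24 0 isT; rewrite scale0r.
by apply/eqP => /matrixP /(_ 0 0) /eqP; rewrite !mxE /= oner_eq0.
Qed.

End FirstParts.

(** * The inner product of square integrable holomorphic functions *)

Section InnerProduct.
Variable R : realType.
Local Notation C := R[i].
Local Notation P := (@C2_of_R4 R).
Local Notation L4 := (lebesgue4 R).
Local Notation TR := (measurableTypeR R).
Local Notation T4 := (TR * TR * TR * TR)%type.
Variable D : set (C2 R).
Hypothesis oD : open D.
Implicit Types (f g h : C2 R -> C).
Local Notation DD := (P @^-1` D : set T4).

Lemma cdiff2D f g z : cdiff2 f z -> cdiff2 g z -> cdiff2 (fun z => f z + g z) z.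
Proof.
move=> [a [b hf]] [a' [b' hg]]; exists (a + a'), (b + b') => e e0.
have e2 : 0 < e / 2 by rewrite divr_gt0.
have [r r0 hr] := hf _ e2; have [s s0 hs] := hg _ e2.
exists (Num.min r s); first by rewrite lt_min r0.
move=> w; rewrite lt_min => /andP[/hr h1 /hs h2].
set x := w 0 0 - z 0 0 in h1 h2 *; set y := w 0 1 - z 0 1 in h1 h2 *.
have -> : f w + g w - (f z + g z) - ((a + a') * x + (b + b') * y) =
  (f w - f z - (a * x + b * y)) + (g w - g z - (a' * x + b' * y)) by ring.
by apply: le_trans (cmodD _ _) _; rewrite [e]splitr mulrDl lerD.
Qed.

Lemma cdiff2Z (c : C) f z : cdiff2 f z -> cdiff2 (fun z => c * f z) z.
Proof.
move=> [a [b hf]]; exists (c * a), (c * b) => e e0.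
have c1 : 0 < cmod c + 1 by rewrite ltr_wpDl ?cmod_ge0.
have [r r0 hr] := hf _ (divr_gt0 e0 c1); exists r => // w /hr.
set x := w 0 0 - z 0 0; set y := w 0 1 - z 0 1 => h1.
have -> : c * f w - c * f z - (c * a * x + c * b * y) = c * (f w - f z - (a * x + b * y)) by ring.
rewrite cmodM; apply: (@le_trans _ _ (cmod c * (e / (cmod c + 1) * cn (w - z)))).
  by rewrite ler_wpM2l ?cmod_ge0.
have -> : cmod c * (e / (cmod c + 1) * cn (w - z)) = e * cn (w - z) * (cmod c / (cmod c + 1)) by ring.
by rewrite ler_piMr ?mulr_ge0 ?(ltW e0) ?cn_ge0 // ler_pdivrMr // mul1r lerDl.
Qed.

Definition hol f := forall z, D z -> differentiable f z.
Definition HH f := hol f /\ (sqint D f < +oo)%E.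
Definition nr f : R := fine (sqint D f).

Lemma holD f g : hol f -> hol g -> hol (fun z => f z + g z).
Proof. by move=> hf hg z Dz; apply/differentiableC2P; apply: cdiff2D; apply/differentiableC2P; auto. Qed.

Lemma holZ c f : hol f -> hol (fun z => c * f z).
Proof. by move=> hf z Dz; apply/differentiableC2P; apply: cdiff2Z; apply/differentiableC2P; auto. Qed.

Lemma nrE f : HH f -> sqint D f = (nr f)%:E.
Proof. by move=> [_ h]; rewrite /nr fineK // ge0_fin_numE // sqint_ge0. Qed.

Lemma nr_ge0 f : 0 <= nr f.
Proof. exact: fine_ge0 (sqint_ge0 D f). Qed.

Definition okint f := L4.-integrable DD (fun p => (complex.Re (f (P p)))%:E) /\
  L4.-integrable DD (fun p => (complex.Im (f (P p)))%:E).

Definition cint f : C := (Rintegral L4 DD (fun p => complex.Re (f (P p)))) +i*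
  (Rintegral L4 DD (fun p => complex.Im (f (P p)))).

Let mD : measurable DD := open_measurable4 oD.

Lemma ImD (z w : C) : complex.Im (z + w) = complex.Im z + complex.Im w.
Proof. by case: z; case: w. Qed.

Lemma cintD f g : okint f -> okint g -> cint (fun z => f z + g z) = cint f + cint g.
Proof.
move=> [hf hf'] [hg hg']; rewrite /cint.
have -> : (fun p => complex.Re (f (P p) + g (P p))) = (fun p => complex.Re (f (P p)) + complex.Re (g (P p))).
  by apply/funext => p; rewrite ReD.
have -> : (fun p => complex.Im (f (P p) + g (P p))) = (fun p => complex.Im (f (P p)) + complex.Im (g (P p))).
  by apply/funext => p; rewrite ImD.
by rewrite !RintegralD.
Qed.

Lemma ReM (z w : C) : complex.Re (z * w) = complex.Re z * complex.Re w + - complex.Im z * complex.Im w.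
Proof. by case: z => a b; case: w => c d /=; ring. Qed.

Lemma ImM (z w : C) : complex.Im (z * w) = complex.Im z * complex.Re w + complex.Re z * complex.Im w.
Proof. by case: z => a b; case: w => c d /=; ring. Qed.

Lemma cintZ c f : okint f -> cint (fun z => c * f z) = c * cint f.
Proof.
move=> [hf hf']; rewrite /cint.
have -> : (fun p => complex.Re (c * f (P p))) = (fun p => complex.Re c * complex.Re (f (P p)) + - complex.Im c * complex.Im (f (P p))).
  by apply/funext => p; rewrite ReM.
have -> : (fun p => complex.Im (c * f (P p))) = (fun p => complex.Im c * complex.Re (f (P p)) + complex.Re c * complex.Im (f (P p))).
  by apply/funext => p; rewrite ImM.
have k (x : R) (F : T4 -> R) : L4.-integrable DD (fun p => (F p)%:E) -> L4.-integrable DD (EFin \o (fun p => x * F p)).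
  move=> hF; have -> : EFin \o (fun p => x * F p) = (fun p => x%:E * (F p)%:E)%E by [].
  exact: integrableZl.
rewrite !RintegralD ?RintegralZl //; try exact: k.
by case: c => a b /=; apply/eqP; rewrite eq_complex /=; apply/andP; split; apply/eqP; ring.
Qed.

Lemma cintJ f : okint f -> cint (fun z => conjc (f z)) = conjc (cint f).
Proof.
move=> [hf hf']; rewrite /cint.
have -> : (fun p => complex.Re (conjc (f (P p)))) = (fun p => complex.Re (f (P p))) by apply/funext => p; rewrite ReJ.
have -> : (fun p => complex.Im (conjc (f (P p)))) = (fun p => -1 * complex.Im (f (P p))).
  by apply/funext => p; rewrite mulN1r; case: (f _).
by rewrite RintegralZl // mulN1r.
Qed.

Lemma lip_meas (k : C -> R) g : (forall z w, `|k z - k w| <= cmod (z - w)) -> contC D g ->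
  measurable_fun DD (fun p : T4 => k (g (P p))).
Proof.
move=> kl gc mD'; apply: (measurability _ (RGenOInfty.measurableE R)) => //.
move=> _ [_ [a ->] <-].
have -> : DD `&` (fun p => k (g (P p))) @^-1` `]a, +oo[%classic = P @^-1` [set z | D z /\ a < k (g z)].
  by apply/seteqP; split=> p /=; rewrite in_itv /= andbT.
apply: open_measurable4; rewrite openE => z [Dz az]; apply/nbhsC2P.
have [e e0 he] := open_polydisc oD Dz.
have az0 : 0 < k (g z) - a by rewrite subr_gt0.
have [r r0 hr] := gc z Dz _ az0; exists (Num.min e r); first by rewrite lt_min e0.
move=> w; rewrite lt_min => /andP[/he Dw /hr h]; split=> //.
have := le_lt_trans (kl (g w) (g z)) h; rewrite ltr_norml => /andP[]; lra.
Qed.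

Lemma contCJ g : contC D g -> contC D (fun z => conjc (g z)).
Proof.
move=> gc z Dz e e0; have [r r0 hr] := gc z Dz e e0; exists r => // w /hr.
by rewrite -rmorphB /= cmodJ.
Qed.

Lemma okintHH f g : HH f -> HH g -> okint (fun z => f z * conjc (g z)).
Proof.
move=> [hf ff] [hg fg]; have cf := holo_contC hf; have cg := holo_contC hg.
have cfg := contCM cf (contCJ cg).
have bnd : L4.-integrable DD (fun p => ((cmod (f (P p)) ^+ 2)%:E + (cmod (g (P p)) ^+ 2)%:E)%E).
  have k h : contC D h -> (sqint D h < +oo)%E -> L4.-integrable DD (fun p => (cmod (h (P p)) ^+ 2)%:E).
    move=> ch fh; apply/integrableP; split; first exact: contC_meas2.
    by apply: le_lt_trans fh; rewrite le_eqVlt; apply/orP; left; apply/eqP; apply: eq_integral => p _; rewrite gee0_abs // lee_fin sqr_ge0.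
  by apply: integrableD => //; apply: k.
have main (k : C -> R) : (forall z w, `|k z - k w| <= cmod (z - w)) -> (forall z, `|k z| <= cmod z) ->
    L4.-integrable DD (fun p => (k (f (P p) * conjc (g (P p))))%:E).
  move=> k1 k2; apply: le_integrable bnd => //.
    by apply/measurable_EFinP; exact: (lip_meas k1 cfg).
  move=> p _ /=; have s0 : 0 <= cmod (f (P p)) ^+ 2 + cmod (g (P p)) ^+ 2 by rewrite addr_ge0 ?sqr_ge0.
  rewrite lee_fin [leRHS]ger0_norm //.
  apply: le_trans (k2 _) _; rewrite cmodM cmodJ.
  have := sqr_ge0 (cmod (f (P p)) - cmod (g (P p))); have := sqr_ge0 (cmod (f (P p)) + cmod (g (P p))).
  move: (cmod (f _)) (cmod (g _)) => x y; nra.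
split; apply: main.
- by move=> z w; rewrite -ReN -ReD; exact: Re_le.
- exact: Re_le.
- move=> z w; have -> : complex.Im z - complex.Im w = complex.Im (z - w) by rewrite ImD; case: w.
  exact: Im_le.
- exact: Im_le.
Qed.

Definition ip f g : C := cint (fun z => f z * conjc (g z)).

Lemma ipC f g : HH f -> HH g -> ip g f = conjc (ip f g).
Proof.
move=> hf hg; rewrite /ip -cintJ; last exact: okintHH.
by congr cint; apply/funext => z; rewrite rmorphM /= conjcK mulrC.
Qed.

Lemma ip_self f : HH f -> ip f f = (nr f)%:C.
Proof.
move=> hf; rewrite /ip /cint.
have E z : f z * conjc (f z) = (cmod (f z) ^+ 2)%:C by rewrite cmod_sqr.
under [X in Rintegral _ _ X +i* _]eq_fun do rewrite E /=.
under [X in _ +i* Rintegral _ _ X]eq_fun do rewrite E /=.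
by rewrite /Rintegral integral0 /= -/(sqint D f).
Qed.

Lemma ipZl c f g : HH f -> HH g -> ip (fun z => c * f z) g = c * ip f g.
Proof.
move=> hf hg; rewrite /ip -cintZ; last exact: okintHH.
by congr cint; apply/funext => z; rewrite mulrA.
Qed.

Lemma HH0 : HH (fun=> 0).
Proof. by split; [exact: (unitH0 oD).1 | rewrite sqint_cst // cmod0 expr0n mul0e]. Qed.

Lemma HHZ c f : HH f -> HH (fun z => c * f z).
Proof.
move=> [hf ff]; split; first exact: holZ.
have -> : sqint D (fun z => c * f z) = ((cmod c ^+ 2)%:E * sqint D f)%E.
  rewrite /sqint -ge0_integralZl //.
  - by apply: eq_integral => p _; rewrite cmodM exprMn EFinM.
  - exact: contC_meas2 (holo_contC hf).
  - by move=> p _; rewrite lee_fin sqr_ge0.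
  by rewrite lee_fin sqr_ge0.
by case: (sqint D f) (sqint_ge0 D f) ff => // x _ _; rewrite -EFinM ltry.
Qed.

Lemma HHD f g : HH f -> HH g -> HH (fun z => f z + g z).
Proof.
move=> [hf ff] [hg fg]; split; first exact: holD.
have cf := holo_contC hf; have cg := holo_contC hg.
pose F2 h p : \bar R := (2%:E * (cmod (h (P p)) ^+ 2)%:E)%E.
have m2 h : contC D h -> measurable_fun DD (F2 h).
  by move=> ch; apply: emeasurable_funM; [exact: measurable_cst | exact: contC_meas2].
have p2 h p : (0 <= F2 h p)%E by rewrite /F2 -EFinM lee_fin mulr_ge0 // sqr_ge0.
have i2 h : contC D h -> (2%:E * sqint D h = \int[L4]_(p in DD) F2 h p)%E.
  by move=> ch; rewrite /sqint -ge0_integralZl // ?lee_fin // => [|p _]; [exact: contC_meas2 | rewrite lee_fin sqr_ge0].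
have : (sqint D (fun z => f z + g z)%R <= 2%:E * sqint D f + 2%:E * sqint D g)%E.
  rewrite !i2 // -ge0_integralD //; try exact: m2.
  apply: ge0_le_integral => //.
  - by move=> p _; rewrite lee_fin sqr_ge0.
  - exact: contC_meas2 (contCD cf cg).
  - by apply: emeasurable_funD; exact: m2.
  move=> p _; rewrite /F2 -!EFinM -EFinD lee_fin.
  have h := cmodD (f (P p)) (g (P p)).
  apply: (@le_trans _ _ ((cmod (f (P p)) + cmod (g (P p))) ^+ 2)).
    by rewrite lerXn2r ?nnegrE ?addr_ge0 ?cmod_ge0.
  have := sqr_ge0 (cmod (f (P p)) - cmod (g (P p))); move: (cmod (f _)) (cmod (g _)) => x y; nra.
move/le_lt_trans; apply.
case: (sqint D f) (sqint_ge0 D f) ff => // x _ _; case: (sqint D g) (sqint_ge0 D g) fg => // y _ _.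
by rewrite -!EFinM -EFinD ltry.
Qed.

Lemma ipDl f g h : HH f -> HH g -> HH h -> ip (fun z => f z + g z) h = ip f h + ip g h.
Proof.
move=> hf hg hh; rewrite /ip -cintD; try exact: okintHH.
by congr cint; apply/funext => z; rewrite mulrDl.
Qed.

Lemma HH_sum n (c : nat -> C) (q : nat -> C2 R -> C) : (forall i, (i < n)%N -> HH (q i)) ->
  HH (fun z => \sum_(i < n) c i * q i z).
Proof.
elim: n => [|n IH] h; first by under eq_fun do rewrite big_ord0; exact: HH0.
under eq_fun do rewrite big_ord_recr /=; apply: HHD; last by apply: HHZ; exact: h.
by apply: IH => i ni; apply: h; exact: ltnW.
Qed.

Lemma ip_suml n (c : nat -> C) (q : nat -> C2 R -> C) h : HH h -> (forall i, (i < n)%N -> HH (q i)) ->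
  ip (fun z => \sum_(i < n) c i * q i z) h = \sum_(i < n) c i * ip (q i) h.
Proof.
move=> hh; elim: n => [|n IH] hq.
  under [X in ip X _]eq_fun do rewrite big_ord0; rewrite big_ord0.
  transitivity (ip (fun=> 0 * 0) h); first by congr ip; apply/funext => z; rewrite mulr0.
  by rewrite (ipZl 0 HH0 hh) mul0r.
under [X in ip X _]eq_fun do rewrite big_ord_recr /=.
have hq' i : (i < n)%N -> HH (q i) by move=> ni; apply: hq; exact: ltnW.
rewrite ipDl // ?big_ord_recr /=; try exact: HH_sum; try (by apply: HHZ; exact: hq).
by rewrite IH // ipZl //; exact: hq.
Qed.

End InnerProduct.

(** * Orthonormalisation *)

Section GramSchmidt.
Variable R : realType.
Local Notation C := R[i].
Local Notation P := (@C2_of_R4 R).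
Local Notation L4 := (lebesgue4 R).
Variable D : set (C2 R).
Hypothesis oD : open D.
Implicit Types (f h : C2 R -> C).
Local Notation HH := (HH D).
Local Notation ip := (ip D).
Local Notation nr := (nr D).

Lemma conjcMr (c : C) (x : R) : conjc (c * x%:C) = conjc c * x%:C.
Proof. by case: c => a b; apply/eqP; rewrite eq_complex /=; apply/andP; split; apply/eqP; ring. Qed.

Lemma sum_CS n (x y : nat -> R) : (\sum_(i < n) x i * y i) ^+ 2 <= (\sum_(i < n) x i ^+ 2) * \sum_(i < n) y i ^+ 2.
Proof.
elim: n => [|n IH]; first by rewrite !big_ord0 expr0n mul0r.
rewrite !big_ord_recr /=; set S := \sum_(i < n) _ * _ in IH *; set A := \sum_(i < n) _ in IH *; set B := \sum_(i < n) _ in IH *.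
have A0 : 0 <= A by apply: sumr_ge0 => i _; exact: sqr_ge0.
have B0 : 0 <= B by apply: sumr_ge0 => i _; exact: sqr_ge0.
set a := x n; set b := y n.
have h : 2 * (S * (a * b)) <= A * b ^+ 2 + B * a ^+ 2.
  have u0 := addr_ge0 (mulr_ge0 A0 (sqr_ge0 b)) (mulr_ge0 B0 (sqr_ge0 a)).
  apply: le_trans (ler_norm _) _; rewrite -(@ler_pXn2r _ 2) ?nnegrE ?normr_ge0 //.
  rewrite real_normK ?num_real //.
  have -> : (2 * (S * (a * b))) ^+ 2 = 4 * (S ^+ 2 * (a * b) ^+ 2) by ring.
  have : S ^+ 2 * (a * b) ^+ 2 <= A * B * (a * b) ^+ 2 by rewrite ler_wpM2r ?sqr_ge0.
  have := sqr_ge0 (A * b ^+ 2 - B * a ^+ 2).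
  have -> : (A * b ^+ 2 - B * a ^+ 2) ^+ 2 = (A * b ^+ 2 + B * a ^+ 2) ^+ 2 - 4 * (A * B * (a * b) ^+ 2) by ring.
  lra.
have -> : (S + a * b) ^+ 2 = S ^+ 2 + 2 * (S * (a * b)) + (a * b) ^+ 2 by ring.
have -> : (A + a ^+ 2) * (B + b ^+ 2) = A * B + (A * b ^+ 2 + B * a ^+ 2) + (a * b) ^+ 2 by ring.
lra.
Qed.

(** Point evaluations are bounded by the norm, so a function of norm 0 vanishes everywhere on [D],
    not only almost everywhere. *)
Lemma HH_null f z : HH f -> nr f = 0 -> D z -> f z = 0.
Proof.
move=> hf n0 Dz; have [r r0 [M M0 [_ hM]]] := unif_bound oD Dz.
have := hM f 0 z hf.1; rewrite (nrE hf) n0 subrr cn_0 mulr0 => /(_ (lexx _) r0) h.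
by apply/eqP; rewrite -cmod_eq0 -sqrf_eq0 eq_le h sqr_ge0.
Qed.

Lemma nrZ (c : C) f : HH f -> nr (fun z => c * f z) = cmod c ^+ 2 * nr f.
Proof.
move=> hf; have hc := HHZ oD c hf.
have := ip_self hc; rewrite (ipZl oD c hf hc) (ipC oD hc hf) (ipZl oD c hf hf) (ip_self hf).
rewrite conjcMr mulrA -cmod_sqr -rmorphM => h; exact: (congr1 (@complex.Re R) (esym h)).
Qed.

Lemma nr_eq f h : (forall z, D z -> f z = h z) -> nr f = nr h.
Proof. by move=> e; rewrite /nr /sqint; congr fine; apply: eq_integral => p; rewrite inE => Dp; rewrite e. Qed.

Lemma ip0r f : HH f -> ip f (fun=> 0) = 0.
Proof.
move=> hf; rewrite (ipC oD (HH0 oD) hf).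
have -> : ip (fun=> 0) f = 0.
  transitivity (ip (fun=> 0 * 0) f); first by apply: (congr1 (fun F => ip F f)); apply/funext => z; rewrite mulr0.
  by rewrite (ipZl oD 0 (HH0 oD) hf) mul0r.
by rewrite rmorph0.
Qed.

Variable g : nat -> C2 R -> C.
Hypothesis hg : forall n, HH (g n).

(* A vector depending linearly on its predecessors contributes [0] instead of being dropped. *)
Definition gs_step f (s : seq (C2 R -> C)) : C2 R -> C :=
  let r z := f z - \sum_(q <- s) ip f q * q z in
  if nr r == 0 then fun=> 0 else fun z => (Num.sqrt (nr r))^-1%:C * r z.

Fixpoint gs_list n := if n is m.+1 then rcons (gs_list m) (gs_step (g m) (gs_list m)) else [::].

Definition gs n := nth (fun=> 0) (gs_list n.+1) n.

Lemma gs_listE n : gs_list n = mkseq gs n.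
Proof.
elim: n => [//|n IH]; rewrite mkseqS -IH /=; congr rcons.
by rewrite /gs /= nth_rcons IH size_mkseq ltnn eqxx.
Qed.

Definition resid n z := g n z - \sum_(i < n) ip (g n) (gs i) * gs i z.

Lemma gsE n : gs n = if nr (resid n) == 0 then fun=> 0 else fun z => (Num.sqrt (nr (resid n)))^-1%:C * resid n z.
Proof.
have -> : gs n = gs_step (g n) (gs_list n) by rewrite /gs /= nth_rcons gs_listE size_mkseq ltnn eqxx.
pose r z := g n z - \sum_(q <- mkseq gs n) ip (g n) q * q z.
have rE : r = resid n.
  apply/funext => z; rewrite /r /resid big_map.
  by rewrite -[in RHS](big_mkord xpredT (fun i => ip (g n) (gs i) * gs i z)) /index_iota subn0.
by rewrite -rE gs_listE.
Qed.

Lemma resid_HH n : (forall i, (i < n)%N -> HH (gs i)) -> HH (resid n).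
Proof.
move=> h; have -> : resid n = fun z => g n z + \sum_(i < n) (- ip (g n) (gs i)) * gs i z.
  by apply/funext => z; rewrite /resid -sumrN; congr (_ + _); apply: eq_bigr => i _; rewrite mulNr.
by apply: HHD => //; exact: (HH_sum oD (fun i => - ip (g n) (gs i)) h).
Qed.

Lemma gs_HH n : HH (gs n).
Proof.
elim/ltn_ind: n => n IH; rewrite gsE; case: ifP => _; first exact: HH0.
apply: HHZ => //; exact: resid_HH.
Qed.

Lemma gs_nr n : nr (gs n) = 1 \/ gs n = fun=> 0.
Proof.
rewrite gsE; case: eqVneq => [_|n0]; [by right | left].
have rH := resid_HH (fun i _ => gs_HH i).
rewrite nrZ // cmod_real ger0_norm ?invr_ge0 ?sqrtr_ge0 // exprVn sqr_sqrtr ?nr_ge0 // mulVf //.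
Qed.

Lemma nr_gs01 n : 0 <= nr (gs n) <= 1.
Proof.
case: (gs_nr n) => -> ; first by rewrite ler01 lexx.
have -> : nr (fun=> 0) = 0 by rewrite /nr sqint_cst // cmod0 expr0n mul0e.
by rewrite lexx ler01.
Qed.

Lemma gs_orth_lt n j : (j < n)%N -> ip (gs n) (gs j) = 0.
Proof.
elim/ltn_ind: n j => n IH j jn.
have orth i k : (i < n)%N -> (k < n)%N -> i != k -> ip (gs i) (gs k) = 0.
  move=> i_n k_n; rewrite neq_ltn => /orP[ik|ki]; last exact: IH.
  by rewrite (ipC oD (gs_HH k) (gs_HH i)) (IH k k_n i ik) rmorph0.
have rH := resid_HH (fun i _ => gs_HH i) : HH (resid n).
suff h : ip (resid n) (gs j) = 0.
  rewrite gsE; case: eqVneq => _; last by rewrite ipZl // ?h ?mulr0 //; exact: gs_HH.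
  by rewrite (ipC oD (gs_HH j) (HH0 oD)) ip0r ?rmorph0 //; exact: gs_HH.
have -> : resid n = fun z => g n z + \sum_(i < n) (- ip (g n) (gs i)) * gs i z.
  by apply/funext => z; rewrite /resid -sumrN; congr (_ + _); apply: eq_bigr => i _; rewrite mulNr.
rewrite ipDl //; [|exact: (HH_sum oD (fun i => - ip (g n) (gs i)) (fun i _ => gs_HH i))|exact: gs_HH].
rewrite (ip_suml oD (fun i => - ip (g n) (gs i)) (gs_HH j) (fun i _ => gs_HH i)).
rewrite (bigD1 (Ordinal jn)) //= big1 ?addr0; last first.
  by move=> i /negP ij; rewrite orth ?mulr0 //; apply/negP => /eqP e; apply: ij; apply/eqP/val_inj.
rewrite (ip_self (gs_HH j)); case: (gs_nr j) => [-> | e]; first by rewrite mulr1 subrr.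
by rewrite e !ip0r // oppr0 mul0r addr0.
Qed.

Lemma gs_orth i j : i != j -> ip (gs i) (gs j) = 0.
Proof.
rewrite neq_ltn => /orP[ij|]; last exact: gs_orth_lt.
by rewrite (ipC oD (gs_HH j) (gs_HH i)) gs_orth_lt // rmorph0.
Qed.

Lemma nr_sum n (c : nat -> C) : nr (fun z => \sum_(i < n) c i * gs i z) = \sum_(i < n) cmod (c i) ^+ 2 * nr (gs i).
Proof.
have hS := HH_sum oD c (fun i (_ : (i < n)%N) => gs_HH i).
have e i : (i < n)%N -> ip (fun z => \sum_(i < n) c i * gs i z) (gs i) = c i * (nr (gs i))%:C.
  move=> ni; rewrite (ip_suml oD c (gs_HH i) (fun i _ => gs_HH i)) (bigD1 (Ordinal ni)) //= (ip_self (gs_HH i)).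
  rewrite big1 ?addr0 // => k /negP ki; rewrite gs_orth ?mulr0 //; apply/negP => /eqP kE; apply: ki; exact/eqP/val_inj.
have := ip_self hS; rewrite (ip_suml oD c hS (fun i _ => gs_HH i)).
have -> : \sum_(i < n) c i * ip (gs i) (fun z => \sum_(i < n) c i * gs i z) = (\sum_(i < n) cmod (c i) ^+ 2 * nr (gs i))%:C.
  rewrite rmorph_sum; apply: eq_bigr => i _; rewrite (ipC oD hS (gs_HH i)) e // conjcMr mulrA -cmod_sqr.
  by rewrite -rmorphM.
by move=> h; exact: (congr1 (@complex.Re R) (esym h)).
Qed.

Lemma gs_span n : exists2 b : nat -> C, forall z, D z -> g n z = \sum_(i < n.+1) b i * gs i z &
  \sum_(i < n.+1) cmod (b i) ^+ 2 * nr (gs i) = nr (g n).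
Proof.
have rH := resid_HH (fun i _ => gs_HH i) : HH (resid n).
pose b i : C := if (i < n)%N then ip (g n) (gs i) else (Num.sqrt (nr (resid n)))%:C.
have E z : D z -> g n z = \sum_(i < n.+1) b i * gs i z.
  move=> Dz; rewrite big_ord_recr /= {2}/b ltnn.
  have -> : (Num.sqrt (nr (resid n)))%:C * gs n z = resid n z.
    rewrite gsE; case: eqVneq => [n0|n0]; first by rewrite mulr0 (HH_null rH n0 Dz).
    by rewrite mulrA -rmorphM mulfV ?mul1r // gt_eqF // sqrtr_gt0 lt0r n0 nr_ge0.
  rewrite /resid; have -> : \sum_(i < n) b i * gs i z = \sum_(i < n) ip (g n) (gs i) * gs i z.
    by apply: eq_bigr => i _; rewrite /b ltn_ord.
  by rewrite addrC subrK.
exists b => //; rewrite -nr_sum; apply: nr_eq => z Dz; by rewrite -E.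
Qed.

(** Cauchy-Schwarz for the expansion of [g n]; null vectors of the orthonormalisation have weight
    [nr (gs i) = 0] and do not disturb it. *)
Lemma gs_le n z : D z -> cmod (g n z) ^+ 2 <= nr (g n) * \sum_(i < n.+1) cmod (gs i z) ^+ 2.
Proof.
move=> Dz; have [b E bn] := gs_span n; rewrite E // -bn.
have h : cmod (\sum_(i < n.+1) b i * gs i z) <= \sum_(i < n.+1) (cmod (b i) * nr (gs i)) * cmod (gs i z).
  apply: le_trans (cmod_sum _ _ _) _; apply: ler_sum => i _; rewrite cmodM.
  by case: (gs_nr i) => ->; rewrite ?mulr1 // cmod0 !mulr0.
apply: (@le_trans _ _ ((\sum_(i < n.+1) (cmod (b i) * nr (gs i)) * cmod (gs i z)) ^+ 2)).
  rewrite lerXn2r ?nnegrE ?cmod_ge0 //; exact: le_trans (cmod_ge0 _) h.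
apply: le_trans (sum_CS n.+1 (fun i => cmod (b i) * nr (gs i)) (fun i => cmod (gs i z))) _.
rewrite ler_wpM2r ?sumr_ge0 // => [i _|]; first exact: sqr_ge0.
apply: ler_sum => i _; rewrite exprMn ler_wpM2l ?sqr_ge0 //.
by have /andP[h0 h1] := nr_gs01 i; rewrite expr2 ler_piMr.
Qed.

(** Tests the bound on [f], the sum of the [conjc (T (gs i)) * gs i]: there [T f] equals the sum [S]
    of squares, while the squared norm of [f] is at most [S]. Of the linearity of [T] just this
    instance is asked. *)
Lemma bessel (T : (C2 R -> C) -> C) (B : R) n : 0 <= B ->
  T (fun z => \sum_(i < n) conjc (T (gs i)) * gs i z) = \sum_(i < n) conjc (T (gs i)) * T (gs i) ->
  (forall f S, HH f -> 0 < S -> nr f <= S -> cmod (T f) ^+ 2 <= B * S) ->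
  \sum_(i < n) cmod (T (gs i)) ^+ 2 <= B.
Proof.
move=> B0 TE Tb; set S := \sum_(i < n) _.
have [S0|S0] := leP S 0; first exact: le_trans S0 B0.
have hf := HH_sum oD (fun i => conjc (T (gs i))) (fun i (_ : (i < n)%N) => gs_HH i).
have nf : nr (fun z => \sum_(i < n) conjc (T (gs i)) * gs i z) <= S.
  rewrite (nr_sum n (fun i => conjc (T (gs i)))); apply: ler_sum => i _; rewrite cmodJ.
  by have /andP[h0 h1] := nr_gs01 i; rewrite ler_piMr ?sqr_ge0.
have := Tb _ S hf S0 nf; rewrite TE.
have -> : \sum_(i < n) conjc (T (gs i)) * T (gs i) = S%:C.
  by rewrite rmorph_sum; apply: eq_bigr => i _; rewrite /= cmod_sqr mulrC.
by rewrite cmod_real ger0_norm ?(ltW S0) // expr2 ler_pM2r.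
Qed.

End GramSchmidt.

(** * Square summable sequences *)

Section L2Sequences.
Variable R : realType.
Local Notation C := R[i].
Implicit Types (a b : nat -> C).

Definition l2 a (M : R) := 0 <= M /\ forall n, \sum_(i < n) cmod (a i) ^+ 2 <= M ^+ 2.

Lemma l2_CS a b M N n : l2 a M -> l2 b N -> \sum_(i < n) cmod (a i) * cmod (b i) <= M * N.
Proof.
move=> [M0 hM] [N0 hN]; rewrite -(@ler_pXn2r _ 2) ?nnegrE ?mulr_ge0 ?sumr_ge0 //; last first.
  by move=> i _; rewrite mulr_ge0 ?cmod_ge0.
apply: le_trans (sum_CS n (fun i => cmod (a i)) (fun i => cmod (b i))) _; rewrite exprMn.
by apply: ler_pM => //; apply: sumr_ge0 => i _; exact: sqr_ge0.
Qed.

Lemma l2D a b M N : l2 a M -> l2 b N -> l2 (fun i => a i + b i) (M + N).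
Proof.
move=> ha hb; have [M0 hM] := ha; have [N0 hN] := hb; split=> [|n]; first exact: addr_ge0.
apply: (@le_trans _ _ (\sum_(i < n) cmod (a i) ^+ 2 + 2 * (\sum_(i < n) cmod (a i) * cmod (b i)) + \sum_(i < n) cmod (b i) ^+ 2)).
  rewrite mulr_sumr -!big_split /=; apply: ler_sum => i _.
  apply: (@le_trans _ _ ((cmod (a i) + cmod (b i)) ^+ 2)).
    by rewrite lerXn2r ?nnegrE ?addr_ge0 ?cmod_ge0 // cmodD.
  by rewrite le_eqVlt; apply/orP; left; apply/eqP; ring.
have := hM n; have := hN n; have := l2_CS n ha hb.
have -> : (M + N) ^+ 2 = M ^+ 2 + 2 * (M * N) + N ^+ 2 by ring.
move: (\sum_(i < n) _ * _) (\sum_(i < n) cmod (a i) ^+ 2) (\sum_(i < n) cmod (b i) ^+ 2) (M * N) (M ^+ 2) (N ^+ 2) => *; lra.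
Qed.

Lemma l2Z (c : C) a M : l2 a M -> l2 (fun i => c * a i) (cmod c * M).
Proof.
move=> [M0 hM]; split=> [|n]; first by rewrite mulr_ge0 ?cmod_ge0.
under eq_bigr do rewrite cmodM exprMn.
by rewrite -mulr_sumr exprMn ler_wpM2l ?sqr_ge0.
Qed.

Lemma l2_le a M N : l2 a M -> M <= N -> l2 a N.
Proof.
move=> [M0 hM] MN; have N0 := le_trans M0 MN; split=> // n; apply: le_trans (hM n) _.
by rewrite lerXn2r ?nnegrE.
Qed.

Lemma l2_ex a b M N : l2 a M -> l2 b N -> exists l, climC (fun n => \sum_(i < n) a i * conjc (b i)) l.
Proof.
move=> ha hb; apply: climC_cauchy => e e0; pose s n := \sum_(i < n) cmod (a i) * cmod (b i).
have sn : nondecreasing_seq s.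
  apply/nondecreasing_seqP => n; rewrite /s big_ord_recr /= lerDl mulr_ge0 ?cmod_ge0 //.
have sb : has_ubound (range s) by exists (M * N) => _ [n _ <-]; exact: l2_CS.
have /cvg_ex [L /cvgrPdist_lt hL] := nondecreasing_is_cvgn sn sb.
have e2 : 0 < e / 2 by rewrite divr_gt0.
have [n0 _ hn0] := hL _ e2; exists n0.
have main m n : (n0 <= m)%N -> (n0 <= n)%N -> (m <= n)%N ->
    cmod (\sum_(i < n) a i * conjc (b i) - \sum_(i < m) a i * conjc (b i)) < e.
  move=> hm hn mn; have h1 := hn0 m hm; have h2 := hn0 n hn.
  have E (F : nat -> C) : \sum_(i < n) F i - \sum_(i < m) F i = \sum_(m <= i < n) F i.
    by rewrite -!(big_mkord xpredT F) (big_cat_nat (leq0n m) mn) /= [X in X - _]addrC addrK.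
  have E' (F : nat -> R) : \sum_(i < n) F i - \sum_(i < m) F i = \sum_(m <= i < n) F i.
    by rewrite -!(big_mkord xpredT F) (big_cat_nat (leq0n m) mn) /= [X in X - _]addrC addrK.
  rewrite (E (fun i => a i * conjc (b i))); apply: le_lt_trans (cmod_sum _ _ _) _.
  rewrite (eq_bigr (fun i => cmod (a i) * cmod (b i))); last by move=> i _; rewrite cmodM cmodJ.
  rewrite -(E' (fun i => cmod (a i) * cmod (b i))) -/(s n) -/(s m).
  move: h1 h2; rewrite !ltr_norml => /andP[h1 h1'] /andP[h2 h2']; lra.
move=> m n hm hn; have [mn|/ltnW nm] := leqP m n; last exact: main.
by rewrite cmodC; exact: main.
Qed.

(* The limit exists when [L2 a] and [L2 b]; otherwise [ipl a b] may be the junk value [0]. *)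
Definition ipl a b : C := xget 0 [set l | climC (fun n => \sum_(i < n) a i * conjc (b i)) l].

Definition L2 a := exists M, l2 a M.

Lemma iplP a b : L2 a -> L2 b -> climC (fun n => \sum_(i < n) a i * conjc (b i)) (ipl a b).
Proof.
by move=> [M ha] [N hb]; rewrite /ipl; case: xgetP => [l -> //|h]; have [l hl] := l2_ex ha hb; case: (h l).
Qed.

Lemma ipl_le a b M N : l2 a M -> l2 b N -> cmod (ipl a b) <= M * N.
Proof.
move=> ha hb; apply: climC_le (iplP (ex_intro _ M ha) (ex_intro _ N hb)); exists 0%N => n _.
apply: le_trans (cmod_sum _ _ _) _; apply: le_trans (l2_CS n ha hb).
by apply: ler_sum => i _; rewrite cmodM cmodJ.
Qed.

Lemma L2D a b : L2 a -> L2 b -> L2 (fun i => a i + b i).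
Proof. by move=> [M ha] [N hb]; exists (M + N); exact: l2D. Qed.

Lemma L2Z c a : L2 a -> L2 (fun i => c * a i).
Proof. by move=> [M ha]; exists (cmod c * M); exact: l2Z. Qed.

Lemma eq_climC (u v : nat -> C) l : u =1 v -> climC u l -> climC v l.
Proof. by move=> /funext ->. Qed.

Lemma iplDl a a' b : L2 a -> L2 a' -> L2 b -> ipl (fun i => a i + a' i) b = ipl a b + ipl a' b.
Proof.
move=> ha ha' hb; apply: (climC_uniq (iplP (L2D ha ha') hb)).
apply: eq_climC (climCD (iplP ha hb) (iplP ha' hb)) => n.
by rewrite -big_split /=; apply: eq_bigr => i _; rewrite mulrDl.
Qed.

Lemma iplZl c a b : L2 a -> L2 b -> ipl (fun i => c * a i) b = c * ipl a b.
Proof.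
move=> ha hb; apply: (climC_uniq (iplP (L2Z c ha) hb)).
apply: eq_climC (climCZ c (iplP ha hb)) => n.
by rewrite mulr_sumr; apply: eq_bigr => i _; rewrite mulrA.
Qed.

Lemma iplC a b : L2 a -> L2 b -> ipl b a = conjc (ipl a b).
Proof.
move=> ha hb; apply: (climC_uniq (iplP hb ha)) => e e0; have [N hN] := iplP ha hb e0.
exists N => n /hN; rewrite -[X in X < _ -> _]cmodJ rmorphB rmorph_sum /=.
congr (cmod (_ - _) < _); apply: eq_bigr => i _; by rewrite rmorphM /= conjcK mulrC.
Qed.

Lemma iplDr a b b' : L2 a -> L2 b -> L2 b' -> ipl a (fun i => b i + b' i) = ipl a b + ipl a b'.
Proof.
by move=> ha hb hb'; rewrite (iplC (L2D hb hb') ha) iplDl // rmorphD /= -!iplC.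
Qed.

Lemma iplZr c a b : L2 a -> L2 b -> ipl a (fun i => c * b i) = conjc c * ipl a b.
Proof. by move=> ha hb; rewrite (iplC (L2Z c hb) ha) iplZl // rmorphM /= -iplC. Qed.

Lemma ipl_self a : L2 a -> exists2 x : R, ipl a a = x%:C & forall i, cmod (a i) ^+ 2 <= x.
Proof.
move=> ha; have hl := iplP ha ha; have hc := iplC ha ha.
have e : ipl a a = (complex.Re (ipl a a))%:C.
  move: hc; case: (ipl a a) => x y [] hy; apply/eqP; rewrite eq_complex /= eqxx /=; apply/eqP; lra.
exists (complex.Re (ipl a a)) => // i; rewrite leNgt; apply/negP => hlt.
have d0 : 0 < cmod (a i) ^+ 2 - complex.Re (ipl a a) by rewrite subr_gt0.
have [N hN] := hl _ d0; have := hN (maxn N i.+1) (leq_maxl _ _); rewrite e.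
have -> : \sum_(k < maxn N i.+1) a k * conjc (a k) = (\sum_(k < maxn N i.+1) cmod (a k) ^+ 2)%:C.
  by rewrite rmorph_sum; apply: eq_bigr => k _; rewrite -cmod_sqr.
rewrite -rmorphB cmod_real /= ltNge => /negP; apply; apply: le_trans (ler_norm _); rewrite lerD2r.
have im : (i < maxn N i.+1)%N by rewrite leq_max ltnSn orbT.
by rewrite (bigD1 (Ordinal im)) //= lerDl sumr_ge0 // => k _; exact: sqr_ge0.
Qed.

(** A first-order expansion at 0 with a remainder [O(t^2)]; this quantitative form passes through
    products and quotients and yields the derivative. *)
Definition oexp (phi : R -> C) (p0 p1 : C) := exists2 K : R, 0 <= K & exists2 d : R, 0 < d &
  forall t : R, `|t| < d -> cmod (phi t - p0 - t%:C * p1) <= K * t ^+ 2.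

(** The same expansion in the l^2 norm, which is what termwise differentiation of the kernel series
    requires. *)
Definition sexp (x : R -> nat -> C) (x0 x1 : nat -> C) := exists2 K : R, 0 <= K & exists2 d : R, 0 < d &
  forall t : R, `|t| < d -> l2 (fun i => x t i - x0 i - t%:C * x1 i) (K * t ^+ 2).

(** The product rule for the sesquilinear form; Cauchy-Schwarz bounds the remainder terms. *)
Lemma ipl_sexp x x0 x1 y y0 y1 : L2 x0 -> L2 x1 -> L2 y0 -> L2 y1 -> sexp x x0 x1 -> sexp y y0 y1 ->
  oexp (fun t => ipl (x t) (y t)) (ipl x0 y0) (ipl x1 y0 + ipl x0 y1).
Proof.
move=> hx0 hx1 hy0 hy1 [K K0 [d d0 hx]] [K' K'0 [d' d'0 hy]].
have [M0 m0] := hx0; have [M1 m1] := hx1; have [N0 n0] := hy0; have [N1 n1] := hy1.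
have [M00 _] := m0; have [M10 _] := m1; have [N00 _] := n0; have [N10 _] := n1.
exists (M1 * N1 + K * (N0 + N1 + K') + (M0 + M1) * K').
  by rewrite !addr_ge0 ?mulr_ge0 ?addr_ge0.
exists (Num.min 1 (Num.min d d')); first by rewrite !lt_min ltr01 d0.
move=> t; rewrite !lt_min => /and3P[t1 /hx ht /hy ht'].
set r := (fun i : nat => _) in ht; set s := (fun i : nat => _) in ht'.
have hr : L2 r by exists (K * t ^+ 2). have hs : L2 s by exists (K' * t ^+ 2).
have t2 : t ^+ 2 <= 1 by rewrite -real_normK ?num_real // expr_le1 ?normr_ge0 // ltW.
have ct : cmod t%:C = `|t| by rewrite cmod_real.
have ly : l2 (y t) (N0 + N1 + K').
  have -> : y t = fun i => (y0 i + t%:C * y1 i) + s i by apply/funext => i; rewrite /s; ring.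
  apply: l2_le (l2D (l2D n0 (l2Z t%:C n1)) ht') _; rewrite ct.
  by apply: lerD; [rewrite lerD2l ler_piMl // ltW | rewrite ler_piMr].
have lx : l2 (fun i => x0 i + t%:C * x1 i) (M0 + M1).
  by apply: l2_le (l2D m0 (l2Z t%:C m1)) _; rewrite ct lerD2l ler_piMl // ltW.
have LX : L2 (fun i => x0 i + t%:C * x1 i) by exists (M0 + M1).
have LY : L2 (y t) by exists (N0 + N1 + K').
have Ex : x t = fun i => (x0 i + t%:C * x1 i) + r i by apply/funext => i; rewrite /r; ring.
have Ey : y t = fun i => (y0 i + t%:C * y1 i) + s i by apply/funext => i; rewrite /s; ring.
have zy1 := L2Z t%:C hy1; have zx1 := L2Z t%:C hx1.
have -> : ipl (x t) (y t) = ipl (fun i => x0 i + t%:C * x1 i) (fun i => y0 i + t%:C * y1 i) +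
   ipl (fun i => x0 i + t%:C * x1 i) s + ipl r (y t).
  by rewrite {1}Ex iplDl // {1}Ey iplDr //; exact: L2D.
have LY0 := L2D hy0 zy1.
have e1 z : L2 z -> ipl z (fun i => y0 i + t%:C * y1 i) = ipl z y0 + t%:C * ipl z y1.
  by move=> hz; rewrite (iplDr hz hy0 zy1) (iplZr _ hz hy1) conjc_real.
rewrite (iplDl hx0 zx1 LY0) (iplZl _ hx1 LY0) !e1 //.
rewrite [X in cmod X](_ : _ = (t ^+ 2)%:C * ipl x1 y1 + ipl r (y t) + ipl (fun i => x0 i + t%:C * x1 i) s); last first.
  by rewrite rmorphXn /=; ring.
rewrite !mulrDl; apply: le_trans (cmodD _ _) _; apply: lerD.
  apply: le_trans (cmodD _ _) _; apply: lerD.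
    by rewrite cmodM cmod_real ger0_norm ?sqr_ge0 // mulrC ler_wpM2r ?sqr_ge0 // ipl_le.
  by apply: le_trans (ipl_le ht ly) _; rewrite mulrAC.
apply: le_trans (ipl_le lx ht') _; by rewrite mulrA -!mulrDl.
Qed.

Lemma oexp0 phi p0 p1 : oexp phi p0 p1 -> phi 0 = p0.
Proof.
move=> [K K0 [d d0 h]]; have := h 0; rewrite normr0 => /(_ d0); rewrite expr0n mulr0 mul0r subr0 => h0.
by apply/eqP; rewrite -subr_eq0 -cmod_eq0 eq_le h0 cmod_ge0.
Qed.

Lemma is_derive_lip (f : R -> R) (l K d : R) : 0 <= K -> 0 < d ->
  (forall t, `|t| < d -> `|f t - f 0 - t * l| <= K * t ^+ 2) -> is_derive (0 : R) (1 : R) f l.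
Proof.
move=> K0 d0 h.
have L : (h^-1 *: ((f \o shift (0 : R)) (h *: (1 : R)) - f 0)) @[h --> (0 : R)^'] --> l.
  apply/cvgrPdist_lt => e e0; have K1 : 0 < K + 1 by rewrite ltr_wpDl.
  near=> t; have t0 : t != 0 by near: t; exact: nbhs_dnbhs_neq.
  have td : `|t| < Num.min d (e / (K + 1)).
    near: t; apply: dnbhs0_lt; by rewrite lt_min d0 divr_gt0.
  move: td; rewrite lt_min => /andP[td te]; rewrite /shift /= addr0.
  have -> : t *: (1 : R) = t by rewrite /GRing.scale /= mulr1.
  have -> : l - t^-1 *: (f t - f 0) = - (t^-1 * (f t - f 0 - t * l)).
    by rewrite /GRing.scale /= [in RHS]mulrBr mulKf // opprB.
  rewrite normrN normrM normfV mulrC ltr_pdivrMr ?normr_gt0 //.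
  apply: le_lt_trans (h t td) _; rewrite -real_normK ?num_real // expr2 mulrA ltr_pM2r ?normr_gt0 //.
  move: te; rewrite ltr_pdivlMr // => te; apply: le_lt_trans te.
  by rewrite mulrC ler_wpM2l ?normr_ge0 // lerDl.
by split; [exact: cvgP L | exact: cvg_lim L].
Unshelve. all: by end_near. Qed.

Lemma oexp_Re phi p0 p1 : oexp phi p0 p1 -> is_derive (0 : R) (1 : R) (fun t => complex.Re (phi t)) (complex.Re p1).
Proof.
move=> ho; have e := oexp0 ho; have [K K0 [d d0 h]] := ho; apply: (is_derive_lip K0 d0) => t /h; apply: le_trans.
by rewrite e -ReZ -!ReN -!ReD; exact: Re_le.
Qed.

Lemma oexp_Im phi p0 p1 : oexp phi p0 p1 -> is_derive (0 : R) (1 : R) (fun t => complex.Im (phi t)) (complex.Im p1).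
Proof.
move=> ho; have e := oexp0 ho; have [K K0 [d d0 h]] := ho; apply: (is_derive_lip K0 d0) => t /h; apply: le_trans.
apply: le_trans (Im_le _); rewrite e; case: (phi t) => a b; case: (p0) => a' b'; case: (p1) => a'' b'' /=.
by rewrite mul0r addr0.
Qed.

End L2Sequences.

(** * Local expansions *)

Section Derivatives.
Variable R : realType.
Local Notation C := R[i].
Implicit Types (z w : C2 R).
Local Notation e_ k := (delta_mx 0 k : C2 R).

Definition isd (F : C -> C) (l : C) := forall e : R, 0 < e -> exists2 r : R, 0 < r &
  forall x, cmod x < r -> cmod (F x - F 0 - l * x) <= e * cmod x.

Lemma isd_uniq F l l' : isd F l -> isd F l' -> l = l'.
Proof.
move=> h h'; apply/eqP; rewrite -subr_eq0 -cmod_eq0 eq_le cmod_ge0 andbT.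
apply/ler_addgt0Pr => e e0; rewrite add0r; have e2 : 0 < e / 2 by rewrite divr_gt0.
have [r r0 hr] := h _ e2; have [s s0 hs] := h' _ e2.
pose m := Num.min r s / 2; have m0 : 0 < m by rewrite divr_gt0 // lt_min r0.
have cm : cmod m%:C = m by rewrite cmod_real gtr0_norm.
have mlt : m < Num.min r s by rewrite /m ltr_pdivrMr // ltr_pMr ?lt_min ?r0 // ltr1n.
move: mlt; rewrite lt_min => /andP[m1 m2].
have := hr m%:C; have := hs m%:C; rewrite cm => /(_ m2) h2 /(_ m1) h1.
rewrite -(ler_pM2r m0) -[X in _ * X <= _]cm -cmodM.
have -> : (l - l') * m%:C = (F m%:C - F 0 - l' * m%:C) - (F m%:C - F 0 - l * m%:C) by ring.
by apply: le_trans (cmodB _ _) _; rewrite [e]splitr mulrDl lerD.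
Qed.

Lemma isd_local F G l (d : R) : 0 < d -> (forall x, cmod x < d -> F x = G x) -> isd F l -> isd G l.
Proof.
move=> d0 FG h e e0; have [r r0 hr] := h e e0; exists (Num.min r d); first by rewrite lt_min r0.
move=> x; rewrite lt_min => /andP[xr xd]; rewrite -!FG ?cmod0 //; exact: hr.
Qed.

Lemma isd_lin n (c : nat -> C) (F : nat -> C -> C) (l : nat -> C) : (forall i, isd (F i) (l i)) ->
  isd (fun x => \sum_(i < n) c i * F i x) (\sum_(i < n) c i * l i).
Proof.
move=> h; elim: n => [|n IH].
  by rewrite big_ord0; under eq_fun do rewrite big_ord0; move=> e e0; exists 1 => // x _;
    rewrite mul0r !subr0 cmod0 mulr_ge0 ?cmod_ge0 // ltW.
rewrite big_ord_recr /=; under eq_fun do rewrite big_ord_recr /=.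
move=> e e0; have e2 : 0 < e / 2 by rewrite divr_gt0.
have c1 : 0 < cmod (c n) + 1 by rewrite ltr_wpDl ?cmod_ge0.
have [r r0 hr] := IH _ e2; have [s s0 hs] := h n _ (divr_gt0 e2 c1).
exists (Num.min r s); first by rewrite lt_min r0.
move=> x; rewrite lt_min => /andP[/hr h1 /hs h2].
set A := \sum_(i < n) c i * F i x in h1 *; set A0 := \sum_(i < n) c i * F i 0 in h1 *; set L := \sum_(i < n) c i * l i in h1 *.
have -> : A + c n * F n x - (A0 + c n * F n 0) - (L + c n * l n) * x = (A - A0 - L * x) + c n * (F n x - F n 0 - l n * x) by ring.
apply: le_trans (cmodD _ _) _; rewrite [e]splitr mulrDl lerD // cmodM.
apply: (@le_trans _ _ (cmod (c n) * (e / 2 / (cmod (c n) + 1) * cmod x))); first by rewrite ler_wpM2l ?cmod_ge0.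
have -> : cmod (c n) * (e / 2 / (cmod (c n) + 1) * cmod x) = e / 2 * cmod x * (cmod (c n) / (cmod (c n) + 1)) by ring.
apply: ler_piMr; first exact: mulr_ge0 (ltW e2) (cmod_ge0 x).
by rewrite ler_pdivrMr // mul1r lerDl.
Qed.

(** Chosen with default 0 where no derivative exists, so [pd] is total and can be iterated; [isd_pd]
    gives its value from a proven derivative. *)
Definition pd (k : 'I_2) (f : C2 R -> C) w : C := xget 0 [set l | isd (fun x => f (w + x *: e_ k)) l].

Lemma isd_pd k f w l : isd (fun x => f (w + x *: e_ k)) l -> pd k f w = l.
Proof. by move=> h; rewrite /pd; case: xgetP => [l' -> h'|/(_ l)] //; exact: isd_uniq h' h. Qed.

Lemma pser0 c (r M : R) g : pser c r M g -> 0 < r -> g 0 = c 0%N.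
Proof.
move=> hp r0; apply: (climC_uniq (hp.2 0 _)); first by rewrite cmod0.
move=> d d0; exists 1%N => -[//|n] _; rewrite big_ord_recl big1 ?addr0 ?expr0 ?mulr1 ?subrr ?cmod0 //.
by move=> i _; rewrite expr0n mulr0.
Qed.

Lemma pser_rem c (r M : R) g x : pser c r M g -> 0 < r -> 0 <= M -> cmod x <= r / 2 ->
  cmod (g x - g 0 - c 1%N * x) <= 2 * M / r ^+ 2 * cmod x ^+ 2.
Proof.
move=> hp r0 M0 xr; have xr' : cmod x < r by lra.
have := pser_tail 2 hp r0 (lexx (cmod x)) xr'; rewrite !big_ord_recl big_ord0 /= addr0 expr0 expr1 mulr1 -(pser0 hp r0) opprD addrA.
move=> /le_trans; apply; rewrite expr_div_n.
have q : cmod x / r <= 1 / 2 by rewrite ler_pdivrMr //; lra.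
have -> : 2 * M / r ^+ 2 * cmod x ^+ 2 = M * (2 * (cmod x ^+ 2 / r ^+ 2)) by ring.
rewrite ler_wpM2l // ler_pdivrMr; last by lra.
have y0 : 0 <= cmod x ^+ 2 / r ^+ 2 by rewrite divr_ge0 ?sqr_ge0.
move: (cmod x / r) (cmod x ^+ 2 / r ^+ 2) q y0 => u y; nra.
Qed.

Lemma isd_of_rem (F : C -> C) (l : C) (K d : R) : 0 <= K -> 0 < d ->
  (forall x, cmod x <= d -> cmod (F x - F 0 - l * x) <= K * cmod x ^+ 2) -> isd F l.
Proof.
move=> K0 d0 h e e0; have K1 : 0 < K + 1 by rewrite ltr_wpDl.
exists (Num.min d (e / (K + 1))); first by rewrite lt_min d0 divr_gt0.
move=> x; rewrite lt_min => /andP[/ltW xd]; rewrite ltr_pdivlMr // => xe.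
apply: le_trans (h x xd) _; rewrite expr2 mulrA ler_wpM2r ?cmod_ge0 // mulrC.
by apply: le_trans (ltW xe); rewrite ler_wpM2l ?cmod_ge0 // lerDl.
Qed.

Lemma pser_avgM (c : C -> nat -> C) (r M : R) (F : C -> C -> C) n : 0 < r -> 0 <= M ->
  (forall u, cmod u = 1 -> pser (c u) r M (F u)) ->
  pser (fun k => avg n (fun u => c u k * conjc u)) r M (fun x => avg n (fun u => F u x * conjc u)).
Proof.
move=> r0 M0 h; split=> [k|x xr].
  have -> : r ^+ k = cmod ((r ^+ k)%:C : C) by rewrite cmod_real ger0_norm // exprn_ge0 // ltW.
  rewrite -cmodM mulrC -avgZ; apply: avg_le => // u u1.
  rewrite !cmodM cmodJ u1 mulr1 cmod_real ger0_norm ?exprn_ge0 ?(ltW r0) // mulrC; exact: (h u u1).1.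
have -> : (fun m => \sum_(k < m) avg n (fun u => c u k * conjc u) * x ^+ k) =
   (fun m => n%:R^-1 * \sum_(j < n) (\sum_(k < m) c (om R n ^+ j) k * x ^+ k) * conjc (om R n ^+ j)).
  apply/funext => m; rewrite /avg; under eq_bigr do rewrite -mulrA; rewrite -mulr_sumr; congr (_ * _).
  under eq_bigr do rewrite mulr_suml; rewrite exchange_big; apply: eq_bigr => j _.
  by rewrite mulr_suml; apply: eq_bigr => k _; rewrite mulrAC.
apply: climCZ; apply: (@climC_sum _ n (fun j m => (\sum_(k < m) c (om R n ^+ j) k * x ^+ k) * conjc (om R n ^+ j))
  (fun j => F (om R n ^+ j) x * conjc (om R n ^+ j))) => j _.
by apply: climCZr; exact: (h _ (cmod_omX R n j)).2.
Qed.

Lemma cn_ek (x : C) k : cn (x *: e_ k) = cmod x.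
Proof.
rewrite cnZ (_ : cn (e_ k) = 1) ?mulr1 //; rewrite /cn !mxE /=.
by move: k; apply: ord2P; rewrite /= cmod0 cmod1 ?(max_l ler01) ?(max_r ler01).
Qed.

Variable D : set (C2 R).
Hypothesis oD : open D.

Lemma line_pser f z (M : R) k (r r' : R) : hol D f -> 0 < r -> r < r' ->
  (forall x, cmod x < r' -> D (z + x *: e_ k)) ->
  (forall x, cmod x < r' -> cmod (f (z + x *: e_ k)) <= M) ->
  exists c, pser c r M (fun x => f (z + x *: e_ k)).
Proof.
move=> hf r0 rr' hD hM; have [|c hc] := @taylor R (fun x => f (z + x *: e_ k)) r' (lt_trans r0 rr').
  by move=> x xr; apply: cdiff2_line; apply/differentiableC2P; apply: hf; exact: hD.
by exists c; apply: hc => // u u1; apply: hM; rewrite cmod_circ // ltW.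
Qed.

Lemma local_expansion z : D z -> exists2 r : R, 0 < r & exists2 A : R, 0 <= A &
  (forall w, cn (w - z) < r -> D w) /\
  forall f S, HH D f -> 0 < S -> nr D f <= S -> forall (j k : 'I_2),
  [/\ cmod (f z) <= A * Num.sqrt S,
      isd (fun x => f (z + x *: e_ j)) (pd j f z) /\ cmod (pd j f z) <= A * Num.sqrt S,
      isd (fun x => pd k f (z + x *: e_ j)) (pd j (pd k f) z) /\ cmod (pd j (pd k f) z) <= A * Num.sqrt S,
      forall x, cmod x < r -> cmod (f (z + x *: e_ j) - f z - x * pd j f z) <= A * cmod x ^+ 2 * Num.sqrt S &
      forall x, cmod x < r -> cmod (pd k f (z + x *: e_ j) - pd k f z - x * pd j (pd k f) z) <= A * cmod x ^+ 2 * Num.sqrt S].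
Proof.
move=> Dz; have [rho rho0 [B B0 [hD hB]]] := unif_bound oD Dz.
(* A displacement [r] in direction [j] followed by a Taylor disc of radius up to [3 r] in direction
   [k] stays within [rho]. *)
pose r := rho / 4; have r0 : 0 < r by rewrite divr_gt0.
have rrho : 4 * r = rho by rewrite /r; lra.
pose b := Num.sqrt B; have b0 : 0 <= b by exact: sqrtr_ge0.
(* The sum of the constants of the five estimates, so that each of them is below [A]. *)
pose A := b + b / r + 2 * b / r ^+ 2 + b / r ^+ 2 + 2 * b / r ^+ 3.
have q1 : 0 <= b / r by rewrite divr_ge0 // ltW.
have q2 : 0 <= b / r ^+ 2 by rewrite divr_ge0 ?exprn_ge0 // ltW.
have q3 : 0 <= 2 * b / r ^+ 2 by rewrite divr_ge0 ?exprn_ge0 ?mulr_ge0 // ltW.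
have q4 : 0 <= 2 * b / r ^+ 3 by rewrite divr_ge0 ?exprn_ge0 ?mulr_ge0 // ltW.
have A0 : 0 <= A by rewrite !addr_ge0.
exists (r / 2); first by rewrite divr_gt0.
exists A => //; split=> [w wr|f S hf S0 fS j k]; first by apply: hD; lra.
set s := Num.sqrt S; have s0 : 0 <= s by exact: sqrtr_ge0.
pose M := b * s; have M0 : 0 <= M by rewrite mulr_ge0.
have fM w : cn (w - z) < rho -> cmod (f w) <= M.
  move=> wr; have := hB f S w hf.1 _ wr; rewrite (nrE hf) lee_fin => /(_ fS) h.
  rewrite -(@ler_pXn2r _ 2) ?nnegrE ?cmod_ge0 // /M exprMn !sqr_sqrtr // ltW //.
have p1 w i x : cn (w - z) + cmod x < rho -> cn (w + x *: e_ i - z) < rho.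
  move=> h; have -> : w + x *: e_ i - z = (w - z) + x *: e_ i by rewrite addrAC.
  by apply: le_lt_trans (cnD _ _) _; rewrite cn_ek.
have ps w i : cn (w - z) <= r -> exists c, pser c (2 * r) M (fun x => f (w + x *: e_ i)).
  move=> wr; apply: (@line_pser f w M i (2 * r) (3 * r) hf.1); try lra.
  - by move=> x xr; apply: hD; apply: p1; lra.
  - by move=> x xr; apply: fM; apply: p1; lra.
have ps1 w i : cn (w - z) <= r -> exists c, pser c r M (fun x => f (w + x *: e_ i)).
  move=> wr; apply: (@line_pser f w M i r (2 * r) hf.1); try lra.
  - by move=> x xr; apply: hD; apply: p1; lra.
  - by move=> x xr; apply: fM; apply: p1; lra.
have pdE w i c : 0 <= M -> pser c r M (fun x => f (w + x *: e_ i)) -> isd (fun x => f (w + x *: e_ i)) (c 1%N).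
  move=> _ hp; apply: (@isd_of_rem _ _ (2 * M / r ^+ 2) (r / 2)).
  - by rewrite divr_ge0 ?exprn_ge0 ?mulr_ge0 // ltW.
  - by rewrite divr_gt0.
  by move=> x xr; exact: (pser_rem hp r0 M0 xr).
have zz : cn (z - z) <= r by rewrite subrr cn_0 ltW.
have [c hc] := ps1 z j zz; have hj := pdE z j c M0 hc; have ej := isd_pd hj.
(* Along direction [j], [r * pd k f] is the limit of Cauchy means over circles in direction [k];
   each mean is a power series in [x] bounded by [M], and [pser_lim] passes to the limit. *)
have [c' hc'] : exists c', pser c' r M (fun x => r%:C * pd k f (z + x *: e_ j)).
  have /choice [cu hcu] : forall u : C, exists c, cmod u = 1 -> pser c r M (fun x => f (z + x *: e_ j + (r%:C * u) *: e_ k)).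
    move=> u; have [u1|u1] := pselect (cmod u = 1); last by exists (fun=> 0).
    have [|c0 hc0] := ps1 (z + (r%:C * u) *: e_ k) j.
      by rewrite addrC addKr cn_ek cmod_circ // ltW.
    by exists c0 => _; under eq_fun do rewrite addrAC.
  apply: (pser_lim r0 (fun N => pser_avgM (2 ^ N) r0 M0 hcu)) => x xr.
  have xw : cn (z + x *: e_ j - z) <= r by rewrite addrC addKr cn_ek ltW.
  have [c2 hc2] := ps _ k xw.
  have r2 : 0 < 2 * r by rewrite mulr_gt0.
  have rr2 : r < 2 * r by lra.
  have := climC_exp (pser_avg_lim 1 hc2 r2 (ltW r0) rr2).
  have [c3 hc3] := ps1 _ k xw.
  have i2 : isd (fun y => f (z + x *: e_ j + y *: e_ k)) (c2 1%N).
    apply: (@isd_of_rem _ _ (2 * M / (2 * r) ^+ 2) r) => //.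
      by rewrite divr_ge0 ?exprn_ge0 ?mulr_ge0 // ltW.
    by move=> y yr; apply: (pser_rem hc2 r2 M0); lra.
  rewrite (isd_pd i2) expr1 mulrC; apply: eq_climC => N; apply: eq_avg => u _; by rewrite expr1.
have rc : r%:C != 0 :> C by exact: real_complex_neq0.
have rem2 x : cmod x <= r / 2 -> cmod (pd k f (z + x *: e_ j) - pd k f (z + 0 *: e_ j) - c' 1%N / r%:C * x) <= 2 * b / r ^+ 3 * s * cmod x ^+ 2.
  move=> xr; have := pser_rem hc' r0 M0 xr.
  set p := pd k f (z + x *: e_ j); set p0 := pd k f (z + 0 *: e_ j).
  have -> : r%:C * p - r%:C * p0 - c' 1%N * x = r%:C * (p - p0 - c' 1%N / r%:C * x) by field.
  rewrite cmodM cmod_real gtr0_norm // mulrC -ler_pdivlMr //; congr (_ <= _); rewrite /M.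
  by field; rewrite gt_eqF.
have i3 : isd (fun x => pd k f (z + x *: e_ j)) (c' 1%N / r%:C).
  apply: (@isd_of_rem _ _ (2 * b / r ^+ 3 * s) (r / 2)) => //; first by rewrite mulr_ge0.
  by rewrite divr_gt0.
have e3 := isd_pd i3.
have As t : t <= A -> t * s <= A * s by move=> h; rewrite ler_wpM2r.
have z0 i : z + 0 *: e_ i = z by rewrite scale0r addr0.
split.
- apply: (le_trans (fM z _)); first by rewrite subrr cn_0.
  by apply: As; rewrite /A; lra.
- split; first by rewrite ej.
  rewrite ej; have := hc.1 1%N; rewrite expr1 -ler_pdivlMr // => /le_trans; apply.
  by rewrite /M mulrAC; apply: As; rewrite /A; lra.
- split; first by rewrite e3.
  rewrite e3 cmodM cmodV cmod_real gtr0_norm //; have := hc'.1 1%N; rewrite expr1 -ler_pdivlMr // => h.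
  have : cmod (c' 1%N) / r <= M / r / r by rewrite ler_pM2r ?invr_gt0.
  move/le_trans; apply; have -> : M / r / r = b / r ^+ 2 * s by rewrite /M; field; rewrite gt_eqF.
  by apply: As; rewrite /A; lra.
- move=> x xr; have := pser_rem hc r0 M0 (ltW xr); rewrite z0 ej mulrC => /le_trans; apply.
  have -> : 2 * M / r ^+ 2 * cmod x ^+ 2 = 2 * b / r ^+ 2 * (cmod x ^+ 2 * s) by rewrite /M; ring.
  rewrite -[leRHS]mulrA; apply: ler_wpM2r; first exact: mulr_ge0 (sqr_ge0 _) s0.
  rewrite /A; lra.
move=> x xr; have := rem2 x (ltW xr); rewrite z0 e3 mulrC => /le_trans; apply.
have -> : 2 * b / r ^+ 3 * s * cmod x ^+ 2 = 2 * b / r ^+ 3 * (cmod x ^+ 2 * s) by ring.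
rewrite -[leRHS]mulrA; apply: ler_wpM2r; first exact: mulr_ge0 (sqr_ge0 _) s0.
  rewrite /A; lra.
Qed.

End Derivatives.

(** * The kernel as a series *)

Section KernelSeries.
Variable R : realType.
Local Notation C := R[i].
Local Notation e_ k := (delta_mx 0 k : C2 R).
Variable D : set (C2 R).
Hypothesis oD : open D.
Variable g : nat -> C2 R -> C.
Hypothesis hg : forall n, HH D (g n).
Implicit Types (z w : C2 R).

Local Notation q := (gs D g).
Definition aq z (i : nat) : C := q i z.
Definition dq (k : 'I_2) z (i : nat) : C := pd k (q i) z.
Definition ddq (j k : 'I_2) z (i : nat) : C := pd j (pd k (q i)) z.

Let qH i : HH D (q i) := gs_HH oD hg i.

Let qn i : nr D (q i) <= 1.
Proof. by have /andP[] := nr_gs01 oD hg i. Qed.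

(** Bessel's inequality for a functional of norm [A], used for evaluations, for derivatives and for
    the remainders of expansions. *)
Lemma l2_T (T : (C2 R -> C) -> C) (A : R) : 0 <= A ->
  (forall n (c : nat -> C), T (fun z => \sum_(i < n) c i * q i z) = \sum_(i < n) c i * T (q i)) ->
  (forall f S, HH D f -> 0 < S -> nr D f <= S -> cmod (T f) <= A * Num.sqrt S) ->
  l2 (fun i => T (q i)) A.
Proof.
move=> A0 TE Tb; split=> // n; apply: (bessel oD hg (sqr_ge0 A) (TE n (fun i => conjc (T (q i))))) => f S hf S0 fS.
rewrite -[X in _ * X]sqr_sqrtr ?(ltW S0) // -exprMn lerXn2r ?nnegrE ?cmod_ge0 ?mulr_ge0 ?sqrtr_ge0 //; exact: Tb.
Qed.

Lemma isd_q z j i : D z -> isd (fun x => q i (z + x *: e_ j)) (dq j z i).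
Proof. by move=> /(local_expansion oD) [r r0 [A A0 [_ h]]]; have [_ [] ] := h _ 1 (qH i) ltr01 (qn i) j j. Qed.

Lemma isd_dq z j k i : D z -> isd (fun x => pd k (q i) (z + x *: e_ j)) (ddq j k z i).
Proof. by move=> /(local_expansion oD) [r r0 [A A0 [_ h]]]; have [_ _ [] ] := h _ 1 (qH i) ltr01 (qn i) j k. Qed.

Lemma pd_comb n (c : nat -> C) z k : D z -> pd k (fun z => \sum_(i < n) c i * q i z) z = \sum_(i < n) c i * dq k z i.
Proof. by move=> Dz; apply: isd_pd; exact: (isd_lin n c (fun i => isd_q k i Dz)). Qed.

Lemma pdd_comb n (c : nat -> C) z j k : D z ->
  pd j (pd k (fun z => \sum_(i < n) c i * q i z)) z = \sum_(i < n) c i * ddq j k z i.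
Proof.
move=> Dz; apply: isd_pd; have [r r0 hr] := open_polydisc oD Dz.
apply: (isd_local r0 _ (isd_lin n c (fun i => isd_dq j k i Dz))) => x xr.
by rewrite pd_comb //; apply: hr; rewrite addrC addKr cn_ek.
Qed.

Lemma lineE z (t : R) (u : C) j : z + t%:C *: (u *: e_ j) = z + (t%:C * u) *: e_ j.
Proof. by rewrite scalerA. Qed.

Lemma aq_L2 z : D z -> L2 (aq z).
Proof.
move=> /(local_expansion oD) [r r0 [A A0 [_ h]]]; exists A.
by apply: (@l2_T (fun f => f z)) => // f S hf S0 fS; have [] := h f S hf S0 fS 0 0.
Qed.

Lemma dq_L2 z k : D z -> L2 (dq k z).
Proof.
move=> Dz; have [r r0 [A A0 [_ h]]] := local_expansion oD Dz; exists A.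
apply: (@l2_T (fun f => pd k f z)) => // [n c|f S hf S0 fS]; first exact: pd_comb.
by have [_ []] := h f S hf S0 fS k k.
Qed.

Lemma ddq_L2 z j k : D z -> L2 (ddq j k z).
Proof.
move=> Dz; have [r r0 [A A0 [_ h]]] := local_expansion oD Dz; exists A.
apply: (@l2_T (fun f => pd j (pd k f) z)) => // [n c|f S hf S0 fS]; first exact: pdd_comb.
by have [_ _ []] := h f S hf S0 fS j k.
Qed.

(** The first-order remainder is itself a functional of norm at most [A t^2], so [l2_T] bounds its
    values on the orthonormal system in l^2. *)
Lemma aq_sexp z (u : C) j : D z -> cmod u = 1 ->
  sexp (fun t => aq (z + t%:C *: (u *: e_ j))) (aq z) (fun i => u * dq j z i).
Proof.
move=> Dz u1; have [r r0 [A A0 [hD h]]] := local_expansion oD Dz; exists A => //; exists r => // t tr.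
have xr : cmod (t%:C * u) = `|t| by rewrite cmodM u1 mulr1 cmod_real.
have t2 : t ^+ 2 = cmod (t%:C * u) ^+ 2 by rewrite xr real_normK ?num_real.
have -> : (fun i => aq (z + t%:C *: (u *: e_ j)) i - aq z i - t%:C * (u * dq j z i)) =
   (fun i => q i (z + (t%:C * u) *: e_ j) - q i z - (t%:C * u) * pd j (q i) z).
  by apply/funext => i; rewrite /aq lineE mulrA.
rewrite t2; apply: (@l2_T (fun f => f (z + (t%:C * u) *: e_ j) - f z - (t%:C * u) * pd j f z)).
- by rewrite mulr_ge0 ?sqr_ge0.
- move=> n c; rewrite pd_comb // mulr_sumr -!sumrB; apply: eq_bigr => i _; rewrite /dq; ring.
by move=> f S hf S0 fS; have [_ _ _ hh _] := h f S hf S0 fS j j; apply: hh; rewrite xr.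
Qed.

Lemma dq_sexp z (u : C) j k : D z -> cmod u = 1 ->
  sexp (fun t => dq k (z + t%:C *: (u *: e_ j))) (dq k z) (fun i => u * ddq j k z i).
Proof.
move=> Dz u1; have [r r0 [A A0 [hD h]]] := local_expansion oD Dz; exists A => //; exists r => // t tr.
have xr : cmod (t%:C * u) = `|t| by rewrite cmodM u1 mulr1 cmod_real.
have t2 : t ^+ 2 = cmod (t%:C * u) ^+ 2 by rewrite xr real_normK ?num_real.
have Dw : D (z + (t%:C * u) *: e_ j) by apply: hD; rewrite addrC addKr cn_ek xr.
have -> : (fun i => dq k (z + t%:C *: (u *: e_ j)) i - dq k z i - t%:C * (u * ddq j k z i)) =
   (fun i => pd k (q i) (z + (t%:C * u) *: e_ j) - pd k (q i) z - (t%:C * u) * pd j (pd k (q i)) z).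
  by apply/funext => i; rewrite /dq lineE mulrA.
rewrite t2; apply: (@l2_T (fun f => pd k f (z + (t%:C * u) *: e_ j) - pd k f z - (t%:C * u) * pd j (pd k f) z)).
- by rewrite mulr_ge0 ?sqr_ge0.
- move=> n c; rewrite pdd_comb // !pd_comb // mulr_sumr -!sumrB; apply: eq_bigr => i _; rewrite /dq /ddq; ring.
by move=> f S hf S0 fS; have [_ _ _ _ hh] := h f S hf S0 fS j k; apply: hh; rewrite xr.
Qed.

(** The one-variable Taylor estimate on the complex line through [z] and [w], with [v] the unit
    vector from [z] towards [w]. *)
Lemma local_lip z : D z -> exists2 r : R, 0 < r & exists2 A : R, 0 <= A &
  forall f S w, HH D f -> 0 < S -> nr D f <= S -> cn (w - z) < r ->
    D w /\ cmod (f w - f z) <= A * cn (w - z) * Num.sqrt S.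
Proof.
move=> Dz; have [rho rho0 [B B0 [hD hB]]] := unif_bound oD Dz.
pose r := rho / 2; have r0 : 0 < r by rewrite divr_gt0.
have r2 : r < rho by rewrite /r; lra.
exists (r / 2); first by rewrite divr_gt0.
exists (2 * Num.sqrt B / r); first by rewrite divr_ge0 ?mulr_ge0 ?sqrtr_ge0 // ltW.
move=> f S w hf S0 fS wr; have Dw : D w by apply: hD; lra.
split=> //; have [->|wz] := eqVneq w z; first by rewrite !subrr cmod0 cn_0 mulr0 mul0r.
have c0 : 0 < cn (w - z) by rewrite cn_gt0 subr_eq0.
pose v := (cn (w - z))^-1%:C *: (w - z).
have v1 : cn v = 1 by rewrite /v cnZ cmod_real ger0_norm ?invr_ge0 ?(ltW c0) // mulVf // gt_eqF.
pose M := Num.sqrt B * Num.sqrt S; have M0 : 0 <= M by rewrite mulr_ge0 ?sqrtr_ge0.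
have zv x : cmod x < rho -> cn (z + x *: v - z) < rho by rewrite addrC addKr cnZ v1 mulr1.
have [|c hc] := @taylor R (fun x => f (z + x *: v)) rho rho0.
  by move=> x xr; apply: cdiff2_line; apply/differentiableC2P; apply: hf.1; apply: hD; exact: zv.
have hp : pser c r M (fun x => f (z + x *: v)).
  apply: hc => // u u1; have ru : cmod (r%:C * u) < rho by rewrite cmod_circ // ltW.
  have := hB f S _ hf.1 _ (zv _ ru); rewrite (nrE hf) lee_fin => /(_ fS) h.
  by rewrite -(@ler_pXn2r _ 2) ?nnegrE ?cmod_ge0 // /M exprMn !sqr_sqrtr // ltW.
have xr : cmod (cn (w - z))%:C < r by rewrite cmod_real gtr0_norm //; lra.
have := pser_tail 1 hp r0 (lexx _) xr; rewrite big_ord1 expr0 mulr1 -(pser0 hp r0) expr1 scale0r addr0.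
have zw : z + (cn (w - z))%:C *: v = w.
  by rewrite /v scalerA -rmorphM mulfV ?gt_eqF // scale1r [z + _]addrC subrK.
rewrite zw cmod_real gtr0_norm // => /le_trans; apply.
have -> : 2 * Num.sqrt B / r * cn (w - z) * Num.sqrt S = M * (2 * (cn (w - z) / r)) by rewrite /M; ring.
rewrite ler_wpM2l //.
have qq : cn (w - z) / r <= 1 / 2 by rewrite ler_pdivrMr //; lra.
have q0 : 0 <= cn (w - z) / r by rewrite divr_ge0 // ltW.
rewrite ler_pdivrMr; last by lra.
move: (cn (w - z) / r) qq q0 => y; nra.
Qed.

Definition kq z : R := complex.Re (ipl (aq z) (aq z)).

Lemma kqE z : D z -> ipl (aq z) (aq z) = (kq z)%:C.
Proof. by move=> Dz; have [x e _] := ipl_self (aq_L2 Dz); rewrite /kq e. Qed.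

Lemma partial_kq z n : D z -> \sum_(i < n) cmod (q i z) ^+ 2 <= kq z.
Proof.
move=> Dz; rewrite leNgt; apply/negP => hlt.
have d0 : 0 < \sum_(i < n) cmod (q i z) ^+ 2 - kq z by rewrite subr_gt0.
have [N hN] := iplP (aq_L2 Dz) (aq_L2 Dz) d0; have := hN (maxn N n) (leq_maxl _ _); rewrite kqE //.
have -> : \sum_(k < maxn N n) aq z k * conjc (aq z k) = (\sum_(k < maxn N n) cmod (q k z) ^+ 2)%:C.
  by rewrite rmorph_sum; apply: eq_bigr => k _; rewrite -cmod_sqr.
rewrite -rmorphB cmod_real /= ltNge => /negP; apply; apply: le_trans (ler_norm _); rewrite lerD2r.
rewrite -!(big_mkord xpredT (fun i => cmod (q i z) ^+ 2)) (big_cat_nat (leq0n n) (leq_maxr N n)) /= lerDl.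
by apply: sumr_ge0 => k _; exact: sqr_ge0.
Qed.

Lemma kq_le z x : D z -> (forall n, \sum_(i < n) cmod (q i z) ^+ 2 <= x) -> kq z <= x.
Proof.
move=> Dz h; apply/ler_addgt0Pr => e e0.
have [N hN] := iplP (aq_L2 Dz) (aq_L2 Dz) e0; have := hN N (leqnn _); rewrite kqE //.
have -> : \sum_(k < N) aq z k * conjc (aq z k) = (\sum_(k < N) cmod (q k z) ^+ 2)%:C.
  by rewrite rmorph_sum; apply: eq_bigr => k _; rewrite -cmod_sqr.
rewrite -rmorphB cmod_real ltr_norml => /andP[h1 _]; have := h N; lra.
Qed.

Lemma kq_kernel z : D z -> kq z <= bergman_kernel D z.
Proof.
move=> Dz; apply: kq_le => // n.
have K0 : 0 <= bergman_kernel D z.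
  by apply: le_trans (kernel_ge oD Dz (unitH0 oD)); exact: sqr_ge0.
apply: (@bessel _ _ oD g hg (fun f => f z)) => // f S hf S0 fS.
have s0 : 0 < Num.sqrt S by rewrite sqrtr_gt0.
have u : unitH D (fun z => (Num.sqrt S)^-1%:C * f z).
  have hh := HHZ oD (Num.sqrt S)^-1%:C hf; split; first exact: hh.1.
  rewrite (nrE hh) nrZ // lee_fin cmod_real ger0_norm ?invr_ge0 ?(ltW s0) // exprVn sqr_sqrtr ?(ltW S0) //.
  by rewrite mulrC ler_pdivrMr // mul1r.
have := kernel_ge oD Dz u; rewrite cmodM cmod_real ger0_norm ?invr_ge0 ?(ltW s0) // exprMn exprVn sqr_sqrtr ?(ltW S0) //.
by rewrite mulrC ler_pdivrMr.
Qed.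

Hypothesis extremal : forall z (e r : R), D z -> 0 < e -> 0 < r -> exists n w,
  [/\ cn (w - z) < r, D w, nr D (g n) <= 1 & bergman_kernel D w - e <= cmod (g n w) ^+ 2].

(** The family is nearly extremal only at points [w] near [z]. There the kernel is at most
    [kq w + e/2]; both [kq] and [|f|^2] change by [O(cn (w - z))], which carries the comparison to
    [z]. *)
Lemma kernel_kq z : D z -> bergman_kernel D z = kq z.
Proof.
move=> Dz; apply/eqP; rewrite eq_le kq_kernel // andbT; apply: kernel_le => // f fD.
have hf : HH D f by split; [exact: fD.1 | exact: le_lt_trans fD.2 (ltry 1)].
have f1 : nr D f <= 1 by rewrite -lee_fin -(nrE hf); exact: fD.2.
have [r r0 [A A0 hl]] := local_lip Dz.
have [N0 hN0] := aq_L2 Dz; have [N00 _] := hN0.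
apply/ler_addgt0Pr => e e0.
have fz0 := cmod_ge0 (f z).
(* The Lipschitz constants at [z] of [kq] and of [|f|^2]; half of [e] goes to their error and half
   to near extremality. *)
pose Q := A * (N0 + A + N0) + A * (2 * cmod (f z) + A); have Q0 : 0 <= Q by rewrite addr_ge0 // mulr_ge0 ?addr_ge0 ?mulr_ge0.
have Q1 : 0 < Q + 1 by rewrite ltr_wpDl.
have e2 : 0 < e / 2 by rewrite divr_gt0.
have rr : 0 < Num.min 1 (Num.min r (e / 2 / (Q + 1))) by rewrite !lt_min ltr01 r0 divr_gt0.
have [n [w [wz Dw gn gw]]] := extremal Dz e2 rr.
move: wz; rewrite !lt_min => /and3P[w1 w2 w3].
set d := cn (w - z) in w1 w2 w3; have d0 : 0 <= d := cn_ge0 _.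
have kw : bergman_kernel D w - e / 2 <= kq w.
  apply: le_trans gw _; apply: le_trans (gs_le oD hg n Dw) _.
  apply: le_trans (partial_kq n.+1 Dw); rewrite ler_piMl // sumr_ge0 // => i _; exact: sqr_ge0.
have dl : l2 (fun i => q i w - q i z) (A * d).
  apply: (@l2_T (fun f => f w - f z)); first by rewrite mulr_ge0.
    by move=> m c; rewrite -sumrB; apply: eq_bigr => i _; rewrite mulrBr.
  by move=> h S hh S0 hS; exact: (hl h S w hh S0 hS w2).2.
have Ld : L2 (fun i => q i w - q i z) by exists (A * d).
have Ew : aq w = fun i => aq z i + (q i w - q i z) by apply/funext => i; rewrite /aq; ring.
have lw : l2 (aq w) (N0 + A).
  by rewrite Ew; apply: l2_le (l2D hN0 dl) _; rewrite lerD2l ler_piMr // ltW.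
have kd : kq w <= kq z + d * (A * (N0 + A + N0)).
  have E : ipl (aq w) (aq w) - ipl (aq z) (aq z) = ipl (fun i => q i w - q i z) (aq w) + ipl (aq z) (fun i => q i w - q i z).
    rewrite {1}Ew (iplDl (aq_L2 Dz) Ld (aq_L2 Dw)) {1}Ew (iplDr (aq_L2 Dz) (aq_L2 Dz) Ld); ring.
  have := congr1 (@cmod R) E; rewrite !kqE // -rmorphB cmod_real => E1.
  have h2 : `|kq w - kq z| <= d * (A * (N0 + A + N0)).
    rewrite E1; apply: le_trans (cmodD _ _) _.
    have -> : d * (A * (N0 + A + N0)) = A * d * (N0 + A) + N0 * (A * d) by ring.
    by apply: lerD; apply: ipl_le.
  by move: h2; rewrite ler_norml => /andP[_]; lra.
have fw : cmod (f w) ^+ 2 <= bergman_kernel D w by exact: kernel_ge.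
have fd : cmod (f z) <= cmod (f w) + A * d.
  have [_] := hl f 1 w hf ltr01 f1 w2; rewrite sqrtr1 mulr1 -/d => h.
  have -> : f z = f w - (f w - f z) by ring.
  by apply: le_trans (cmodB _ _) _; rewrite lerD2l.
have fd2 : cmod (f z) ^+ 2 <= cmod (f w) ^+ 2 + d * (A * (2 * cmod (f z) + A)).
  have Ad : 0 <= A * d by rewrite mulr_ge0.
  have d2 : d ^+ 2 <= d by rewrite expr2 ler_piMr // ltW.
  have w0 := cmod_ge0 (f w).
  have [h|h] := leP (cmod (f z)) (A * d).
    have : cmod (f z) ^+ 2 <= cmod (f z) * (A * d) by rewrite expr2 ler_wpM2l.
    have p2 : 0 <= cmod (f z) * (A * d) by rewrite mulr_ge0.
    have p3 : 0 <= A * d * A by rewrite mulr_ge0.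
    have := sqr_ge0 (cmod (f w)); have -> : d * (A * (2 * cmod (f z) + A)) = 2 * (cmod (f z) * (A * d)) + A * d * A by ring.
    lra.
  have h1 : (cmod (f z) - A * d) ^+ 2 <= cmod (f w) ^+ 2.
    by rewrite lerXn2r ?nnegrE ?subr_ge0 ?(ltW h) //; lra.
  have -> : cmod (f z) ^+ 2 = (cmod (f z) - A * d) ^+ 2 + d * (A * (2 * cmod (f z))) - (A * d) ^+ 2 by ring.
  have p4 : 0 <= d * (A * A) by rewrite !mulr_ge0.
  have := sqr_ge0 (A * d); have -> : d * (A * (2 * cmod (f z) + A)) = d * (A * (2 * cmod (f z))) + d * (A * A) by ring.
  lra.
have dQ : d * Q <= e / 2.
  move: w3; rewrite ltr_pdivlMr // => w3; apply: le_trans (ltW w3); rewrite ler_wpM2l // lerDl //.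
have : d * Q = d * (A * (N0 + A + N0)) + d * (A * (2 * cmod (f z) + A)) by rewrite /Q; ring.
move: dQ; move: (d * Q) (d * (A * (N0 + A + N0))) (d * (A * (2 * cmod (f z) + A))) kd fd2 => x y y' *; lra.
Qed.

End KernelSeries.

(** * Quotients of expansions and Wirtinger derivatives *)

Section Expansions.
Variable R : realType.
Local Notation C := R[i].
Implicit Types (phi psi : R -> C).

Lemma oexp_local phi psi p0 p1 (d : R) : 0 < d -> (forall t, `|t| < d -> phi t = psi t) ->
  oexp phi p0 p1 -> oexp psi p0 p1.
Proof.
move=> d0 h [K K0 [e e0 he]]; exists K => //; exists (Num.min d e); first by rewrite lt_min d0.
by move=> t; rewrite lt_min => /andP[/h <- /he].
Qed.

Lemma conjc_exp (a b c : C) (t : R) : conjc (a - b - t%:C * c) = conjc a - conjc b - t%:C * conjc c.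
Proof.
by case: a => ? ?; case: b => ? ?; case: c => ? ?; apply/eqP; rewrite eq_complex /=; apply/andP; split; apply/eqP; ring.
Qed.

Lemma oexpJ phi p0 p1 : oexp phi p0 p1 -> oexp (fun t => conjc (phi t)) (conjc p0) (conjc p1).
Proof.
move=> [K K0 [e e0 he]]; exists K => //; exists e => // t /he; rewrite -[X in X <= _ -> _]cmodJ.
by rewrite conjc_exp.
Qed.

(** The quotient rule with an explicit remainder: for small [t] the denominator stays above
    [|q0| / 2], and the numerator of the error is a combination of the two remainders and a term in
    [t^2]. *)
Lemma oexp_div phi psi p0 p1 q0 q1 : q0 != 0 -> oexp phi p0 p1 -> oexp psi q0 q1 ->
  oexp (fun t => phi t / psi t) (p0 / q0) ((p1 * q0 - p0 * q1) / q0 ^+ 2).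
Proof.
move=> q00 [K K0 [d d0 hd]] [L L0 [e e0 he]].
have cq : 0 < cmod q0 by rewrite cmod_gt0.
pose Y := p1 * q0 - p0 * q1.
pose A := cmod q0 ^+ 2 * K + cmod (p0 * q0) * L + cmod Y * (cmod q1 + L).
have A0 : 0 <= A by rewrite !addr_ge0 ?mulr_ge0 ?addr_ge0 ?exprn_ge0 ?cmod_ge0.
have B0 : 0 < cmod q0 ^+ 3 / 2 by rewrite divr_gt0 ?exprn_gt0.
exists (A / (cmod q0 ^+ 3 / 2)); first by rewrite divr_ge0 // ltW.
have s0 : 0 < cmod q1 + L + 1 by rewrite ltr_wpDl ?addr_ge0 ?cmod_ge0.
exists (Num.min 1 (Num.min (cmod q0 / 2 / (cmod q1 + L + 1)) (Num.min d e))).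
  by rewrite !lt_min ltr01 d0 e0 !divr_gt0.
move=> t; rewrite !lt_min => /and4P[t1 ts /hd ht /he ht'].
set rho := phi t - _ - _ in ht; set tau := psi t - _ - _ in ht'.
have n0 := normr_ge0 t.
have t2 : t ^+ 2 = `|t| * `|t| by rewrite -expr2 real_normK ?num_real.
have ct : cmod t%:C = `|t| by rewrite cmod_real.
have Ep : phi t = p0 + t%:C * p1 + rho by rewrite /rho; ring.
have Eq : psi t = q0 + t%:C * q1 + tau by rewrite /tau; ring.
have tauL : cmod tau <= L * `|t|.
  by apply: le_trans ht' _; rewrite ler_wpM2l // t2 ler_piMl // ltW.
have dq : cmod (psi t - q0) <= cmod q0 / 2.
  have -> : psi t - q0 = t%:C * q1 + tau by rewrite Eq; ring.
  apply: le_trans (cmodD _ _) _; rewrite cmodM ct.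
  apply: (@le_trans _ _ (`|t| * (cmod q1 + L + 1))).
    by rewrite !mulrDr mulr1 -addrA lerD2l; apply: le_trans tauL _; rewrite mulrC lerDl.
  by apply: ltW; rewrite -ltr_pdivlMr.
have pq : cmod q0 / 2 <= cmod (psi t).
  have := cmodB (psi t) (psi t - q0); have -> : psi t - (psi t - q0) = q0 by ring.
  lra.
have ps0 : psi t != 0 by rewrite -cmod_gt0; apply: lt_le_trans pq; rewrite divr_gt0.
have -> : phi t / psi t - p0 / q0 - t%:C * (Y / q0 ^+ 2) =
    (q0 ^+ 2 * rho - p0 * q0 * tau - t%:C * Y * (t%:C * q1 + tau)) / (psi t * q0 ^+ 2).
  have E2 : q0 ^+ 2 * rho - p0 * q0 * tau - t%:C * Y * (t%:C * q1 + tau) =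
    phi t * q0 ^+ 2 - p0 * q0 * psi t - t%:C * Y * psi t by rewrite /rho /tau /Y; ring.
  by rewrite E2; field; rewrite q00 ps0.
rewrite cmodM cmodV ler_pdivrMr ?cmod_gt0 ?mulf_neq0 ?expf_neq0 //.
have num : cmod (q0 ^+ 2 * rho - p0 * q0 * tau - t%:C * Y * (t%:C * q1 + tau)) <= A * t ^+ 2.
  rewrite /A !mulrDl; apply: le_trans (cmodB _ _) _; apply: lerD.
    apply: le_trans (cmodB _ _) _; apply: lerD.
      by rewrite cmodM cmodX -mulrA ler_wpM2l // exprn_ge0 // cmod_ge0.
    by rewrite cmodM -mulrA ler_wpM2l // cmod_ge0.
  rewrite !cmodM ct t2.
  have -> : cmod Y * (cmod q1 + L) * (`|t| * `|t|) = `|t| * cmod Y * (`|t| * cmod q1 + L * `|t|) by ring.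
  rewrite ler_wpM2l ?mulr_ge0 ?cmod_ge0 //; apply: le_trans (cmodD _ _) _.
  by rewrite cmodM ct lerD2l.
apply: le_trans num _.
have hP : cmod q0 ^+ 3 / 2 <= cmod (psi t * q0 ^+ 2).
  rewrite cmodM cmodX (_ : cmod q0 ^+ 3 / 2 = cmod q0 / 2 * cmod q0 ^+ 2); last by ring.
  by rewrite ler_wpM2r ?sqr_ge0.
move: (cmod q0 ^+ 3 / 2) B0 hP => B B0 hP.
have -> : A * t ^+ 2 = A / B * t ^+ 2 * B by rewrite mulrAC divfK // gt_eqF.
by rewrite ler_wpM2l // mulr_ge0 ?sqr_ge0 // divr_ge0 // ltW.
Qed.

Lemma real_deriv_oexp (v : C2 R) f z p0 p1 : oexp (fun t : R => f (z + t%:C *: v)) p0 p1 -> real_deriv v f z = p1.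
Proof.
move=> h; rewrite /real_deriv !derive1E.
by have [_ ->] := oexp_Re h; have [_ ->] := oexp_Im h; case: (p1).
Qed.

Lemma conjCc (x : C) : (x^*)%R = conjc x.
Proof.
have [->|x0] := eqVneq x 0; first by rewrite !rmorph0.
apply: (mulfI x0); have h1 := normCK x; have h2 := cmod_sqr x.
rewrite cmod_norm in h1; apply: etrans (esym h1) _; apply: etrans _ h2; by rewrite rmorphXn.
Qed.

Lemma cmod_i : cmod ('i : C) = 1.
Proof. by rewrite cmodE /= expr0n add0r expr1n sqrtr1. Qed.

Lemma ii : 'i * 'i = -1 :> C.
Proof. by apply/eqP; rewrite eq_complex /=; apply/andP; split; apply/eqP; ring. Qed.

Lemma conj_i : conjc ('i : C) = - 'i.
Proof. by apply/eqP; rewrite eq_complex /=; apply/andP; split; apply/eqP; ring. Qed.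

(** If the derivative of the kernel in direction [u] is [2 Re (u S)], then this combination of the
    directions 1 and ['i] is the antiholomorphic derivative of its logarithm. *)
Lemma wirtinger_bar (S : C) (k : R) : k != 0 ->
  2^-1 * ((2 * complex.Re (1 * S) / k)%:C + 'i * (2 * complex.Re ('i * S) / k)%:C) = conjc S / k%:C.
Proof.
move=> k0; have -> : conjc S / k%:C = conjc S * (k^-1)%:C by rewrite fmorphV.
have -> : (2^-1 : C) = (2^-1 : R)%:C by rewrite fmorphV /= real_complex_nat.
case: S => x y; apply/eqP; rewrite eq_complex /=; apply/andP; split; apply/eqP; field => //.
Qed.

End Expansions.

(** * Positivity of the metric *)

Section GramForms.
Variable R : realType.
Local Notation C := R[i].
Implicit Types (a b c : nat -> C) (x y : C).

Lemma conjc_comb (x y s t : C) : conjc (x * s + y * t) = conjc x * conjc s + conjc y * conjc t.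
Proof. by rewrite rmorphD !rmorphM. Qed.

Lemma L2_comb x y a b : L2 a -> L2 b -> L2 (fun i => x * a i + y * b i).
Proof. by move=> ha hb; exact: L2D (L2Z x ha) (L2Z y hb). Qed.

Lemma ipl_combl x y a b c : L2 a -> L2 b -> L2 c ->
  ipl (fun i => x * a i + y * b i) c = x * ipl a c + y * ipl b c.
Proof.
by move=> ha hb hc; rewrite (iplDl (L2Z x ha) (L2Z y hb) hc) (iplZl x ha hc) (iplZl y hb hc).
Qed.

Lemma ipl_combr x y a b c : L2 a -> L2 b -> L2 c ->
  ipl c (fun i => x * a i + y * b i) = conjc x * ipl c a + conjc y * ipl c b.
Proof.
by move=> ha hb hc; rewrite (iplDr hc (L2Z x ha) (L2Z y hb)) (iplZr x hc ha) (iplZr y hc hb).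
Qed.

Lemma ipl_comb x y a b : L2 a -> L2 b ->
  ipl (fun i => x * a i + y * b i) (fun i => x * a i + y * b i) =
  ipl a a * x * conjc x + ipl a b * x * conjc y + (ipl b a * y * conjc x + ipl b b * y * conjc y).
Proof.
move=> ha hb; rewrite (ipl_combl x y ha hb (L2_comb x y ha hb)) (ipl_combr x y ha hb ha) (ipl_combr x y ha hb hb).
move: (ipl a a) (ipl a b) (ipl b a) (ipl b b) (conjc x) (conjc y) => A B B' D x' y'; ring.
Qed.

(** The vector is [k] times the component of [b] orthogonal to [a], so its squared norm is [k] times
    the Gram determinant of [a] and [b]. *)
Lemma ipl_residual a b (k : R) : L2 a -> L2 b -> ipl a a = k%:C ->
  ipl (fun i => k%:C * b i + (- ipl b a) * a i) (fun i => k%:C * b i + (- ipl b a) * a i) =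
  k%:C * (ipl b b * k%:C - ipl b a * conjc (ipl b a)).
Proof.
move=> ha hb hk; rewrite (ipl_comb _ _ hb ha) hk (iplC hb ha) conjc_real rmorphN.
move: (ipl b b) (conjc (ipl b a)) (ipl b a) k%:C => B l' l x; ring.
Qed.

End GramForms.

Lemma quotient_split (F : comNzRingType) (u v a b k s s1 s2 m : F) :
  ((v * a + u * b) * k - s * (u * s1 + v * s2)) * m = u * ((b * k - s1 * s) * m) + v * ((a * k - s2 * s) * m).
Proof. ring. Qed.

(** The coefficient [x] of [u] survives in the holomorphic Wirtinger derivative, and the coefficient
    [y] of [conjc u] cancels between the directions 1 and ['i]. *)
Lemma wirtinger_split (F : comNzRingType) (i x y : F) : i * i = -1 ->
  1 * x + 1 * y - i * (i * x + - i * y) = 2 * x.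
Proof.
move=> ii; rewrite (_ : _ - _ = (x + y) - (i * i) * (x - y)); last by ring.
rewrite ii; ring.
Qed.

Lemma hermitian_form (F : comNzRingType) (B : 'I_2 -> 'I_2 -> F) (x y s t : 'I_2 -> F) (k m : F) :
  \sum_(i < 2) \sum_(j < 2) (B i j * k - s i * t j) * m * x i * y j =
  ((B 0 0 * x 0 * y 0 + B 0 1 * x 0 * y 1 + (B 1 0 * x 1 * y 0 + B 1 1 * x 1 * y 1)) * k -
  (x 0 * s 0 + x 1 * s 1) * (y 0 * t 0 + y 1 * t 1)) * m.
Proof.
rewrite !big_ord_recl !big_ord0 !addr0 (_ : lift ord0 ord0 = 1 :> 'I_2); last exact/val_inj.
ring.
Qed.

Lemma scale_relation (F : comNzRingType) (k l b x0 x1 d0 d1 a : F) :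
  k * (x0 * d0 + x1 * d1) + - l * a = 0 -> k * (x0 * (b * d0) + x1 * (b * d1)) = l * (b * a).
Proof.
move=> h; rewrite (_ : k * (x0 * (b * d0) + x1 * (b * d1)) = b * (k * (x0 * d0 + x1 * d1) + - l * a) + l * (b * a)); last by ring.
by rewrite h mulr0 add0r.
Qed.

(** * The metric as a Gram determinant *)

Section BergmanMetric.
Variable R : realType.
Local Notation C := R[i].
Local Notation e_ k := (delta_mx 0 k : C2 R).
Variable D : set (C2 R).
Hypothesis oD : open D.
Implicit Types (z w : C2 R).

Definition rpt (t : rat * rat * rat * rat) : C2 R :=
  \row_(j < 2) if j == 0 then (ratr t.1.1.1 +i* ratr t.1.1.2)%C else (ratr t.1.2 +i* ratr t.2)%C.

Lemma rpt_dense z (r : R) : 0 < r -> exists t, cn (rpt t - z) < r.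
Proof.
move=> r0; have r2 : 0 < r / 2 by rewrite divr_gt0.
have [a ha] := ratr_approx (complex.Re (z 0 0)) r2; have [b hb] := ratr_approx (complex.Im (z 0 0)) r2.
have [c hc] := ratr_approx (complex.Re (z 0 1)) r2; have [d hd] := ratr_approx (complex.Im (z 0 1)) r2.
exists (a, b, c, d); rewrite cn_lt !mxE /=; apply/andP; split; apply: le_lt_trans (cmod_le_ReIm _) _; rewrite [ltRHS]splitr.
  by case: (z 0 0) ha hb => x y /= ha hb; apply: ltrD; rewrite distrC.
by case: (z 0 1) hc hd => x y /= hc hd; apply: ltrD; rewrite distrC.
Qed.

(** A countable choice indexed by coded pairs of a rational point and a precision [1 / (m+1)]; codes
    without meaning and points outside [D] receive the zero function. *)
Lemma extremal_family : exists fam : nat -> C2 R -> C, (forall n, HH D (fam n) /\ nr D (fam n) <= 1) /\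
  forall t m, D (rpt t) -> exists n, bergman_kernel D (rpt t) - m.+1%:R^-1 <= cmod (fam n (rpt t)) ^+ 2.
Proof.
have un f : unitH D f -> HH D f /\ nr D f <= 1.
  move=> fD; have hf : HH D f by split; [exact: fD.1 | exact: le_lt_trans fD.2 (ltry 1)].
  by split=> //; rewrite -lee_fin -(nrE hf); exact: fD.2.
have /choice [fam hfam] : forall n, exists f, (HH D f /\ nr D f <= 1) /\
    forall t m, @unpickle ((rat * rat * rat * rat) * nat)%type n = Some (t, m) -> D (rpt t) ->
      bergman_kernel D (rpt t) - m.+1%:R^-1 <= cmod (f (rpt t)) ^+ 2.
  move=> n; case: (unpickle n) => [[t m]|]; last by exists (fun=> 0); split=> //; exact: un (unitH0 oD).
  have [Dt|nD] := pselect (D (rpt t)); last first.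
    by exists (fun=> 0); split; [exact: un (unitH0 oD) | move=> t' m' [<- _]].
  have [f fD hf] : exists2 f, unitH D f & bergman_kernel D (rpt t) - m.+1%:R^-1 <= cmod (f (rpt t)) ^+ 2.
    apply: contrapT => hn; have : bergman_kernel D (rpt t) <= bergman_kernel D (rpt t) - m.+1%:R^-1.
      apply: kernel_le => // f fD; rewrite leNgt; apply/negP => h; apply: hn; exists f => //; exact: ltW.
    by apply/negP; rewrite -ltNge ltrBlDr ltrDl invr_gt0 ltr0n.
  by exists f; split; [exact: un | move=> t' m' [<- <-]].
exists fam; split=> [n|t m Dt]; first exact: (hfam n).1.
by exists (pickle (t, m)); apply: (hfam _).2 => //; exact: pickleK.
Qed.

Lemma coord_diff j z : differentiable (fun z : C2 R => z 0 j) z.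
Proof.
apply/differentiableC2P; exists (if j == 0 then 1 else 0), (if j == 0 then 0 else 1) => e e0; exists 1 => // w _.
rewrite (_ : _ - _ = 0) ?cmod0 ?mulr_ge0 ?cn_ge0 ?(ltW e0) //.
by move: j; apply: ord2P; rewrite /=; ring.
Qed.

Hypothesis H1 : HH D (fun=> 1).
Hypothesis Hz : forall j, HH D (fun z => z 0 j).

Lemma good_family : exists g : nat -> C2 R -> C, [/\ forall n, HH D (g n),
  forall z (e r : R), D z -> 0 < e -> 0 < r -> exists n w,
    [/\ cn (w - z) < r, D w, nr D (g n) <= 1 & bergman_kernel D w - e <= cmod (g n w) ^+ 2],
  g 0%N = fun=> 1 & forall j : 'I_2, g j.+1 = fun z => z 0 j].
Proof.
have [fam [hf hK]] := extremal_family.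
exists (fun n => match n with 0%N => fun=> 1 | 1%N => fun z => z 0 0 | 2%N => fun z => z 0 1 | m.+3 => fam m end).
split=> //.
- by move=> [|[|[|m]]] //; exact: (hf m).1.
- move=> z e r Dz e0 r0; have [s s0 hs] := open_polydisc oD Dz.
  have rs : 0 < Num.min r s by rewrite lt_min r0.
  have [t] := rpt_dense z rs; rewrite lt_min => /andP[tr /hs Dt].
  have [m hm] : exists m : nat, m.+1%:R^-1 < e.
    by exists (Num.truncn e^-1); rewrite -[ltRHS]invrK ltf_pV2 ?posrE ?invr_gt0 // truncnS_gt.
  have [n hn] := hK t m Dt; exists n.+3, (rpt t); split=> //; first exact: (hf n).2.
  by apply: le_trans hn; rewrite lerD2l lerN2 ltW.
by apply: ord2P.
Qed.

Lemma metric_gt0 z (X : C2 R) : D z -> X != 0 -> 0 < bergman_kernel D z -> (forall w, D w -> 0 < bergman_kernel D w) ->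
  0 < bergman_metric2 D z X.
Proof.
move=> Dz X0 Kz Kpos; have [g [hg ext g0 gj]] := good_family.
have KE w : D w -> ipl (aq D g w) (aq D g w) = (bergman_kernel D w)%:C.
  by move=> Dw; rewrite (kqE oD hg Dw) (kernel_kq oD hg ext Dw).
have aL w : D w -> L2 (aq D g w) by move=> Dw; exact: aq_L2.
have dL w k : D w -> L2 (dq D g k w) by move=> Dw; exact: dq_L2.
have ddL w j k : D w -> L2 (ddq D g j k w) by move=> Dw; exact: ddq_L2.
pose S k w := ipl (dq D g k w) (aq D g w).
pose K w := bergman_kernel D w.
have near (w : C2 R) (u : C) j : D w -> cmod u = 1 -> exists2 r : R, 0 < r & forall t : R, `|t| < r -> D (w + t%:C *: (u *: e_ j)).
  move=> Dw u1; have [r r0 hr] := open_polydisc oD Dw; exists r => // t tr; apply: hr.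
  by rewrite addrC addKr scalerA cn_ek cmodM u1 mulr1 cmod_real.
(* The kernel is [<a, a>] with [a] holomorphic in [w], so its derivative in direction [u e_j] is
   [2 Re (u S_j)]. *)
have Kexp w u j : D w -> cmod u = 1 -> oexp (fun t => (K (w + t%:C *: (u *: e_ j)))%:C) (K w)%:C (u * S j w + conjc (u * S j w)).
  move=> Dw u1; have [r r0 hr] := near w u j Dw u1.
  have sa := aq_sexp oD hg j Dw u1.
  have uL := L2Z u (dL w j Dw).
  have := ipl_sexp (aL w Dw) uL (aL w Dw) uL sa sa; rewrite KE //.
  rewrite (iplC uL (aL w Dw)) (iplZl _ (dL w j Dw) (aL w Dw)).
  by apply: (oexp_local r0) => t /hr Dt; rewrite KE.
have rdln w u k : D w -> cmod u = 1 -> real_deriv (u *: e_ k) (fun w => (ln (K w))%:C) w = (2 * complex.Re (u * S k w) / K w)%:C.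
  move=> Dw u1; have h1 := oexp_Re (Kexp w u k Dw u1); rewrite /= in h1.
  have Kw : 0 < K (w + (0 : R)%:C *: (u *: e_ k)) by rewrite scale0r addr0; exact: Kpos.
  have h2 := is_derive1_comp (is_derive1_ln Kw) h1.
  rewrite /real_deriv !derive1E.
  have -> : 'D_1 (fun t : R => complex.Re ((ln (K (w + t%:C *: (u *: e_ k))))%:C)) 0 = 2 * complex.Re (u * S k w) / K w.
    have [_ ->] := h2; rewrite scale0r addr0 ReD ReJ; ring.
  have -> : 'D_1 (fun t : R => complex.Im ((ln (K (w + t%:C *: (u *: e_ k))))%:C)) 0 = 0 by rewrite /= derive_cst.
  by [].
have bar w k : D w -> dzbar k (fun w => (ln (K w))%:C) w = conjc (S k w) / (K w)%:C.
  move=> Dw; rewrite /dzbar -[X in real_deriv X]scale1r (rdln w 1 k Dw (cmod1 R)) (rdln w 'i k Dw (cmod_i R)).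
  by apply: wirtinger_bar; rewrite gt_eqF //; exact: Kpos.
pose B j k := ipl (dq D g j z) (dq D g k z).
have K0 : (K z)%:C != 0 :> C by rewrite real_complex_neq0.
have HB j k : dz j (dzbar k (fun w => (ln (K w))%:C)) z = (B j k * (K z)%:C - S j z * conjc (S k z)) / (K z)%:C ^+ 2.
  (* Second derivatives of the functions enter only through [A], which comes with [conjc u]; the
     holomorphic Wirtinger combination keeps the coefficient of [u], so [A] drops out. *)
  pose A := ipl (ddq D g j k z) (aq D g z).
  have rd u : cmod u = 1 -> real_deriv (u *: e_ j) (dzbar k (fun w => (ln (K w))%:C)) z =
      u * ((B j k * (K z)%:C - S j z * conjc (S k z)) / (K z)%:C ^+ 2) +
      conjc u * ((conjc A * (K z)%:C - conjc (S j z) * conjc (S k z)) / (K z)%:C ^+ 2).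
    move=> u1; apply: (@real_deriv_oexp _ _ _ _ (conjc (S k z) / (K z)%:C)).
    have [r r0 hr] := near z u j Dz u1.
    have uL := L2Z u (dL z j Dz); have uLL := L2Z u (ddL z j k Dz).
    have sS := ipl_sexp (dL z k Dz) uLL (aL z Dz) uL (dq_sexp oD hg j k Dz u1) (aq_sexp oD hg j Dz u1).
    rewrite (iplZl _ (ddL z j k Dz) (aL z Dz)) (iplZr _ (dL z k Dz) (dL z j Dz)) -/A in sS.
    have := oexp_div K0 (oexpJ sS) (Kexp z u j Dz u1).
    have -> : conjc (u * A + conjc u * ipl (dq D g k z) (dq D g j z)) = conjc u * conjc A + u * B j k.
      by rewrite rmorphD !rmorphM /= conjcK (iplC (dL z j Dz) (dL z k Dz)) conjcK.
    have -> : conjc (u * S j z) = conjc u * conjc (S j z) by rewrite rmorphM.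
    rewrite -/(S k z).
    rewrite (quotient_split u (conjc u)).
    by apply: (oexp_local r0) => t /hr Dt; rewrite (bar _ k Dt).
  rewrite /dz -{1}[delta_mx 0 j](scale1r (e_ j)) (rd 1 (cmod1 R)) (rd 'i (cmod_i R)) conj_i.
  have -> : conjc (1 : C) = 1 by rewrite rmorph1.
  rewrite (wirtinger_split _ _ (ii R)).
  by rewrite mulrA mulVf ?mul1r // pnatr_eq0.
pose b i := X 0 0 * dq D g 0 z i + X 0 1 * dq D g 1 z i.
have bL : L2 b by exact: L2_comb (dL z 0 Dz) (dL z 1 Dz).
pose lam := ipl b (aq D g z).
pose c i := (K z)%:C * b i + (- lam) * aq D g z i.
have cL : L2 c by exact: L2_comb bL (aL z Dz).
have lamE : lam = X 0 0 * S 0 z + X 0 1 * S 1 z by exact: ipl_combl (dL z 0 Dz) (dL z 1 Dz) (aL z Dz).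
have bb : ipl b b = B 0 0 * X 0 0 * conjc (X 0 0) + B 0 1 * X 0 0 * conjc (X 0 1) +
    (B 1 0 * X 0 1 * conjc (X 0 0) + B 1 1 * X 0 1 * conjc (X 0 1)).
  by exact: ipl_comb (dL z 0 Dz) (dL z 1 Dz).
have mE : bergman_metric2 D z X = (ipl b b * (K z)%:C - lam * conjc lam) / (K z)%:C ^+ 2.
  rewrite /bergman_metric2 bb lamE.
  under eq_bigr do under eq_bigr do rewrite HB conjCc.
  have -> : conjc (X 0 0 * S 0 z + X 0 1 * S 1 z) = conjc (X 0 0) * conjc (S 0 z) + conjc (X 0 1) * conjc (S 1 z).
    exact: conjc_comb.
  exact: (hermitian_form B (fun j => X 0 j) (fun j => conjc (X 0 j)) (fun j => S j z) (fun j => conjc (S j z))).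
have [x xE xle] := ipl_self cL.
have cc : ipl c c = (K z)%:C * (ipl b b * (K z)%:C - lam * conjc lam) by exact: ipl_residual (aL z Dz) bL (KE z Dz).
(* The metric is the squared l^2 norm of [c] over [K^3], so it is nonnegative and vanishes only if
   every [c i] does. *)
have -> : bergman_metric2 D z X = (x / K z ^+ 3)%:C.
  have -> : (x / K z ^+ 3)%:C = x%:C / (K z)%:C ^+ 3 :> C by rewrite rmorphM fmorphV rmorphXn.
  rewrite -xE cc mE; move: (_ - _) K0 => y; move: (K z)%:C => k k0; by field.
suff xp : 0 < x by rewrite ltcR divr_gt0 // exprn_gt0.
have x_ge0 : 0 <= x by apply: le_trans (xle 0%N); exact: sqr_ge0.
rewrite lt_neqAle x_ge0 andbT eq_sym; apply/negP => /eqP x0; move: X0; apply/negP; rewrite negbK.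
have ci i : c i = 0.
  by apply/eqP; rewrite -cmod_eq0 -sqrf_eq0 eq_le sqr_ge0 andbT -x0; exact: xle.
(* Vanishing of [c] is the relation [K d_X f = lam f] for each orthonormal function; it extends
   linearly to every [g n], a finite combination of them on [D]. *)
have key n : (K z)%:C * (X 0 0 * pd 0 (g n) z + X 0 1 * pd 1 (g n) z) = lam * g n z.
  have [bb' E _] := gs_span oD hg n; have [r r0 hr] := open_polydisc oD Dz.
  have P k : pd k (g n) z = \sum_(i < n.+1) bb' i * dq D g k z i.
    apply: isd_pd; apply: (isd_local r0 _ (isd_lin n.+1 bb' (fun i => isd_q oD hg k i Dz))) => y yr.
    by rewrite E //; apply: hr; rewrite addrC addKr cn_ek.
  rewrite !P (E z Dz) !mulr_sumr -big_split mulr_sumr /=; apply: eq_bigr => i _.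
  exact: scale_relation (ci i).
have pd1 k : pd k (g 0%N) z = 0.
  apply: isd_pd; rewrite g0 => e e0; exists 1 => // y _; by rewrite mul0r !subr0 subrr cmod0 mulr_ge0 ?cmod_ge0 // ltW.
have pdj k j : pd k (g (j : 'I_2).+1) z = (j == k)%:R.
  apply: isd_pd; rewrite gj => e e0; exists 1 => // y _; rewrite !mxE eqxx /= (eq_sym j k).
  rewrite [X in cmod X](_ : _ = 0) ?cmod0 ?mulr_ge0 ?cmod_ge0 ?(ltW e0) //; ring.
(* The constant function 1 has zero derivative and forces [lam = 0]; the coordinate functions then
   give [X = 0]. *)
have l0 : lam = 0 by have := key 0%N; rewrite !pd1 !mulr0 addr0 mulr0 g0 mulr1.
have X_0 (j : 'I_2) : X 0 j = 0.
  apply: (mulfI K0); have := key j.+1; rewrite !pdj l0 mul0r mulr0 => <-; congr (_ * _).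
  by move: j; apply: ord2P; rewrite /= ?mulr1 ?mulr0 ?addr0 ?add0r.
by apply/eqP/C2P; rewrite mxE X_0.
Qed.

Lemma admits_of_L2 : admits_bergman_metric D.
Proof.
have Kpos w : D w -> 0 < bergman_kernel D w.
  by move=> Dw; apply: kernel_pos => //; have := H1.2; rewrite sqint_cst // cmod1 expr1n mul1e.
by split=> // z X Dz X0; apply: metric_gt0 => //; exact: Kpos.
Qed.

End BergmanMetric.

Lemma metric_exists (R : realType) : siciak_domain (@Dn R 1) /\ admits_bergman_metric (@Dn R 1).
Proof.
split; first exact: Dn_siciak.
have oD : open (@Dn R 1) by exact: Dn_open.
apply: admits_of_L2 => //.
  split; first by move=> z _; exact: (differentiable_const 1).
  by apply: sqint_fin1; [exact: contC_cst | move=> z; rewrite cmod1 le_max lexx].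
move=> j; split; first by move=> z _; exact: coord_diff.
by apply: sqint_fin1; [exact: contC_coord | move=> z; rewrite le_max coord_cn orbT].
Qed.

Theorem theorem17 (R : realType) :
  [/\
    (exists D : set (C2 R), siciak_domain D /\ volume D = +oo%E),
    (exists D : set (C2 R),
       [/\ siciak_domain D,
           forall z, D z -> 0 < bergman_kernel D z &
           ~ admits_bergman_metric D])
    /\ (forall D : set (C2 R), siciak_domain D ->
          ((forall z, D z -> 0 < bergman_kernel D z) <->
           (volume D < +oo)%E)) &
    exists D : set (C2 R), siciak_domain D /\ admits_bergman_metric D].
Proof.
split; first by exists (@Dn R 48); exact: infinite_volume.
  split; first by exists (@Dn R 24); exact: kernel_pos_no_metric.
  exact: siciak_kernel_pos.
by exists (@Dn R 1); exact: metric_exists.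
Qed.
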